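(* Let $k$ be an algebraically closed field and let $B$ be an integral domain containing $k$, of finite transcendence degree $d\ge 2$ over $k$. The following conditions on $B$ are equivalent. (1) $B\cong_k k[\Delta]^{[m]}$ for some trinomial data $\Delta$ over $k$ and some integer $m\ge 0$. (2) $B$ is a unirational UFD which admits an effective unmixed $\mathbb{Z}^{d-1}$-grading with $B_0=k$. (3) $B$ is an affine UFD which admits an effective unmixed $\mathbb{Z}^{d-1}$-grading with $B_0=k$. (4) $B$ is a unirational UFD with $B^*=k^*$ which admits an effective $\mathbb{Z}^{d-1}$-grading with $B_0=k$. (5) $B$ is an affine UFD with $B^*=k^*$ which admits an effective $\mathbb{Z}^{d-1}$-grading with $B_0=k$.
   Context: Trinomial data $\Delta$ over a field $k$ consist of: (i) an integer $n\ge 2$ and a partition $n=n_0+\cdots+n_r$ with $r\ge 1$ and all $n_i\ge 1$ ($0\le i\le r$); (ii) tuples $\beta_i=(\beta_{i1},\dots,\beta_{in_i})$ of positive integers, $0\le i\le r$, such that with $d_i=\gcd(\beta_{i1},\dots,\beta_{in_i})$ one has $\gcd(d_i,d_j)=1$ for $i\ne j$; (iii) distinct elements $\lambda_2,\dots,\lambda_r\in k^*$ (the empty sequence if $r=1$). The associated ring is $$k[\Delta]=k[t_{ij}\mid 0\le i\le r,\ 1\le j\le n_i]/(T_0^{\beta_0}+\lambda_iT_1^{\beta_1}+T_i^{\beta_i})_{2\le i\le r},$$ where the $t_{ij}$ are $n$ independent variables and $T_i^{\beta_i}=t_{i1}^{\beta_{i1}}\cdots t_{in_i}^{\beta_{in_i}}$.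 If $r=1$, $k[\Delta]$ is the polynomial ring in $n$ variables. $R^{[m]}$ denotes the polynomial ring in $m$ variables over $R$; $\cong_k$ means isomorphic as $k$-algebras; $B^*$ is the unit group of $B$. ''Affine'' means finitely generated as a $k$-algebra. ''Unirational'' means that $\mathrm{frac}(B)$ embeds over $k$ in a purely transcendental extension $k(x_1,\dots,x_s)$ for some $s$. For $G=\mathbb{Z}^s$, a $G$-grading $B=\bigoplus_{g\in G}B_g$ (always with $k\subset B_0$) has weight monoid $M=\{g\in G\mid B_g\ne 0\}$. It is effective if $M$ generates $G$ as a group, and unmixed if the maximal subgroup $\{g\in M\mid -g\in M\}$ of $M$ is trivial. *)

(* Defs.v *)
From HB Require Import structures.
From mathcomp Require Import all_boot all_order all_algebra.
From mathcomp Require Import generic_quotient ring_quotient fraction.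
From mathcomp Require Import boolp.
From mathcomp Require Import mpoly.
Set Implicit Arguments. Unset Strict Implicit. Unset Printing Implicit Defensive.
Import GRing.Theory.
Local Open Scope ring_scope.
Local Open Scope quotient_scope.

(* The requirement n >= 2 on n = \sum_i tri_n i follows from tri_r_gt0 and
   tri_n_gt0.  For i : 'I_(tri_r.-1), [tri_lam i] is lambda_(i+2). *)
Record trinomial_data (k : fieldType) := TrinomialData {
  tri_r : nat;
  tri_n : 'I_tri_r.+1 -> nat;
  tri_beta : forall i : 'I_tri_r.+1, 'I_(tri_n i) -> nat;
  tri_lam : 'I_tri_r.-1 -> k;
  tri_r_gt0 : (0 < tri_r)%N;
  tri_n_gt0 : forall i, (0 < tri_n i)%N;
  tri_beta_gt0 : forall i (j : 'I_(tri_n i)), (0 < tri_beta j)%N;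
  tri_coprime : forall i i', i != i' ->
    coprime (\big[gcdn/0%N]_(j < tri_n i) tri_beta j)
            (\big[gcdn/0%N]_(j < tri_n i') tri_beta j);
  tri_lam_neq0 : forall i, tri_lam i != 0;
  tri_lam_inj : injective tri_lam
}.

Arguments tri_n {k} _ _.
Arguments tri_beta {k} _ _ _.
Arguments tri_lam {k} _ _.

Section TrinomialRing.
Variables (k : fieldType) (D : trinomial_data k).

(* k[t_ij]; the variable t_ij is 'X_(tagnat.Rank i j), where tagnat.Rank is the
   bijection of the pairs (i, j) with 'I_(\sum_i n_i). *)
Local Notation kt := {mpoly k[\sum_(i < (tri_r D).+1) tri_n D i]}.

Definition tri_T (i : 'I_(tri_r D).+1) : kt :=
  \prod_(j < tri_n D i) 'X_(tagnat.Rank i j) ^+ tri_beta D i j.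

Definition tri_rel (i : 'I_(tri_r D).-1) : kt :=
  tri_T ord0 + tri_lam D i *: tri_T (inord 1) + tri_T (inord i.+2).

Definition tri_ideal : {pred kt} := fun p =>
  `[< exists q : 'I_(tri_r D).-1 -> kt, p = \sum_i q i * tri_rel i >].

Lemma tri_T_at0 i : (tri_T i).@[fun=> 0] = 0.
Proof.
rewrite /tri_T rmorph_prod /= (bigD1 (Ordinal (tri_n_gt0 i))) //=.
by rewrite rmorphXn /= mevalXU expr0n -[_ == _]negbK -lt0n tri_beta_gt0 mul0r.
Qed.

Lemma tri_rel_at0 i : (tri_rel i).@[fun=> 0] = 0.
Proof. by rewrite /tri_rel !mevalD mevalZ !tri_T_at0 mulr0 !addr0. Qed.

Lemma tri_ideal_closed : idealr_closed tri_ideal.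
Proof.
split.
- by apply/asboolP; exists (fun=> 0); symmetry; apply: big1 => i _; rewrite mul0r.
- apply/asboolP => -[q] /(congr1 (meval (fun=> 0))) /eqP.
  rewrite meval1 rmorph_sum big1 ?oner_eq0 // => i _.
  by rewrite /= mevalM tri_rel_at0 mulr0.
- move=> a u v /asboolP[q ->] /asboolP[q' ->]; apply/asboolP.
  exists (fun i => a * q i + q' i); rewrite mulr_sumr -big_split /=.
  by apply: eq_bigr => i _; rewrite mulrDl mulrA.
Qed.

HB.instance Definition _ := isIdealr.Build kt tri_ideal tri_ideal_closed.

Definition trinomial_ring := {ideal_quot tri_ideal}.
HB.instance Definition _ := GRing.ComNzRing.on trinomial_ring.

Definition tri_const (c : k) : trinomial_ring := \pi_{ideal_quot tri_ideal} (c%:MP : kt).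

End TrinomialRing.

Arguments tri_T {k} D _.
Arguments tri_rel {k} D _.
Arguments tri_ideal {k} D _.

(* The inclusion of k in B is the morphism iota, injective as k is a field. *)
Section Domains.
Variables (k : fieldType) (B : idomainType) (iota : {rmorphism k -> B}).

Definition iso_trinomial (D : trinomial_data k) (m : nat) : Prop :=
  exists f : {rmorphism {mpoly (trinomial_ring D)[m]} -> B},
    bijective f /\ forall c : k, f ((tri_const D c)%:MP) = iota c.

Definition alg_indep (L : comNzRingType) (f : {rmorphism k -> L}) (n : nat)
    (x : 'I_n -> L) : Prop :=
  forall p : {mpoly k[n]}, mmap f x p = 0 -> p = 0.

(* frac(B) has a transcendence basis (a maximal algebraically independent
   family) with d elements. *)
Definition has_trdeg (d : nat) : Prop :=
  let f : {rmorphism k -> {fraction B}} := @tofrac B \o iota in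
  exists x : 'I_d -> {fraction B}, alg_indep f x /\
    forall y : {fraction B},
      ~ alg_indep f (fun i : 'I_d.+1 => oapp x y (unlift ord_max i)).

Definition affine : Prop :=
  exists n (x : 'I_n -> B), forall b, exists p : {mpoly k[n]}, b = mmap iota x p.

Definition unirational : Prop :=
  exists s (f : {rmorphism {fraction B} -> {fraction {mpoly k[s]}}}),
    forall c : k, f (tofrac (iota c)) = tofrac (c%:MP).

Definition irreducible (p : B) : Prop :=
  [/\ p != 0, p \isn't a GRing.unit
    & forall a b, p = a * b -> a \is a GRing.unit \/ b \is a GRing.unit].

Definition associated (p q : B) : Prop :=
  exists2 u, u \is a GRing.unit & q = u * p.

Definition UFD : Prop :=
  (forall x : B, x != 0 -> x \isn't a GRing.unit ->
    exists2 s : seq B, {in s, forall p, irreducible p} & x = \prod_(p <- s) p)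
  /\ (forall s t : seq B,
        {in s, forall p, irreducible p} -> {in t, forall p, irreducible p} ->
        \prod_(p <- s) p = \prod_(p <- t) p ->
      exists t', [/\ perm_eq t t', size s = size t'
        & forall i, (i < size s)%N -> associated s`_i t'`_i]).

Definition trivial_units : Prop :=
  forall b : B, b \is a GRing.unit <-> exists2 c : k, c != 0 & b = iota c.

Section Gradings.
Variables (G : zmodType) (Bg : G -> B -> Prop).

(* The last two fields say that B is the direct sum of the Bg g. *)
Record grading : Prop := Grading {
  grad0 : forall g, Bg g 0;
  gradD : forall g x y, Bg g x -> Bg g y -> Bg g (x + y);
  gradM : forall g h x y, Bg g x -> Bg h y -> Bg (g + h) (x * y);
  grad_const : forall c, Bg 0 (iota c);
  grad_span : forall b, exists (s : seq G) (x : G -> B),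
    (forall g, Bg g (x g)) /\ b = \sum_(g <- s) x g;
  grad_direct : forall (s : seq G) (x : G -> B), uniq s ->
    (forall g, Bg g (x g)) -> \sum_(g <- s) x g = 0 ->
    {in s, forall g, x g = 0}
}.

Definition weight (g : G) : Prop := exists2 b, Bg g b & b != 0.

Definition effective : Prop :=
  forall H : G -> Prop,
    H 0 -> (forall g h, H g -> H h -> H (g - h)) ->
    (forall g, weight g -> H g) -> forall g, H g.

Definition unmixed : Prop := forall g, weight g -> weight (- g) -> g = 0.

Definition deg0_const : Prop := forall b, Bg 0 b <-> exists c, b = iota c.

End Gradings.

Definition admits_effective_grading (s : nat) : Prop :=
  exists Bg : 'rV[int]_s -> B -> Prop,
    [/\ grading Bg, effective Bg & deg0_const Bg].

Definition admits_effective_unmixed_grading (s : nat) : Prop :=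
  exists Bg : 'rV[int]_s -> B -> Prop,
    [/\ grading Bg, effective Bg, unmixed Bg & deg0_const Bg].

End Domains.

(* Main.v *)
(* Write K for the field of fractions of degree 0 of a graded UFD B with B_0 = k
   and B^* = k^*; it has transcendence degree 1. Choose homogeneous, linearly
   independent a, b of the same degree with few prime factors. If B is affine, a
   descent on the minimal pair, and if B is unirational, Lueroth's theorem on a
   generic line, shows K = k(a / b), and every graded piece consists of a fixed
   element times binary forms in a, b. By counting degrees, only finitely many
   members a - z b of this pencil are reducible, and only finitely many
   homogeneous primes divide no member. The reducible members, together with a and
   b, are the T_i of trinomial data, and the remaining homogeneous primes are the
   polynomial variables; the coprimality of the d_i holds because two distinct
   members cannot both be l-th powers up to units.

   Conversely, the relations of k[Delta]^[m] are homogeneous for the cokernel of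
   the lattice spanned by the beta_0 - beta_i, which is torsion free because the
   d_i are coprime in pairs. A reduced monomial times a binary form in T_0, T_1 is
   the general homogeneous element, the points of Spec show that its evident
   factors are prime, and a graded domain whose homogeneous elements factor into
   primes is a UFD, by a Euclidean argument in one degree coordinate at a time.
   As K = k(T_0 / T_1), the fraction field is purely transcendental. *)
Require Import Defs.
From HB Require Import structures.
From mathcomp Require Import all_boot all_order all_algebra.
From mathcomp Require Import generic_quotient ring_quotient fraction boolp.
From mathcomp Require Import zify ring.
From mathcomp Require Import mpoly polyXY.
Set Implicit Arguments. Unset Strict Implicit. Unset Printing Implicit Defensive.
Import GRing.Theory.
Local Open Scope ring_scope.

(** [has_trdeg] provides a single maximal independent family, so all bounds on transcendence degree
    come from counting: the many monomials in too many elements lie in a small span. Since the rank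
    of the grading group is one less than the transcendence degree, two homogeneous fractions of
    degree 0 are always algebraically dependent.

    In the pair a, b the length of a (its number of prime factors) is minimal over all degrees. A
    form of degree n in another coprime independent pair a', b' then has length at least n times
    that of a, so a / b cannot be a function of degree n > 1 of a' / b'. Lueroth's theorem is
    applied to two fractions at a time: k(phi, psi) has transcendence degree 1, so restricting to a
    line on which phi is not constant creates no new relation.

    In the converse, the grading is the morphism from B to Laurent polynomials that multiplies each
    variable by the monomial of its weight, and the direct sum property becomes independence of
    Laurent monomials. The trinomial ring is a domain through its isomorphism with B. *)

(** * Linear dependence by counting monomials *)

Section Span.
Variables (k : fieldType) (L : comNzRingType) (f : {rmorphism k -> L}).

Inductive kspan (S : L -> Prop) : L -> Prop :=
| kspan_0 : kspan S 0
| kspan_cons c v z : S v -> kspan S z -> kspan S (f c * v + z).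

Lemma kspanD S u v : kspan S u -> kspan S v -> kspan S (u + v).
Proof.
elim=> [|c w z Sw _ IH] Sv; first by rewrite add0r.
by rewrite -addrA; apply: kspan_cons => //; apply: IH.
Qed.

Lemma kspan_gen S v : S v -> kspan S v.
Proof.
move=> Sv; have := kspan_cons 1 Sv (kspan_0 S).
by rewrite rmorph1 mul1r addr0.
Qed.

Lemma kspan_scale S c v : kspan S v -> kspan S (f c * v).
Proof.
elim=> [|c' w z Sw _ IH]; first by rewrite mulr0; apply: kspan_0.
by rewrite mulrDr mulrA -rmorphM; apply: kspan_cons.
Qed.

Lemma kspan_sum (I : Type) (r : seq I) (P : pred I) (F : I -> L) S :
  (forall i, P i -> kspan S (F i)) -> kspan S (\sum_(i <- r | P i) F i).
Proof.
by move=> H; apply: big_ind => //; [apply: kspan_0 | apply: kspanD].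
Qed.

Lemma kspan_mulr S T b u : (forall v, S v -> kspan T (b * v)) ->
  kspan S u -> kspan T (b * u).
Proof.
move=> H; elim=> [|c v z Sv _ IH]; first by rewrite mulr0; apply: kspan_0.
rewrite mulrDr mulrCA; apply: kspanD => //; apply: kspan_scale; exact: H.
Qed.

Lemma kspan_fin (J : finType) (g : J -> L) S u :
  (forall v, S v -> exists j, v = g j) -> kspan S u ->
  exists c : J -> k, u = \sum_j f (c j) * g j.
Proof.
move=> H; elim=> [|c v z Sv _ [c' ->]].
  by exists (fun=> 0); rewrite big1 // => j _; rewrite rmorph0 mul0r.
have [j ->] := H v Sv.
exists (fun i => (if i == j then c else 0) + c' i).
under [RHS]eq_bigr => i _ do rewrite rmorphD mulrDl.
rewrite big_split /=; congr (_ + _); rewrite (bigD1 j) //= eqxx big1 ?addr0 //.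
by move=> i /negbTE ->; rewrite rmorph0 mul0r.
Qed.

(** The coefficient matrix has more rows than columns, so its left kernel contains a nonzero vector,
    which is the relation. *)
Lemma lin_dependent (I J : finType) (g : J -> L) (v : I -> L) :
  (#|J| < #|I|)%N ->
  (forall i, exists c : J -> k, v i = \sum_j f (c j) * g j) ->
  exists c : I -> k, (exists i, c i != 0) /\ \sum_i f (c i) * v i = 0.
Proof.
move=> lt /choice[A defA].
pose M : 'M[k]_(#|I|, #|J|) := \matrix_(i, j) A (enum_val i) (enum_val j).
have : kermx M != 0.
  rewrite -mxrank_eq0 mxrank_ker subn_eq0 -ltnNge.
  exact: leq_ltn_trans (rank_leq_col M) lt.
case/rowV0Pn => w /sub_kermxP wM w0.
exists (fun i => w 0 (enum_rank i)); split.
  have [i hi] : exists i, w 0 i != 0.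
    apply: contrapT => H; move/eqP: w0; apply; apply/rowP => i; rewrite mxE.
    by apply: contrapT => h; apply: H; exists i; apply/eqP.
  by exists (enum_val i); rewrite enum_valK.
rewrite (eq_bigr (fun i => \sum_j f (w 0 (enum_rank i) * A i j) * g j)); last first.
  move=> i _; rewrite defA mulr_sumr; apply: eq_bigr => j _.
  by rewrite rmorphM mulrA.
rewrite exchange_big big1 //= => j _; rewrite -mulr_suml -rmorph_sum.
have /rowP/(_ (enum_rank j)) := wM; rewrite !mxE => e.
rewrite (_ : \sum_i _ = 0) ?rmorph0 ?mul0r // -[RHS]e.
rewrite (reindex (@enum_val I I)) /=; last exact/onW_bij/enum_val_bij.
by apply: eq_bigr => i _; rewrite enum_valK mxE enum_rankK.
Qed.

End Span.

Section Count.
Variables (k : fieldType) (L : idomainType) (f : {rmorphism k -> L}).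
Variables (e : nat) (x : 'I_e -> L) (Y : finType) (y : Y -> L).
Local Notation ev := (mmap f x).

(** The exponents of the [x] may grow with [t], while those of the [y] stay below a fixed [D]; only
    the [e] variables [x] contribute to the growth of the number of such monomials. *)
Definition box (D t : nat) (v : L) := exists (mu : 'I_e -> nat) (g : Y -> nat),
  [/\ forall i, (mu i <= t)%N, forall i, (g i < D)%N
    & v = (\prod_i x i ^+ mu i) * \prod_i y i ^+ g i].

Lemma box_mul_ev D t s v (q : {mpoly k[e]}) : (msize q <= s.+1)%N ->
  box D t v -> kspan f (box D (t + s)) (ev q * v).
Proof.
move=> qs [mu [g [h1 h2 ->]]]; rewrite /mmap mulr_suml.
rewrite big_seq; apply: kspan_sum => m mq; rewrite -mulrA; apply: kspan_scale.
apply: kspan_gen; exists (fun i => m i + mu i)%N, g; split=> //.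
- move=> i; rewrite addnC leq_add // -ltnS.
  have lm : (mdeg m <= s)%N by have := msize_mdeg_lt mq; lia.
  apply: leq_ltn_trans (_ : mdeg m < s.+1)%N => //.
  by rewrite mdegE (bigD1 i) //= leq_addr.
- by rewrite mulrA; congr (_ * _); rewrite -big_split /=; apply: eq_bigr => i _; rewrite exprD.
Qed.

Lemma card_box D t : (0 < D)%N ->
  exists (J : finType) (g : J -> L), #|J| = ((t.+1) ^ e * D ^ #|Y|)%N /\
    forall v, box D t v -> exists j, v = g j.
Proof.
case: D => // D _.
exists ({ffun 'I_e -> 'I_t.+1} * {ffun Y -> 'I_D.+1})%type.
exists (fun j : {ffun 'I_e -> 'I_t.+1} * {ffun Y -> 'I_D.+1} => (\prod_i x i ^+ j.1 i) * \prod_i y i ^+ j.2 i); split.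
  by rewrite card_prod !card_ffun !card_ord.
move=> v [mu [g [h1 h2 ->]]].
exists ([ffun i => inord (mu i)], [ffun i => inord (g i)]) => /=.
by congr (_ * _); apply: eq_bigr => i _; rewrite ffunE inordK // ltnS.
Qed.

(** Let C be the product of (s N + 1)^e and D^N, and n = C + 1. The left side is at most C n^e,
    hence less than n^(e+1), and e < N. *)
Lemma count_ineq N D s : (e < N)%N -> exists n, (0 < n)%N /\
   ((s * (N * n)).+1 ^ e * D ^ N < n ^ N)%N.
Proof.
move=> eN; pose n := ((s * N).+1 ^ e * D ^ N).+1; exists n; split=> //.
apply: (@leq_ltn_trans ((n * (s * N).+1) ^ e * D ^ N)).
  rewrite leq_mul2r; apply/orP; right.
  by case: (e) => // e'; rewrite leq_exp2r //; nia.
apply: (@leq_trans (n ^ e.+1)); last by rewrite leq_pexp2l.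
rewrite expnMn expnSr -mulnA ltn_pmul2l ?expn_gt0 //.
Qed.

(** Each [y i] is algebraic over k(x). Up to a power of a common denominator, the n^N monomials in
    the N elements [y] with exponents below n lie in a span of size O(n^e); as e < N, they are
    dependent for large n. This does the work of the exchange lemma. *)
Lemma monomial_relation :
  (e < #|Y|)%N ->
  (forall i, exists P : {poly {mpoly k[e]}},
     ev (lead_coef P) != 0 /\ (map_poly ev P).[y i] = 0) ->
  exists n (c : {ffun Y -> 'I_n} -> k), (exists a, c a != 0) /\
    \sum_a f (c a) * \prod_i y i ^+ a i = 0.
Proof.
move=> eY /choice[P hP].
have szP i : (0 < size (P i))%N.
  rewrite size_poly_gt0 -lead_coef_eq0; apply/eqP => h.
  by have [] := hP i; rewrite h rmorph0 eqxx.
pose D := (\max_i size (P i))%N.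
have szD i : (size (P i) <= D)%N by apply: leq_bigmax.
have D0 : (0 < D)%N.
  have /card_gt0P[i _] : (0 < #|Y|)%N by apply: leq_ltn_trans eY.
  exact: leq_trans (szP i) (szD i).
(* All equations are brought to the common degree [D]; multiplying by a power of the variable keeps
   the leading coefficients. *)
pose P' i := P i * 'X^(D.+1 - size (P i)).
have szP' i : size (P' i) = D.+1.
  rewrite /P' size_Mmonic ?monicXn -?size_poly_gt0 // size_polyXn.
  by rewrite addnS /= subnKC // (leq_trans (szD i)).
have lcP' i : lead_coef (P' i) = lead_coef (P i).
  by rewrite /P' lead_coef_Mmonic // monicXn.
have rP' i : (map_poly ev (P' i)).[y i] = 0.
  by rewrite /P' rmorphM hornerM (hP i).2 mul0r.
pose Dp := \prod_i lead_coef (P i).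
pose c i j := - (P' i)`_j * \prod_(i' | i' != i) lead_coef (P i').
have Dp0 : ev Dp != 0.
  by rewrite rmorph_prod; apply/prodf_neq0 => i _; case: (hP i).
have rel i : ev Dp * y i ^+ D = \sum_(j < D) ev (c i j) * y i ^+ j.
  have := rP' i; rewrite (horner_coef_wide _ (n := D.+1)); last first.
    by rewrite -(szP' i) size_poly.
  have lcD : (P' i)`_D = lead_coef (P i) by rewrite -lcP' lead_coefE szP'.
  rewrite big_ord_recr /= coef_map /= lcD => /eqP; rewrite addrC addr_eq0 => /eqP h.
  rewrite /Dp (bigD1 i) //= rmorphM mulrAC h mulNr mulr_suml -sumrN.
  apply: eq_bigr => j _; rewrite coef_map /c [in RHS]rmorphM [in RHS]raddfN /= !mulNr.
  by congr (- _); rewrite mulrAC.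
(* One degree bound for the common denominator and all coefficients: multiplying by any of them
   raises the exponents of the [x] by at most [s]. *)
pose s := (msize Dp + \sum_i \sum_(j < D) msize (c i j))%N.
have sD : (msize Dp <= s.+1)%N by rewrite /s; lia.
have sc i j : (j < D)%N -> (msize (c i j) <= s.+1)%N.
  move=> jD; rewrite ltnW // ltnS /s (bigD1 i) //= (bigD1 (Ordinal jD)) //=; lia.
(* For the price of one factor [ev Dp], multiplication by [y i] stays inside the boxes: when the
   exponent would reach [D], the equation [rel] lowers it. *)
have step t v i : box D t v -> kspan f (box D (t + s)) (ev Dp * (y i * v)).
  move=> [mu [g [h1 h2 ->]]]; case: (ltnP (g i).+1 D) => gi.
    apply: box_mul_ev => //; exists mu, (fun i' => (i' == i) + g i')%N; split=> //.
      by move=> i'; case: eqP => [->|_] //=; rewrite add0n.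
    rewrite mulrCA; congr (_ * _); rewrite (bigD1 i) //= [RHS](bigD1 i) //= eqxx.
    rewrite mulrA -exprS; congr (_ * _); apply: eq_bigr => i' /negbTE ->.
    by rewrite add0n.
  have giD : (g i).+1 = D by apply/eqP; rewrite eqn_leq gi h2.
  rewrite (bigD1 i) //= (_ : _ * _ = ev Dp * y i ^+ D *
     ((\prod_i0 x i0 ^+ mu i0) * \prod_(i0 | i0 != i) y i0 ^+ g i0)); last first.
    by rewrite -giD exprS; ring.
  rewrite rel mulr_suml; apply: kspan_sum => j _; rewrite -mulrA.
  apply: box_mul_ev; first exact: sc.
  exists mu, (fun i' => if i' == i then val j else g i'); split=> //.
    by move=> i'; case: eqP => _ //; apply: ltn_ord.
  rewrite mulrCA; congr (_ * _); rewrite [RHS](bigD1 i) //= eqxx; congr (_ * _).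
  by apply: eq_bigr => i' /negbTE ->.
(* Here [t] counts how many factors of the common denominator have been spent. *)
pose Q t z := kspan f (box D (s * t)) (ev Dp ^+ t * z).
have Q1 : Q 0%N 1.
  rewrite /Q muln0 expr0 mulr1; apply: kspan_gen.
  exists (fun=> 0%N), (fun=> 0%N); split=> //.
  by rewrite !big1 ?mulr1.
have QS t z : Q t z -> Q t.+1 z.
  rewrite /Q exprS -mulrA mulnS addnC; apply: kspan_mulr => v.
  exact: box_mul_ev.
have Qy t z i : Q t z -> Q t.+1 (y i * z).
  rewrite /Q exprS (_ : ev Dp * _ * _ = ev Dp * y i * (ev Dp ^+ t * z)); last by ring.
  rewrite mulnS addnC; apply: kspan_mulr => v bv; rewrite -mulrA; exact: step.
have QD t t' z : (t <= t')%N -> Q t z -> Q t' z.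
  move=> /subnK <- H; elim: (t' - t)%N => // m; exact: QS.
have Qya t z i a : Q t z -> Q (a + t)%N (y i ^+ a * z).
  by move=> H; elim: a => [|a IH]; rewrite ?mul1r // exprS -mulrA; apply: Qy.
have Qprod (r : seq Y) (a : Y -> nat) :
    Q (\sum_(i <- r) a i)%N (\prod_(i <- r) y i ^+ a i).
  by elim: r => [|i r IH]; rewrite ?big_nil // !big_cons; apply: Qya.
have [n [n0 hn]] := count_ineq D s eY.
pose T := (#|Y| * n)%N.
have Qbox (a : {ffun Y -> 'I_n}) : Q T (\prod_i y i ^+ a i).
  apply: QD (Qprod _ _); rewrite /T -sum_nat_const; apply: leq_sum => i _.
  exact: ltnW.
have [J [g [cJ gJ]]] := card_box (s * T) D0.
have [||w [w0 sw]] := @lin_dependent _ _ f {ffun Y -> 'I_n} J g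
    (fun a => ev Dp ^+ T * \prod_i y i ^+ a i).
- by rewrite cJ card_ffun card_ord.
- by move=> a; apply: kspan_fin gJ (Qbox a).
exists n, w; split=> //; have /eqP := sw.
rewrite (eq_bigr (fun a => ev Dp ^+ T * (f (w a) * \prod_i y i ^+ a i))).
  by rewrite -mulr_sumr mulf_eq0 expf_eq0 (negbTE Dp0) andbF => /eqP.
by move=> a _; rewrite mulrCA.
Qed.
End Count.

(** * Divisibility and unique factorization *)

Section Divisibility.
Variable B : idomainType.
Implicit Types a b c p q u x y z : B.

Definition dvdr a b := exists c, b = c * a.

Lemma dvdrr a : dvdr a a. Proof. by exists 1; rewrite mul1r. Qed.
Lemma dvdr0 a : dvdr a 0. Proof. by exists 0; rewrite mul0r. Qed.
Lemma dvdr_mull a b c : dvdr a b -> dvdr a (c * b).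
Proof. by case=> d ->; exists (c * d); rewrite mulrA. Qed.
Lemma dvdr_mulr a b c : dvdr a b -> dvdr a (b * c).
Proof. by rewrite mulrC; apply: dvdr_mull. Qed.
Lemma dvdr_trans b a c : dvdr a b -> dvdr b c -> dvdr a c.
Proof. by move=> ab [d ->]; apply: dvdr_mull. Qed.
Lemma dvdrD a b c : dvdr a b -> dvdr a c -> dvdr a (b + c).
Proof. by move=> [d ->] [e ->]; exists (d + e); rewrite mulrDl. Qed.
Lemma dvdrB a b c : dvdr a b -> dvdr a c -> dvdr a (b - c).
Proof. by move=> [d ->] [e ->]; exists (d - e); rewrite mulrBl. Qed.
Lemma dvdr_unit u a : u \is a GRing.unit -> dvdr u a.
Proof. by move=> uu; exists (a / u); rewrite divrK. Qed.
Lemma dvdr_unitP u a : dvdr a u -> u \is a GRing.unit -> a \is a GRing.unit.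
Proof. by case=> c ->; rewrite unitrM => /andP[]. Qed.
Lemma dvdr_mul2l c a b : c != 0 -> dvdr (c * a) (c * b) -> dvdr a b.
Proof.
move=> c0 [d e]; exists d; apply: (mulfI c0); rewrite e; ring.
Qed.
Lemma dvdr_sum (I : Type) (r : seq I) (P : pred I) (F : I -> B) a :
  (forall i, P i -> dvdr a (F i)) -> dvdr a (\sum_(i <- r | P i) F i).
Proof. by move=> H; apply: big_ind => //; [apply: dvdr0 | apply: dvdrD]. Qed.

Definition prime_elt p := [/\ p != 0, p \isn't a GRing.unit
  & forall a b, dvdr p (a * b) -> dvdr p a \/ dvdr p b].

Lemma prime_dvdM p a b : prime_elt p -> dvdr p (a * b) -> dvdr p a \/ dvdr p b.
Proof. by case=> _ _; apply. Qed.

Lemma dvdr_prime_prod p (I : Type) (r : seq I) (F : I -> B) : prime_elt p ->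
  dvdr p (\prod_(i <- r) F i) -> exists2 i, dvdr p (F i) & List.In i r.
Proof.
move=> pp; elim: r => [|i r IH].
  case: pp => p0 pu _.
  by rewrite big_nil => /dvdr_unitP; rewrite unitr1 => /(_ isT) h; rewrite h in pu.
rewrite big_cons => /(prime_dvdM pp)[h|/IH[j h hj]]; first by exists i => //; left.
by exists j => //; right.
Qed.

Lemma dvdr_prime_prod_seq p (r : seq B) : prime_elt p ->
  dvdr p (\prod_(q <- r) q) -> exists2 q, dvdr p q & q \in r.
Proof.
move=> pp; elim: r => [|i r IH].
  case: pp => p0 pu pp.
  by rewrite big_nil => /dvdr_unitP; rewrite unitr1 => /(_ isT) h; rewrite h in pu.
rewrite big_cons => /(prime_dvdM pp)[]; first by exists i; rewrite ?mem_head.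
by case/IH=> j h jr; exists j; rewrite // inE jr orbT.
Qed.

Lemma dvdr_primeX p a n : prime_elt p -> dvdr p (a ^+ n) -> dvdr p a.
Proof.
move=> [p0 pu pp]; elim: n => [|n IH]; last by rewrite exprS => /pp[].
by rewrite expr0 => /dvdr_unitP; rewrite unitr1 => /(_ isT) h; rewrite h in pu.
Qed.

Lemma prime_irreducible p : prime_elt p -> irreducible p.
Proof.
move=> [p0 pu pp]; split=> // a b e.
have : dvdr p (a * b) by rewrite -e; apply: dvdrr.
have [a0 b0] : a != 0 /\ b != 0.
  by move: p0; rewrite e mulf_eq0 negb_or => /andP[].
case/pp=> -[c h]; [right|left].
- apply/unitrPr; exists c; apply: (mulfI a0); rewrite mulr1 {2}h e; ring.
- apply/unitrPr; exists c; apply: (mulIf b0); rewrite mul1r {2}h e; ring.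
Qed.

Lemma irreducible_unit_mul u p :
  u \is a GRing.unit -> irreducible p -> irreducible (u * p).
Proof.
move=> uu [p0 pu pp]; split.
- by rewrite mulf_neq0 //; apply: contraTneq uu => ->; rewrite unitr0.
- by rewrite unitrMr.
- move=> a b e; have := pp (u^-1 * a) b; rewrite -mulrA -e mulKr //.
  by case=> //; rewrite ?unitrMr ?unitrV // => h; [left|right].
Qed.

Lemma irreducible_dvd_assoc p q : p \isn't a GRing.unit -> irreducible q -> dvdr p q ->
  exists2 u, u \is a GRing.unit & q = u * p.
Proof.
move=> pu [q0 qu qq] [c e]; exists c => //.
by case: (qq _ _ e) => // h; rewrite h in pu.
Qed.

Lemma irreducible_assoc p q :
  irreducible p -> irreducible q -> dvdr p q -> dvdr q p.
Proof.
move=> [_ pu _] iq /(irreducible_dvd_assoc pu iq)[u uu ->].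
by exists u^-1; rewrite mulKr.
Qed.

Lemma prod_unit (r : seq B) : \prod_(q <- r) q \is a GRing.unit ->
  {in r, forall q, q \is a GRing.unit}.
Proof.
elim: r => // p r IH; rewrite big_cons unitrM => /andP[pu /IH H] q.
by rewrite inE => /orP[/eqP->|/H].
Qed.

(** Primes on one side suffice: each of them divides an irreducible of the other side and is
    associated to it. The unit [u] collects what the cancellations leave behind. *)
Lemma prime_factorization_unique (s t : seq B) u :
  {in s, forall p, prime_elt p} -> {in t, forall p, irreducible p} ->
  u \is a GRing.unit ->
  \prod_(p <- s) p = u * \prod_(p <- t) p ->
  exists t', [/\ perm_eq t t', size s = size t'
        & forall i, (i < size s)%N -> associated s`_i t'`_i].
Proof.
elim: s t u => [|p s IH] t u ps it uu.
  rewrite big_nil; case: t it => [|q t] it; first by exists [::].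
  move=> e; have : u * \prod_(p <- q :: t) p \is a GRing.unit by rewrite -e unitr1.
  rewrite unitrMr // => /prod_unit/(_ q (mem_head _ _)) qu.
  by have [_] := it q (mem_head _ _); rewrite qu.
rewrite big_cons => e; have pp := ps p (mem_head _ _).
have : dvdr p (u * \prod_(p <- t) p) by rewrite -e; apply/dvdr_mulr/dvdrr.
case/(prime_dvdM pp) => [/dvdr_unitP/(_ uu) h|]; first by case: pp => _; rewrite h.
case/(dvdr_prime_prod_seq pp) => q pq qt.
have [v uv qv] := irreducible_dvd_assoc (let: And3 _ h _ := pp in h) (it q qt) pq.
have [||||t' [h1 h2 h3]] := IH (rem q t) (u * v).
- by move=> x xs; apply: ps; rewrite inE xs orbT.
- by move=> x /mem_rem; apply: it.
- by rewrite unitrMr.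
- apply: (mulfI (x := p)); first by case: pp.
  rewrite e (perm_big _ (perm_to_rem qt)) big_cons; set R := \prod_(j <- _) j; rewrite [in LHS]qv /=; ring.
exists (q :: t'); split.
- by rewrite (perm_trans (perm_to_rem qt)) // perm_cons.
- by rewrite /= h2.
- case=> [|i] /= hi; first by exists v.
  exact: h3.
Qed.

(** An irreducible element with a prime factorization is a unit times one prime, hence prime itself;
    uniqueness is then cancellation. *)
Lemma UFD_of_prime_factorizations :
  (forall x, x != 0 -> x \isn't a GRing.unit ->
     exists2 s : seq B, {in s, forall p, prime_elt p} & x = \prod_(p <- s) p) ->
  UFD B.
Proof.
move=> H; split.
  move=> x x0 xu; have [s ps ->] := H x x0 xu; exists s => // p /ps.
  exact: prime_irreducible.
have ip p : irreducible p -> prime_elt p.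
  move=> ip; have [p0 pu _] := ip; have [s ps e] := H p p0 pu.
  case: s ps e => [|q s] ps e; first by move: pu; rewrite e big_nil unitr1.
  have pq := ps q (mem_head _ _).
  have [||v uv e'] := @irreducible_dvd_assoc q p _ ip.
  - by case: pq.
  - by rewrite e big_cons; apply/dvdr_mulr/dvdrr.
  split=> // a b [c e2]; have : dvdr q (a * b) by exists (c * v); rewrite e2 e'; ring.
  have qp x : dvdr q x -> dvdr p x.
    by case=> d ->; exists (d * v^-1); rewrite e' mulrA mulrVK.
  by case: pq => _ _ h /h[/qp|/qp]; [left|right].
move=> s t is' it e; apply: (@prime_factorization_unique _ _ 1) => //.
- by move=> p /is'/ip.
- exact: unitr1.
- by rewrite mul1r.
Qed.

Section UFDTheory.
Hypothesis U : UFD B.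

(** If a b = c p, uniqueness places an associate of [p] in the concatenated factorizations of [a]
    and [b]. *)
Lemma UFD_irreducible_prime p : irreducible p -> prime_elt p.
Proof.
move=> ip; have [p0 pu _] := ip; split=> // a b [c e].
have [->|a0] := eqVneq a 0; first by left; apply: dvdr0.
have [->|b0] := eqVneq b 0; first by right; apply: dvdr0.
have c0 : c != 0.
  by apply: contra_neq (mulf_neq0 a0 b0) => c0; rewrite e c0 mul0r.
have [au|au] := boolP (a \is a GRing.unit).
  by right; exists (a^-1 * c); rewrite -mulrA -e mulKr.
have [bu|bu] := boolP (b \is a GRing.unit).
  by left; exists (c / b); rewrite mulrAC -e mulrK.
have [s is' es] := U.1 a a0 au; have [t it et] := U.1 b b0 bu.
(* The cofactor [c] may be a unit, which has no factorization; it is then merged into [p]. *)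
have [p' [r [ip' pp' ir e']]] : exists p' r, [/\ irreducible p', associated p p',
    {in r, forall q, irreducible q} & c * p = p' * \prod_(q <- r) q].
  have [cu|cu] := boolP (c \is a GRing.unit).
    exists (c * p), [::]; split=> //; last by rewrite big_nil mulr1.
    - exact: irreducible_unit_mul.
    - by exists c.
  have [r ir er] := U.1 c c0 cu; exists p, r; split=> //.
  - by exists 1; rewrite ?unitr1 ?mul1r.
  - by rewrite -er mulrC.
have [|||t' [h1 h2 h3]] := U.2 (p' :: r) (s ++ t).
- by move=> q; rewrite inE => /orP[/eqP->|/ir].
- by move=> q; rewrite mem_cat => /orP[/is'|/it].
- by rewrite big_cons big_cat /= -es -et -e'.
have pt : dvdr p t'`_0.
  have [u _ ->] := h3 0%N isT; have [v _ ->] := pp'.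
  by apply/dvdr_mull/dvdr_mull/dvdrr.
have : t'`_0 \in s ++ t by rewrite (perm_mem h1) mem_nth // -h2.
rewrite mem_cat => /orP[] h; [left; rewrite es|right; rewrite et];
  rewrite (big_rem _ h) /=; exact: dvdr_mulr.
Qed.

Lemma UFD_factor x : x != 0 -> exists u s, [/\ u \is a GRing.unit,
   {in s, forall p, irreducible p} & x = u * \prod_(p <- s) p].
Proof.
move=> x0; have [xu|xu] := boolP (x \is a GRing.unit).
  by exists x, [::]; rewrite big_nil mulr1.
have [s h1 h2] := U.1 x x0 xu; exists 1, s; split=> //; first exact: unitr1.
by rewrite mul1r.
Qed.

Lemma UFD_irreducible_dvd x : x != 0 -> x \isn't a GRing.unit ->
  exists2 p, irreducible p & dvdr p x.
Proof.
move=> x0 xu; have [[|p s] h1 e] := U.1 x x0 xu.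
  by move: xu; rewrite e big_nil unitr1.
exists p; first by apply: h1; rewrite mem_head.
by rewrite e big_cons; apply/dvdr_mulr/dvdrr.
Qed.

(** The number of irreducible factors, well defined by uniqueness and arbitrary at 0. It is the
    measure of most descents below. *)
Lemma UFD_length : exists len : B -> nat,
  [/\ forall x y, x != 0 -> y != 0 -> len (x * y) = (len x + len y)%N,
      forall u, u \is a GRing.unit -> len u = 0%N,
      forall x, x != 0 -> len x = 0%N -> x \is a GRing.unit
    & forall x, x != 0 -> len x = 1%N <-> irreducible x].
Proof.
have H x : exists n, x != 0 -> exists u s, [/\ u \is a GRing.unit,
   {in s, forall p, irreducible p}, x = u * \prod_(p <- s) p & size s = n].
  have [->|x0] := eqVneq x 0; first by exists 0%N.
  have [u [s [h1 h2 h3]]] := UFD_factor x0.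
  by exists (size s) => _; exists u, s.
have [len hl] := choice H; exists len.
have lenE x u s : x != 0 -> u \is a GRing.unit -> {in s, forall p, irreducible p} ->
    x = u * \prod_(p <- s) p -> len x = size s.
  move=> x0 uu is' e; have [v [t [vu it e' <-]]] := hl x x0.
  have [|||| t' [/perm_size h1 h2 _]] := @prime_factorization_unique s t (u^-1 * v).
  - by move=> p /is'/UFD_irreducible_prime.
  - by [].
  - by rewrite unitrMr ?unitrV.
  - by rewrite -mulrA -e' e mulKr.
  - by rewrite h2 h1.
split.
- move=> x y x0 y0; have [u [s [h1 h2 e <-]]] := hl x x0.
  have [v [t [h3 h4 e' <-]]] := hl y y0.
  rewrite (@lenE (x * y) (u * v) (s ++ t)) ?size_cat ?mulf_neq0 ?unitrMr //.
  - by move=> q; rewrite mem_cat => /orP[/h2|/h4].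
  - rewrite big_cat e e' /=; ring.
- move=> u uu; rewrite (@lenE u u [::]) ?big_nil ?mulr1 //.
  by apply: contraTneq uu => ->; rewrite unitr0.
- move=> x x0; have [u [s [h1 h2 e <-]]] := hl x x0; move/size0nil => es.
  by rewrite e es big_nil mulr1.
- move=> x x0; split.
  + have [u [s [h1 h2 e <-]]] := hl x x0.
    case: s h2 e => [|p [|q s]] //= h2 -> _; rewrite big_seq1.
    by apply: irreducible_unit_mul => //; apply: h2; rewrite mem_head.
  + move=> ix; apply: (@lenE x 1 [:: x]) => //; first exact: unitr1.
      by move=> q; rewrite inE => /eqP->.
    by rewrite big_seq1 mul1r.
Qed.

Definition coprime_elt u v := forall p, irreducible p -> dvdr p u -> dvdr p v -> False.

Lemma coprime_elt_sym u v : coprime_elt u v -> coprime_elt v u.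
Proof. by move=> h p ip pv pu; apply: h pv. Qed.

(** Euclid's lemma: the prime factors of [u] are found in [w] one after the other, since none of
    them divides [v]. *)
Lemma coprime_elt_dvdr u v w : u != 0 -> coprime_elt u v -> dvdr u (v * w) -> dvdr u w.
Proof.
move=> u0; have [c [s [cu is' ->]]] := UFD_factor u0 => {u u0}.
elim: s w is' => [|p s IH] w is' cop.
  by move=> _; rewrite big_nil mulr1; apply: dvdr_unit.
have ip : irreducible p by apply: is'; rewrite mem_head.
rewrite big_cons mulrCA => h.
have : dvdr p (v * w) by apply: dvdr_trans h; apply/dvdr_mulr/dvdrr.
case/(prime_dvdM (UFD_irreducible_prime ip)) => [pv|[w' e]].
  case: (cop p ip) => //; rewrite big_cons mulrCA; apply/dvdr_mulr/dvdrr.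
have p0 : p != 0 by case: ip.
move: h; rewrite e (_ : v * (w' * p) = p * (v * w')); last by ring.
move/(dvdr_mul2l p0)/IH => [||z ->].
- by move=> q qs; apply: is'; rewrite inE qs orbT.
- by move=> q iq qu; apply: cop iq _; rewrite big_cons mulrCA; apply: dvdr_mull.
- by exists z; ring.
Qed.

Lemma coprime_elt_mulr u v w : coprime_elt u v -> coprime_elt u w -> coprime_elt u (v * w).
Proof.
move=> h1 h2 p ip pu /(prime_dvdM (UFD_irreducible_prime ip))[]; [exact: h1|exact: h2].
Qed.

Lemma coprime_elt_unitr u v : v \is a GRing.unit -> coprime_elt u v.
Proof. by move=> vu p [_ pu _] _ /dvdr_unitP/(_ vu) h; rewrite h in pu. Qed.

Lemma coprime_elt_prod u (I : eqType) (r : seq I) (F : I -> B) :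
  {in r, forall i, coprime_elt u (F i)} -> coprime_elt u (\prod_(i <- r) F i).
Proof.
move=> H; rewrite big_seq; apply: big_ind => //.
- by apply: coprime_elt_unitr; apply: unitr1.
- exact: coprime_elt_mulr.
Qed.

End UFDTheory.
End Divisibility.

(** * Graded domains *)

Section GradedComponents.
Variables (k : fieldType) (B : idomainType) (iota : {rmorphism k -> B}).
Variables (G : zmodType) (Bg : G -> B -> Prop) (gr : grading iota Bg).

Let Bg0 := grad0 gr.
Let BgD := gradD gr.
Let BgM := gradM gr.

Lemma hom_scale g c x : Bg g x -> Bg g (iota c * x).
Proof. by move=> h; rewrite -[g]add0r; apply: BgM => //; apply: grad_const gr _. Qed.

Lemma homN g x : Bg g x -> Bg g (- x).
Proof. by move=> h; rewrite -mulN1r -(rmorph1 iota) -rmorphN; apply: hom_scale. Qed.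

Lemma homB g x y : Bg g x -> Bg g y -> Bg g (x - y).
Proof. by move=> h1 h2; apply: BgD => //; apply: homN. Qed.

Lemma hom_sum (I : Type) (r : seq I) (P : pred I) (F : I -> B) g :
  (forall i, P i -> Bg g (F i)) -> Bg g (\sum_(i <- r | P i) F i).
Proof. by move=> H; apply: big_ind => //; apply: BgD. Qed.

Lemma hom1 : Bg 0 1.
Proof. by rewrite -(rmorph1 iota); apply: grad_const gr _. Qed.

Lemma homX g x n : Bg g x -> Bg (g *+ n) (x ^+ n).
Proof.
move=> h; elim: n => [|n IH]; first by rewrite mulr0n expr0; apply: hom1.
by rewrite mulrS exprS; apply: BgM.
Qed.

Lemma hom_prod (I : Type) (r : seq I) (P : pred I) (F : I -> B) (d : I -> G) :
  (forall i, P i -> Bg (d i) (F i)) ->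
  Bg (\sum_(i <- r | P i) d i) (\prod_(i <- r | P i) F i).
Proof.
move=> H; apply: (big_rec2 (fun x y => Bg x y)); first exact: hom1.
by move=> i x y Pi; apply: BgM; apply: H.
Qed.

Lemma decomp_exists b : exists sx : seq G * (G -> B),
  [/\ uniq sx.1, forall g, Bg g (sx.2 g), forall g, (sx.2 g != 0) = (g \in sx.1)
    & b = \sum_(g <- sx.1) sx.2 g].
Proof.
have [s [x [h1 ->]]] := grad_span gr b.
(* [grad_span] allows repeated degrees in [s], so a component counts with the multiplicity of its
   degree. *)
pose y g := if g \in s then x g *+ count_mem g s else 0.
have hy g : Bg g (y g).
  rewrite /y; case: ifP => // _; elim: (count_mem g s) => // n IH.
  by rewrite mulrS; apply: BgD.
have e : \sum_(g <- s) x g = \sum_(g <- undup s) y g.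
  rewrite -big_undup_iterop_count /=; apply: eq_big_seq => g; rewrite mem_undup => gs.
  by rewrite /y gs.
exists ([seq g <- undup s | y g != 0], y) => /=; split=> //.
- by rewrite filter_uniq ?undup_uniq.
- move=> g; rewrite mem_filter mem_undup; case: eqP => //= /eqP.
  by rewrite /y; case: ifP => //; rewrite eqxx.
- rewrite e big_filter [LHS](bigID (fun g => y g != 0)) /= [X in _ + X]big1 ?addr0 //.
  by move=> g; rewrite negbK => /eqP.
Qed.

(** Support and components are obtained by choice; [hcomp_unique] shows that any other decomposition
    has the same components, whence additivity. *)
Definition supp b := (sval (cid (decomp_exists b))).1.
Definition hcomp b := (sval (cid (decomp_exists b))).2.

Lemma supp_uniq b : uniq (supp b).
Proof. by rewrite /supp; case: cid => ? []. Qed.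
Lemma hcomp_hom b g : Bg g (hcomp b g).
Proof. by rewrite /hcomp; case: cid => ? []. Qed.
Lemma mem_supp b g : (g \in supp b) = (hcomp b g != 0).
Proof. by rewrite /hcomp /supp; case: cid => ? []. Qed.
Lemma sum_hcomp b : b = \sum_(g <- supp b) hcomp b g.
Proof. by rewrite /hcomp /supp; case: cid => ? []. Qed.

Lemma sum_hcompW b s : uniq s -> {subset supp b <= s} -> \sum_(g <- s) hcomp b g = b.
Proof.
move=> us sub; rewrite {2}(sum_hcomp b) (bigID (fun g => g \in supp b)) /=.
rewrite [X in _ + X]big1 ?addr0; last by move=> g; rewrite mem_supp negbK => /eqP.
rewrite -big_filter; apply: perm_big; apply: uniq_perm.
- by rewrite filter_uniq.
- exact: supp_uniq.
- by move=> g; rewrite mem_filter; case h: (g \in supp b) => //=; apply: sub.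
Qed.

Lemma hcomp_unique b s (x : G -> B) : uniq s -> (forall g, Bg g (x g)) ->
  (forall g, g \notin s -> x g = 0) -> b = \sum_(g <- s) x g -> hcomp b =1 x.
Proof.
move=> us hx x0 e g.
pose t := undup (s ++ supp b).
have ut : uniq t by rewrite undup_uniq.
have st : {subset s <= t} by move=> h hs; rewrite mem_undup mem_cat hs.
have bt : {subset supp b <= t} by move=> h hs; rewrite mem_undup mem_cat hs orbT.
have e1 : \sum_(g <- t) x g = b.
  rewrite e (bigID (fun g => g \in s)) /= [X in _ + X]big1 ?addr0 //.
  rewrite -big_filter; apply: perm_big; apply: uniq_perm => //.
    by rewrite filter_uniq.
  by move=> h; rewrite mem_filter; case hs: (h \in s) => //=; apply: st.
have e2 : \sum_(g <- t) (hcomp b g - x g) = 0.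
  by rewrite big_split sumrN /= e1 sum_hcompW // subrr.
case ht: (g \in t).
  apply/eqP; rewrite -subr_eq0; apply/eqP; apply: (grad_direct gr ut _ e2) => // h.
  by apply: homB => //; apply: hcomp_hom.
rewrite x0; last by apply: contraFN ht => /st.
by apply/eqP; rewrite -[_ == _]negbK -mem_supp; apply: contraFN ht => /bt.
Qed.

Lemma hcomp_homE g x : Bg g x -> forall h, hcomp x h = if h == g then x else 0.
Proof.
move=> hx; apply: (@hcomp_unique _ [:: g]) => //.
- by move=> h; case: eqP => [->|].
- by move=> h; rewrite inE => /negbTE->.
- by rewrite big_seq1 eqxx.
Qed.

Lemma hom_hcomp g x : Bg g x <-> (forall h, hcomp x h != 0 -> h = g).
Proof.
split=> [hx h|H]; first by rewrite (hcomp_homE hx); case: (h =P g) => // _; rewrite eqxx.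
rewrite (sum_hcomp x) big_seq; apply: hom_sum => h; rewrite mem_supp => /H <-.
exact: hcomp_hom.
Qed.

Lemma hom_uniq g h x : Bg g x -> Bg h x -> x != 0 -> g = h.
Proof.
move=> gx hx x0; move/hom_hcomp: hx; apply.
by rewrite (hcomp_homE gx) eqxx.
Qed.

Lemma hcompD x y g : hcomp (x + y) g = hcomp x g + hcomp y g.
Proof.
apply: (@hcomp_unique _ (undup (supp x ++ supp y)) (fun g => hcomp x g + hcomp y g)).
- exact: undup_uniq.
- by move=> h; apply: BgD; apply: hcomp_hom.
- move=> h; rewrite mem_undup mem_cat !mem_supp negb_or !negbK.
  by move=> /andP[/eqP-> /eqP->]; rewrite addr0.
- rewrite big_split /= !sum_hcompW ?undup_uniq // => h hs;
  by rewrite mem_undup mem_cat hs ?orbT.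
Qed.

Lemma hcomp0 g : hcomp 0 g = 0.
Proof. by rewrite (hcomp_homE (Bg0 0)); case: eqP. Qed.

Lemma hcomp_sum (I : Type) (r : seq I) (P : pred I) (F : I -> B) g :
  hcomp (\sum_(i <- r | P i) F i) g = \sum_(i <- r | P i) hcomp (F i) g.
Proof.
elim/big_rec2: _ => [|i x y _ <-]; first exact: hcomp0.
exact: hcompD.
Qed.

Lemma hcompN x g : hcomp (- x) g = - hcomp x g.
Proof. by apply/eqP; rewrite -subr_eq0 opprK addrC -hcompD subrr hcomp0. Qed.

Lemma hcomp_homM m x y g : Bg m x -> hcomp (x * y) g = x * hcomp y (g - m).
Proof.
move=> hx; rewrite {1}(sum_hcomp y) mulr_sumr hcomp_sum.
transitivity (\sum_(i <- supp y) if g - m == i then x * hcomp y i else 0).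
  apply: eq_bigr => i _; rewrite (hcomp_homE (BgM hx (hcomp_hom y i))).
  by rewrite subr_eq [i + m]addrC.
rewrite -big_mkcond /= -big_filter.
case h : (g - m \in supp y).
  rewrite (@perm_big _ _ _ _ _ [:: g - m]) ?big_seq1 //.
  apply: uniq_perm => //; first by rewrite filter_uniq ?supp_uniq.
  move=> i; rewrite mem_filter inE eq_sym; case: eqP => // ->; exact: h.
have /eqP-> : hcomp y (g - m) == 0 by rewrite -[_ == _]negbK -mem_supp h.
rewrite mulr0 big_seq big1 // => i; rewrite mem_filter => /andP[/eqP<-].
by rewrite h.
Qed.

Lemma hcompM x y g : hcomp (x * y) g = \sum_(i <- supp x) hcomp x i * hcomp y (g - i).
Proof.
rewrite {1}(sum_hcomp x) mulr_suml hcomp_sum; apply: eq_bigr => i _.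
by apply: hcomp_homM; apply: hcomp_hom.
Qed.

Lemma supp_neq0 x : x != 0 -> exists g, hcomp x g != 0.
Proof.
move=> x0; apply: contrapT => H; move/eqP: x0; apply.
rewrite (sum_hcomp x) big1_seq // => g /andP[_]; rewrite mem_supp => h.
by case: H; exists g.
Qed.

Lemma hcomp_dvdr p d b : Bg d p -> dvdr p b -> forall g, dvdr p (hcomp b g).
Proof.
move=> hp [c ->] g; exists (hcomp c (g - d)).
by rewrite mulrC (hcomp_homM _ _ hp) mulrC.
Qed.

Lemma hom_dvdr_quot g d p x c : Bg d p -> p != 0 -> Bg g x -> x = c * p -> Bg (g - d) c.
Proof.
move=> hp p0 hx e; apply/hom_hcomp => h ch.
have : hcomp x (h + d) != 0.
  by rewrite e mulrC (hcomp_homM _ _ hp) addrK mulf_neq0.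
by rewrite (hcomp_homE hx); case: (_ =P g) => [<-|]; rewrite ?addrK ?eqxx.
Qed.

(** Coarsening along a map of degree groups. It is used for the projections of Z^s to one
    coordinate, where degrees are ordered and leading terms exist. *)
Definition coarse (H : zmodType) (L : G -> H) (c : H) (x : B) :=
  forall g, hcomp x g != 0 -> L g = c.

Lemma coarse_grading (H : zmodType) (L : G -> H) :
  {morph L : x y / x + y} -> grading iota (coarse L).
Proof.
move=> LD; have L0 : L 0 = 0 by apply: (addrI (L 0)); rewrite -LD !addr0.
split.
- by move=> c g; rewrite hcomp0 eqxx.
- move=> c x y hx hy g; rewrite hcompD; have [->|/hx//] := eqVneq (hcomp x g) 0.
  by rewrite add0r => /hy.
- move=> c c' x y hx hy g; rewrite hcompM => h.
  have [i hi hij] : exists2 i, i \in supp x & hcomp x i * hcomp y (g - i) != 0.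
    apply: contrapT => H0; move/eqP: h; apply; rewrite big1_seq // => i /andP[_ ix].
    by apply: contrapT => h; apply: H0; exists i => //; apply/eqP.
  move: hij; rewrite mulf_eq0 negb_or => /andP[/hx <- /hy <-].
  by rewrite -LD addrC subrK.
- move=> c g; rewrite (hcomp_homE (grad_const gr c)); case: (g =P 0) => [->//|].
  by rewrite eqxx.
- move=> b; exists (undup (map L (supp b))).
  exists (fun c => \sum_(g <- supp b | L g == c) hcomp b g); split.
    move=> c g; rewrite hcomp_sum => h; apply: contrapT => /eqP Lg.
    move/eqP: h; apply; rewrite big1 // => i /eqP Li.
    rewrite (hcomp_homE (hcomp_hom b i)); case: (g =P i) => // e.
    by move: Lg; rewrite e Li eqxx.
  under eq_bigr do rewrite big_mkcond; rewrite /= exchange_big {1}(sum_hcomp b) /=.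
  apply: eq_big_seq => g gs.
  rewrite (bigD1_seq (L g)) ?undup_uniq ?mem_undup ?map_f //= eqxx big1 ?addr0 //.
  by move=> c; rewrite eq_sym => /negbTE->.
- move=> s x us hx e c cs; apply: contrapT => /eqP xc.
  have [g xg] := supp_neq0 xc; have : hcomp (\sum_(c <- s) x c) g = 0.
    by rewrite e hcomp0.
  rewrite hcomp_sum (bigD1_seq c) //= big1 ?addr0; first by move/eqP: xg.
  move=> c' c'c; apply: contrapT => /eqP h.
  by move: c'c; rewrite -(hx _ _ h) (hx _ _ xg) eqxx.
Qed.

End GradedComponents.

(** * Leading terms; gradings by Z and by Z^s *)

Section MoreGradings.
Import Order.TTheory Num.Theory.

Lemma seq_max_exists (s : seq int) i0 : i0 \in s ->
  exists2 m, m \in s & forall i, i \in s -> (i <= m)%R.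
Proof.
elim: s i0 => // a [|b s] IH i0 _.
  by exists a; rewrite ?mem_head // => i; rewrite inE => /eqP->.
have [m ms hm] := IH b (mem_head _ _).
have [am|ma] := leP a m.
  by exists m; [rewrite inE ms orbT | move=> i; rewrite inE => /orP[/eqP->|/hm]].
exists a; rewrite ?mem_head // => i; rewrite inE => /orP[/eqP->|/hm h] //.
exact: le_trans h (ltW ma).
Qed.

Variables (k : fieldType) (B : idomainType) (iota : {rmorphism k -> B}).

Lemma hcompM_extreme (G : zmodType) (Bg : G -> B -> Prop) (gr : grading iota Bg) x y a b :
  (forall i j, hcomp gr x i != 0 -> hcomp gr y j != 0 -> i + j = a + b -> i = a) ->
  hcomp gr (x * y) (a + b) = hcomp gr x a * hcomp gr y b.
Proof.
move=> H; rewrite hcompM.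
have z i : i != a -> hcomp gr x i * hcomp gr y (a + b - i) = 0.
  move=> ia; apply: contrapT => /eqP; rewrite mulf_eq0 negb_or => /andP[xi yi].
  by move: ia; rewrite (H _ _ xi yi) ?eqxx // addrC subrK.
have e : a + b - a = b by rewrite addrAC subrr add0r.
case h : (a \in supp gr x).
  rewrite (bigD1_seq a) ?supp_uniq //= e big1 ?addr0 // => i; exact: z.
have /eqP-> : hcomp gr x a == 0 by rewrite -[_ == _]negbK -mem_supp h.
rewrite mul0r big1_seq // => i /andP[_ ix]; apply: z.
by apply: contraFneq h => <-.
Qed.

Section IntGrading.
Variables (Bz : int -> B -> Prop) (gr : grading iota Bz).

Lemma top_exists x : exists h, x != 0 ->
  hcomp gr x h != 0 /\ forall i, hcomp gr x i != 0 -> (i <= h)%R.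
Proof.
have [->|x0] := eqVneq x 0; first by exists 0.
have [g] := supp_neq0 gr x0; rewrite -mem_supp => /seq_max_exists[m ms hm].
by exists m => _; rewrite -mem_supp; split=> // i; rewrite -mem_supp; apply: hm.
Qed.

Lemma bot_exists x : exists h, x != 0 ->
  hcomp gr x h != 0 /\ forall i, hcomp gr x i != 0 -> (h <= i)%R.
Proof.
have [->|x0] := eqVneq x 0; first by exists 0.
have [g] := supp_neq0 gr x0; rewrite -mem_supp => gx.
have [m ms hm] := seq_max_exists (map_f (-%R) gx).
exists (- m) => _; rewrite -mem_supp; split.
  by case/mapP: ms => i ix ->; rewrite opprK.
by move=> i; rewrite -mem_supp => ix; rewrite lerNl; apply: hm; apply: map_f.
Qed.

(** Degrees of the leading and of the trailing component; the values at 0 are unspecified. *)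
Definition top := projT1 (choice top_exists).
Definition bot := projT1 (choice bot_exists).

Lemma hcomp_top x : x != 0 -> hcomp gr x (top x) != 0.
Proof. by rewrite /top; case: choice => t /= h /h[]. Qed.
Lemma top_max x i : hcomp gr x i != 0 -> (i <= top x)%R.
Proof.
have [->|x0] := eqVneq x 0; first by rewrite hcomp0 eqxx.
by rewrite /top; case: choice => t /= h; have [_] := h _ x0; apply.
Qed.
Lemma hcomp_bot x : x != 0 -> hcomp gr x (bot x) != 0.
Proof. by rewrite /bot; case: choice => t /= h /h[]. Qed.
Lemma bot_min x i : hcomp gr x i != 0 -> (bot x <= i)%R.
Proof.
have [->|x0] := eqVneq x 0; first by rewrite hcomp0 eqxx.
by rewrite /bot; case: choice => t /= h; have [_] := h _ x0; apply.
Qed.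
Lemma bot_le_top x : x != 0 -> (bot x <= top x)%R.
Proof. by move=> /hcomp_top/bot_min. Qed.

Lemma hcompM_top x y : hcomp gr (x * y) (top x + top y) = hcomp gr x (top x) * hcomp gr y (top y).
Proof. by apply: hcompM_extreme => i j /top_max ? /top_max ? ?; lia. Qed.
Lemma hcompM_bot x y : hcomp gr (x * y) (bot x + bot y) = hcomp gr x (bot x) * hcomp gr y (bot y).
Proof. by apply: hcompM_extreme => i j /bot_min ? /bot_min ? ?; lia. Qed.

Lemma hcompM_neq0 x y g : hcomp gr (x * y) g != 0 ->
  exists i j, [/\ hcomp gr x i != 0, hcomp gr y j != 0 & g = i + j].
Proof.
rewrite hcompM => h; apply: contrapT => H; move/eqP: h; apply.
rewrite big1_seq // => i /andP[_]; rewrite mem_supp => ix.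
apply: contrapT => /eqP; rewrite mulf_eq0 negb_or => /andP[xi yi].
by apply: H; exists i, (g - i); split=> //; rewrite addrC subrK.
Qed.

Lemma topM x y : x != 0 -> y != 0 -> top (x * y) = top x + top y.
Proof.
move=> x0 y0; apply/eqP; rewrite eq_le; apply/andP; split.
  have /hcompM_neq0[i [j [/top_max hi /top_max hj ->]]] := hcomp_top (mulf_neq0 x0 y0).
  lia.
by apply: top_max; rewrite hcompM_top mulf_neq0 ?hcomp_top.
Qed.

Lemma botM x y : x != 0 -> y != 0 -> bot (x * y) = bot x + bot y.
Proof.
move=> x0 y0; apply/eqP; rewrite eq_le; apply/andP; split; last first.
  have /hcompM_neq0[i [j [/bot_min hi /bot_min hj ->]]] := hcomp_bot (mulf_neq0 x0 y0).
  lia.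
by apply: bot_min; rewrite hcompM_bot mulf_neq0 ?hcomp_bot.
Qed.

Lemma hom_top_bot x : x != 0 -> top x = bot x <-> exists c, Bz c x.
Proof.
move=> x0; split=> [e|[c hx]].
  by exists (top x); apply/(hom_hcomp gr) => i xi; have := top_max xi; have := bot_min xi; lia.
have := hcomp_top x0; have := hcomp_bot x0.
move/(hom_hcomp gr): hx => hx.
by move=> /hx -> /hx ->.
Qed.

(** The difference of top and bottom degree is additive and nonnegative; it vanishes for the
    product, hence for both factors. *)
Lemma hom_factor_int c x y : x * y != 0 -> Bz c (x * y) ->
  exists a b, Bz a x /\ Bz b y.
Proof.
move=> xy0 hxy; have := xy0; rewrite mulf_eq0 negb_or => /andP[x0 y0].
have /(hom_top_bot xy0) : exists c, Bz c (x * y) by exists c.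
rewrite topM // botM // => e.
have bx := bot_le_top x0; have by_ := bot_le_top y0.
have /(hom_top_bot x0)[a ha] : top x = bot x by lia.
have /(hom_top_bot y0)[b hb] : top y = bot y by lia.
by exists a, b.
Qed.

End IntGrading.

Section LatticeGrading.
Variables (s : nat) (Bg : 'rV[int]_s -> B -> Prop) (gr : grading iota Bg).

Definition deg_coord (j : 'I_s) (v : 'rV[int]_s) : int := v 0 j.

Lemma coordD j : {morph deg_coord j : x y / x + y}.
Proof. by move=> x y; rewrite /deg_coord mxE. Qed.

Definition coord_gr j := coarse_grading gr (coordD j).

(** The product is homogeneous for every coordinate grading, hence so are its factors; their
    coordinate degrees are collected into vectors. *)
Lemma hom_factor g x y : x * y != 0 -> Bg g (x * y) ->
  exists a b, [/\ Bg a x, Bg b y & a + b = g].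
Proof.
move=> xy0 hxy.
have H j : exists ab : int * int, coarse gr (deg_coord j) ab.1 x /\ coarse gr (deg_coord j) ab.2 y.
  have [|a [b [ha hb]]] := @hom_factor_int _ (coord_gr j) (deg_coord j g) x y xy0.
    by move=> h; rewrite (hcomp_homE gr hxy); case: (h =P g) => [->|]; rewrite ?eqxx.
  by exists (a, b).
have [c hc] := choice H.
have hx : Bg (\row_j (c j).1) x.
  by apply/(hom_hcomp gr) => h xh; apply/rowP => j; rewrite mxE -((hc j).1 _ xh).
have hy : Bg (\row_j (c j).2) y.
  by apply/(hom_hcomp gr) => h xh; apply/rowP => j; rewrite mxE -((hc j).2 _ xh).
exists (\row_j (c j).1), (\row_j (c j).2); split=> //.
have hM := gradM gr hx hy.
exact: (hom_uniq gr hM hxy xy0).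
Qed.

Lemma hom_dvdr g x y : x != 0 -> Bg g x -> dvdr y x -> exists2 a, Bg a y & exists2 c, Bg (g - a) c & x = c * y.
Proof.
move=> x0 hx [c e]; have cy0 : c * y != 0 by rewrite -e.
have [|a [b [ha hb ab]]] := @hom_factor g c y cy0; first by rewrite -e.
by exists b => //; exists c => //; rewrite -ab addrK.
Qed.

Hypothesis B0 : deg0_const iota Bg.

Lemma hom0_const b : Bg 0 b -> exists c, b = iota c.
Proof. by move/B0. Qed.

Lemma unit_hom u : u \is a GRing.unit -> exists g, Bg g u /\ Bg (- g) u^-1.
Proof.
move=> uu; have [||a [b [ha hb ab]]] := @hom_factor 0 u u^-1.
- by rewrite mulrV ?oner_eq0.
- by rewrite mulrV //; apply: hom1 gr.
exists a; split=> //.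
by rewrite (_ : - a = b) //; apply/eqP; rewrite eq_sym -addr_eq0 addrC ab.
Qed.

(** Units are homogeneous, with inverse in the opposite degree. Conversely, as B_0 = k, nonzero
    elements of opposite degrees multiply to a nonzero constant and are units. *)
Lemma unmixed_trivial_units : unmixed Bg <-> trivial_units iota.
Proof.
split=> [um b|tu g [x hx x0] [y hy y0]].
  split=> [bu|[c c0 ->]]; last by rewrite rmorph_unit ?unitfE.
  have [g [h1 h2]] := unit_hom bu.
  have g0 : g = 0.
    apply: um; [exists b => // | exists b^-1 => //]; apply: contraTneq bu => e.
      by rewrite e unitr0.
    by rewrite -unitrV e unitr0.
  move: h1; rewrite g0 => /hom0_const[c e]; exists c => //.
  by apply: contraTneq bu => c0; rewrite e c0 rmorph0 unitr0.
have : Bg 0 (x * y) by rewrite -(subrr g); apply: (gradM gr).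
case/hom0_const => c e.
have xu : x \is a GRing.unit.
  have : x * y \is a GRing.unit.
    rewrite e rmorph_unit // unitfE; apply: contra_neq (mulf_neq0 x0 y0).
    by rewrite e => ->; rewrite rmorph0.
  by rewrite unitrM => /andP[].
have [c' c'0 e'] := (tu x).1 xu.
by apply: (hom_uniq gr hx _ x0); rewrite e'; apply: grad_const gr _.
Qed.

End LatticeGrading.
End MoreGradings.

(** * Transcendence degree and homogeneous fractions *)

Section MPolyLast.
Variables (R : comNzRingType) (n : nat).

(** Evaluation in two stages: first all variables but the last through [phi], then the last one at
    [y]. *)
Lemma horner_muni (S : comNzRingType) (phi : {rmorphism {mpoly R[n]} -> S}) (y : S)
    (f : {rmorphism R -> S}) (h : 'I_n.+1 -> S) (p : {mpoly R[n.+1]}) :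
  (forall c, phi c%:MP = f c) ->
  (forall i, h (widen_ord (leqnSn n) i) = phi 'X_i) -> h ord_max = y ->
  (map_poly phi (muni p)).[y] = mmap f h p.
Proof.
move=> hc hx hy; rewrite muniE rmorph_sum horner_sum /mmap; apply: eq_bigr => m _.
rewrite /= map_polyZ /= map_polyXn hornerZ hornerXn -mul_mpolyC rmorphM hc -mulrA.
congr (_ * _); rewrite /mmap1 big_ord_recr /= hy; congr (_ * _).
rewrite mpolyXE_id rmorph_prod; apply: eq_bigr => i _.
by rewrite rmorphXn /= hx mnmE.
Qed.

(** Substituting the variables themselves recovers [p] from [muni p]. *)
Lemma muni_eq0 (p : {mpoly R[n.+1]}) : muni p = 0 -> p = 0.
Proof.
move=> e.
have := @horner_muni _ (@mwiden n R) 'X_ord_max (@mpolyC n.+1 R) (fun i => 'X_i) p.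
rewrite e rmorph0 horner0 => /(_ _ _ erefl) => ->.
- rewrite [LHS]mpolyE; apply: eq_bigr => m _; rewrite mul_mpolyC; congr (_ *: _).
  by rewrite mmap1_id.
- by move=> c; rewrite /= mwidenC.
- by move=> i; rewrite /= mwidenX mnmwiden1.
Qed.
End MPolyLast.

Section TrdegCount.
Variables (k : fieldType) (L : fieldType) (f : {rmorphism k -> L}).

(** Membership in the field k(w), expressed without constructing that field. *)
Definition gen n (w : 'I_n -> L) (z : L) := exists P Q : {mpoly k[n]},
  mmap f w Q != 0 /\ z * mmap f w Q = mmap f w P.

Section Gen.
Variables (n : nat) (w : 'I_n -> L).
Local Notation gen := (gen w).
Local Notation ev := (mmap f w).

Lemma gen_const c : gen (f c).
Proof. by exists c%:MP, 1; rewrite rmorph1 oner_eq0 mulr1 mmapC. Qed.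
Lemma gen_var i : gen (w i).
Proof. by exists 'X_i, 1; rewrite rmorph1 oner_eq0 mulr1 mmapX mmap1U. Qed.
Lemma genD a b : gen a -> gen b -> gen (a + b).
Proof.
move=> [P [Q [Q0 e]]] [P' [Q' [Q'0 e']]]; exists (P * Q' + P' * Q), (Q * Q').
rewrite rmorphD !rmorphM /= mulf_neq0 // -e -e'; split=> //; ring.
Qed.
Lemma genM a b : gen a -> gen b -> gen (a * b).
Proof.
move=> [P [Q [Q0 e]]] [P' [Q' [Q'0 e']]]; exists (P * P'), (Q * Q').
rewrite !rmorphM /= mulf_neq0 // -e -e'; split=> //; ring.
Qed.
Lemma genV a : gen a -> gen a^-1.
Proof.
have [->|a0] := eqVneq a 0; first by rewrite invr0.
move=> [P [Q [Q0 e]]]; exists Q, P; rewrite -e mulf_neq0 //; split=> //.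
by rewrite mulKf.
Qed.
Lemma gen0 : gen 0. Proof. by rewrite -(rmorph0 f); apply: gen_const. Qed.
Lemma gen1 : gen 1. Proof. by rewrite -(rmorph1 f); apply: gen_const. Qed.
Lemma genX a m : gen a -> gen (a ^+ m).
Proof. by move=> h; elim: m => [|m IH]; rewrite ?expr0 ?exprS; [apply: gen1|apply: genM]. Qed.
Lemma genXz a (m : int) : gen a -> gen (a ^ m).
Proof.
move=> h; case: m => m; first exact: genX.
by rewrite NegzE -exprnN -exprVn; apply/genX/genV.
Qed.
Lemma gen_sum (I : Type) (r : seq I) (P : pred I) (F : I -> L) :
  (forall i, P i -> gen (F i)) -> gen (\sum_(i <- r | P i) F i).
Proof. by move=> H; apply: big_ind => //; [apply: gen0|apply: genD]. Qed.
Lemma gen_prod (I : Type) (r : seq I) (P : pred I) (F : I -> L) :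
  (forall i, P i -> gen (F i)) -> gen (\prod_(i <- r | P i) F i).
Proof. by move=> H; apply: big_ind => //; [apply: gen1|apply: genM]. Qed.
End Gen.

(** A presentation of [y i] as P / Q makes it a root of the linear polynomial Q X - P over k[w]. *)
Lemma dependent_of_generators n (w : 'I_n -> L) (Y : finType) (y : Y -> L) :
  (n < #|Y|)%N -> (forall i, gen w (y i)) ->
  exists m (c : {ffun Y -> 'I_m} -> k), (exists a, c a != 0) /\
    \sum_a f (c a) * \prod_i y i ^+ a i = 0.
Proof.
move=> nY H; apply: (@monomial_relation k L f n w) => // i.
have [P [Q [Q0 e]]] := H i; exists (Q *: 'X - P%:P).
have Qn0 : Q != 0 by apply: contra_neq Q0 => ->; rewrite rmorph0.
have lc : lead_coef (Q *: 'X - P%:P) = Q.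
  rewrite lead_coefDl ?lead_coefZ ?lead_coefX ?mulr1 //.
  rewrite size_polyN size_scale // size_polyX.
  by rewrite (leq_ltn_trans (size_polyC_leq1 _)).
rewrite lc; split=> //; rewrite rmorphB /= map_polyC map_polyZ /= map_polyX.
by rewrite hornerD hornerN hornerZ hornerX hornerC mulrC e subrr.
Qed.

Lemma indep_no_relation n (x : 'I_n -> L) m (c : {ffun 'I_n -> 'I_m} -> k) :
  alg_indep f x -> (exists a, c a != 0) ->
  \sum_a f (c a) * \prod_i x i ^+ a i = 0 -> False.
Proof.
move=> ind [a ca] e.
pose mn (a : {ffun 'I_n -> 'I_m}) := [multinom (a i : nat) | i < n].
have mn_inj : injective mn.
  move=> a1 a2 /mnmP h; apply/ffunP => i; apply: val_inj.
  by have := h i; rewrite !mnmE.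
have /ind/mpolyP/(_ (mn a)) : mmap f x (\sum_a c a *: 'X_[mn a]) = 0.
  rewrite rmorph_sum /= -[RHS]e; apply: eq_bigr => b _.
  by rewrite mmapZ mmapX; congr (_ * _); apply: eq_bigr => i _; rewrite mnmE.
rewrite mcoeff0 raddf_sum /= (bigD1 a) //= mcoeffZ mcoeffX eqxx mulr1 big1 ?addr0.
  by move/eqP; rewrite (negbTE ca).
move=> b ba; rewrite mcoeffZ mcoeffX (inj_eq mn_inj) (negbTE ba) mulr0 //.
Qed.

End TrdegCount.

Lemma fraction_repr (B : idomainType) (z : {fraction B}) :
  exists x y : B, y != 0 /\ z = tofrac x / tofrac y.
Proof.
elim/quotW: z => r; exists (frac r).1, (frac r).2; split; first exact: denom_ratioP.
have d0 : tofrac (frac r).2 != 0 by rewrite tofrac_eq0 denom_ratioP.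
apply: (mulIf d0); rewrite mulfVK //; unlock FracField.tofrac.
rewrite -[LHS]FracField.pi_mul; apply/eqmodP => /=.
rewrite FracField.equivfE /FracField.mulf !numden_Ratio ?oner_eq0 ?mulf_neq0 ?denom_ratioP //.
all: by rewrite ?oner_eq0 // !mulr1 mulrC.
Qed.

Section TrdegFraction.
Variables (k : fieldType) (B : idomainType) (iota : {rmorphism k -> B}) (d : nat).
Local Notation L := {fraction B}.
Local Notation f := (@tofrac B \o iota : {rmorphism k -> L}).
Hypothesis td : has_trdeg iota d.

(** By maximality of the transcendence basis, each [y i] satisfies a relation over it. Read in its
    last variable, the relation has a leading coefficient that does not vanish on the basis, as
    [monomial_relation] requires. *)
Lemma trdeg_dependent (Y : finType) (y : Y -> L) : (d < #|Y|)%N ->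
  exists m (c : {ffun Y -> 'I_m} -> k), (exists a, c a != 0) /\
    \sum_a f (c a) * \prod_i y i ^+ a i = 0.
Proof.
have [x [ind mx]] := td => dY; apply: (@monomial_relation k L f d x) => // i.
have [p pe p0] : exists2 p : {mpoly k[d.+1]},
    mmap f (fun j : 'I_d.+1 => oapp x (y i) (unlift ord_max j)) p = 0 & p != 0.
  apply: contrapT => H; apply: (mx (y i)) => p pe.
  by apply: contrapT => /eqP p0; apply: H; exists p.
have Pp : (map_poly (mmap f x) (muni p)).[y i] = 0.
  rewrite -[RHS]pe; apply: horner_muni.
  - by move=> c; rewrite /= mmapC.
  - move=> j; rewrite /= mmapX mmap1U.
    by rewrite (_ : widen_ord _ j = lift ord_max j) ?liftK //; apply: val_inj; exact: esym (lift_max j).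
  - by rewrite unlift_none.
exists (muni p); split=> //.
have : lead_coef (muni p) != 0.
  by rewrite lead_coef_eq0; apply: contra_neq p0 => /muni_eq0.
by apply: contra_neq => /ind.
Qed.

Lemma trdeg_le_generators n (w : 'I_n -> L) : (forall z, gen f w z) -> (d <= n)%N.
Proof.
have [x [ind _]] := td => H; rewrite leqNgt; apply/negP => nd.
have [||m [c [c0 e]]] := @dependent_of_generators k L f n w 'I_d x.
- by rewrite card_ord.
- by [].
exact: indep_no_relation ind c0 e.
Qed.

Lemma trdeg_ge_indep n (w : 'I_n -> L) : alg_indep f w -> (n <= d)%N.
Proof.
move=> ind; rewrite leqNgt; apply/negP => nd.
have [|m [c [c0 e]]] := @trdeg_dependent 'I_n w; first by rewrite card_ord.
exact: indep_no_relation ind c0 e.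
Qed.

End TrdegFraction.

Section HomFractions.
Variables (k : fieldType) (B : idomainType) (iota : {rmorphism k -> B}).
Variables (s : nat) (Bg : 'rV[int]_s -> B -> Prop) (gr : grading iota Bg).
Hypothesis eff : effective Bg.
Local Notation G := 'rV[int]_s.
Local Notation L := {fraction B}.
Local Notation f := (@tofrac B \o iota : {rmorphism k -> L}).
Local Notation F := (@tofrac B).

(** The degree-[g] part of the localization of [B] at its nonzero homogeneous elements. *)
Definition homfrac (g : G) (z : L) := exists a b x y,
  [/\ Bg a x, Bg b y, y != 0, a - b = g & z = F x / F y].

Lemma homfrac_hom g x : Bg g x -> homfrac g (F x).
Proof.
move=> hx; exists g, 0, x, 1; rewrite oner_eq0 subr0 rmorph1 divr1.
by split=> //; apply: hom1 gr.
Qed.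

Lemma homfrac0 g : homfrac g 0.
Proof. by rewrite -(rmorph0 F); apply/homfrac_hom/(grad0 gr). Qed.

Lemma homfrac_const c : homfrac 0 (f c).
Proof. exact/homfrac_hom/(grad_const gr). Qed.

Lemma homfracM g h z w : homfrac g z -> homfrac h w -> homfrac (g + h) (z * w).
Proof.
move=> [a [b [x [y [hx hy y0 <- ->]]]]] [a' [b' [x' [y' [hx' hy' y0' <- ->]]]]].
exists (a + a'), (b + b'), (x * x'), (y * y'); split.
- exact: (gradM gr).
- exact: (gradM gr).
- exact: mulf_neq0.
- by rewrite opprD addrACA.
- by rewrite !rmorphM invfM /= mulrACA.
Qed.

Lemma homfracV g z : homfrac g z -> homfrac (- g) z^-1.
Proof.
have [-> _|z0] := eqVneq z 0; first by rewrite invr0; apply: homfrac0.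
move=> [a [b [x [y [hx hy y0 <- e]]]]]; exists b, a, y, x; split=> //.
- by apply: contra_neq z0 => x0; rewrite e x0 rmorph0 mul0r.
- by rewrite opprB.
- by rewrite e invf_div.
Qed.

Lemma homfracD g z w : homfrac g z -> homfrac g w -> homfrac g (z + w).
Proof.
move=> [a [b [x [y [hx hy y0 <- ->]]]]] [a' [b' [x' [y' [hx' hy' y0' e ->]]]]].
have ea : a' + b = a + b' by rewrite -[a'](subrK b') e addrAC subrK.
exists (a + b'), (b + b'), (x * y' + x' * y), (y * y'); split.
- apply: (gradD gr); first exact: (gradM gr).
  by rewrite -ea; apply: (gradM gr).
- exact: (gradM gr).
- exact: mulf_neq0.
- by rewrite opprD addrACA subrr addr0.
- by rewrite !(rmorphD, rmorphM) /= addf_div // tofrac_eq0.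
Qed.

Lemma homfrac1 : homfrac 0 1.
Proof. by rewrite -(rmorph1 f); apply: homfrac_const. Qed.

Lemma homfracX g z n : homfrac g z -> homfrac (g *+ n) (z ^+ n).
Proof.
move=> h; elim: n => [|n IH]; first exact: homfrac1.
by rewrite mulrS exprS; apply: homfracM.
Qed.

Lemma homfracXz g z (n : int) : homfrac g z -> homfrac (g *~ n) (z ^ n).
Proof.
move=> h; case: n => n; first exact: homfracX.
rewrite NegzE -exprnN mulrNz; apply/homfracV; exact: homfracX.
Qed.

Lemma homfrac_sum g (I : Type) (r : seq I) (P : pred I) (E : I -> L) :
  (forall i, P i -> homfrac g (E i)) -> homfrac g (\sum_(i <- r | P i) E i).
Proof. by move=> H; apply: big_ind => //; [apply: homfrac0|apply: homfracD]. Qed.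

Lemma homfrac_prod (I : Type) (r : seq I) (P : pred I) (E : I -> L) (e : I -> G) :
  (forall i, P i -> homfrac (e i) (E i)) ->
  homfrac (\sum_(i <- r | P i) e i) (\prod_(i <- r | P i) E i).
Proof.
move=> H; apply: (big_rec2 (fun x y => homfrac x y)); first exact: homfrac1.
by move=> i x y Pi; apply: homfracM; apply: H.
Qed.

Lemma homfrac_common (I : Type) (r : seq I) (g : I -> G) (z : I -> L) :
  (forall i, homfrac (g i) (z i)) ->
  exists D Y, [/\ Bg D Y, Y != 0 & forall i, List.In i r -> exists2 w, Bg (g i + D) w & z i * F Y = F w].
Proof.
move=> hz; elim: r => [|i r [D [Y [hY Y0 H]]]].
  by exists 0, 1; split=> //; [apply: hom1 gr | rewrite oner_eq0].
have [a [b [x [y [hx hy y0 e ez]]]]] := hz i.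
exists (D + b), (Y * y); split; first exact: (gradM gr).
  exact: mulf_neq0.
move=> j [<-|/H[w hw ew]]; last first.
  by exists (w * y); [rewrite addrA; apply: (gradM gr)|rewrite !rmorphM mulrA ew].
exists (x * Y); last by rewrite !rmorphM ez /= [F Y * _]mulrC mulrA divfK ?tofrac_eq0.
by rewrite -e addrA addrAC subrK; apply: (gradM gr).
Qed.

(** A common homogeneous denominator shifts all degrees by the same amount, so directness of the
    grading of [B] applies to the numerators. *)
Lemma homfrac_direct (I : finType) (g : I -> G) (z : I -> L) : injective g ->
  (forall i, homfrac (g i) (z i)) -> \sum_i z i = 0 -> forall i, z i = 0.
Proof.
move=> gi hz e i; have [D [Y [hY Y0 H]]] := homfrac_common (enum I) hz.
have inl j : List.In j (enum I).
  have : j \in enum I by rewrite mem_enum.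
  elim: (enum I) => // a r IH; rewrite inE => /orP[/eqP->|/IH]; by [left|right].
have [w hw] : exists w : I -> B, forall j, Bg (g j + D) (w j) /\ z j * F Y = F (w j).
  have [j|w hw] := @choice I B (fun j w => Bg (g j + D) w /\ z j * F Y = F w).
    by have [w ? ?] := H j (inl j); exists w.
  by exists w.
have FY : F Y != 0 by rewrite tofrac_eq0.
have e' : \sum_j w j = 0.
  apply/eqP; rewrite -tofrac_eq0 rmorph_sum /=.
  by rewrite (eq_bigr (fun j => z j * F Y)) -?mulr_suml ?e ?mul0r // => j _; case: (hw j).
have : hcomp gr (\sum_j w j) (g i + D) = 0 by rewrite e' hcomp0.
rewrite hcomp_sum (bigD1 i) //= (hcomp_homE gr (hw i).1) eqxx big1 ?addr0.
  move=> w0; apply: (mulIf FY); by rewrite (hw i).2 w0 mul0r rmorph0.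
move=> j ji; rewrite (hcomp_homE gr (hw j).1); case: (_ =P g j + D) => // /addIr/gi.
by move=> ij; rewrite ij eqxx in ji.
Qed.

(** The degrees of nonzero homogeneous fractions form a group that contains all weights;
    effectiveness makes it the whole of Z^s. *)
Lemma effective_homfrac g : exists2 z, homfrac g z & z != 0.
Proof.
suff: exists a b x y, [/\ Bg a x, Bg b y, x != 0, y != 0 & a - b = g].
  move=> [a [b [x [y [hx hy x0 y0 e]]]]]; exists (F x / F y).
    by exists a, b, x, y.
  by rewrite mulf_neq0 ?invr_eq0 ?tofrac_eq0.
apply: (eff (H := fun g => exists a b x y, [/\ Bg a x, Bg b y, x != 0, y != 0 & a - b = g])).
- by exists 0, 0, 1, 1; rewrite oner_eq0 subr0; split=> //; apply: hom1 gr.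
- move=> _ _ [a [b [x [y [hx hy x0 y0 <-]]]]] [a' [b' [x' [y' [hx' hy' x0' y0' <-]]]]].
  exists (a + b'), (b + a'), (x * y'), (y * x'); rewrite !mulf_neq0 //.
  by split=> //; [exact: (gradM gr)|exact: (gradM gr)|rewrite opprB opprD addrACA].
- move=> h [x hx x0]; exists h, 0, x, 1; rewrite oner_eq0 subr0.
  by split=> //; apply: hom1 gr.
Qed.

Lemma basis_homfracs : exists z : 'I_s -> L,
  (forall j, homfrac (delta_mx 0 j) (z j)) /\ forall j, z j != 0.
Proof.
have H j : exists z : L, homfrac (delta_mx 0 j) z /\ z != 0.
  by have [z ? ?] := effective_homfrac (delta_mx 0 j); exists z.
have [z hz] := choice H; exists z; split=> j; by case: (hz j).
Qed.

Section Basis.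
Variables (z : 'I_s -> L) (hz : forall j, homfrac (delta_mx 0 j) (z j)).
Hypothesis z0 : forall j, z j != 0.

Definition zmon (g : G) := \prod_j z j ^ g 0 j.

Lemma zmon_neq0 g : zmon g != 0.
Proof. by apply/prodf_neq0 => j _; rewrite expfz_neq0. Qed.

Lemma zmon_homfrac g : homfrac g (zmon g).
Proof.
rewrite [g in homfrac g]row_sum_delta; apply: homfrac_prod => j _.
by rewrite -[g 0 j in X in homfrac X]intz scaler_int; apply: homfracXz.
Qed.

(** Dividing a homogeneous element by the monomial [zmon] of its degree leaves a fraction of degree
    0. So the fraction field is generated by the [z j] over the fractions of degree 0. *)
Lemma gen_of_homfrac0 n (w : 'I_n -> L) :
  (forall x, homfrac 0 x -> gen f w x) -> (forall j, gen f w (z j)) ->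
  forall x, gen f w x.
Proof.
move=> h1 h2 x.
have hom g b : Bg g b -> gen f w (F b).
  move=> hb; rewrite -[F b](mulfVK (zmon_neq0 g)); apply: genM.
    apply: h1; rewrite -(subrr g); apply: homfracM; first exact: homfrac_hom.
    by apply: homfracV; apply: zmon_homfrac.
  by apply: gen_prod => j _; apply: genXz.
have gB b : gen f w (F b).
  rewrite (sum_hcomp gr b) rmorph_sum; apply: gen_sum => g _.
  exact: hom (hcomp_hom gr b g).
have [a [b [b0 ->]]] := fraction_repr x.
by apply: genM; [|apply: genV].
Qed.

Variables (d : nat) (td : has_trdeg iota d).

(** The [phi] and the [s] elements [z] together exceed [d] in number, hence are dependent. Sorting
    the relation by monomials in [z] yields terms of distinct degrees, each of which vanishes. *)
Lemma homfrac0_dependent (E : finType) (phi : E -> L) :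
  (forall i, homfrac 0 (phi i)) -> (d < #|E| + s)%N ->
  exists m (c : {ffun E -> 'I_m} -> k), (exists a, c a != 0) /\
    \sum_a f (c a) * \prod_i phi i ^+ a i = 0.
Proof.
move=> hphi ds.
pose y (i : E + 'I_s) := match i with inl e => phi e | inr j => z j end.
have [|m [c [[a0 ca0] e]]] := trdeg_dependent td y.
  by rewrite card_sum card_ord.
pose pr (a : {ffun E -> 'I_m} * {ffun 'I_s -> 'I_m}) : {ffun E + 'I_s -> 'I_m} :=
  [ffun i => match i with inl e => a.1 e | inr j => a.2 j end].
have prK : bijective pr.
  exists (fun b : {ffun E + 'I_s -> 'I_m} => ([ffun i => b (inl i)], [ffun j => b (inr j)])).
    by case=> a b; congr (_, _); apply/ffunP => i; rewrite !ffunE.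
  by move=> b; apply/ffunP => -[i|j]; rewrite !ffunE.
(* The part of the relation kept is the one whose [z]-exponents are those of the nonzero coefficient
   [a0]. *)
exists m, (fun a => c (pr (a, [ffun j => a0 (inr j)]))); split.
  exists [ffun i => a0 (inl i)]; rewrite (_ : pr _ = a0) //.
  by apply/ffunP => -[i|j]; rewrite !ffunE.
pose S (b : {ffun 'I_s -> 'I_m}) := \sum_a f (c (pr (a, b))) * \prod_i phi i ^+ a i.
pose Z (b : {ffun 'I_s -> 'I_m}) := \prod_j z j ^+ b j.
have Z0 b : Z b != 0 by apply/prodf_neq0 => j _; rewrite expf_neq0.
have eS : \sum_b S b * Z b = 0.
  rewrite -[RHS]e (reindex pr) /=; last exact: onW_bij.
  rewrite -(pair_bigA _ (fun a b => f (c (pr (a, b))) * \prod_i y i ^+ pr (a, b) i)) /=.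
  rewrite exchange_big /=; apply: eq_bigr => b _; rewrite mulr_suml.
  apply: eq_bigr => a _; rewrite -mulrA; congr (_ * _).
  by rewrite big_sumType /=; congr (_ * _); apply: eq_bigr => i _; rewrite ffunE.
have hom (b : {ffun 'I_s -> 'I_m}) : homfrac (\row_j (b j : nat)%:Z) (S b * Z b).
  rewrite -[\row__ _]add0r; apply: homfracM.
    apply: homfrac_sum => a _; rewrite -[0]add0r; apply: homfracM.
      exact: homfrac_const.
    have := @homfrac_prod E (index_enum E) predT (fun i => phi i ^+ a i) (fun=> 0).
    by rewrite big1 //; apply => i _; rewrite -(mul0rn _ (a i)); apply: homfracX.
  rewrite [X in homfrac X]row_sum_delta; apply: homfrac_prod => j _.
  by rewrite mxE -[X in X *: _]intz scaler_int; apply: (@homfracXz _ _ (b j : nat)).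
have inj : injective (fun b : {ffun 'I_s -> 'I_m} => \row_j (b j : nat)%:Z).
  move=> b b' /rowP h; apply/ffunP => j; apply: val_inj.
  by have := h j; rewrite !mxE => -[].
have /eqP := homfrac_direct inj hom eS [ffun j => a0 (inr j)].
by rewrite mulf_eq0 (negbTE (Z0 _)) orbF => /eqP.
Qed.

End Basis.
End HomFractions.

(** * Binary forms *)

Section Homogenization.
Variables (k : fieldType) (R : comNzRingType) (kap : {rmorphism k -> R}).

(** Homogenization: a form of degree [j] in [a], [b] is stored as a polynomial of size at most j +
    1, and the drop of its degree below [j] is the multiplicity of the factor [b]. *)
Definition hf (P : {poly k}) (j : nat) (a b : R) : R :=
  \sum_(i < j.+1) kap P`_i * (a ^+ i * b ^+ (j - i)).

Lemma hf_sum (I : Type) (r : seq I) (Q : pred I) (P : I -> {poly k}) j a b :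
  hf (\sum_(i <- r | Q i) P i) j a b = \sum_(i <- r | Q i) hf (P i) j a b.
Proof.
rewrite /hf exchange_big /=; apply: eq_bigr => i _.
by rewrite coef_sum rmorph_sum mulr_suml.
Qed.

Lemma hfZ c P j a b : hf (c *: P) j a b = kap c * hf P j a b.
Proof.
by rewrite /hf mulr_sumr; apply: eq_bigr => i _; rewrite coefZ rmorphM -mulrA.
Qed.

Lemma hfD P Q j a b : hf (P + Q) j a b = hf P j a b + hf Q j a b.
Proof.
by rewrite /hf -big_split /=; apply: eq_bigr => i _; rewrite coefD rmorphD mulrDl.
Qed.

Lemma hfXn n j a b : (n <= j)%N -> hf 'X^n j a b = a ^+ n * b ^+ (j - n).
Proof.
move=> nj; rewrite /hf (bigD1 (Ordinal (nj : n < j.+1)%N)) //= coefXn eqxx rmorph1 mul1r.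
rewrite big1 ?addr0 // => i; rewrite -val_eqE /= => /negbTE h.
by rewrite coefXn h rmorph0 mul0r.
Qed.

Lemma poly_wide (P : {poly k}) n : (size P <= n)%N -> P = \sum_(i < n) P`_i *: 'X^i.
Proof.
move=> h; apply/polyP => i; rewrite coef_sum; case: (ltnP i n) => hi.
  rewrite (bigD1 (Ordinal hi)) //= coefZ coefXn eqxx mulr1 big1 ?addr0 // => l.
  by rewrite -val_eqE /= eq_sym => /negbTE h'; rewrite coefZ coefXn h' mulr0.
rewrite nth_default ?(leq_trans h) // big1 // => l _.
by rewrite coefZ coefXn gtn_eqF ?mulr0 // (leq_trans (ltn_ord l)).
Qed.

Lemma hfM (P Q : {poly k}) j l a b : (size P <= j.+1)%N -> (size Q <= l.+1)%N ->
  hf (P * Q) (j + l) a b = hf P j a b * hf Q l a b.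
Proof.
move=> hP hQ; rewrite {1}(poly_wide hP) {1}(poly_wide hQ) big_distrlr /= hf_sum.
rewrite [RHS]mulr_suml; apply: eq_bigr => u _.
rewrite hf_sum mulr_sumr; apply: eq_bigr => v _.
have hu := ltn_ord u; have hv := ltn_ord v.
rewrite -scalerAl -scalerAr scalerA -exprD hfZ hfXn; last by rewrite leq_add.
rewrite rmorphM (_ : (j + l - (u + v) = (j - u) + (l - v))%N) ?exprD; first ring.
by lia.
Qed.

Lemma hf_linear u v a b : hf (u *: 'X + v%:P) 1 a b = kap u * a + kap v * b.
Proof.
rewrite -[v%:P]mulr1 mul_polyC hfD !hfZ -[X in hf X _ _ _]expr1 hfXn //.
by rewrite -[X in _ + _ * hf X _ _ _](expr0 'X) hfXn // !expr1 expr0 mulr1 mul1r.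
Qed.

Lemma hf_XsubC c a b : hf ('X - c%:P) 1 a b = a - kap c * b.
Proof.
by rewrite -['X]scale1r -polyCN hf_linear rmorph1 mul1r rmorphN mulNr.
Qed.

Lemma hf1 j a b : hf 1 j a b = b ^+ j.
Proof. by rewrite -(expr0 'X) hfXn // expr0 mul1r subn0. Qed.

Lemma hf0 j a b : hf 0 j a b = 0.
Proof. by rewrite -(scale0r 0) hfZ rmorph0 mul0r. Qed.

Lemma hfC c j a b : hf c%:P j a b = kap c * b ^+ j.
Proof. by rewrite -[c%:P]mulr1 mul_polyC hfZ hf1. Qed.

Lemma hf_prod_XsubC (r : seq k) j a b : (size r <= j)%N ->
  hf (\prod_(c <- r) ('X - c%:P)) j a b =
  b ^+ (j - size r) * \prod_(c <- r) (a - kap c * b).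
Proof.
elim: r j => [|c r IH] j hj; first by rewrite !big_nil hf1 subn0 mulr1.
case: j hj => // j hj; rewrite !big_cons -[j.+1]add1n hfM ?size_XsubC //; last first.
  by rewrite size_prod_XsubC.
by rewrite hf_XsubC IH //= subSS; ring.
Qed.

Lemma hf_prod (I : Type) (r : seq I) (P : I -> {poly k}) (e : I -> nat) (a b : R) :
  (forall i, size (P i) <= (e i).+1)%N ->
  (size (\prod_(i <- r) P i)%R <= (\sum_(i <- r) e i).+1)%N /\
  hf (\prod_(i <- r) P i) (\sum_(i <- r) e i) a b = \prod_(i <- r) hf (P i) (e i) a b.
Proof.
move=> hP; elim: r => [|i r [IH1 IH2]].
  by rewrite !big_nil size_poly1 hf1 expr0.
rewrite !big_cons hfM // IH2; split=> //.
by apply: (leq_trans (size_polyMleq _ _)); have := hP i; lia.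
Qed.

Lemma hf_exp (P : {poly k}) n (a b : R) : (size P <= 2)%N ->
  (size (P ^+ n) <= n.+1)%N /\ hf (P ^+ n) n a b = (hf P 1 a b) ^+ n.
Proof.
move=> hP; elim: n => [|n [IH1 IH2]]; first by rewrite !expr0 size_poly1 hf1 expr0.
rewrite !exprS -{2}[n.+1]add1n hfM // IH2; split=> //.
by apply: (leq_trans (size_polyMleq _ _)); lia.
Qed.

End Homogenization.

Lemma rmorph_hf (k : fieldType) (R S : comNzRingType) (kap : {rmorphism k -> R})
    (kap' : {rmorphism k -> S}) (phi : {rmorphism R -> S}) P j a b :
  (forall c, phi (kap c) = kap' c) ->
  phi (hf kap P j a b) = hf kap' P j (phi a) (phi b).
Proof.
move=> h; rewrite /hf rmorph_sum; apply: eq_bigr => i _.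
by rewrite !rmorphM !rmorphXn h.
Qed.

Section HomogenizationClosed.
Variables (k : closedFieldType) (R : comNzRingType) (kap : {rmorphism k -> R}).

Lemma hf_split (P : {poly k}) j : (size P <= j.+1)%N -> P != 0 ->
  exists c r, [/\ c != 0, (size r <= j)%N &
   forall a b, hf kap P j a b = kap c * (b ^+ (j - size r) * \prod_(z <- r) (a - kap z * b))].
Proof.
move=> hP P0; have [r e] := closed_field_poly_normal P.
exists (lead_coef P), r; have hr : (size r <= j)%N.
  have := hP; rewrite e size_scale ?lead_coef_eq0 // size_prod_XsubC //.
split=> // [|a b]; first by rewrite lead_coef_eq0.
by rewrite {1}e hfZ hf_prod_XsubC.
Qed.

Lemma closed_field_avoid (s : seq k) : exists c, c \notin s.
Proof.
(* The root 0 is added so that [p] is not constant when [s] is empty. *)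
pose p := (1 + \prod_(c <- 0 :: s) ('X - c%:P)) : {poly k}.
have /closed_rootP[c rc] : size p != 1%N.
  by rewrite /p addrC size_polyDl size_prod_XsubC ?size_poly1.
exists c; apply/negP => cs; move: rc; rewrite rootE hornerD hornerC.
have /eqP-> : root (\prod_(c <- 0 :: s) ('X - c%:P)) c.
  by rewrite root_prod_XsubC inE cs orbT.
by rewrite addr0 oner_eq0.
Qed.

End HomogenizationClosed.

Section Bivariate.
Variables (k : fieldType) (R : comNzRingType) (kap : {rmorphism k -> R}).

Definition uniev (x : R) : {rmorphism {poly k} -> R} := horner_eval x \o map_poly kap.
(** The inner variable goes to [x], the outer one to [y]. *)
Definition biev (x y : R) : {rmorphism {poly {poly k}} -> R} :=
  horner_eval y \o map_poly (uniev x).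

Lemma biev_monomial x y c i j : biev x y ((c *: 'X^i)%:P * 'X^j) = kap c * (x ^+ i * y ^+ j).
Proof.
rewrite /biev /= rmorphM /= map_polyC map_polyXn /= /horner_eval hornerM hornerC hornerXn.
by rewrite map_polyZ /= map_polyXn hornerZ hornerXn mulrA.
Qed.

Lemma biev_X x y : biev x y 'X = y.
Proof. by rewrite /biev /= map_polyX /horner_eval hornerX. Qed.

Lemma unievE x n (P : {poly k}) : (size P <= n)%N -> uniev x P = \sum_(i < n) kap P`_i * x ^+ i.
Proof.
move=> h; rewrite /uniev /= /horner_eval (horner_coef_wide _ (n := n)); last first.
  exact: leq_trans (size_poly _ _) h.
by apply: eq_bigr => i _; rewrite coef_map.
Qed.

Lemma bievE x y M (P : {poly {poly k}}) : (size P <= M)%N ->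
  biev x y P = \sum_(j < M) uniev x P`_j * y ^+ j.
Proof.
move=> h; rewrite /biev /= /horner_eval (horner_coef_wide _ (n := M)); last first.
  exact: leq_trans (size_poly _ _) h.
by apply: eq_bigr => i _; rewrite (coef_map (uniev x)).
Qed.

End Bivariate.

Section ClearDenominators.
Variables (k : fieldType) (E : fieldType) (kap : {rmorphism k -> E}).

Lemma clear_uniev (P : {poly k}) N (x y : E) : y != 0 -> (size P <= N.+1)%N ->
  y ^+ N * uniev kap (x / y) P = hf kap P N x y.
Proof.
move=> y0 h; rewrite (unievE _ _ h) mulr_sumr; apply: eq_bigr => i _.
rewrite mulrCA; congr (_ * _); rewrite expr_div_n mulrCA; congr (_ * _).
have hi : (i <= N)%N by rewrite -ltnS.
by rewrite -{1}(subnK hi) exprD mulfK // expf_neq0.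
Qed.

Lemma clear_biev (P : {poly {poly k}}) N M (x y u v : E) : y != 0 -> v != 0 ->
  (size P <= M.+1)%N -> (forall j, (size (P`_j)%R <= N.+1)%N) ->
  y ^+ N * v ^+ M * biev kap (x / y) (u / v) P =
  \sum_(j < M.+1) hf kap P`_j N x y * (u ^+ j * v ^+ (M - j)).
Proof.
move=> y0 v0 h1 h2; rewrite (bievE _ _ _ h1) mulr_sumr; apply: eq_bigr => j _.
rewrite -(clear_uniev _ y0 (h2 j)) mulrACA; congr (_ * _).
have hj : (j <= M)%N by rewrite -ltnS.
rewrite expr_div_n mulrCA; congr (_ * _).
by rewrite -{1}(subnK hj) exprD mulfK // expf_neq0.
Qed.

Lemma biev_bound (P : {poly {poly k}}) : exists N, forall j, (size (P`_j)%R <= N.+1)%N.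
Proof.
exists (\max_(j < size P) size (P`_j)%R)%N => j; case: (ltnP j (size P)) => hj.
  by apply: leqW; apply: (leq_bigmax (Ordinal hj)).
by rewrite nth_default // size_poly0.
Qed.

End ClearDenominators.

Section GradedUFD.
Variables (k : closedFieldType) (B : idomainType) (iota : {rmorphism k -> B}).
Variables (s : nat) (Bg : 'rV[int]_s -> B -> Prop) (gr : grading iota Bg).
Hypothesis eff : effective Bg.
Hypothesis B0 : deg0_const iota Bg.
Hypothesis tu : trivial_units iota.
Hypothesis td : has_trdeg iota s.+1.
Local Notation L := {fraction B}.
Local Notation f := (@tofrac B \o iota : {rmorphism k -> L}).
Local Notation F := (@tofrac B).
Local Notation HF := (hf iota).

Definition lin_indep (x y : B) := y != 0 /\ forall c, x - iota c * y != 0.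

Lemma lin_indep_neq0 x y : lin_indep x y -> x != 0.
Proof. by case=> _ /(_ 0); rewrite rmorph0 mul0r subr0. Qed.

Lemma F_hf P j a b : F (HF P j a b) = hf f P j (F a) (F b).
Proof. exact: rmorph_hf. Qed.

Lemma const_neq0 c : c != 0 -> iota c != 0.
Proof. by rewrite fmorph_eq0. Qed.

Lemma hf_neq0 (P : {poly k}) j a b : (size P <= j.+1)%N -> P != 0 -> lin_indep a b -> HF P j a b != 0.
Proof.
move=> hP P0 [b0 ab]; have [c [r [c0 _ ->]]] := hf_split iota hP P0.
rewrite !mulf_neq0 ?const_neq0 ?expf_neq0 // prodf_seq_neq0 //.
by apply/allP => z _; apply: ab.
Qed.

Lemma unit_const u : u \is a GRing.unit -> exists2 c, c != 0 & u = iota c.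
Proof. by move/tu. Qed.

Lemma unit_deg0 g u : Bg g u -> u \is a GRing.unit -> g = 0.
Proof.
move=> hu uu; have [c c0 e] := unit_const uu; apply: (hom_uniq gr hu).
  by rewrite e; apply: (grad_const gr).
by rewrite e const_neq0.
Qed.

Lemma lin_indep_nonunit g x y : Bg g x -> Bg g y -> lin_indep x y -> y \isn't a GRing.unit.
Proof.
move=> hx hy [y0 xy]; apply/negP => yu; have g0 := unit_deg0 hy yu.
have [c c0 e] := unit_const yu; move: hx; rewrite g0 => /B0[c' e'].
by have := xy (c' / c); rewrite e e' -rmorphM divfK // subrr eqxx.
Qed.

Lemma lin_indepC x y : lin_indep x y -> lin_indep y x.
Proof.
move=> li; have [y0 xy] := li; split=> [|c]; first exact: lin_indep_neq0 li.
have [->|c0] := eqVneq c 0; first by rewrite rmorph0 mul0r subr0.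
apply: contra_neq (xy c^-1) => h; apply: (mulfI (const_neq0 c0)).
by rewrite mulrBr mulrA -rmorphM divff // rmorph1 mul1r -(opprB y) h oppr0 mulr0.
Qed.

Lemma lin_indep_sub x y c : lin_indep x y -> lin_indep (x - iota c * y) y.
Proof. by move=> [y0 xy]; split=> // c'; rewrite -addrA -opprD -mulrDl -rmorphD. Qed.

Lemma lin_indep_mul w x y : w != 0 -> lin_indep (w * x) (w * y) <-> lin_indep x y.
Proof.
move=> w0; rewrite /lin_indep mulf_eq0 (negbTE w0) /=.
suff E c : (w * x - iota c * (w * y) == 0) = (x - iota c * y == 0).
  by split=> -[h1 h2]; split=> // c; have := h2 c; rewrite E.
by rewrite mulrCA -mulrBr mulf_eq0 (negbTE w0).
Qed.

Lemma ratio_dependent m m' x y x' y' : Bg m x -> Bg m y -> y != 0 ->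
  Bg m' x' -> Bg m' y' -> y' != 0 ->
  exists2 R : {poly {poly k}}, R != 0 & biev f (F x / F y) (F x' / F y') R = 0.
Proof.
move=> hx hy y0 hx' hy' y0'; have [z [hz z0]] := basis_homfracs gr eff.
pose phi (b : bool) := if b then F x' / F y' else F x / F y.
have [||n [c [[a0 ca0] e]]] := @homfrac0_dependent _ _ _ _ _ gr z hz z0 _ td bool phi.
- by case; [exists m', m', x', y'|exists m, m, x, y]; rewrite subrr.
- by rewrite card_bool.
exists (\sum_(a : {ffun bool -> 'I_n}) (c a *: 'X^(a false))%:P * 'X^(a true)); last first.
  rewrite rmorph_sum -[RHS]e; apply: eq_bigr => a _.
  by rewrite biev_monomial big_bool /= /phi [_ ^+ a true * _]mulrC.
apply/eqP => /polyP/(_ (a0 true))/polyP/(_ (a0 false))/eqP.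
rewrite !coef0 !coef_sum (bigD1 a0) //= coefMXn ltnn subnn coefC eqxx coefZ coefXn eqxx mulr1.
rewrite big1 ?addr0 ?(negbTE ca0) // => a aa0.
rewrite coefMXn; case: ltnP => h1; first by rewrite coef0.
rewrite coefC subn_eq0; case: leqP => h2; last by rewrite coef0.
rewrite coefZ coefXn; case: eqP => h3; last by rewrite mulr0.
case/eqP: aa0; apply/ffunP => -[]; apply: val_inj => //=.
by apply/eqP; rewrite eqn_leq h1 h2.
Qed.

(** Otherwise every fraction of degree 0 is constant and the fraction field is generated by the [s]
    elements [z], against its transcendence degree s + 1. *)
Lemma lin_indep_exists : exists m x y, [/\ Bg m x, Bg m y & lin_indep x y].
Proof.
apply: contrapT => H; have [z [hz z0]] := basis_homfracs gr eff.
suff /(trdeg_le_generators td) : forall x, gen f z x by rewrite ltnn.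
apply: (gen_of_homfrac0 gr hz z0); last by move=> j; apply: gen_var.
move=> _ [a [b [x [y [hx hy y0 /eqP e ->]]]]].
have {e}e : a = b by apply/eqP; rewrite -subr_eq0.
have [c ->] : exists c, x = iota c * y.
  apply: contrapT => h; apply: H; exists b, x, y; rewrite -{1}e; split=> //; split=> // c.
  by apply/eqP => /eqP; rewrite subr_eq0 => /eqP hc; apply: h; exists c.
by rewrite rmorphM mulfK ?tofrac_eq0 //; apply: gen_const.
Qed.

(** The fractions x / y and f1 / f2 are algebraically dependent. Take a relation not divisible by
    its second variable, clear denominators and reduce modulo [f1]: then [f1] divides a binary form
    in x, y. The form splits over [k], and the prime [f1] divides one of the factors x - c y. *)
Lemma residue_const g f1 f2 m x y : prime_elt f1 -> Bg g f1 -> Bg g f2 -> ~ dvdr f1 f2 ->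
  Bg m x -> Bg m y -> ~ dvdr f1 y -> exists c, dvdr f1 (x - iota c * y).
Proof.
move=> pf1 hf1 hf2 n12 hx hy n1y.
have f20 : f2 != 0 by apply/eqP => e; apply: n12; rewrite e; apply: dvdr0.
have y0 : y != 0 by apply/eqP => e; apply: n1y; rewrite e; apply: dvdr0.
have f10 : f1 != 0 by case: pf1.
have [R R0 eR] := ratio_dependent hx hy y0 hf1 hf2 f20.
(* Powers of the outer variable are split off, so that [Q] has a nonzero constant coefficient. *)
have [n [Q]] := multiplicity_XsubC R 0; rewrite R0 /= rootE horner_coef0 subr0 => Q0 eRQ.
have {}eR : biev f (F x / F y) (F f1 / F f2) Q = 0.
  move: eR; rewrite eRQ rmorphM rmorphXn => /eqP; rewrite mulf_eq0 => /orP[/eqP //|].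
  rewrite biev_X expf_eq0 mulf_eq0 invr_eq0 !tofrac_eq0.
  by rewrite (negbTE f10) (negbTE f20) andbF.
have [N hN] := biev_bound Q.
have := @clear_biev _ _ f Q N (size Q) (F x) (F y) (F f1) (F f2).
rewrite !tofrac_eq0 eR mulr0 => /(_ y0 f20 (leqnSn _) hN) e.
have {}e : \sum_(j < (size Q).+1) HF Q`_j N x y * (f1 ^+ j * f2 ^+ (size Q - j)) = 0.
  apply/eqP; rewrite -tofrac_eq0 e rmorph_sum /=; apply/eqP; apply: eq_bigr => j _.
  by rewrite !rmorphM !rmorphXn /= F_hf.
have : dvdr f1 (HF Q`_0 N x y * f2 ^+ size Q).
  move: e; rewrite big_ord_recl /= expr0 mul1r subn0 => /eqP; rewrite addr_eq0 => /eqP->.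
  rewrite -sumrN; apply: dvdr_sum => j _; rewrite -mulrN exprS.
  by apply: dvdr_mull; rewrite -mulNr -mulrN -!mulrA; apply/dvdr_mulr/dvdrr.
case/(prime_dvdM pf1) => [|/(dvdr_primeX pf1)//].
have [c [r [c0 _ ->]]] := hf_split iota (hN 0%N) Q0.
case/(prime_dvdM pf1) => [h|].
  by case: pf1 => _ + _; rewrite (dvdr_unitP h) // rmorph_unit ?unitfE.
case/(prime_dvdM pf1) => [/(dvdr_primeX pf1)//|/(dvdr_prime_prod pf1)[z hz _]].
by exists z.
Qed.

End GradedUFD.

(** * The pencil of an affine graded UFD *)

Section Dickson.

Lemma min_from (f : nat -> nat) N : exists i, (N <= i)%N /\ forall j, (N <= j)%N -> (f i <= f j)%N.
Proof.
pose P v := `[< exists2 i, (N <= i)%N & f i = v >].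
have exP : exists v, P v by exists (f N); apply/asboolP; exists N.
case: (ex_minnP exP) => v /asboolP[i Ni <-] hm; exists i; split=> // j Nj.
by apply: hm; apply/asboolP; exists j.
Qed.

(** Each new index minimizes [f] among all indices beyond the previous one. *)
Lemma monotone_subsequence (f : nat -> nat) : exists sg : nat -> nat,
  (forall i j, (i < j)%N -> (sg i < sg j)%N) /\
  (forall i j, (i <= j)%N -> (f (sg i) <= f (sg j))%N).
Proof.
have [nx hnx] := choice (min_from f).
pose sg := fix sg n := if n is m.+1 then nx (sg m).+1 else nx 0%N.
have s1 i : (sg i < sg i.+1)%N by have [] := hnx (sg i).+1.
have s2 i : (f (sg i) <= f (sg i.+1))%N.
  case: i => [|i]; [have [_ h] := hnx 0%N | have [h0 h] := hnx (sg i).+1]; apply: h => //.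
  exact: leq_trans h0 (ltnW (s1 i.+1)).
exists sg; split=> i j.
  elim: j => // j IH; rewrite ltnS leq_eqVlt => /orP[/eqP->//|/IH h].
  exact: ltn_trans (s1 j).
elim: j => [|j IH]; first by rewrite leqn0 => /eqP->.
rewrite leq_eqVlt => /orP[/eqP->//|]; rewrite ltnS => /IH h.
exact: leq_trans (s2 j).
Qed.

Lemma dickson n (al : nat -> nat -> nat) : exists sg : nat -> nat,
  (forall i j, (i < j)%N -> (sg i < sg j)%N) /\
  (forall c, (c < n)%N -> forall i j, (i <= j)%N -> (al (sg i) c <= al (sg j) c)%N).
Proof.
elim: n => [|n [sg [h1 h2]]]; first by exists id.
have [ta [h3 h4]] := monotone_subsequence (fun i => al (sg i) n).
exists (sg \o ta); split=> [i j /h3/h1//|c]; rewrite ltnS leq_eqVlt => /orP[/eqP->|cn] i j ij.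
  exact: h4.
apply: h2 => //; move: ij; rewrite leq_eqVlt => /orP[/eqP->//|/h3/ltnW//].
Qed.

(** Monomials are lists up to permutation; Dickson's lemma for their multiplicities gives one that
    divides a later one, with quotient [r]. *)
Lemma dickson_seq (T : eqType) (ps : seq T) (t : nat -> seq T) :
  (forall i, {subset t i <= ps}) ->
  exists i j, (i < j)%N /\ exists r, perm_eq (t j) (t i ++ r).
Proof.
move=> tp; case: ps tp => [|x0 ps] tp.
  have t0 i : t i = [::].
    by case e : (t i) => [|a r] //; have := tp i a; rewrite e mem_head => /(_ isT).
  by exists 0%N, 1%N; split=> //; exists [::]; rewrite !t0.
set qs := x0 :: ps in tp *.
have [sg [h1 h2]] := dickson (size qs) (fun i c => count_mem (nth x0 qs c) (t i)).
exists (sg 0%N), (sg 1%N); split; first exact: h1.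
have /count_subseqP[u /perm_to_subseq[r pr] pm] :
    forall x, (count_mem x (t (sg 0%N)) <= count_mem x (t (sg 1%N)))%N.
  move=> x; case xq : (x \in qs).
    by have := h2 (index x qs); rewrite index_mem nth_index // => /(_ xq 0%N 1%N isT).
  have /count_memPn-> // : x \notin t (sg 0%N).
  by apply: contraFN xq => /tp.
by exists r; apply: (perm_trans pr); rewrite perm_cat2r perm_sym.
Qed.
End Dickson.

Lemma closed_field_pigeonhole (k : closedFieldType) (T : eqType) (ps : seq T) (phi : k -> T) :
  (forall c, phi c \in ps) -> exists c c', c != c' /\ phi c = phi c'.
Proof.
move=> h; have [cs ucs scs] : exists2 cs : seq k, uniq cs & size cs = (size ps).+1.
  elim: (size ps).+1 => [|n [cs u e]]; first by exists [::].
  by have [c hc] := closed_field_avoid cs; exists (c :: cs); rewrite /= ?hc ?e.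
apply: contrapT => H.
have u : uniq (map phi cs).
  rewrite map_inj_in_uniq // => c c' _ _ e; apply: contrapT => /eqP cc; apply: H.
  by exists c, c'.
have sub : {subset map phi cs <= ps} by move=> _ /mapP[c _ ->].
by have := uniq_leq_size u sub; rewrite size_map scs ltnn.
Qed.

(** * Minimal pairs, and the pencil in the affine case *)

Section Pencil.
Variables (k : closedFieldType) (B : idomainType) (iota : {rmorphism k -> B}).
Variables (s : nat) (Bg : 'rV[int]_s -> B -> Prop) (gr : grading iota Bg).
Hypothesis eff : effective Bg.
Hypothesis B0 : deg0_const iota Bg.
Hypothesis U : UFD B.
Hypothesis tu : trivial_units iota.
Hypothesis td : has_trdeg iota s.+1.
Local Notation HF := (hf iota).
Local Notation lin_indep := (lin_indep iota).

(* Every nonzero graded piece is h times the forms of some degree j in a, b;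
   in particular the degree-zero homogeneous fractions form the field k(a / b). *)
Definition pencil g a b := [/\ Bg g a, Bg g b, lin_indep a b, coprime_elt a b
  & forall m x, Bg m x -> x != 0 -> exists h j, [/\ h != 0, Bg (m - g *+ j) h
    & forall y, Bg m y -> exists2 P : {poly k}, (size P <= j.+1)%N & y = h * HF P j a b]].

Definition is_length (len : B -> nat) := [/\ forall x y, x != 0 -> y != 0 -> len (x * y) = (len x + len y)%N,
      forall u, u \is a GRing.unit -> len u = 0%N,
      forall x, x != 0 -> len x = 0%N -> x \is a GRing.unit
    & forall x, x != 0 -> len x = 1%N <-> irreducible x].

Section Minimal.
Variables (len : B -> nat) (hlen : is_length len).

(** The minimum runs over all degrees and all pairs, so the length of [a] is a lower bound for the
    members of every pencil, not only of its own. *)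
Definition min_pair g a b := [/\ Bg g a, Bg g b, lin_indep a b &
  forall m x y, Bg m x -> Bg m y -> lin_indep x y -> (len a <= len x)%N].

Lemma min_pair_exists : exists g a b, min_pair g a b.
Proof.
pose P n := `[< exists m x y, [/\ Bg m x, Bg m y, lin_indep x y & len x = n] >].
have exP : exists n, P n.
  have [m [x [y [h1 h2 h3]]]] := lin_indep_exists gr eff td.
  by exists (len x); apply/asboolP; exists m, x, y.
case: (ex_minnP exP) => n /asboolP[g [a [b [h1 h2 h3 <-]]]] hm.
exists g, a, b; split=> // m x y hx hy li; apply: hm; apply/asboolP.
by exists m, x, y.
Qed.

(** A common prime factor could be cancelled, leaving an independent pair of smaller length. *)
Lemma min_pair_coprime g a b : min_pair g a b -> coprime_elt a b.
Proof.
move=> [ha hb li hm] p ip pa pb; have [lM _ _ l1] := hlen.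
have a0 := lin_indep_neq0 li; have b0 := lin_indep_neq0 (lin_indepC li).
have p0 : p != 0 by case: ip.
have [d hd [a' ha' ea]] := hom_dvdr gr a0 ha pa.
have [c eb] := pb; have hc := hom_dvdr_quot gr hd p0 hb eb.
have a'0 : a' != 0 by apply: contra_neq a0 => e; rewrite ea e mul0r.
have : (len a <= len a')%N.
  apply: hm ha' hc _; apply/(lin_indep_mul _ _ _ p0).
  by rewrite ![p * _]mulrC -ea -eb.
by rewrite ea lM // (l1 p p0).2 // addn1 ltnn.
Qed.

End Minimal.

Section Affine.
Hypothesis aff : affine iota.

Definition monomial_in (ps : seq B) (v : B) :=
  exists2 t : seq B, {subset t <= ps} & v = \prod_(p <- t) p.

(** The homogeneous components of the algebra generators are factored; the prime factors are again
    homogeneous, and the units are constants, which a span absorbs. *)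
Lemma affine_prime_generators : exists ps : seq B,
  [/\ {in ps, forall p, irreducible p}, {in ps, forall p, exists d, Bg d p}
    & forall b, kspan iota (monomial_in ps) b].
Proof.
have [n [x hx]] := aff.
have sM ps u v : kspan iota (monomial_in ps) u -> kspan iota (monomial_in ps) v ->
    kspan iota (monomial_in ps) (u * v).
  move=> hu hv; apply: kspan_mulr hv => w [t tp ->]; rewrite mulrC.
  apply: kspan_mulr hu => w' [t' tp' ->]; apply: kspan_gen; exists (t ++ t').
    by move=> q; rewrite mem_cat => /orP[/tp|/tp'].
  by rewrite big_cat.
have s1 ps : kspan iota (monomial_in ps) 1.
  by apply: kspan_gen; exists [::]; rewrite ?big_nil.
have mono ps ps' u : {subset ps <= ps'} -> kspan iota (monomial_in ps) u ->
    kspan iota (monomial_in ps') u.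
  move=> sub hu; rewrite -[u]mul1r; apply: kspan_mulr hu => v [t tp ->]; rewrite mul1r.
  by apply: kspan_gen; exists t => // q /tp/sub.
have [ps [h1 h2 h3]] : exists ps : seq B, [/\ {in ps, forall p, irreducible p},
    {in ps, forall p, exists d, Bg d p} &
    forall i g, kspan iota (monomial_in ps) (hcomp gr (x i) g)].
  have H (r : seq B) : {in r, forall b, exists d, Bg d b} -> exists ps : seq B,
     [/\ {in ps, forall p, irreducible p}, {in ps, forall p, exists d, Bg d p} &
      {in r, forall b, kspan iota (monomial_in ps) b}].
    elim: r => [|b r IH] hr; first by exists [::].
    have [|ps [h1 h2 h3]] := IH; first by move=> q qr; apply: hr; rewrite inE qr orbT.
    have [b0|b0] := eqVneq b 0.
      exists ps; split=> // q; rewrite inE => /orP[/eqP->|/h3//].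
      rewrite b0; exact: kspan_0.
    have [u [t [uu it eb]]] := UFD_factor U b0.
    have [c c0 ec] := unit_const tu uu.
    have [d hd] := hr b (mem_head _ _).
    exists (t ++ ps); split.
    - by move=> q; rewrite mem_cat => /orP[/it|/h1].
    - move=> q; rewrite mem_cat => /orP[qt|/h2//].
      have [|d' hd' _] := hom_dvdr gr (y := q) b0 hd; last by exists d'.
      by rewrite eb (big_rem _ qt) /=; apply/dvdr_mull/dvdr_mulr/dvdrr.
    - move=> q; rewrite inE => /orP[/eqP->|/h3]; last first.
        by apply: mono => z zp; rewrite mem_cat zp orbT.
      rewrite eb ec; apply: kspan_scale; apply: kspan_gen; exists t => //.
      by move=> z zt; rewrite mem_cat zt.
  have [|ps [h1 h2 h3]] := H (flatten [seq [seq hcomp gr (x i) g | g <- supp gr (x i)] | i : 'I_n]).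
    by move=> b /flatten_mapP[i _] /mapP[g _ ->]; exists g; apply: hcomp_hom.
  exists ps; split=> // i g; case hg : (g \in supp gr (x i)); last first.
    by move: hg; rewrite mem_supp => /negbT; rewrite negbK => /eqP->; apply: kspan_0.
  apply: h3; apply/flatten_mapP; exists i; first by rewrite mem_enum.
  by apply/mapP; exists g.
exists ps; split=> // b; have [p ->] := hx b.
apply: kspan_sum => m _; apply: kspan_scale.
apply: (big_ind (kspan iota (monomial_in ps))) => // [u v|i _]; first exact: sM.
elim: (m i) => [|l IH]; rewrite ?expr0 ?exprS //; apply: sM => //.
by rewrite (sum_hcomp gr (x i)); apply: kspan_sum.
Qed.

(** Monomials in [ps] are homogeneous, so a nonzero component of degree [m] can only come from a
    monomial of that degree. *)
Lemma monomial_of_degree ps m y : {in ps, forall p, exists d, Bg d p} ->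
  kspan iota (monomial_in ps) y -> hcomp gr y m != 0 ->
  exists2 t : seq B, {subset t <= ps} & Bg m (\prod_(p <- t) p).
Proof.
move=> hp; elim=> [|c v z [t tp ->] _ IH]; first by rewrite hcomp0 eqxx.
have [d hd] : exists d, Bg d (\prod_(p <- t) p).
  elim: t tp => [|q t IHt] tp; first by exists 0; rewrite big_nil; apply: hom1 gr.
  have [|d hd] := IHt; first by move=> z' zt; apply: tp; rewrite inE zt orbT.
  have [d' hd'] := hp q (tp q (mem_head _ _)).
  by exists (d' + d); rewrite big_cons; apply: (gradM gr).
rewrite hcompD (hcomp_homE gr (hom_scale gr c hd)); case: (m =P d) => [->|_].
  by exists t.
by rewrite add0r.
Qed.

(** The element [a] of a minimal pair is prime. Dividing by it lowers degrees by [g], which reaches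
    a zero piece after finitely many steps; each step back raises the degree of the forms by one. *)
Lemma affine_pencil : exists g a b, pencil g a b.
Proof.
have [len hlen] := UFD_length U; have [lM l0 lu l1] := hlen.
have [g [a [b mp]]] := min_pair_exists len; have cop := min_pair_coprime hlen mp.
have [ha hb li hm] := mp.
have [ps [psi psh pspan]] := affine_prime_generators.
have a0 := lin_indep_neq0 li; have b0 := lin_indep_neq0 (lin_indepC li).
have au := lin_indep_nonunit gr B0 tu hb ha (lin_indepC li).
have ia : irreducible a.
  apply: contrapT => nia.
  (* Were [a] reducible, a prime factor p of b - c a would be shorter than [a], so the piece of its
     degree is one-dimensional. That piece also contains a monomial in [ps], a multiple of p; hence
     p is associated to an element of the finite list [ps]. *)
  have Hq c : exists q, q \in ps /\ dvdr q (b - iota c * a).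
    have Fc0 : b - iota c * a != 0 by case: (lin_indepC li).
    have hFc : Bg g (b - iota c * a) by apply: (homB gr) => //; apply: (hom_scale gr).
    have Fcu := lin_indep_nonunit gr B0 tu ha hFc (lin_indepC (lin_indep_sub c (lin_indepC li))).
    have [p ip pF] := UFD_irreducible_dvd U Fc0 Fcu; have [p0 pu _] := ip.
    have [d hd _] := hom_dvdr gr Fc0 hFc pF.
    have one y : Bg d y -> exists c, y = iota c * p.
      move=> hy; apply: contrapT => ny.
      have liy : lin_indep y p.
        by split=> // c'; apply/eqP => /eqP; rewrite subr_eq0 => /eqP e; apply: ny; exists c'.
      have := hm _ _ _ hd hy (lin_indepC liy); rewrite (l1 p p0).2 //.
      case e : (len a) => [|[|?]] // _; first by have := lu a a0 e; rewrite (negbTE au).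
      by apply: nia; apply/(l1 a a0).
    have [|t tp ht] := @monomial_of_degree ps d p psh (pspan p).
      by rewrite (hcomp_homE gr hd) eqxx.
    have [c' e] := one _ ht.
    have [q pq qt] : exists2 q, dvdr p q & q \in t.
      apply: (dvdr_prime_prod_seq (UFD_irreducible_prime U ip)); rewrite e.
      exact/dvdr_mull/dvdrr.
    exists q; split; first exact: tp.
    by apply: dvdr_trans pF; apply: (irreducible_assoc ip (psi q (tp q qt)) pq).
  have [phi hphi] := choice Hq.
  (* Infinitely many members and finitely many primes: two members share a prime, which then divides
     both a and b. *)
  have [|c [c' [cc e]]] := @closed_field_pigeonhole k _ ps phi; first by move=> c; case: (hphi c).
  have [qps d1] := hphi c; have [_ d2] := hphi c'; rewrite -e in d2.
  have iq := psi _ qps.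
  have da : dvdr (phi c) a.
    have : dvdr (phi c) (iota (c - c') * a).
      rewrite rmorphB mulrBl.
      rewrite (_ : _ - _ = b - iota c' * a - (b - iota c * a)); last ring.
      exact: dvdrB.
    case=> z ez; exists (iota (c - c')^-1 * z); rewrite -mulrA -ez mulrA -rmorphM.
    by rewrite mulVf ?rmorph1 ?mul1r // subr_eq0.
  apply: (cop _ iq da); rewrite -[b](subrK (iota c * a)).
  by apply: dvdrD => //; apply: dvdr_mull.
have pa := UFD_irreducible_prime U ia.
have nab : ~ dvdr a b by apply: (cop a ia (dvdrr a)).
(* If all degrees m - J g carried monomials in [ps], one would divide a later one by Dickson's
   lemma. The quotient times a power of [a] has degree 0, so it is a constant and [a] would be a
   unit. *)
have term m : exists J, forall x, Bg (m - g *+ J) x -> x = 0.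
  apply: contrapT => H.
  have Ht J : exists t : seq B, {subset t <= ps} /\ Bg (m - g *+ J) (\prod_(p <- t) p).
    apply: contrapT => nt; apply: H; exists J => x hx.
    apply: contrapT => /eqP x0; apply: nt.
    have [|t ? ?] := @monomial_of_degree ps (m - g *+ J) x psh (pspan x); last by exists t.
    by rewrite (hcomp_homE gr hx) eqxx.
  have [t ht] := choice Ht.
  have [i [j [ij [r pr]]]] := @dickson_seq _ ps t (fun i => (ht i).1).
  have ti0 : \prod_(p <- t i) p != 0.
    by rewrite prodf_seq_neq0; apply/allP => q /(ht i).1/psi[].
  have ep : \prod_(p <- t j) p = (\prod_(p <- r) p) * \prod_(p <- t i) p.
    by rewrite (perm_big _ pr) big_cat mulrC.
  have hr := hom_dvdr_quot gr (ht i).2 ti0 (ht j).2 ep.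
  have r0 : \prod_(p <- r) p != 0.
    rewrite prodf_seq_neq0; apply/allP => q qr.
    have /(ht j).1/psi[] // : q \in t j by rewrite (perm_mem pr) mem_cat qr orbT.
  have hz : Bg 0 (a ^+ (j - i) * \prod_(p <- r) p).
    rewrite (_ : 0 = g *+ (j - i) + (m - g *+ j - (m - g *+ i))).
      by apply: (gradM gr) => //; apply: (homX gr).
    by rewrite mulrnBr ?(ltnW ij) // opprB [_ - _ + (_ - m)]addrC subrKA subrKA subrr.
  have [c ec] := hom0_const B0 hz.
  have : a ^+ (j - i) * \prod_(p <- r) p \is a GRing.unit.
    rewrite ec rmorph_unit // unitfE; apply/eqP => c0; move: ec; rewrite c0 rmorph0 => /eqP.
    by rewrite mulf_eq0 expf_eq0 (negbTE a0) (negbTE r0) andbF.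
  by rewrite unitrM unitrX_pos ?subn_gt0 // (negbTE au).
exists g, a, b; split=> // m x; have [J hJ] := term m; elim: J m hJ x => [|J IH] m hJ x hx x0.
  by move: x0; rewrite (hJ x) ?eqxx // mulr0n subr0.
have [Hz|[y [hy y0]]] : (forall y, Bg (m - g) y -> y = 0) \/ exists y, Bg (m - g) y /\ y != 0.
  have [H|H] := EM (exists y, Bg (m - g) y /\ y != 0); [by right|left=> y hy].
  by apply: contrapT => /eqP y0; apply: H; exists y.
(* The piece of degree m - g is zero: an element of degree m agrees with a multiple of x modulo [a],
   and the difference divided by [a] vanishes. *)
- exists x, 0%N; split=> //; first by rewrite mulr0n subr0.
  move=> y hy; have nax : ~ dvdr a x.
    move=> [c ec]; have := Hz c (hom_dvdr_quot gr ha a0 hx ec).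
    by move=> c0; move: x0; rewrite ec c0 mul0r eqxx.
  have [c [w ew]] := residue_const gr eff td pa ha hb nab hy hx nax.
  exists c%:P; first by rewrite size_polyC; case: (c != 0).
  have hyx : Bg m (y - iota c * x) by apply: (homB gr) => //; apply: (hom_scale gr).
  have := ew; rewrite (Hz w (hom_dvdr_quot gr ha a0 hyx ew)) mul0r => /eqP.
  by rewrite subr_eq0 => /eqP->; rewrite hfC expr0 mulr1 mulrC.
have [|h [j [h0 hh hj]]] := IH (m - g) _ y hy y0.
  by move=> z hz; apply: hJ; rewrite mulrS opprD addrA.
exists h, j.+1; split=> //; first by rewrite mulrS opprD addrA.
(* Otherwise (h / a) b^(j+1) has degree m - g, so by induction it is h times a form, and [a] divides
   b^(j+1). *)
have nah : ~ dvdr a h.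
  move=> [h' eh]; have hh' := hom_dvdr_quot gr ha a0 hh eh.
  have : Bg (m - g) (h' * b ^+ j.+1).
    rewrite (_ : m - g = m - g - g *+ j - g + g *+ j.+1).
      by apply: (gradM gr) => //; apply: (homX gr).
    by rewrite mulrS addrA subrK subrK.
  move=> /hj[P _ e]; apply: nab; apply: (dvdr_primeX (n := j.+1) pa).
  exists (HF P j a b); apply: (mulfI (x := h')); last by rewrite e eh; ring.
  by apply: contra_neq h0 => z; rewrite eh z mul0r.
(* Modulo [a], every element of degree m is a multiple of h b^(j+1); the difference is [a] times an
   element of degree m - g, known by induction. *)
move=> z hz; have hm' : Bg m (h * b ^+ j.+1).
  rewrite (_ : m = m - g - g *+ j + g *+ j.+1).
    by apply: (gradM gr) => //; apply: (homX gr).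
  by rewrite mulrS addrA addrAC subrK subrK.
have na : ~ dvdr a (h * b ^+ j.+1).
  by move=> /(prime_dvdM pa)[//|/(dvdr_primeX pa)].
have [c [w ew]] := residue_const gr eff td pa ha hb nab hz hm' na.
have hzz : Bg m (z - iota c * (h * b ^+ j.+1)).
  by apply: (homB gr) => //; apply: (hom_scale gr).
have [P hP eP] := hj w (hom_dvdr_quot gr ha a0 hzz ew).
exists (c%:P + 'X * P).
  apply: (leq_trans (size_polyD _ _)); rewrite geq_max; apply/andP; split.
    by apply: (leq_trans (size_polyC_leq1 _)).
  by apply: (leq_trans (size_polyMleq _ _)); rewrite size_polyX.
rewrite hfD hfC -add1n hfM ?size_polyX // -[X in hf _ X 1]expr1 hfXn // expr1 expr0 mulr1.
rewrite -[z](subrK (iota c * (h * b ^+ j.+1))) ew eP add1n; ring.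
Qed.

End Affine.
End Pencil.

(** * Lueroth's theorem *)

Section PredSubfield.
Variables (k E : fieldType) (kap : {rmorphism k -> E}) (S : E -> Prop).

Definition subfield := [/\ forall c, S (kap c), forall a b, S a -> S b -> S (a + b),
  forall a b, S a -> S b -> S (a * b) & forall a, S a -> S a^-1].

Definition coefs_in (p : {poly E}) := forall i, S p`_i.

Hypothesis Sf : subfield.

Lemma subfieldN a : S a -> S (- a).
Proof.
case: Sf => Sc _ SM _ Sa; rewrite -mulN1r -(rmorph1 kap) -rmorphN; exact: SM.
Qed.

Lemma subfield0 : S 0. Proof. by case: Sf => Sc _ _ _; rewrite -(rmorph0 kap). Qed.

Lemma coefs_inB p q : coefs_in p -> coefs_in q -> coefs_in (p - q).
Proof.
case: Sf => _ SD _ _ hp hq i; rewrite coefB; apply: SD => //; exact: subfieldN.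
Qed.

Lemma coefs_inM p q : coefs_in p -> coefs_in q -> coefs_in (p * q).
Proof.
case: Sf => _ SD SM _ hp hq i; rewrite coefM; apply: big_ind => //; first exact: subfield0.
by move=> j _; apply: SM.
Qed.

Lemma coefs_inZ c p : S c -> coefs_in p -> coefs_in (c *: p).
Proof. by case: Sf => _ _ SM _ Sc hp i; rewrite coefZ; apply: SM. Qed.

Lemma coefs_in_map p : coefs_in (map_poly kap p).
Proof. by case: Sf => Sc _ _ _ i; rewrite coef_map; apply: Sc. Qed.

Lemma coefs_inZXn c n : S c -> coefs_in (c *: 'X^n).
Proof.
move=> Sc i; rewrite coefZ coefXn; case: eqP => _; rewrite ?mulr1 ?mulr0 //.
exact: subfield0.
Qed.

(** Long division uses field operations on coefficients only, so quotient and remainder stay over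
    the subfield. *)
Lemma coefs_in_division m N : m != 0 -> coefs_in m -> coefs_in N ->
  exists q r, [/\ coefs_in q, coefs_in r, N = q * m + r & (size r < size m)%N].
Proof.
move=> m0 hm; have [Sc SD SM SV] := Sf.
elim: {N}(size N) {-2}N (leqnn (size N)) => [|n IH] N sN hN.
  exists 0, N; split=> //; first by move=> i; rewrite coef0; apply: subfield0.
    by rewrite mul0r add0r.
  by apply: leq_ltn_trans sN _; rewrite size_poly_gt0.
have [sm|sm] := ltnP (size N) (size m).
  exists 0, N; split=> //; first by move=> i; rewrite coef0; apply: subfield0.
  by rewrite mul0r add0r.
pose t := lead_coef N / lead_coef m *: 'X^(size N - size m).
have ht : coefs_in t by apply: coefs_inZXn; apply: SM; [apply: hN | apply/SV/hm].
have N0 : N != 0 by rewrite -size_poly_gt0 (leq_trans _ sm) // size_poly_gt0.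
have lm0 : lead_coef m != 0 by rewrite lead_coef_eq0.
have st : size (t * m) = size N.
  rewrite /t -scalerAl size_scale ?mulf_neq0 ?invr_eq0 ?lead_coef_eq0 //.
  by rewrite mulrC size_mulXn // subnK.
have lt : lead_coef (t * m) = lead_coef N.
  by rewrite /t -scalerAl lead_coefZ [_ * m]mulrC lead_coef_Mmonic ?monicXn // divfK.
have [|| q [r [hq hr e sr]]] := IH (N - t * m).
- rewrite -ltnS; apply: leq_trans sN.
  have le1 : (size (N - t * m)%R <= size N)%N.
    by apply: (leq_trans (size_polyD _ _)); rewrite size_polyN st maxnn.
  rewrite ltn_neqAle le1 andbT; apply/eqP => es.
  have : (N - t * m)`_(size N).-1 = 0.
    by rewrite coefB -[N`__]/(lead_coef N) -st -lead_coefE lt subrr.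
  rewrite -{1}es -lead_coefE => /eqP; rewrite lead_coef_eq0 -size_poly_eq0 es.
  by rewrite size_poly_eq0 (negbTE N0).
- by apply: coefs_inB => //; apply: coefs_inM.
exists (q + t), r; split=> //.
- by move=> i; rewrite coefD; apply: SD.
- by rewrite mulrDl addrAC -e subrK.
Qed.

End PredSubfield.

(** * Gauss's lemma over k[X] *)

Section GaussPrimitive.
Variable (k : closedFieldType).
Local Notation E := {fraction {poly k}}.
Local Notation F := (@tofrac {poly k}).
Local Notation MF := (map_poly (@tofrac {poly k})).

Definition at_point (y : k) : {rmorphism {poly {poly k}} -> {poly k}} := map_poly (horner_eval y).

(** Since [k] is algebraically closed, the primes of k[X] are the X - y up to constants; vanishing
    at y means that X - y divides all coefficients. *)
Definition primitive (q : {poly {poly k}}) := forall y, at_point y q != 0.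

Lemma MF_inj : injective MF.
Proof. by apply: map_inj_poly; [move=> x y /eqP; rewrite tofrac_eq => /eqP | rewrite rmorph0]. Qed.

Lemma coprime_rep (z : E) : exists A C, [/\ C != 0, z = F A / F C &
  forall y, ~~ (root A y && root C y)].
Proof.
have [A0 [C0 [C00 e0]]] := fraction_repr z.
elim: {C0}(size C0) {-2}C0 (leqnn (size C0)) A0 C00 e0 => [|n IH] C sC A C0 e.
  by move: C0; rewrite -size_poly_gt0; case: (size C) sC.
have [[y /andP[rA rC]]|H] := EM (exists y, root A y && root C y); last first.
  by exists A, C; split=> // y; apply/negP => h; apply: H; exists y.
have /factor_theorem[C' eC] := rC; have /factor_theorem[A' eA] := rA.
have X0 := polyXsubC_eq0 y.
have C'0 : C' != 0 by apply: contra_neq C0 => h; rewrite eC h mul0r.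
apply: (IH C' _ A') => //.
  by move: sC; rewrite eC size_Mmonic ?monicXsubC // size_XsubC addn2.
by rewrite e eA eC !rmorphM /= -mulf_div divff ?mulr1 // tofrac_eq0 X0.
Qed.

(** Denominators are cleared, then factors X - y are divided out as long as the polynomial vanishes
    at some y; the sum of the sizes of the coefficients decreases. *)
Lemma primitive_part (q : {poly E}) : q != 0 ->
  exists r p, [/\ r != 0, q = r *: MF p & primitive p].
Proof.
move=> q0.
have [D [p0 [D0 e0]]] : exists D p, D != 0 /\ F D *: q = MF p.
  have H n : exists D, D != 0 /\ forall i, (i < n)%N -> exists a, F D * q`_i = F a.
    elim: n => [|n [D [D0 IH]]]; first by exists 1; rewrite oner_eq0.
    have [a [b [b0 e]]] := fraction_repr q`_n.
    exists (D * b); rewrite mulf_neq0 //; split=> // i; rewrite ltnS leq_eqVlt.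
    case/orP=> [/eqP->|/IH[c ec]].
      by exists (D * a); rewrite e !rmorphM /= -mulrA [F b * _]mulrC divfK ?tofrac_eq0 //.
    by exists (c * b); rewrite !rmorphM /= -ec mulrAC.
  have [D [D0 H']] := H (size q).
  have [a ha] : exists a : nat -> {poly k}, forall i, (i < size q)%N -> F D * q`_i = F (a i).
    have [i|a h] := @choice nat {poly k} (fun i a => (i < size q)%N -> F D * q`_i = F a).
      case: (ltnP i (size q)) => [/H'[c ec]|_]; first by exists c.
      by exists 0.
    by exists a.
  exists D, (\poly_(i < size q) a i); split=> //; apply/polyP => i.
  rewrite coefZ coef_map coef_poly; case: ltnP => hi; first exact: ha.
  by rewrite nth_default // mulr0 /= tofrac0.
have FD0 : F D != 0 by rewrite tofrac_eq0.
have e1 : q = (F D)^-1 *: MF p0 by rewrite -e0 scalerA mulVf // scale1r.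
have r0 : (F D)^-1 != 0 by rewrite invr_eq0.
pose mu (p : {poly {poly k}}) := (\sum_(i < size p) size (p`_i)%R)%N.
elim: {p0 e0}(mu p0) {-2}p0 (leqnn (mu p0)) (F D)^-1 r0 e1 => [|n IH] p sp r r0 e.
  exists r, p; split=> // y; apply/eqP => h.
  have p00 : p != 0 by apply: contra_neq q0 => z; rewrite e z rmorph0 scaler0.
  move: sp; rewrite leqn0 sum_nat_eq0 => /forallP h2.
  have hs : ((size p).-1 < size p)%N by rewrite prednK // size_poly_gt0.
  have := h2 (Ordinal hs); rewrite /= size_poly_eq0 -lead_coefE lead_coef_eq0.
  by rewrite (negbTE p00).
have p00 : p != 0 by apply: contra_neq q0 => z; rewrite e z rmorph0 scaler0.
have [[y hy]|H] := EM (exists y, at_point y p = 0); last first.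
  by exists r, p; split=> // y; apply/eqP => h; apply: H; exists y.
have ry i : root p`_i y.
  by have /polyP/(_ i) := hy; rewrite coef_map coef0 rootE => /eqP.
pose p' := \poly_(i < size p) (p`_i %/ ('X - y%:P)).
have ep : p = ('X - y%:P)%:P * p'.
  apply/polyP => i; rewrite coefCM coef_poly; case: ltnP => hi.
    by rewrite mulrC divpK // dvdp_XsubCl.
  by rewrite nth_default // mulr0.
have sp' : size p' = size p.
  by rewrite ep size_Cmul // polyXsubC_eq0.
have X0 : 'X - y%:P != 0 := negbT (polyXsubC_eq0 y).
apply: (IH p' _ (r * F ('X - y%:P))).
- have : (mu p' < mu p)%N; last by move=> h; rewrite -ltnS; apply: leq_trans sp.
  rewrite /mu sp'.
  have hs : ((size p).-1 < size p)%N by rewrite prednK // size_poly_gt0.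
  have ple i : (size p'`_i)%R = (size (p`_i)%R).-1.
    rewrite ep coefCM; have [->|c0] := eqVneq p'`_i 0; first by rewrite mulr0 size_poly0.
    by rewrite size_monicM ?monicXsubC // size_XsubC.
  rewrite (bigD1 (Ordinal hs)) //= [X in (_ < X)%N](bigD1 (Ordinal hs)) //=.
  rewrite -addSn leq_add //; first by rewrite ple prednK // size_poly_gt0 -lead_coefE lead_coef_eq0.
  by apply: leq_sum => i _; rewrite ple leq_pred.
- by apply: mulf_neq0; [exact: r0|rewrite tofrac_eq0; exact: X0].
- by rewrite e ep rmorphM /= map_polyC /= mul_polyC scalerA.
Qed.

End GaussPrimitive.

Section Unigen.
Variables (k E : fieldType) (kap : {rmorphism k -> E}) (th : E).
Local Notation ev := (uniev kap th).

Definition unigen (z : E) := exists P Q : {poly k}, ev Q != 0 /\ z * ev Q = ev P.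

Lemma unigen_var : unigen th.
Proof.
exists 'X, 1; rewrite rmorph1 oner_eq0 mulr1; split=> //.
by rewrite /uniev /= map_polyX /horner_eval hornerX.
Qed.

Lemma unigen_subfield : subfield kap unigen.
Proof.
split.
- move=> a; exists a%:P, 1; rewrite rmorph1 oner_eq0 mulr1; split=> //.
  by rewrite (unievE _ _ (size_polyC_leq1 a)) big_ord1 coefC mulr1.
- move=> a b [P [Q [Q0 e]]] [P' [Q' [Q'0 e']]]; exists (P * Q' + P' * Q), (Q * Q').
  rewrite !(rmorphD, rmorphM); split; first exact: mulf_neq0.
  rewrite -e -e'; ring.
- move=> a b [P [Q [Q0 e]]] [P' [Q' [Q'0 e']]]; exists (P * P'), (Q * Q').
  rewrite !rmorphM; split; first exact: mulf_neq0.
  rewrite -e -e'; ring.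
- move=> a [P [Q [Q0 e]]]; have [->|a0] := eqVneq a 0.
    by exists 0, 1; rewrite rmorph1 oner_eq0 rmorph0 invr0 mul0r.
  exists Q, P; rewrite -e; split; first exact: mulf_neq0.
  exact: mulKf.
Qed.

End Unigen.

Section Luroth.
Variable (k : closedFieldType).
Local Notation E := {fraction {poly k}}.
Local Notation F := (@tofrac {poly k}).
Local Notation MF := (map_poly (@tofrac {poly k})).
Local Notation kE := (@tofrac {poly k} \o polyC : {rmorphism k -> E}).

Lemma uniev_frac (A : {poly k}) : uniev kE (F 'X) A = F A.
Proof.
rewrite (unievE _ _ (leqnn _)) [in RHS](poly_wide (leqnn (size A))) rmorph_sum.
by apply: eq_bigr => i _; rewrite -mul_polyC rmorphM rmorphXn.
Qed.

Lemma primitiveM (p q : {poly {poly k}}) : primitive p -> primitive q -> primitive (p * q).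
Proof. by move=> hp hq y; rewrite rmorphM mulf_neq0. Qed.

Lemma no_root_const (p : {poly k}) : (forall y, ~~ root p y) -> exists2 c, c != 0 & p = c%:P.
Proof.
move=> h; have /size_poly1P[c c0 ->] : size p == 1%N; last by exists c.
apply: contrapT => /negP/closed_rootP[y ry].
by move: (h y); rewrite ry.
Qed.

(** Write r = N / D in lowest terms, so that D p = N q. At a root of D the factor N does not vanish,
    so q would; likewise for p at a root of N. Hence N and D are constants. *)
Lemma primitive_proportional (p q : {poly {poly k}}) (r : E) : r != 0 ->
  primitive p -> primitive q -> MF p = r *: MF q -> exists2 c : k, c != 0 & p = c%:P *: q.
Proof.
move=> r0 pp pq; have [N [D [D0 er cop]]] := coprime_rep r.
have N0 : N != 0 by apply: contra_neq r0 => h; rewrite er h rmorph0 mul0r.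
move=> e; have {}e : D *: p = N *: q.
  apply: (@MF_inj k); rewrite !map_polyZ e er scalerA /=; congr (_ *: _).
  by rewrite mulrC divfK ?tofrac_eq0.
have ev y (A : {poly k}) (w : {poly {poly k}}) : at_point y (A *: w) = A.[y] *: at_point y w.
  by rewrite /at_point /= map_polyZ.
have [d d0 eD] : exists2 c, c != 0 & D = c%:P.
  apply: no_root_const => y; apply/negP => rD.
  have := cop y; rewrite rD andbT => rN.
  have /eqP := congr1 (at_point y) e; rewrite !ev (eqP rD) scale0r eq_sym scaler_eq0.
  by rewrite (negbTE (pq y)) orbF -rootE (negbTE rN).
have [c c0 eN] : exists2 c, c != 0 & N = c%:P.
  apply: no_root_const => y; apply/negP => rN.
  have := cop y; rewrite rN /= => rD.
  have /eqP := congr1 (at_point y) e; rewrite !ev (eqP rN) scale0r scaler_eq0.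
  by rewrite (negbTE (pp y)) orbF -rootE (negbTE rD).
exists (c / d); first by rewrite mulf_neq0 ?invr_eq0.
have d0' : d%:P%:P != 0 :> {poly {poly k}} by rewrite !polyC_eq0.
apply: (mulfI d0'); rewrite !mul_polyC scalerA -polyCM -eD e eN; congr (_%:P *: _).
by rewrite mulrC divfK.
Qed.

Section Subfield.
Variables (S : E -> Prop) (Sf : subfield kE S).
Hypothesis nonconst : exists2 z, S z & forall c, z <> kE c.
Local Notation coefsS := (coefs_in S).

Definition rep_le n (z : E) := exists A C : {poly k},
  [/\ C != 0, z = F A / F C, (size A <= n.+1)%N & (size C <= n.+1)%N].

(** Let th = A / C be nonconstant in S of least degree n, and m the minimal polynomial of X over S,
    a divisor of A(T) - th C(T). Gauss's lemma compares the degrees in X of the primitive parts: the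
    one of m is already at least n, so the two polynomials are proportional. Thus X has the same
    degree over S as over k(th). *)
Lemma luroth : exists th, [/\ S th, forall c, th <> kE c &
  forall psi, S psi -> unigen kE th psi].
Proof.
have [Sc SD SM SV] := Sf.
pose Pn n := `[< exists z, [/\ S z, forall c, z <> kE c & rep_le n z] >].
have exP : exists n, Pn n.
  have [z Sz zc] := nonconst; have [A [C [C0 e _]]] := coprime_rep z.
  exists (maxn (size A) (size C)); apply/asboolP; exists z; split=> //.
  by exists A, C; split=> //; apply: leqW; rewrite ?leq_maxl ?leq_maxr.
case: (ex_minnP exP) => n /asboolP[th [Sth thc [A [C [C0 eth sA sC]]]]] nmin.
have hmin z : S z -> (forall c, z <> kE c) -> forall m, rep_le m z -> (n <= m)%N.
  by move=> Sz zc m hm; apply: nmin; apply/asboolP; exists z.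
exists th; split=> // psi Spsi.
have FC0 : F C != 0 by rewrite tofrac_eq0.
have n0 : (0 < n)%N.
  rewrite lt0n; apply/eqP => n0; move: sA sC; rewrite n0.
  move=> /size1_polyC eA /size1_polyC eC; apply: (thc (A`_0 / C`_0)).
  by rewrite (fmorph_div kE) eth {1}eA {1}eC.
(* By minimality of [n] the fraction A / C is in lowest terms: cancelling a common root would lower
   the degree. *)
have cop y : ~~ (root A y && root C y).
  apply/negP => /andP[/factor_theorem[A' eA] /factor_theorem[C' eC]].
  have C'0 : C' != 0 by apply: contra_neq C0 => h; rewrite eC h mul0r.
  suff /(hmin _ Sth thc) : rep_le n.-1 th by move: n0; case: (n) => // l; rewrite ltnn.
  exists A', C'; rewrite (prednK n0); split; first exact: C'0.
  - rewrite eth eA eC !rmorphM -mulf_div divff ?mulr1; first reflexivity.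
    by rewrite tofrac_eq0 polyXsubC_eq0.
  - have [->|A'0] := eqVneq A' 0; first by rewrite size_poly0.
    by move: sA; rewrite eA size_Mmonic ?monicXsubC // size_XsubC addn2.
  - by move: sC; rewrite eC size_Mmonic ?monicXsubC // size_XsubC addn2.
pose lift (P : {poly k}) : {poly {poly k}} := map_poly polyC P.
have nprop y : C.[y] *: A - A.[y] *: C != 0.
  apply/eqP => /eqP; rewrite subr_eq0 => /eqP h.
  have [c0|c0] := eqVneq C.[y] 0.
    move/eqP: h; rewrite c0 scale0r eq_sym scaler_eq0 (negbTE C0) orbF => a0.
    by move: (cop y); rewrite !rootE c0 a0 eqxx.
  apply: (thc (A.[y] / C.[y])); rewrite eth; apply: (mulIf FC0); rewrite divfK //.
  by rewrite /= -rmorphM mul_polyC mulrC -scalerA -h scalerA mulVf // scale1r.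
(* A(T) - th C(T) without denominators. Exchanging the two variables only changes its sign, so it
   has no factor in one variable alone. *)
pose Om := C *: lift A - A *: lift C.
have pOm : primitive Om.
  move=> y; rewrite /Om rmorphB /= /at_point /= !map_polyZ /=.
  have id P : map_poly (horner_eval y) (lift P) = P.
    rewrite /lift -map_poly_comp map_poly_id // => c _ /=.
    by rewrite /horner_eval hornerC.
  by rewrite !id; apply: nprop.
have sYOm : (sizeY Om <= n.+1)%N.
  apply/bigmax_leqP => i _; rewrite coefB !coefZ !coef_map /=.
  apply: (leq_trans (size_polyD _ _)); rewrite size_polyN geq_max.
  rewrite ![_ * _%:P]mulrC !mul_polyC.
  by rewrite !(leq_trans (size_scale_leq _ _)).
pose M : {poly E} := map_poly kE A - th *: map_poly kE C.
have eM : MF Om = F C *: M.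
  rewrite /Om rmorphB /= !map_polyZ /= -!map_poly_comp scalerBr scalerA; congr (_ - _ *: _).
  by rewrite eth mulrC divfK.
have SM_ : coefsS M.
  by apply: (coefs_inB Sf); [|apply: (coefs_inZ Sf) => //]; apply: (coefs_in_map Sf).
have evM P : (map_poly kE P).[F 'X] = F P by exact: uniev_frac P.
have M0 : M != 0.
  apply: contra_neq (pOm 0) => h; suff -> : Om = 0 by rewrite rmorph0.
  by apply: (@MF_inj k); rewrite eM h scaler0 rmorph0.
have Mv : M.[F 'X] = 0.
  by rewrite /M hornerD hornerN hornerZ !evM eth divfK // subrr.
pose Pm l := `[< exists m : {poly E}, [/\ m != 0, coefsS m, m.[F 'X] = 0 & size m = l] >].
have exm : exists l, Pm l by exists (size M); apply/asboolP; exists M.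
case: (ex_minnP exm) => l /asboolP[m [m0 hm mv sm]] lmin.
have divm N : coefsS N -> N.[F 'X] = 0 -> exists2 q, coefsS q & N = q * m.
  move=> hN Nv; have [q [r [hq hr e sr]]] := coefs_in_division Sf m0 hm hN.
  exists q => //; suff r0 : r = 0 by rewrite e r0 addr0.
  apply: contrapT => /eqP r0; move: sr; rewrite sm ltnNge; move/negP; apply.
  apply: lmin; apply/asboolP; exists r; split=> //.
  have /eqP := Nv; rewrite e hornerD hornerM mv mulr0 add0r => /eqP //.
have [q hq eMq] := divm M SM_ Mv.
have q0 : q != 0 by apply: contra_neq M0 => h; rewrite eMq h mul0r.
have [r1 [mu [r10 emu pmu]]] := primitive_part m0.
have [r2 [ch [r20 ech pch]]] := primitive_part q0.
have [c c0 eOm] : exists2 c : k, c != 0 & Om = c%:P *: (ch * mu).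
  apply: (@primitive_proportional Om (ch * mu) (F C * (r2 * r1)) _ pOm (primitiveM pch pmu)).
    by apply: mulf_neq0; [exact: FC0|apply: mulf_neq0; [exact: r20|exact: r10]].
  rewrite eM eMq emu ech (rmorphM (map_poly (@tofrac {poly k}))) -scalerAl -scalerAr !scalerA mulrA.
  reflexivity.
have mu0 : mu != 0 by apply: contra_neq (pmu 0) => ->; rewrite rmorph0.
have ch0 : ch != 0 by apply: contra_neq (pch 0) => ->; rewrite rmorph0.
have c0' : c%:P != 0 :> {poly k} by rewrite polyC_eq0.
have sYe : (sizeY ch + sizeY mu = (sizeY Om).+1)%N.
  rewrite eOm !sizeYE; have -> : swapXY (c%:P *: (ch * mu)) = (c%:P)%:P * (swapXY ch * swapXY mu).
    by rewrite -mul_polyC rmorphM rmorphM /= swapXY_polyC /= map_polyC.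
  rewrite size_Cmul // size_mul ?swapXY_eq0 // prednK // addn_gt0.
  by rewrite size_poly_gt0 swapXY_eq0 ch0.
(* Some ratio of coefficients of [mu] is not constant, since X is not algebraic over [k]. This ratio
   lies in S, so its degree is at least [n]. *)
have sYmu : (n.+1 <= sizeY mu)%N.
  have [i hi] : exists i, forall c, F mu`_i / F (lead_coef mu) <> kE c.
    apply: contrapT => H.
    have [a ha] : exists a : nat -> k, forall i, F mu`_i / F (lead_coef mu) = kE (a i).
      have [i|a h] := @choice nat k (fun i c => F mu`_i / F (lead_coef mu) = kE c).
        by apply: contrapT => h; apply: H; exists i => c' e; apply: h; exists c'.
      by exists a.
    have lm0 : F (lead_coef mu) != 0 by rewrite tofrac_eq0 lead_coef_eq0.
    pose h := \poly_(i < size mu) a i.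
    have eh : MF mu = F (lead_coef mu) *: map_poly kE h.
      apply/polyP => i; rewrite coefZ !coef_map coef_poly /=; case: ltnP => hi.
        by rewrite -[F (a i)%:P]/(kE (a i)) -ha mulrC divfK.
      by rewrite nth_default // !rmorph0 mulr0.
    have : F h = 0.
      rewrite -evM; have : (MF mu).[F 'X] = 0.
        by have /eqP := mv; rewrite emu hornerZ mulf_eq0 (negbTE r10) => /eqP.
      by rewrite eh hornerZ => /eqP; rewrite mulf_eq0 (negbTE lm0) => /eqP.
    move/eqP; rewrite tofrac_eq0 => /eqP h0.
    have : MF mu = 0 by rewrite eh h0 rmorph0 scaler0.
    by move/eqP; rewrite -(rmorph0 MF) (inj_eq (@MF_inj k)) (negbTE mu0).
  have lm0 : lead_coef mu != 0 by rewrite lead_coef_eq0.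
  have sYc j : (size (mu`_j)%R <= sizeY mu)%N.
    case: (ltnP j (size mu)) => hj; first exact: (leq_bigmax (Ordinal hj)).
    by rewrite nth_default // size_poly0.
  have sY0 : (0 < sizeY mu)%N.
    by apply: leq_trans (sYc (size mu).-1); rewrite size_poly_gt0.
  rewrite -(prednK sY0) ltnS; apply: hmin hi _ _.
    have mc j : m`_j = r1 * F mu`_j by rewrite emu coefZ coef_map.
    have -> : F mu`_i / F (lead_coef mu) = m`_i / m`_(size mu).-1.
      by rewrite !mc -mulf_div divff // mul1r.
    by apply: SM => //; apply: SV.
  by exists mu`_i, (lead_coef mu); rewrite prednK //; split=> //; apply: sYc.
have sYch : (sizeY ch <= 1)%N by lia.
pose h := map_poly (fun p : {poly k} => p`_0) ch.
have ech' : ch = lift h.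
  apply/polyP => i; rewrite /lift /h coef_map /= coef_map_id0 ?coef0 //.
  apply: size1_polyC; case: (ltnP i (size ch)) => hi.
    exact: leq_trans (leq_bigmax (Ordinal hi)) sYch.
  by rewrite nth_default // size_poly0.
(* A root t of [h] would make [Om] vanish at T = t, that is, A(t) C = C(t) A, which [nprop]
   excludes. *)
have [e0 e00 eh] : exists2 c, c != 0 & h = c%:P.
  apply: no_root_const => t; apply/negP => /eqP rt.
  have evl P : (lift P).[t%:P] = (P.[t])%:P.
    by rewrite /lift horner_map.
  have : Om.[t%:P] = 0 by rewrite eOm hornerZ hornerM ech' evl rt mul0r mulr0.
  rewrite /Om hornerD hornerN !hornerZ !evl => /eqP.
  rewrite [C * _]mulrC [A * _]mulrC !mul_polyC -oppr_eq0 opprB => /eqP e.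
  by have := nprop t; rewrite e eqxx.
have qconst : exists2 e, e != 0 & M = e *: m.
  exists (r2 * kE e0); first by apply: mulf_neq0; [exact: r20|rewrite fmorph_eq0].
  rewrite eMq ech ech' eh /lift map_polyC /= map_polyC /= -scalerAl mul_polyC.
  by rewrite scalerA.
have divM N : coefsS N -> N.[F 'X] = 0 -> exists q, N = q * M.
  move=> hN Nv; have [q' _ e'] := divm N hN Nv; have [e ee0 eMm] := qconst.
  exists (e^-1 *: q'); rewrite eMm -scalerAl -scalerAr scalerA mulVf // scale1r //.
have [E1 [F1 [F10 epsi _]]] := coprime_rep psi.
pose S2 := unigen kE th.
have S2f : subfield kE S2 := unigen_subfield kE th.
have S2th : S2 th := unigen_var kE th.
have S2M : coefs_in S2 M.
  by apply: (coefs_inB S2f); [|apply: (coefs_inZ S2f) => //]; apply: (coefs_in_map S2f).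
(* Numerator and denominator of [psi] are reduced modulo [M] over k(th). Then R1 - psi R2 is a
   multiple of [M] of smaller degree, hence zero, and [psi] is a quotient of coefficients of R1 and
   R2. *)
have [Q1 [R1 [_ hR1 eR1 sR1]]] := coefs_in_division S2f M0 S2M (coefs_in_map S2f E1).
have [Q2 [R2 [_ hR2 eR2 sR2]]] := coefs_in_division S2f M0 S2M (coefs_in_map S2f F1).
have FF10 : F F1 != 0 by rewrite tofrac_eq0.
have [q3 e3] : exists q, map_poly kE E1 - psi *: map_poly kE F1 = q * M.
  apply: divM.
    by apply: (coefs_inB Sf); [|apply: (coefs_inZ Sf) => //]; apply: (coefs_in_map Sf).
  by rewrite hornerD hornerN hornerZ !evM epsi divfK // subrr.
have e4 : R1 - psi *: R2 = (q3 - Q1 + psi *: Q2) * M.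
  rewrite mulrDl mulrBl -e3 eR1 eR2 -scalerAl scalerDr; ring.
have e5 : R1 - psi *: R2 = 0.
  have : (size (R1 - psi *: R2)%R < size M)%N.
    apply: (leq_ltn_trans (size_polyD _ _)); rewrite size_polyN gtn_max sR1 /=.
    exact: leq_ltn_trans (size_scale_leq _ _) sR2.
  rewrite e4; have [->|z0] := eqVneq (q3 - Q1 + psi *: Q2) 0; first by rewrite mul0r.
  by rewrite size_mul //; move: z0; rewrite -size_poly_gt0; case: (size _) => // l0 _; rewrite addSn /= ltnNge leq_addl.
have R20 : R2 != 0.
  apply/eqP => hR; have := evM F1; rewrite eR2 hR addr0 hornerM Mv mulr0 => /esym/eqP.
  by rewrite (negbTE FF10).
have lR2 : lead_coef R2 != 0 by rewrite lead_coef_eq0.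
have : S2 (R1`_(size R2).-1 / lead_coef R2).
  by have [_ _ SM2 SV2] := S2f; apply: SM2; [apply: hR1|apply/SV2/hR2].
suff -> : R1`_(size R2).-1 = psi * lead_coef R2 by rewrite mulfK.
by have /polyP/(_ (size R2).-1) := e5; rewrite coefB coefZ coef0 => /eqP; rewrite subr_eq0 => /eqP.
Qed.

End Subfield.
End Luroth.

(** * The pencil of a unirational graded UFD *)

Section LinearForms.
Variables (k : closedFieldType) (B : idomainType) (iota : {rmorphism k -> B}).
Local Notation HF := (hf iota).

(* Members of the pencil are indexed by the projective line: [None] is infinity. *)
Definition lf (a b : B) (o : option k) : B := if o is Some z then a - iota z * b else b.

Definition lfpoly (o : option k) : {poly k} := if o is Some z then 'X - z%:P else 1.

Lemma size_lfpoly o : (size (lfpoly o) <= 2)%N.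
Proof. by case: o => [z|]; rewrite ?size_XsubC ?size_poly1. Qed.

Lemma lfpoly_neq0 o : lfpoly o != 0.
Proof. by case: o => [z|]; rewrite ?polyXsubC_eq0 ?oner_eq0. Qed.

Lemma hf_lfpoly o a b : HF (lfpoly o) 1 a b = lf a b o.
Proof. by case: o => [z|] /=; rewrite ?hf_XsubC ?hf1. Qed.

(** The drop of the degree of [P] below [j] is recorded by copies of [None], so the list has exactly
    [j] entries: the zeros on the projective line with multiplicity. *)
Lemma hf_lf_split (P : {poly k}) j : (size P <= j.+1)%N -> P != 0 ->
  exists c r, [/\ c != 0, size r = j,
   forall a b, HF P j a b = iota c * \prod_(o <- r) lf a b o,
   forall z, Some z \in r = root P z & None \in r = (size P <= j)%N].
Proof.
move=> hP P0; have [r e] := closed_field_poly_normal P.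
have lc0 : lead_coef P != 0 by rewrite lead_coef_eq0.
have sr : size P = (size r).+1 by rewrite {1}e size_scale // size_prod_XsubC.
have hr : (size r <= j)%N by rewrite -ltnS -sr.
exists (lead_coef P), (nseq (j - size r) None ++ map Some r); split=> //.
- by rewrite size_cat size_nseq size_map subnK.
- move=> a b; rewrite {1}e hfZ hf_prod_XsubC // big_cat big_map /=; congr (_ * (_ * _)).
  by rewrite big_nseq -Monoid.iteropE.
- move=> z; rewrite mem_cat mem_nseq andbF mem_map; last by move=> ? ? [].
  by rewrite e rootZ // root_prod_XsubC.
- rewrite mem_cat mem_nseq eqxx andbT sr subn_gt0.
  by case: ltnP => //= _; apply/mapP => -[].
Qed.

Lemma hf_lf_prod (r : seq (option k)) : exists P : {poly k}, [/\ P != 0, (size P <= (size r).+1)%N &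
  forall a b, HF P (size r) a b = \prod_(o <- r) lf a b o].
Proof.
exists (\prod_(o <- r) lfpoly o).
have H a b := @hf_prod k B iota _ r lfpoly (fun=> 1%N) a b size_lfpoly.
have s1 : (\sum_(o <- r) 1 = size r)%N by rewrite sum1_size.
rewrite -s1; split.
- by rewrite prodf_seq_neq0; apply/allP => o _; apply: lfpoly_neq0.
- by have [] := H 0 0.
- by move=> a b; rewrite (H a b).2; apply: eq_bigr => o _; apply: hf_lfpoly.
Qed.

Section Coprime.
Variables (a b : B) (cop : coprime_elt a b).

(** Two distinct members span the same space as [a] and [b], so a common prime would divide both of
    these. *)
Lemma lf_coprime o o' : o != o' -> coprime_elt (lf a b o) (lf a b o').
Proof.
move=> oo p ip h1 h2; have [p0 pu _] := ip.
have red z : dvdr p b -> dvdr p (a - iota z * b) -> False.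
  move=> pb paz; apply: (cop ip _ pb); rewrite -[a](subrK (iota z * b)).
  by apply: dvdrD => //; apply: dvdr_mull.
case: o o' oo h1 h2 => [z|] [w|] //= zw h1 h2; [|exact: red h2 h1|exact: red h1 h2].
have : dvdr p (iota (z - w) * b).
  by rewrite (_ : _ * b = (a - iota w * b) - (a - iota z * b)) ?rmorphB; [apply: dvdrB|ring].
have zw0 : z - w != 0 by rewrite subr_eq0; apply: contra_neq zw => ->.
case=> c e; apply: (red z) h1; exists (iota (z - w)^-1 * c).
by rewrite -mulrA -e mulrA -rmorphM mulVf // rmorph1 mul1r.
Qed.

End Coprime.
End LinearForms.

Section LinePoints.
Variables (k : closedFieldType).

Lemma poly_nonroot (p : {poly k}) : p != 0 -> exists z, p.[z] != 0.
Proof.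
move=> p0; have [r e] := closed_field_poly_normal p; have [z zr] := closed_field_avoid r.
exists z; apply: contraNneq zr => h; rewrite -root_prod_XsubC.
by rewrite -(@rootZ _ _ (lead_coef p)) ?lead_coef_eq0 // -e rootE h.
Qed.

Lemma mpoly_nonvanishing n (p : {mpoly k[n]}) : p != 0 -> exists u, p.@[u] != 0.
Proof.
elim: n p => [|n IH] p p0.
  exists (fun=> 0); rewrite mevalE.
  case e : (msupp p) => [|m [|m' r]].
  - by move/eqP: e; rewrite msupp_eq0 (negbTE p0).
  - rewrite big_seq1 big_ord0 mulr1 -mcoeff_msupp e mem_head //.
  - have := msupp_uniq p; rewrite e /= inE.
    have -> : m = m' by apply/mnmP => -[].
    by rewrite eqxx.
have : muni p != 0 by apply: contra_neq p0 => /muni_eq0.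
rewrite -lead_coef_eq0 => /IH[u hu].
have q0 : map_poly (meval u) (muni p) != 0.
  apply: contra_neq hu => /polyP/(_ (size (muni p)).-1).
  by rewrite coef_map coef0 /= -lead_coefE.
have [z hz] := poly_nonroot q0.
exists (fun i => oapp u z (unlift ord_max i)).
rewrite /meval -(@horner_muni k n k (meval u) z idfun) //.
- by move=> c; rewrite /= mevalC.
- move=> i; rewrite /= mevalXU.
  by rewrite (_ : widen_ord _ i = lift ord_max i) ?liftK //; apply/val_inj; exact: esym (lift_max i).
- by rewrite unlift_none.
Qed.

Definition line n (u u' : 'I_n -> k) : {rmorphism {mpoly k[n]} -> {poly k}} :=
  mmap polyC (fun i => (u i)%:P + (u' i - u i) *: 'X).

Lemma line_at n (u u' : 'I_n -> k) p z :
  (line u u' p).[z] = p.@[fun i => u i + (u' i - u i) * z].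
Proof.
rewrite /line /= /mmap horner_sum mevalE; apply: eq_bigr => m _.
rewrite hornerM hornerC horner_prod; congr (_ * _); apply: eq_bigr => i _.
by rewrite horner_exp hornerD hornerC hornerZ hornerX.
Qed.

(** Choose two points where C does not vanish and where A / C takes different values, and join them:
    A / C is not constant on that line. *)
Lemma line_exists n (A C : {mpoly k[n]}) : C != 0 -> (forall c, A - c *: C != 0) ->
  exists sg : {rmorphism {mpoly k[n]} -> {poly k}},
    [/\ forall c, sg c%:MP = c%:P, sg C != 0 & forall c, sg A != c *: sg C].
Proof.
move=> C0 AC; have [u hu] := mpoly_nonvanishing C0.
have [u' hu'] := mpoly_nonvanishing (mulf_neq0 C0 (AC (A.@[u] / C.@[u]))).
move: hu'; rewrite mevalM mulf_eq0 negb_or => /andP[hC hA].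
have at0 p : (line u u' p).[0] = p.@[u].
  by rewrite line_at; apply: meval_eq => i; rewrite mulr0 addr0.
have at1 p : (line u u' p).[1] = p.@[u'].
  by rewrite line_at; apply: meval_eq => i; rewrite mulr1 addrC subrK.
exists (line u u'); split.
- by move=> c; rewrite /line /= mmapC.
- by apply: contra_neq hu => h; rewrite -at0 h horner0.
- move=> c; apply/eqP => e; move/eqP: hA; apply.
  have ec : A.@[u] / C.@[u] = c by rewrite -!at0 e hornerZ mulfK // at0.
  by rewrite ec mevalB mevalZ -!at1 e hornerZ subrr.
Qed.

End LinePoints.

Section Bigen.
Variables (k E : fieldType) (kap : {rmorphism k -> E}) (x y : E).
Local Notation ev := (biev kap x y).

Definition bigen (z : E) := exists P Q : {poly {poly k}}, ev Q != 0 /\ z * ev Q = ev P.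

Lemma biev_C (A : {poly k}) : ev A%:P = uniev kap x A.
Proof. by rewrite /biev /= map_polyC /= /horner_eval hornerC. Qed.

Lemma uniev_C c : uniev kap x c%:P = kap c.
Proof. by rewrite (unievE _ _ (size_polyC_leq1 c)) big_ord1 coefC mulr1. Qed.

Lemma uniev_X : uniev kap x 'X = x.
Proof. by rewrite /uniev /= map_polyX /horner_eval hornerX. Qed.

Lemma bigen_subfield : subfield kap bigen.
Proof.
split.
- move=> a; exists a%:P%:P, 1; rewrite rmorph1 oner_eq0 mulr1; split=> //.
  by rewrite biev_C uniev_C.
- move=> a b [P [Q [Q0 e]]] [P' [Q' [Q'0 e']]]; exists (P * Q' + P' * Q), (Q * Q').
  rewrite !(rmorphD, rmorphM); split; first exact: mulf_neq0.
  rewrite -e -e'; ring.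
- move=> a b [P [Q [Q0 e]]] [P' [Q' [Q'0 e']]]; exists (P * P'), (Q * Q').
  rewrite !rmorphM; split; first exact: mulf_neq0.
  rewrite -e -e'; ring.
- move=> a [P [Q [Q0 e]]]; have [->|a0] := eqVneq a 0.
    by exists 0, 1; rewrite rmorph1 oner_eq0 rmorph0 invr0 mul0r.
  exists Q, P; rewrite -e; split; first exact: mulf_neq0.
  exact: mulKf.
Qed.

Lemma bigen_x : bigen x.
Proof. by exists 'X%:P, 1; rewrite rmorph1 oner_eq0 mulr1 biev_C uniev_X. Qed.
Lemma bigen_y : bigen y.
Proof. by exists 'X, 1; rewrite rmorph1 oner_eq0 mulr1 biev_X. Qed.

End Bigen.

(* If (x, y) and (x', y') satisfy the same polynomial relations, k(x, y) and
   k(x', y') are isomorphic. *)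
Lemma unigen_transfer (k E E' : fieldType) (kap : {rmorphism k -> E})
    (kap' : {rmorphism k -> E'}) x y x' y' :
  (forall R, biev kap x y R = 0 <-> biev kap' x' y' R = 0) ->
  forall R1 R2 : {poly {poly k}}, biev kap x y R2 != 0 ->
  forall R0, unigen kap (biev kap x y R1 / biev kap x y R2) (biev kap x y R0) ->
  unigen kap' (biev kap' x' y' R1 / biev kap' x' y' R2) (biev kap' x' y' R0).
Proof.
move=> H R1 R2 R20 R0 [P [Q [Q0 e]]].
have R20' : biev kap' x' y' R2 != 0 by apply: contra_neq R20 => /H.
exists P, Q; pose N := (size P + size Q)%N.
have hP : (size P <= N.+1)%N by rewrite leqW // leq_addr.
have hQ : (size Q <= N.+1)%N by rewrite leqW // leq_addl.
have cl (F : fieldType) (ka : {rmorphism k -> F}) u v (A : {poly k}) :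
    biev ka u v R2 != 0 -> (size A <= N.+1)%N ->
    biev ka u v R2 ^+ N * uniev ka (biev ka u v R1 / biev ka u v R2) A =
    biev ka u v (hf (polyC \o polyC : {rmorphism k -> {poly {poly k}}}) A N R1 R2).
  move=> h hA; rewrite clear_uniev //; apply/esym/rmorph_hf => c.
  by rewrite /= [LHS]biev_C uniev_C.
have R2N : biev kap x y R2 ^+ N != 0 by rewrite expf_neq0.
have R2N' : biev kap' x' y' R2 ^+ N != 0 by rewrite expf_neq0.
split.
  apply: contra_neq Q0 => h; apply: (mulfI R2N); rewrite mulr0 cl //; apply/H.
  by rewrite -cl // h mulr0.
apply: (mulfI R2N'); rewrite mulrCA !cl // -rmorphM; apply/eqP; rewrite -subr_eq0 -rmorphB.
apply/eqP/H; rewrite rmorphB rmorphM -!cl // -e; ring.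
Qed.

Section Forms.
Variables (k : closedFieldType) (B : idomainType) (iota : {rmorphism k -> B}).
Variables (s : nat) (Bg : 'rV[int]_s -> B -> Prop) (gr : grading iota Bg).
Hypothesis eff : effective Bg.
Hypothesis B0 : deg0_const iota Bg.
Hypothesis U : UFD B.
Hypothesis tu : trivial_units iota.
Local Notation HF := (hf iota).
Local Notation lin_indep := (lin_indep iota).
Local Notation lf := (lf iota).

Section Pair.
Variables (g : 'rV[int]_s) (a b : B).
Hypotheses (ha : Bg g a) (hb : Bg g b) (li : lin_indep a b) (cop : coprime_elt a b).

Lemma lf_hom o : Bg g (lf a b o).
Proof. by case: o => //= z; apply: (homB gr) => //; apply: (hom_scale gr). Qed.

Lemma lf_partner o : exists o', lin_indep (lf a b o) (lf a b o').
Proof.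
case: o => [z|]; [exists None|exists (Some 0)] => /=; first exact: lin_indep_sub.
by rewrite rmorph0 mul0r subr0; apply: lin_indepC.
Qed.

Lemma lf_neq0 o : lf a b o != 0.
Proof. by have [o' /lin_indep_neq0] := lf_partner o. Qed.

Lemma lf_nonunit o : lf a b o \isn't a GRing.unit.
Proof.
have [o' h] := lf_partner o.
exact: (lin_indep_nonunit gr B0 tu (lf_hom o') (lf_hom o) (lin_indepC h)).
Qed.

Lemma lf_dvd_hf (P : {poly k}) j o : (size P <= j.+2)%N -> P != 0 ->
  (exists2 P' : {poly k}, (size P' <= j.+1)%N & HF P j.+1 a b = lf a b o * HF P' j a b) \/
  coprime_elt (lf a b o) (HF P j.+1 a b).
Proof.
move=> hP P0; have [c [r [c0 sr e _ _]]] := hf_lf_split iota hP P0.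
have [or|nor] := boolP (o \in r); [left|right]; rewrite e.
  have [P' [_ hP' e']] := hf_lf_prod iota (rem o r).
  have sr' : size (rem o r) = j by rewrite size_rem // sr.
  rewrite sr' in hP' e'; exists (c *: P'); first by rewrite size_scale.
  by rewrite hfZ e' (big_rem _ or) /= mulrCA.
apply: coprime_elt_mulr => //.
  by apply: coprime_elt_unitr; rewrite rmorph_unit ?unitfE.
apply: (coprime_elt_prod U) => o' o'r; apply: lf_coprime => //.
by apply: contraNneq nor => ->.
Qed.

Lemma hf_split_lf (P : {poly k}) j : (size P <= j.+2)%N -> P != 0 ->
  exists o (P' : {poly k}), [/\ P' != 0, (size P' <= j.+1)%N & HF P j.+1 a b = lf a b o * HF P' j a b].
Proof.
move=> hP P0; have [c [[|o r] [c0 sr e _ _]]] := hf_lf_split iota hP P0; first by [].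
have [P' [P'0 hP' e']] := hf_lf_prod iota r.
case: sr => sr; rewrite sr in hP' e'; exists o, (c *: P'); split.
- by rewrite scaler_eq0 negb_or c0.
- by rewrite size_scale.
- by rewrite e hfZ e' big_cons mulrCA.
Qed.

(** The linear factors of the form of [A] are cancelled one at a time: each either divides the form
    of [C] or is coprime to it, and in the latter case it would divide [h]. *)
Lemma form_cancel j h x n (A C : {poly k}) : (forall o, ~ dvdr (lf a b o) h) ->
  (size A <= n.+1)%N -> A != 0 -> (size C <= (n + j).+1)%N ->
  x * HF A n a b = h * HF C (n + j) a b ->
  exists2 P : {poly k}, (size P <= j.+1)%N & x = h * HF P j a b.
Proof.
move=> nh; elim: n A C => [|n IH] A C hA A0 hC e.
  have [c c0 eA] : exists2 c, c != 0 & A = c%:P.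
    by exists A`_0; [move: A0; rewrite {1}(size1_polyC hA) polyC_eq0 | apply: size1_polyC].
  exists (c^-1 *: C); first by apply: leq_trans (size_scale_leq _ _) hC.
  rewrite hfZ mulrCA -e eA hfC expr0 mulr1 mulrCA -rmorphM mulVf //.
  by rewrite rmorph1 mulr1.
rewrite addSn in hC e; have [o [A' [A'0 hA' eA]]] := hf_split_lf hA A0.
have l0 := lf_neq0 o.
have HA'0 : HF A' n a b != 0 by apply: hf_neq0.
have [C0|C0] := eqVneq C 0.
  exists 0; first by rewrite size_poly0.
  move/eqP: e; rewrite C0 !hf0 mulr0 eA !mulf_eq0 (negbTE l0) (negbTE HA'0) orbF.
  by rewrite orbF => /eqP.
have [[C' hC' eC]|copC] := lf_dvd_hf o hC C0.
  apply: (IH A' C' hA' A'0 hC'); apply: (mulfI l0).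
  by rewrite mulrCA -eA e eC mulrCA.
case: (nh o); apply: (coprime_elt_dvdr U l0 copC).
by rewrite mulrC -e eA; exists (x * HF A' n a b); ring.
Qed.

Section Length.
Variables (len : B -> nat) (hlen : is_length len).

Lemma len_const_mul c x : c != 0 -> x != 0 -> len (iota c * x) = len x.
Proof.
have [lM l0 _ _] := hlen; move=> c0 x0; rewrite lM ?fmorph_eq0 // l0 //.
by rewrite rmorph_unit ?unitfE.
Qed.

Lemma len_lf_prod r n : (forall o, n <= len (lf a b o))%N ->
  (size r * n <= len (\prod_(o <- r) lf a b o))%N.
Proof.
have [lM l0 _ _] := hlen; move=> hn; elim: r => [|o r IH]; first by rewrite mul0n.
rewrite big_cons lM ?lf_neq0 // ?mulSn ?leq_add //.
by rewrite prodf_seq_neq0; apply/allP => o' _; apply: lf_neq0.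
Qed.

Lemma len_hf (P : {poly k}) j n : (forall o, n <= len (lf a b o))%N ->
  (size P <= j.+1)%N -> P != 0 -> (j * n <= len (HF P j a b))%N.
Proof.
move=> hn hP P0; have [c [r [c0 sr -> _ _]]] := hf_lf_split iota hP P0.
rewrite len_const_mul // -?sr ?len_lf_prod //.
by rewrite prodf_seq_neq0; apply/allP => o' _; apply: lf_neq0.
Qed.

Lemma len_lf_gt0 o : (1 <= len (lf a b o))%N.
Proof.
have [_ _ lu _] := hlen; rewrite lt0n; apply/eqP => h.
by have := lu _ (lf_neq0 o) h; rewrite (negbTE (lf_nonunit o)).
Qed.

End Length.

(** Write y as [h] times a form of the largest possible degree [j], which the length of y bounds. No
    member then divides [h], and [form_cancel] turns the fact that x / y lies in k(a / b) into x = h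
    times a form of degree [j]. *)
Lemma pencil_of_ratios :
  (forall m x y, Bg m x -> Bg m y -> y != 0 -> exists n (P Q : {poly k}),
    [/\ (size P <= n.+1)%N, (size Q <= n.+1)%N, Q != 0 & x * HF Q n a b = y * HF P n a b]) ->
  pencil iota Bg g a b.
Proof.
move=> H; split=> // m y hy y0; have [len hlen] := UFD_length U.
pose T j := `[< exists h (Q : {poly k}), [/\ (size Q <= j.+1)%N, Q != 0, h != 0, Bg (m - g *+ j) h & y = h * HF Q j a b] >].
have exT : exists j, T j.
  exists 0%N; apply/asboolP; exists y, 1; rewrite size_poly1 oner_eq0 mulr0n subr0 hf1 expr0 mulr1.
  by split.
have [lM l0 lu l1] := hlen.
have bT j : T j -> (j <= len y)%N.
  move=> /asboolP[h [Q [hQ Q0 h0 _ ->]]]; rewrite lM //; last exact: hf_neq0.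
  have := len_hf hlen (len_lf_gt0 hlen) hQ Q0; lia.
case: (ex_maxnP exT bT) => j /asboolP[h [Q [hQ Q0 h0 hh ey]]] jmax.
exists h, j; split=> // x hx.
have nh o : ~ dvdr (lf a b o) h.
  move=> [h' eh]; have h'0 : h' != 0 by apply: contra_neq h0 => z; rewrite eh z mul0r.
  suff /jmax : T j.+1 by rewrite ltnn.
  apply/asboolP; exists h', (lfpoly o * Q); split=> //.
  - apply: (leq_trans (size_polyMleq _ _)); have := size_lfpoly o; lia.
  - by rewrite mulf_neq0 // lfpoly_neq0.
  - by rewrite mulrS opprD addrA addrAC; apply: (hom_dvdr_quot gr (lf_hom o) (lf_neq0 o) hh eh).
  - by rewrite ey eh -add1n hfM ?size_lfpoly // hf_lfpoly mulrA.
have [n [P1 [Q1 [hP1 hQ1 Q10 e]]]] := H m x y hx hy y0.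
apply: (@form_cancel j h x n Q1 (P1 * Q)) => //.
  by apply: (leq_trans (size_polyMleq _ _)); lia.
by rewrite e ey hfM //; ring.
Qed.

End Pair.

Lemma coprime_reduction (len : B -> nat) m x y : is_length len -> Bg m x -> Bg m y -> lin_indep x y ->
  exists g a b w, [/\ Bg g a, Bg g b, lin_indep a b, coprime_elt a b & x = w * a /\ y = w * b].
Proof.
move=> hlen; have [lM l0 lu l1] := hlen.
elim: {x}(len x) {-2}x (leqnn (len x)) m y => [|n IH] x lx m y hx hy li.
  exists m, x, y, 1; rewrite !mul1r; split=> // p ip px py.
  have x0 := lin_indep_neq0 li.
  have xu : x \is a GRing.unit by apply: lu => //; lia.
  by case: ip => _; rewrite (dvdr_unitP px xu).
have [cop|] := EM (coprime_elt x y); first by exists m, x, y, 1; rewrite !mul1r.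
move=> ncop; have [p [ip px py]] : exists p, [/\ irreducible p, dvdr p x & dvdr p y].
  by apply: contrapT => H; apply: ncop => p ip px py; apply: H; exists p.
have x0 := lin_indep_neq0 li; have p0 : p != 0 by case: ip.
have [d hd [x' hx' ex]] := hom_dvdr gr x0 hx px.
have [y' ey] := py; have hy' := hom_dvdr_quot gr hd p0 hy ey.
have li' : lin_indep x' y'.
  by apply/(lin_indep_mul _ _ _ p0); rewrite ![p * _]mulrC -ex -ey.
have lx' : (len x' <= n)%N.
  by move: lx; rewrite ex lM // ?(lin_indep_neq0 li') // (l1 p p0).2 // addn1 ltnS.
have [g [a [b [w [h1 h2 h3 h4 [e1 e2]]]]]] := IH x' lx' _ _ hx' hy' li'.
exists g, a, b, (p * w); split=> //; split; [rewrite ex e1|rewrite ey e2]; ring.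
Qed.

End Forms.

(** After clearing the common denominator, a relation is an identity in [R], which [sg] preserves;
    as the image of [C] is nonzero, one may divide again. *)
Lemma biev_specialize (k : fieldType) (R R' : comNzRingType) (Q Q' : fieldType)
    (kR : {rmorphism k -> R}) (kR' : {rmorphism k -> R'}) (kQ : {rmorphism k -> Q})
    (kQ' : {rmorphism k -> Q'}) (j : {rmorphism R -> Q}) (j' : {rmorphism R' -> Q'})
    (sg : {rmorphism R -> R'}) A C D :
  injective j -> (forall c, sg (kR c) = kR' c) -> (forall c, j (kR c) = kQ c) ->
  (forall c, j' (kR' c) = kQ' c) -> j C != 0 -> j' (sg C) != 0 ->
  forall P, biev kQ (j A / j C) (j D / j C) P = 0 ->
    biev kQ' (j' (sg A) / j' (sg C)) (j' (sg D) / j' (sg C)) P = 0.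
Proof.
move=> ji hs hj hj' C0 C0' P eP; have [N hN] := biev_bound P.
have := clear_biev kQ (j A) (j D) C0 C0 (leqnSn (size P)) hN; rewrite eP mulr0 => e.
have eR : \sum_(i < (size P).+1) hf kR P`_i N A C * (D ^+ i * C ^+ (size P - i)) = 0.
  apply: ji; rewrite rmorph0 rmorph_sum [RHS]e; apply: eq_bigr => i _.
  by rewrite !rmorphM !rmorphXn (rmorph_hf (kap' := kQ)).
have := clear_biev kQ' (j' (sg A)) (j' (sg D)) C0' C0' (leqnSn (size P)) hN.
rewrite (_ : \sum_(i < _) _ = j' (sg 0)); last first.
  rewrite -eR !rmorph_sum; apply: eq_bigr => i _.
  rewrite !rmorphM !rmorphXn; congr (_ * _).
  by rewrite (@rmorph_hf _ _ _ kR kR' sg) // (@rmorph_hf _ _ _ kR' kQ' j').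
rewrite !rmorph0 => /eqP; rewrite mulf_eq0 (negbTE (mulf_neq0 _ _)) ?expf_neq0 //.
by move/eqP.
Qed.

Lemma rmorph_biev (k : fieldType) (R S : comNzRingType) (kR : {rmorphism k -> R})
    (kS : {rmorphism k -> S}) (phi : {rmorphism R -> S}) x y P :
  (forall c, phi (kR c) = kS c) -> phi (biev kR x y P) = biev kS (phi x) (phi y) P.
Proof.
move=> h; rewrite !(bievE _ _ _ (leqnn _)) rmorph_sum; apply: eq_bigr => i _.
rewrite rmorphM rmorphXn !(unievE _ _ (leqnn _)) rmorph_sum; congr (_ * _).
by apply: eq_bigr => j _; rewrite rmorphM rmorphXn h.
Qed.

Section UnigenMore.
Variables (k E : fieldType) (kap : {rmorphism k -> E}).

Lemma subfield_uniev S x P : subfield kap S -> S x -> S (uniev kap x P).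
Proof.
move=> Sf Sx; have [Sc SD SM SV] := Sf; rewrite (unievE _ _ (leqnn _)).
apply: big_ind => //; first exact: subfield0 Sf.
move=> i _; apply: (SM _ _) => //; elim: (nat_of_ord i) => [|n IH].
  by rewrite expr0 -(rmorph1 kap).
by rewrite exprS; apply: SM.
Qed.

Lemma unigen_trans x y z : unigen kap x y -> unigen kap y z -> unigen kap x z.
Proof.
move=> hy [P [Q [Q0 e]]]; have Sf := unigen_subfield kap x; have [_ _ SM SV] := Sf.
rewrite -[z](mulfK Q0) e; apply: SM; [|apply: SV]; exact: subfield_uniev.
Qed.

Lemma uniev_const c P : uniev kap (kap c) P = kap P.[c].
Proof. by rewrite /uniev /= /horner_eval horner_map. Qed.

Lemma unigen_const c z : unigen kap (kap c) z -> exists c', z = kap c'.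
Proof.
move=> [P [Q [Q0 e]]]; exists (P.[c] / Q.[c]); rewrite fmorph_div -!uniev_const -e.
by rewrite mulfK.
Qed.

Lemma unigen_coprime x z : unigen kap x z -> exists P Q,
  [/\ uniev kap x Q != 0, z * uniev kap x Q = uniev kap x P & forall y, ~~ (root P y && root Q y)].
Proof.
move=> [P [Q [Q0 e]]]; elim: {Q}(size Q) {-2}Q (leqnn (size Q)) P Q0 e => [|n IH] Q sQ P Q0 e.
  by move: Q0; rewrite leqn0 size_poly_eq0 in sQ; rewrite (eqP sQ) rmorph0 eqxx.
have [[y /andP[rP rQ]]|H] := EM (exists y, root P y && root Q y); last first.
  by exists P, Q; split=> // y; apply/negP => h; apply: H; exists y.
have /factor_theorem[Q' eQ] := rQ; have /factor_theorem[P' eP] := rP.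
have [Q'0 X0] : uniev kap x Q' != 0 /\ uniev kap x ('X - y%:P) != 0.
  by move: Q0; rewrite eQ rmorphM mulf_eq0 negb_or => /andP[].
have Q'n0 : Q' != 0 by apply: contra_neq Q'0 => ->; rewrite rmorph0.
apply: (IH Q' _ P') => //.
  by move: sQ; rewrite eQ size_Mmonic ?monicXsubC // size_XsubC addn2.
by apply: (mulIf X0); rewrite -mulrA -!rmorphM -eQ -eP.
Qed.

(* A Moebius transformation is invertible. *)
Lemma unigen_moebius x z (P Q : {poly k}) : (forall c, z <> kap c) ->
  (size P <= 2)%N -> (size Q <= 2)%N -> uniev kap x Q != 0 ->
  z * uniev kap x Q = uniev kap x P -> unigen kap z x.
Proof.
move=> zc hP hQ Q0 e.
have ev (A : {poly k}) : (size A <= 2)%N -> uniev kap x A = kap A`_0 + kap A`_1 * x.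
  by move=> hA; rewrite (unievE _ _ hA) big_ord_recl big_ord1 expr0 mulr1 expr1.
move: e Q0; rewrite !ev // => e Q0.
have d0 : z * kap Q`_1 - kap P`_1 != 0.
  apply/eqP => /eqP; rewrite subr_eq0 => /eqP h.
  have [q1|q1] := eqVneq Q`_1 0.
    have p1 : P`_1 = 0.
      by apply/eqP; rewrite -(fmorph_eq0 kap) -h q1 rmorph0 mulr0.
    move: e Q0; rewrite q1 p1 rmorph0 !mul0r !addr0 => e Q0.
    by apply: (zc (P`_0 / Q`_0)); rewrite fmorph_div -e mulfK.
  apply: (zc (P`_1 / Q`_1)); rewrite fmorph_div -h mulfK // fmorph_eq0 //.
have -> : x = (kap P`_0 - z * kap Q`_0) / (z * kap Q`_1 - kap P`_1).
  apply: (mulIf d0); rewrite divfK //.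
  rewrite mulrBr (_ : x * (z * _) = z * (kap Q`_0 + kap Q`_1 * x) - z * kap Q`_0); last ring.
  by rewrite e; ring.
have Sf := unigen_subfield kap z; have [Sc SD SM SV] := Sf.
have Sz := unigen_var kap z.
by apply: (SM _ _); [|apply: SV]; apply: (SD _ _); try apply: (subfieldN Sf); try apply: (SM _ _).
Qed.

End UnigenMore.

Section Unirational.
Variables (k : closedFieldType) (B : idomainType) (iota : {rmorphism k -> B}).
Variables (s : nat) (Bg : 'rV[int]_s -> B -> Prop) (gr : grading iota Bg).
Hypothesis eff : effective Bg.
Hypothesis B0 : deg0_const iota Bg.
Hypothesis U : UFD B.
Hypothesis tu : trivial_units iota.
Hypothesis td : has_trdeg iota s.+1.
Hypothesis unir : unirational iota.
Local Notation HF := (hf iota).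
Local Notation lin_indep := (lin_indep iota).
Local Notation lf := (lf iota).
Local Notation L := {fraction B}.
Local Notation f := (@tofrac B \o iota : {rmorphism k -> L}).
Local Notation F := (@tofrac B).
Local Notation E1 := {fraction {poly k}}.
Local Notation kE := (@tofrac {poly k} \o polyC : {rmorphism k -> E1}).

Lemma homfrac0_rep z : homfrac Bg 0 z -> exists m x y, [/\ Bg m x, Bg m y, y != 0 & z = F x / F y].
Proof.
move=> [a [b [x [y [hx hy y0 /eqP e ez]]]]]; exists a, x, y; split=> //.
by move: e; rewrite subr_eq0 => /eqP->.
Qed.

Lemma homfrac0_biev phi psi R : homfrac Bg 0 phi -> homfrac Bg 0 psi -> homfrac Bg 0 (biev f phi psi R).
Proof.
move=> h1 h2; rewrite (bievE _ _ _ (leqnn _)); apply: (homfrac_sum gr) => j _.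
rewrite -[0]addr0; apply: (homfracM gr).
  rewrite (unievE _ _ (leqnn _)); apply: (homfrac_sum gr) => i _.
  rewrite -[0]addr0; apply: (homfracM gr); first exact: (homfrac_const gr).
  by rewrite -(mul0rn _ i); apply: (homfracX gr).
by rewrite -(mul0rn _ j); apply: (homfracX gr).
Qed.

(** The images of [phi] and [psi] in the purely transcendental field are written over one
    denominator and restricted to a line where [phi] stays nonconstant. *)
Lemma specialization phi psi : (forall c, phi <> f c) -> exists phi' psi' : E1,
  (forall c, phi' <> kE c) /\ forall R, biev f phi psi R = 0 -> biev kE phi' psi' R = 0.
Proof.
move=> phic; have [N [h hc]] := unir.
pose kM := (@mpolyC N k : {rmorphism k -> {mpoly k[N]}}).
pose kQ := (@tofrac {mpoly k[N]} \o kM : {rmorphism k -> {fraction {mpoly k[N]}}}).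
have [A0 [C0 [C00 eA]]] := fraction_repr (h phi).
have [D0 [C1 [C10 eD]]] := fraction_repr (h psi).
pose C := C0 * C1; pose A := A0 * C1; pose D := D0 * C0.
have Cn0 : C != 0 by apply: mulf_neq0.
have tC : tofrac C != 0 by rewrite tofrac_eq0.
have eA' : h phi = tofrac A / tofrac C.
  have tC1 : tofrac C1 != 0 by rewrite tofrac_eq0.
  by rewrite eA !rmorphM -mulf_div divff ?mulr1.
have eD' : h psi = tofrac D / tofrac C.
  have tC0 : tofrac C0 != 0 by rewrite tofrac_eq0.
  by rewrite eD /C mulrC !rmorphM [tofrac C0 * _]mulrC -mulf_div divff ?mulr1 // mulrC.
clearbody A D C.
have AC c : A - c *: C != 0.
  apply/eqP => /eqP; rewrite subr_eq0 => /eqP e; apply: (phic c); apply: (fmorph_inj h).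
  rewrite eA' e -mul_mpolyC rmorphM mulfK //; exact: esym (hc c).
have [sg [sgc sC sA]] := line_exists Cn0 AC.
have tsC : tofrac (sg C) != 0 by rewrite tofrac_eq0.
exists (tofrac (sg A) / tofrac (sg C)), (tofrac (sg D) / tofrac (sg C)); split.
  move=> c e; move/eqP: (sA c); apply; apply/eqP; rewrite -tofrac_eq -mul_polyC rmorphM /=.
  by have := congr1 (fun t => t * tofrac (sg C)) e; rewrite /= divfK // => ->.
move=> R eR; apply: (@biev_specialize k {mpoly k[N]} {poly k} _ _ kM polyC kQ kE
   (@tofrac _) (@tofrac _) sg A C D) => //.
- by move=> x y /eqP; rewrite tofrac_eq => /eqP.
- by rewrite -eA' -eD' -(rmorph_biev (kR := f)) // eR rmorph0.
Qed.

Lemma homfrac0_dep phi z : homfrac Bg 0 phi -> homfrac Bg 0 z ->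
  exists2 R : {poly {poly k}}, R != 0 & biev f phi z R = 0.
Proof.
move=> /homfrac0_rep[m [x [y [hx hy y0 ->]]]] /homfrac0_rep[m' [x' [y' [hx' hy' y0' ->]]]].
exact: (ratio_dependent gr eff td hx hy y0 hx' hy' y0').
Qed.

(** Let z be the value of R before specialization. If z is nonzero, it satisfies an equation over
    k(phi) whose constant coefficient is a nonzero polynomial in phi. After specialization z becomes
    0, so phi' is a root of that polynomial and hence constant. *)
Lemma specialization_faithful phi psi phi' psi' :
  homfrac Bg 0 phi -> homfrac Bg 0 psi -> (forall c, phi' <> kE c) ->
  (forall R, biev f phi psi R = 0 -> biev kE phi' psi' R = 0) ->
  forall R, biev kE phi' psi' R = 0 -> biev f phi psi R = 0.
Proof.
move=> h1 h2 nc T1 R eR; set z := biev f phi psi R.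
apply: contrapT => /eqP z0.
have hz : homfrac Bg 0 z by apply: homfrac0_biev.
have [P P0 eP] := homfrac0_dep h1 hz.
have [n [Q]] := multiplicity_XsubC P 0; rewrite P0 /= rootE horner_coef0 => Q0 ePQ.
have eQ : biev f phi z Q = 0.
  move: eP; rewrite ePQ polyC0 subr0 rmorphM rmorphXn biev_X => /eqP.
  by rewrite mulf_eq0 expf_eq0 (negbTE z0) andbF orbF => /eqP.
(* The equation [Q] of z, with z replaced by the polynomial [R] in the two fractions. *)
pose C := \sum_(j < size Q) (Q`_j)%:P * R ^+ j.
have evC (E : fieldType) (ka : {rmorphism k -> E}) x y :
    biev ka x y C = \sum_(j < size Q) uniev ka x Q`_j * biev ka x y R ^+ j.
  by rewrite rmorph_sum; apply: eq_bigr => j _; rewrite rmorphM rmorphXn biev_C.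
have : biev kE phi' psi' C = 0.
  by apply: T1; rewrite evC -[RHS]eQ (bievE _ _ _ (leqnn (size Q))).
rewrite evC eR; case sQ : (size Q) => [|l].
  by move/eqP: sQ; rewrite size_poly_eq0 => /eqP e; move: Q0; rewrite e coef0 eqxx.
rewrite big_ord_recl big1 ?addr0 => [|j _]; last by rewrite expr0n mulr0.
rewrite expr0 mulr1; have [r e] := closed_field_poly_normal Q`_0.
rewrite (_ : Q`_(ord0 : 'I_l.+1) = lead_coef Q`_0 *: \prod_(z <- r) ('X - z%:P)) //.
rewrite -mul_polyC (rmorphM (uniev kE phi')) uniev_C => /eqP.
rewrite mulf_eq0 fmorph_eq0 lead_coef_eq0 (negbTE Q0) orFb.
rewrite (rmorph_prod (uniev kE phi')) prodf_seq_eq0 => /hasP[w _].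
rewrite andTb (rmorphB (uniev kE phi')) uniev_C uniev_X subr_eq0 => /eqP.
exact: nc.
Qed.

(** By Lueroth, k(phi, psi) = k(th) with th = a' / b' in lowest terms, and phi is a function of th
    of some degree n. Its numerator, a form of degree n in a', b', divides a, while its length is at
    least n times that of a. So n is at most 1 and th lies in k(phi). *)
Lemma unirational_ratio len g a b m x y : is_length len -> min_pair iota Bg len g a b ->
  Bg m x -> Bg m y -> y != 0 -> unigen f (F a / F b) (F x / F y).
Proof.
move=> hlen mp hx hy y0; have cop := min_pair_coprime gr hlen mp.
have [ha hb li hmin] := mp; have [lM l0 lu l1] := hlen.
have a0 := lin_indep_neq0 li; have b0 := lin_indep_neq0 (lin_indepC li).
have Fb0 : F b != 0 by rewrite tofrac_eq0.
set phi := F a / F b; set psi := F x / F y.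
have hphi : homfrac Bg 0 phi by exists g, g, a, b; rewrite subrr.
have hpsi : homfrac Bg 0 psi by exists m, m, x, y; rewrite subrr.
have phic c : phi <> f c.
  move=> e; have [_ /(_ c)] := li; apply/negP; rewrite negbK subr_eq0 -tofrac_eq.
  by have := congr1 (fun t => t * F b) e; rewrite /phi divfK // => ->; rewrite rmorphM.
have [phi' [psi' [nc T1]]] := specialization psi phic.
have T2 := specialization_faithful hphi hpsi nc T1.
have nonc : exists2 z, bigen kE phi' psi' z & forall c, z <> kE c.
  by exists phi' => //; apply: bigen_x.
have [th' [[R1 [R2 [R20 eth']]] thc' gth']] := luroth (bigen_subfield kE phi' psi') nonc.
have {}eth' : th' = biev kE phi' psi' R1 / biev kE phi' psi' R2.
  by rewrite -eth' mulfK.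
have T : forall R, biev kE phi' psi' R = 0 <-> biev f phi psi R = 0.
  by move=> R; split; [apply: T2|apply: T1].
set th := biev f phi psi R1 / biev f phi psi R2.
have tr R0 : bigen kE phi' psi' (biev kE phi' psi' R0) -> unigen f th (biev f phi psi R0).
  by move=> h; apply: (unigen_transfer T R20); rewrite -eth'; apply: gth'.
have gphi : unigen f th phi.
  have := tr 'X%:P; rewrite !biev_C !uniev_X; apply; exact: bigen_x.
have gpsi : unigen f th psi.
  have := tr 'X; rewrite !biev_X; apply; exact: bigen_y.
have hth : homfrac Bg 0 th.
  rewrite /th -[0]subr0; apply: (homfracM gr); first exact: homfrac0_biev.
  by apply: (homfracV gr); apply: homfrac0_biev.
clearbody th; clear tr eth'.
have [m' [x' [y' [hx' hy' y0' eth]]]] := homfrac0_rep hth.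
have Fy0' : F y' != 0 by rewrite tofrac_eq0.
have thc c : th <> f c by move=> e; move: gphi; rewrite e => /unigen_const[c' /phic].
have li' : lin_indep x' y'.
  split=> // c; apply/eqP => /eqP; rewrite subr_eq0 => /eqP e; apply: (thc c).
  by rewrite eth e rmorphM mulfK.
have [g' [a' [b' [w [ha' hb' li2 cop' [ex ey]]]]]] := coprime_reduction gr hlen hx' hy' li'.
have b'0 := lin_indep_neq0 (lin_indepC li2).
have Fb'0 : F b' != 0 by rewrite tofrac_eq0.
have w0 : F w != 0 by rewrite tofrac_eq0; apply: contra_neq y0' => h; rewrite ey h mul0r.
have {}eth : th = F a' / F b'.
  by rewrite eth ex ey !rmorphM -mulf_div divff ?mul1r.
have [P [Q [Q0 ePQ copPQ]]] := unigen_coprime gphi.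
have Qn0 : Q != 0 by apply: contra_neq Q0 => ->; rewrite rmorph0.
have phi0 : phi != 0 by apply/eqP => h; apply: (phic 0); rewrite h rmorph0.
have Pn0 : P != 0.
  apply/eqP => h; move/eqP: ePQ; rewrite h rmorph0.
  by apply/negP; apply: mulf_neq0; [exact: phi0|exact: Q0].
pose n := (maxn (size P) (size Q)).-1.
have mx : maxn (size P) (size Q) = n.+1.
  by rewrite prednK // leq_max; apply/orP; left; rewrite size_poly_gt0.
have hP : (size P <= n.+1)%N by rewrite -mx leq_maxl.
have hQ : (size Q <= n.+1)%N by rewrite -mx leq_maxr.
have eH : a * HF Q n a' b' = b * HF P n a' b'.
  apply/eqP; rewrite -tofrac_eq !rmorphM /= !F_hf -!(clear_uniev _ _ Fb'0) // -eth -ePQ.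
  have -> : F a = phi * F b by rewrite /phi divfK.
  by apply/eqP; rewrite /=; ring.
have HP0 : HF P n a' b' != 0 by apply: hf_neq0.
(* The two forms share no finite zero because P and Q are coprime, and none at infinity because one
   of them has degree exactly [n]. *)
have copH : coprime_elt (HF P n a' b') (HF Q n a' b').
  have [c [r [c0 sr -> rP1 rP2]]] := hf_lf_split iota hP Pn0.
  have [d [r' [d0 sr' -> rQ1 rQ2]]] := hf_lf_split iota hQ Qn0.
  have disj o : o \in r -> o \in r' -> False.
    case: o => [z|]; rewrite ?rP1 ?rQ1 ?rP2 ?rQ2.
      by move=> r1 r2; have := copPQ z; rewrite r1 r2.
    move=> s1 s2; have : (maxn (size P) (size Q) <= n)%N by rewrite geq_max s1 s2.
    by rewrite mx ltnn.
  apply: (coprime_elt_mulr U); first by apply: coprime_elt_unitr; rewrite rmorph_unit ?unitfE.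
  apply: coprime_elt_sym; apply: (coprime_elt_mulr U).
    by apply: coprime_elt_unitr; rewrite rmorph_unit ?unitfE.
  apply: (coprime_elt_prod U) => o or; apply: coprime_elt_sym.
  apply: (coprime_elt_prod U) => o' or'; apply: lf_coprime => //; apply/eqP => e.
  by apply: (disj o) => //; rewrite e.
have dPa : dvdr (HF P n a' b') a.
  apply: (coprime_elt_dvdr U HP0 copH); rewrite mulrC eH; apply/dvdr_mull/dvdrr.
have lPa : (len (HF P n a' b') <= len a)%N.
  case: dPa => q eq; have -> : len a = (len q + len (HF P n a' b'))%N; last exact: leq_addl.
  by rewrite -lM -?eq //; apply: contra_neq a0 => h; rewrite eq h mul0r.
have lmin o : (len a <= len (lf a' b' o))%N.
  have [o' lio] := lf_partner li2 o; apply: hmin lio; exact: (lf_hom gr ha' hb').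
have la : (0 < len a)%N.
  rewrite lt0n; apply/eqP => h; have := lu a a0 h.
  by rewrite (negbTE (lin_indep_nonunit gr B0 tu hb ha (lin_indepC li))).
have n1 : (n <= 1)%N.
  have h := @len_hf _ _ _ _ _ li2 len hlen P n (len a) lmin hP Pn0.
  by have := leq_trans h lPa; rewrite -[X in (_ <= X)%N]mul1n leq_pmul2r.
have gth : unigen f phi th.
  apply: (unigen_moebius phic _ _ Q0 ePQ).
    by apply: leq_trans hP _.
  by apply: leq_trans hQ _.
exact: unigen_trans gth gpsi.
Qed.

Lemma unirational_pencil : exists g a b, pencil iota Bg g a b.
Proof.
have [len hlen] := UFD_length U.
have [g [a [b mp]]] := min_pair_exists gr eff td len.
have cop := min_pair_coprime gr hlen mp; have [ha hb li _] := mp.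
exists g, a, b; apply: (pencil_of_ratios gr B0 U tu ha hb li cop) => m x y hx hy y0.
have [P [Q [Q0 e]]] := unirational_ratio hlen mp hx hy y0.
have b0 := lin_indep_neq0 (lin_indepC li).
have Fb0 : F b != 0 by rewrite tofrac_eq0.
have Fy0 : F y != 0 by rewrite tofrac_eq0.
exists (size P + size Q)%N, P, Q; have hP : (size P <= (size P + size Q).+1)%N by rewrite leqW // leq_addr.
have hQ : (size Q <= (size P + size Q).+1)%N by rewrite leqW // leq_addl.
split=> //; first by apply: contra_neq Q0 => ->; rewrite rmorph0.
apply/eqP; rewrite -tofrac_eq !rmorphM /= !F_hf -!(clear_uniev _ _ Fb0) // -e.
by apply/eqP; rewrite /= mulrCA [RHS]mulrCA; congr (_ * _); rewrite mulrA [F y * _]mulrC divfK.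
Qed.

End Unirational.

(** * Normal forms for monomials of equal degree *)

Lemma sumPosz (I : Type) (r : seq I) (P : pred I) (F : I -> nat) :
  Posz (\sum_(i <- r | P i) F i)%N = \sum_(i <- r | P i) Posz (F i).
Proof. by apply: (big_morph Posz PoszD). Qed.

Section NormalForm.
Variables (V : finType) (r : nat) (bv : 'I_r.+1 -> V -> nat).
Hypothesis bv_disj : forall i i' v, bv i v != 0%N -> bv i' v != 0%N -> i = i'.
Hypothesis bv_neq0 : forall i, exists v, bv i v != 0%N.

Definition mon (R : comNzRingType) (t : V -> R) (al : V -> nat) := \prod_v t v ^+ al v.

Lemma monD (R : comNzRingType) (t : V -> R) al be :
  mon t (fun v => al v + be v)%N = mon t al * mon t be.
Proof. by rewrite /mon -big_split; apply: eq_bigr => v _; rewrite exprD. Qed.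

Lemma eq_mon (R : comNzRingType) (t : V -> R) al be : al =1 be -> mon t al = mon t be.
Proof. by move=> e; apply: eq_bigr => v _; rewrite e. Qed.

Lemma mon0 (R : comNzRingType) (t : V -> R) : mon t (fun=> 0%N) = 1.
Proof. by apply: big1. Qed.

Lemma mon_combination (R : comNzRingType) (t : V -> R) (c : 'I_r.+1 -> nat) :
  mon t (fun v => \sum_l c l * bv l v)%N = \prod_l mon t (bv l) ^+ c l.
Proof.
rewrite /mon; under eq_bigr do rewrite expr_sum.
rewrite exchange_big /=; apply: eq_bigr => l _; rewrite -prodrXl.
by apply: eq_bigr => v _; rewrite mulnC exprM.
Qed.

(** Full fibres [bv l] are subtracted as long as one of them fits; the total exponent decreases. *)
Lemma reduced_exists (al : V -> nat) : exists (ga : V -> nat) (c : 'I_r.+1 -> nat),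
  (forall v, al v = ga v + \sum_l c l * bv l v)%N /\ forall l, exists v, (ga v < bv l v)%N.
Proof.
elim: {al}(\sum_v al v)%N {-2}al (leqnn (\sum_v al v)%N) => [|n IH] al hal.
  exists al, (fun=> 0%N); split=> [v|l]; first by rewrite big1 ?addn0 // => l _; rewrite mul0n.
  have [v hv] := bv_neq0 l; exists v; rewrite (leq_ltn_trans _ (_ : 0 < _)%N) ?lt0n //.
  by apply: leq_trans hal; rewrite (bigD1 v) //= leq_addr.
have [[l hl]|H] := EM (exists l, forall v, (bv l v <= al v)%N); last first.
  exists al, (fun=> 0%N); split=> [v|l]; first by rewrite big1 ?addn0 // => l _; rewrite mul0n.
  apply: contrapT => h; apply: H; exists l => v; rewrite leqNgt; apply/negP => h'.
  by apply: h; exists v.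
have [|ga [c [h1 h2]]] := IH (fun v => al v - bv l v)%N.
  have [v0 hv0] := bv_neq0 l.
  rewrite -ltnS; apply: leq_trans hal; rewrite (bigD1 v0) //= [X in (_ < X)%N](bigD1 v0) //=.
  rewrite -addSn leq_add //; first by have := hl v0; lia.
  by apply: leq_sum => v _; apply: leq_subr.
exists ga, (fun l' => (l' == l) + c l')%N; split=> // v.
rewrite (eq_bigr (fun l' => (l' == l) * bv l' v + c l' * bv l' v)%N); last first.
  by move=> l' _; rewrite mulnDl.
rewrite big_split /= (bigD1 l) //= eqxx mul1n big1 ?addn0 => [|l' /negbTE->//].
by rewrite addnCA -h1 subnKC.
Qed.

(* Exponents congruent to [al0] modulo the lattice spanned by the differences
   of the [bv l] share the reduced part [ga] and the number [j] of full fibres,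
   so a combination of such monomials is one monomial times a binary form. *)
Lemma normal_form (k : fieldType) (ell : 'I_r.+1 -> {poly k}) (al0 : V -> nat) :
  (forall l, (size (ell l) <= 2)%N) ->
  exists (ga : V -> nat) (j : nat) (d : 'I_r.+1 -> nat),
  [/\ forall v, (al0 v = ga v + \sum_l d l * bv l v)%N, (j = \sum_l d l)%N &
  forall (I : finType) (Q : pred I) (c : I -> k) (al : I -> V -> nat),
  (forall i, Q i -> exists e : 'I_r.+1 -> int, \sum_l e l = 0 /\
     forall v, (al i v)%:Z = (al0 v)%:Z + \sum_l e l * (bv l v)%:Z) ->
  exists2 P : {poly k}, (size P <= j.+1)%N &
  forall (R : comNzRingType) (kap : {rmorphism k -> R}) (t : V -> R) (x y : R),
  (forall l, mon t (bv l) = hf kap (ell l) 1 x y) ->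
  \sum_(i | Q i) kap (c i) * mon t (al i) = mon t ga * hf kap P j x y].
Proof.
move=> hell; have [ga [d [h1 h2]]] := reduced_exists al0.
exists ga, (\sum_l d l)%N, d; split=> // I Q c al hal.
have H i : exists e : 'I_r.+1 -> nat, Q i -> (\sum_l e l = \sum_l d l)%N /\
    forall v, (al i v = ga v + \sum_l e l * bv l v)%N.
  case Qi : (Q i); last by exists (fun=> 0%N).
  have [e [e0 he]] := hal i Qi.
  have epos l : 0 <= (d l)%:Z + e l.
    have [v hv] := h2 l; have := he v; rewrite h1.
    have bl : bv l v != 0%N by rewrite -lt0n; apply: leq_ltn_trans hv.
    have z l' : l' != l -> bv l' v = 0%N.
      move=> ll; apply/eqP; apply: contraT => bl'; move: ll.
      by rewrite (bv_disj bl' bl) eqxx.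
    rewrite (bigD1 l) //= big1 => [|l' ll]; last by rewrite z ?muln0.
    rewrite [in X in _ = _ + X](bigD1 l) //= [in X in _ = _ + X]big1 => [|l' ll]; last by rewrite z ?mulr0.
    nia.
  exists (fun l => absz ((d l)%:Z + e l)%R) => _; split.
    apply/eqP; rewrite -eqz_nat !sumPosz; apply/eqP.
    under eq_bigr do rewrite gez0_abs //.
    by rewrite big_split /= e0 addr0.
  move=> v; apply/eqP; rewrite -eqz_nat; apply/eqP; rewrite he h1 !PoszD -addrA; congr (_ + _).
  rewrite !sumPosz -big_split /=; apply: eq_bigr => l _.
  by rewrite !PoszM gez0_abs // mulrDl.
have [e he] := choice H.
exists (\sum_(i | Q i) c i *: \prod_l ell l ^+ e i l).
  apply: (leq_trans (size_sum _ _ _)); apply/bigmax_leqP => i Qi.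
  apply: (leq_trans (size_scale_leq _ _)); have [<- _] := he i Qi.
  by apply: (@hf_prod k k idfun _ (index_enum _) (fun l => ell l ^+ e i l) (e i) 0 0 _).1 => l;
    case: (hf_exp idfun (e i l) 0 0 (hell l)).
move=> R kap t x y ht; rewrite hf_sum mulr_sumr; apply: eq_bigr => i Qi.
have [es hv] := he i Qi; rewrite hfZ mulrCA; congr (_ * _).
rewrite (eq_mon _ hv) monD mon_combination -es; congr (_ * _).
have sz l : (size (ell l ^+ e i l) <= (e i l).+1)%N by case: (hf_exp idfun (e i l) 0 0 (hell l)).
rewrite (@hf_prod k R kap _ (index_enum _) (fun l => ell l ^+ e i l) (e i) x y sz).2.
by apply: eq_bigr => l _; rewrite ht (hf_exp kap (e i l) x y (hell l)).2.
Qed.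

End NormalForm.

(** * Trinomial rings *)

Section TrinomialLift.
Open Scope quotient_scope.
Variables (k : fieldType) (D : trinomial_data k) (E : comNzRingType) (kap : {rmorphism k -> E}).
Local Notation N := (\sum_(i < (tri_r D).+1) tri_n D i)%N.
Variable (v : 'I_N -> E).
Hypothesis rel0 : forall i, mmap kap v (tri_rel D i) = 0.
Local Notation pi := (\pi_{ideal_quot (tri_ideal D)}).

Definition tri_lift (x : trinomial_ring D) : E := mmap kap v (repr x).

Lemma tri_lift_pi p : tri_lift (pi p) = mmap kap v p.
Proof.
rewrite /tri_lift; apply/eqP; rewrite -subr_eq0 -rmorphB /=; apply/eqP.
have : (repr (pi p) - p) \in tri_ideal D.
  by rewrite Quotient.idealrBE; apply/eqP; rewrite reprK.
case/asboolP => q ->; rewrite rmorph_sum big1 // => i _.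
by rewrite rmorphM /= rel0 mulr0.
Qed.

Lemma tri_lift_zmod_morphism : zmod_morphism tri_lift.
Proof.
move=> x y; rewrite -[x]reprK -[y]reprK -rmorphB !tri_lift_pi; exact: rmorphB.
Qed.

Lemma tri_lift_monoid_morphism : monoid_morphism tri_lift.
Proof.
split=> [|x y]; first by rewrite -(rmorph1 pi) tri_lift_pi rmorph1.
by rewrite -[x]reprK -[y]reprK -rmorphM !tri_lift_pi rmorphM.
Qed.

HB.instance Definition _ := GRing.isZmodMorphism.Build (trinomial_ring D) E tri_lift tri_lift_zmod_morphism.
HB.instance Definition _ := GRing.isMonoidMorphism.Build (trinomial_ring D) E tri_lift tri_lift_monoid_morphism.

Definition tri_lift_rmorphism : {rmorphism trinomial_ring D -> E} := tri_lift.

End TrinomialLift.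

Lemma kspan_mpoly_image (k : fieldType) (R : comNzRingType) (kap : {rmorphism k -> R})
    n (phi : {rmorphism {mpoly k[n]} -> R}) (S : R -> Prop) :
  (forall c, phi c%:MP = kap c) -> kspan kap S 1 ->
  (forall u v, kspan kap S u -> kspan kap S v -> kspan kap S (u * v)) ->
  (forall a, kspan kap S (phi 'X_a)) -> forall p, kspan kap S (phi p).
Proof.
move=> hc S1 SM SX p; rewrite [p]mpolyE rmorph_sum; apply: kspan_sum => i _.
rewrite -mul_mpolyC rmorphM hc; apply: kspan_scale.
rewrite mpolyXE_id rmorph_prod; apply: big_ind => // a _.
by rewrite rmorphXn; elim: (i a) => [|l IH]; rewrite ?expr0 // exprS; apply: SM.
Qed.

Section PolyOverQuotient.
Variables (k : fieldType) (N m : nat) (T : comNzRingType) (pi : {rmorphism {mpoly k[N]} -> T}).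
Local Notation A := {mpoly T[m]}.

Definition qincl : {rmorphism {mpoly k[N]} -> A} := @mpolyC m T \o pi.
Definition qkap : {rmorphism k -> A} := qincl \o @mpolyC N k.

(** All variables on an equal footing: [inl] for those of the quotient, [inr] for the adjoined
    polynomial variables. *)
Definition qgen (v : 'I_N + 'I_m) : A :=
  match v with inl a => qincl 'X_a | inr l => 'X_l end.

Lemma qlift_exists (E : comNzRingType) (kap : {rmorphism k -> E}) (t : 'I_N + 'I_m -> E)
    (g : {rmorphism T -> E}) : (forall p, g (pi p) = mmap kap (fun a => t (inl a)) p) ->
  exists phi : {rmorphism A -> E}, (forall c, phi (qkap c) = kap c) /\
    forall v, phi (qgen v) = t v.
Proof.
move=> hg; exists (mmap g (fun l => t (inr l))).
have inclE p : mmap g (fun l => t (inr l)) (qincl p) = mmap kap (fun a => t (inl a)) p.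
  by rewrite /= mmapC /=; apply: hg.
split=> [c|[a|l]].
- exact: etrans (inclE c%:MP) (mmapC _ _ _).
- exact: etrans (inclE 'X_a) (etrans (mmapX _ _ _) (mmap1U _ _)).
- exact: etrans (mmapX _ _ _) (mmap1U _ _).
Qed.

Hypothesis pi_surj : forall x, exists p, x = pi p.

Lemma q_span x : kspan qkap (fun v => exists al, v = mon qgen al) x.
Proof.
set S := fun v => exists al, v = mon qgen al.
have mul (u w : A) : kspan qkap S u -> kspan qkap S w -> kspan qkap S (u * w).
  move=> hu hw; apply: kspan_mulr hw => _ [al ->]; rewrite mulrC.
  apply: kspan_mulr hu => _ [be ->]; apply: kspan_gen.
  by exists (fun v => al v + be v)%N; rewrite monD.
have one : kspan qkap S 1.
  by apply: kspan_gen; exists (fun=> 0%N); rewrite mon0.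
have gen v : kspan qkap S (qgen v).
  apply: kspan_gen; exists (fun w => (w == v) : nat).
  rewrite /mon (bigD1 v) //= eqxx expr1 big1 ?mulr1 // => w /negbTE->.
  by rewrite expr0.
have pow (u : A) n : kspan qkap S u -> kspan qkap S (u ^+ n).
  by move=> hu; elim: n => [|n IH]; rewrite ?expr0 // exprS; apply: mul.
have incl p : kspan qkap S (qincl p).
  exact: (@kspan_mpoly_image k A qkap N qincl S (fun=> erefl) one mul (fun a => gen (inl a)) p).
rewrite [x]mpolyE; apply: kspan_sum => i _; rewrite -mul_mpolyC; apply: (mul _ _).
  by have [p ->] := pi_surj x@_i; apply: incl.
by rewrite mpolyXE_id; apply: (big_ind (kspan qkap S)) => [|u w|l _]; [exact: one|exact: mul|apply: pow; apply: (gen (inr l))].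
Qed.

Lemma q_expansion x : exists (n : nat) (c : 'I_n -> k) (al : 'I_n -> 'I_N + 'I_m -> nat),
  x = \sum_i qkap (c i) * mon qgen (al i).
Proof.
have := q_span x; elim=> [|c w z hw hz IH].
  by exists 0%N, (fun=> 0), (fun _ _ => 0%N); rewrite big_ord0.
have [al ->] := hw; have [n [c' [al' ->]]] := IH.
exists n.+1, (fun i => oapp c' c (unlift ord0 i)), (fun i => oapp al' al (unlift ord0 i)).
rewrite big_ord_recl unlift_none; congr (_ + _); apply: eq_bigr => i _.
by rewrite liftK.
Qed.

End PolyOverQuotient.

Section TrinomialPoly.
Open Scope quotient_scope.
Variables (k : fieldType) (D : trinomial_data k) (m : nat).
Local Notation N := (\sum_(i < (tri_r D).+1) tri_n D i)%N.

Definition tri_pi : {rmorphism {mpoly k[N]} -> trinomial_ring D} :=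
  \pi_{ideal_quot (tri_ideal D)}.

Lemma tri_pi_surj x : exists p, x = tri_pi p.
Proof. by exists (repr x); rewrite /tri_pi /= reprK. Qed.

Lemma tri_pi_rel i : tri_pi (tri_rel D i) = 0.
Proof.
have /eqP : tri_pi (tri_rel D i) = tri_pi 0.
  apply/eqP; rewrite -Quotient.idealrBE subr0; apply/asboolP.
  exists (fun j => (j == i)%:R); rewrite (bigD1 i) //= eqxx mul1r [X in _ + X]big1 ?addr0 //.
  by move=> j /negbTE ->; rewrite mul0r.
by rewrite rmorph0 => /eqP.
Qed.

End TrinomialPoly.

(** * From the pencil to trinomial data *)

Section Valuation.
Variables (B : idomainType) (U : UFD B).

(** The exponent of [q] in [x]: the length bounds it, and it is additive because irreducibles are
    prime. *)
Lemma UFD_valuation : exists val : B -> B -> nat, forall q, irreducible q ->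
  [/\ forall x y, x != 0 -> y != 0 -> val q (x * y) = (val q x + val q y)%N,
      forall x, x != 0 -> (val q x = 0%N <-> ~ dvdr q x),
      val q q = 1%N,
      forall p, irreducible p -> dvdr q p -> val q p = 1%N
    & forall x, x != 0 -> exists2 y, x = q ^+ val q x * y & ~ dvdr q y].
Proof.
have [len [lM l0 lu l1]] := UFD_length U.
have H (q x : B) : exists n, irreducible q -> x != 0 -> exists2 y, x = q ^+ n * y & ~ dvdr q y.
  have [iq|nq] := EM (irreducible q); last by exists 0%N => /nq.
  have [xe|x0] := eqVneq x 0; first by exists 0%N.
  have [q0 qu _] := iq.
  suff [n [y e ny]] : exists n, exists2 y, x = q ^+ n * y & ~ dvdr q y by exists n => _ _; exists y.
  elim: {x}(len x) {-2}x (leqnn (len x)) x0 => [|n IH] x lx x0.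
    exists 0%N, x; rewrite ?mul1r // => /dvdr_unitP h; move/negP: qu; apply; apply: h.
    by apply: lu => //; move: lx; rewrite leqn0 => /eqP.
  have [[c e]|nd] := EM (dvdr q x); last by exists 0%N, x; rewrite ?mul1r.
  have c0 : c != 0 by apply: contra_neq x0 => h; rewrite e h mul0r.
  have [|m [y ey ny]] := IH c _ c0.
    by move: lx; rewrite e lM // (l1 q q0).2 // addn1 ltnS.
  by exists m.+1, y => //; rewrite e ey exprS; ring.
have H2 q : exists v : B -> nat, forall x, irreducible q -> x != 0 -> exists2 y, x = q ^+ v x * y & ~ dvdr q y.
  by have [v hv] := choice (H q); exists v.
have [val hval] := choice H2; exists val => q iq; have [q0 qu _] := iq.
have pq := UFD_irreducible_prime U iq.
have uniq_exp n m y z : q ^+ n * y = q ^+ m * z -> ~ dvdr q y -> ~ dvdr q z -> n = m.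
  have aux n' m' y' z' : (n' < m')%N -> q ^+ n' * y' = q ^+ m' * z' -> dvdr q y'.
    move=> nm; rewrite -(subnKC nm) addSn exprS exprD => e.
    exists (q ^+ (m' - n'.+1) * z'); apply: (mulfI (x := q ^+ n')); first by rewrite expf_neq0.
    by rewrite e; ring.
  case: (ltngtP n m) => // nm e ny nz; first by case: ny; apply: aux nm e.
  by case: nz; apply: (aux _ _ _ _ nm (esym e)).
have valE n x y : x != 0 -> x = q ^+ n * y -> ~ dvdr q y -> val q x = n.
  move=> x0 e ny; have [z ez nz] := hval q x iq x0.
  by apply: (uniq_exp _ _ z y) => //; rewrite -ez.
split.
- move=> x y x0 y0; have [z ez nz] := hval q x iq x0; have [w ew nw] := hval q y iq y0.
  apply: (valE _ _ (z * w)); first exact: mulf_neq0.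
    by rewrite {1}ez {1}ew exprD; ring.
  by case/(prime_dvdM pq).
- move=> x x0; have [z ez nz] := hval q x iq x0; split=> [e|nx].
    by rewrite ez e expr0 mul1r.
  case: (val q x) ez => // n e; case: nx; rewrite e exprS -mulrA; exact/dvdr_mulr/dvdrr.
- apply: (valE _ _ 1) => //; rewrite ?mulr1 // => /dvdr_unitP; rewrite unitr1 => /(_ isT) h.
  by rewrite h in qu.
- move=> p ip qp; have [u uu e] := irreducible_dvd_assoc qu ip qp.
  apply: (valE _ _ u); first by case: ip.
    by rewrite e mulrC.
  by move=> /dvdr_unitP/(_ uu) h; rewrite h in qu.
- by move=> x; apply: hval.
Qed.

End Valuation.

Section FiniteLists.

Lemma finite_of_bounded (T : eqType) (Q : T -> Prop) N :
  (forall r : seq T, uniq r -> {in r, forall x, Q x} -> (size r <= N)%N) ->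
  exists r : seq T, uniq r /\ forall x, Q x <-> x \in r.
Proof.
move=> H; pose P n := `[< exists r : seq T, [/\ uniq r, {in r, forall x, Q x} & size r = n] >].
have exP : exists n, P n by exists 0%N; apply/asboolP; exists [::].
have bP n : P n -> (n <= N)%N by move/asboolP => [r [u q <-]]; apply: H.
case: (ex_maxnP exP bP) => n /asboolP[r [u q sr]] hmax; exists r; split=> // x.
split=> [Qx|/q//]; apply: contraT => xr.
suff /hmax : P n.+1 by rewrite ltnn.
apply/asboolP; exists (x :: r); rewrite /= xr u sr; split=> // y.
by rewrite inE => /orP[/eqP->|/q].
Qed.

(** By the bound there is a list of maximal length, and it cannot be extended. *)
Lemma maximal_pairwise (T : eqType) (Q : T -> Prop) (R : T -> T -> Prop) N :
  (forall x y, R x y -> R y x) ->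
  (forall r : seq T, (forall i j, (i < j < size r)%N -> forall x0, ~ R (nth x0 r i) (nth x0 r j)) ->
      {in r, forall x, Q x} -> (size r <= N)%N) ->
  exists r : seq T, [/\ forall i j, (i < j < size r)%N -> forall x0, ~ R (nth x0 r i) (nth x0 r j),
    {in r, forall x, Q x} & forall x, Q x -> exists2 y, y \in r & R x y].
Proof.
move=> sym H.
pose P n := `[< exists r : seq T, [/\ forall i j, (i < j < size r)%N -> forall x0, ~ R (nth x0 r i) (nth x0 r j),
    {in r, forall x, Q x} & size r = n] >].
have exP : exists n, P n.
  by exists 0%N; apply/asboolP; exists [::]; split=> // i j; rewrite ltn0 andbF.
have bP n : P n -> (n <= N)%N by move/asboolP => [r [u q <-]]; apply: H.
case: (ex_maxnP exP bP) => n /asboolP[r [u q sr]] hmax; exists r; split=> // x Qx.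
apply: contrapT => nx; suff /hmax : P n.+1 by rewrite ltnn.
apply/asboolP; exists (x :: r); rewrite /= sr; split=> //.
- case=> [|i] [|j] //= h x0; last by apply: u; rewrite sr; move: h; rewrite !ltnS.
  by move=> hR; apply: nx; exists (nth x0 r j) => //; rewrite mem_nth // sr.
- by move=> y; rewrite inE => /orP[/eqP->|/q].
Qed.

(** A rational relation exists by rank; its denominators are cleared. *)
Lemma int_relation n s (d : 'I_n -> 'rV[int]_s) : (s < n)%N ->
  exists z : 'I_n -> int, (exists i, z i != 0) /\ forall j, \sum_i z i * d i 0 j = 0.
Proof.
move=> sn; pose M : 'M[rat]_(n, s) := \matrix_(i, j) (d i 0 j)%:~R.
have : kermx M != 0.
  by rewrite -mxrank_eq0 mxrank_ker subn_eq0 -ltnNge; apply: leq_ltn_trans (rank_leq_col M) sn.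
case/rowV0Pn => w /sub_kermxP wM w0.
have [i0 hi0] : exists i, w 0 i != 0.
  apply: contrapT => H; move/eqP: w0; apply; apply/rowP => i; rewrite mxE.
  by apply: contrapT => h; apply: H; exists i; apply/eqP.
pose Dn := \prod_i denq (w 0 i).
have Dn0 : (Dn%:~R : rat) != 0.
  by rewrite intr_eq0; apply/prodf_neq0 => i _; apply: denq_neq0.
have H i : exists z : int, z%:~R = Dn%:~R * w 0 i :> rat.
  exists (numq (w 0 i) * \prod_(j | j != i) denq (w 0 j)).
  rewrite /Dn (bigD1 i isT) !intrM mulrAC; congr (_ * _).
  by rewrite mulrC -{2}(divq_num_den (w 0 i)) divfK // intr_eq0 denq_neq0.
have [z hz] := choice H; exists z; split.
  by exists i0; rewrite -(intr_eq0 rat) hz mulf_neq0.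
move=> j; apply/eqP; rewrite -(intr_eq0 rat) rmorph_sum /=.
rewrite (eq_bigr (fun i => Dn%:~R * (w 0 i * M i j))) => [|i _]; last first.
  by rewrite intrM hz mxE mulrA.
by rewrite -mulr_sumr; have /rowP/(_ j) := wM; rewrite !mxE => ->; rewrite mulr0.
Qed.

End FiniteLists.

Section PencilStructure.
Variables (k : closedFieldType) (B : idomainType) (iota : {rmorphism k -> B}).
Variables (s : nat) (Bg : 'rV[int]_s -> B -> Prop) (gr : grading iota Bg).
Hypothesis B0 : deg0_const iota Bg.
Hypothesis U : UFD B.
Hypothesis tu : trivial_units iota.
Variables (g : 'rV[int]_s) (a b : B) (pen : pencil iota Bg g a b).
Variable (val : B -> B -> nat).
Hypothesis hval : forall q, irreducible q ->
  [/\ forall x y, x != 0 -> y != 0 -> val q (x * y) = (val q x + val q y)%N,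
      forall x, x != 0 -> (val q x = 0%N <-> ~ dvdr q x),
      val q q = 1%N,
      forall p, irreducible p -> dvdr q p -> val q p = 1%N
    & forall x, x != 0 -> exists2 y, x = q ^+ val q x * y & ~ dvdr q y].
Local Notation lf := (lf iota a b).

Lemma pen_hom_a : Bg g a. Proof. by case: pen. Qed.
Lemma pen_hom_b : Bg g b. Proof. by case: pen. Qed.
Lemma pen_indep : lin_indep iota a b. Proof. by case: pen. Qed.
Lemma pen_coprime : coprime_elt a b. Proof. by case: pen. Qed.
Let ha := pen_hom_a. Let hb := pen_hom_b. Let li := pen_indep. Let cop := pen_coprime.

Lemma val_mul q x y : irreducible q -> x != 0 -> y != 0 -> val q (x * y) = (val q x + val q y)%N.
Proof. by move=> /hval[h _ _ _ _]; apply: h. Qed.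
Lemma val_eq0 q x : irreducible q -> x != 0 -> val q x = 0%N <-> ~ dvdr q x.
Proof. by move=> /hval[_ h _ _ _]; apply: h. Qed.
Lemma val_self q : irreducible q -> val q q = 1%N.
Proof. by move=> /hval[_ _ h _ _]. Qed.
Lemma val_unit q u : irreducible q -> u \is a GRing.unit -> val q u = 0%N.
Proof.
move=> iq uu; apply/val_eq0 => //; first by apply: contraTneq uu => ->; rewrite unitr0.
by move=> /dvdr_unitP/(_ uu) h; case: iq; rewrite h.
Qed.
Lemma val_const q c : irreducible q -> c != 0 -> val q (iota c) = 0%N.
Proof. by move=> iq c0; apply: val_unit => //; rewrite rmorph_unit ?unitfE. Qed.

Lemma val_prod q (I : eqType) (r : seq I) (E : I -> B) : irreducible q ->
  (forall i, E i != 0) -> val q (\prod_(i <- r) E i) = (\sum_(i <- r) val q (E i))%N.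
Proof.
move=> iq E0; elim: r => [|i r IH]; first by rewrite !big_nil val_unit ?unitr1.
by rewrite !big_cons val_mul // ?IH // prodf_seq_neq0; apply/allP => j _; apply: E0.
Qed.

Lemma valX q x n : irreducible q -> x != 0 -> val q (x ^+ n) = (n * val q x)%N.
Proof.
move=> iq x0; elim: n => [|n IH]; first by rewrite expr0 val_unit ?unitr1.
by rewrite exprS val_mul ?expf_neq0 // IH mulSn.
Qed.

Lemma lf0 o : lf o != 0. Proof. exact: (lf_neq0 li). Qed.

(** Both elements are the same [h] times forms of the same degree [j]. The coefficient [e o] is the
    difference of the multiplicities of the member [o] in the two forms, so the total is j - j =
    0. *)
Lemma same_degree_relation m x y : Bg m x -> Bg m y -> x != 0 -> y != 0 ->
  exists e : option k -> int, exists os : seq (option k),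
  [/\ uniq os, forall o, o \notin os -> e o = 0, \sum_(o <- os) e o = 0 &
    forall q, irreducible q ->
      (val q x)%:Z = (val q y)%:Z + \sum_(o <- os) e o * (val q (lf o))%:Z].
Proof.
move=> hx hy x0 y0; have [_ _ _ _ /(_ m x hx x0)[h [j [h0 _ H]]]] := pen.
have [P hP eP] := H x hx; have [Q hQ eQ] := H y hy.
have P0 : P != 0 by apply: contra_neq x0 => e; rewrite eP e hf0 mulr0.
have Q0 : Q != 0 by apply: contra_neq y0 => e; rewrite eQ e hf0 mulr0.
have [c [r [c0 sr er _ _]]] := hf_lf_split iota hP P0.
have [d [t [d0 st et _ _]]] := hf_lf_split iota hQ Q0.
have sumc (w : seq (option k)) (os : seq (option k)) (E : option k -> int) :
    uniq os -> {subset w <= os} -> \sum_(o <- w) E o = \sum_(o <- os) (count_mem o w)%:Z * E o.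
  move=> uos; elim: w => [|o w IH] sub.
    by rewrite big_nil big1 // => o _; rewrite mul0r.
  rewrite big_cons IH => [|o' o'w]; last by apply: sub; rewrite inE o'w orbT.
  have oos : o \in os by apply: sub; rewrite mem_head.
  rewrite [RHS](bigD1_seq o) //= eqxx [in LHS](bigD1_seq o) //= addrA; congr (_ + _).
    by rewrite PoszD mulrDl mul1r.
  by apply: eq_bigr => o' /negbTE; rewrite eq_sym => ->.
pose os := undup (r ++ t).
have uos : uniq os by apply: undup_uniq.
have ros : {subset r <= os} by move=> o h'; rewrite mem_undup mem_cat h'.
have tos : {subset t <= os} by move=> o h'; rewrite mem_undup mem_cat h' orbT.
exists (fun o => (count_mem o r)%:Z - (count_mem o t)%:Z), os; split=> //.
- move=> o; rewrite mem_undup mem_cat negb_or => /andP[/count_memPn-> /count_memPn->].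
  by rewrite subrr.
- have h1 := sumc r os (fun=> 1) uos ros; have h2 := sumc t os (fun=> 1) uos tos.
  rewrite sumrB; under eq_bigr do rewrite -[Posz _]mulr1.
  under [X in _ - X]eq_bigr do rewrite -[Posz _]mulr1.
  by rewrite -h1 -h2 !big_const_seq !count_predT sr st subrr.
- move=> q iq; have L0 w : \prod_(o <- w) lf o != 0.
    by rewrite prodf_seq_neq0; apply/allP => o _; apply: lf0.
  have i0 e : e != 0 -> iota e != 0 by rewrite fmorph_eq0.
  have vx : val q x = (val q h + \sum_(o <- r) val q (lf o))%N.
    by rewrite eP er val_mul ?mulf_neq0 ?i0 // val_mul ?i0 // val_const // add0n (val_prod _ _ lf0).
  have vy : val q y = (val q h + \sum_(o <- t) val q (lf o))%N.
    by rewrite eQ et val_mul ?mulf_neq0 ?i0 // val_mul ?i0 // val_const // add0n (val_prod _ _ lf0).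
  rewrite vx vy !PoszD -addrA; congr (_ + _); rewrite !sumPosz.
  rewrite (sumc r os) // (sumc t os) // -big_split /=; apply: eq_bigr => o _.
  by rewrite mulrBl addrC subrK.
Qed.

Lemma lf_irr_unique q o o' : irreducible q -> dvdr q (lf o) -> dvdr q (lf o') -> o = o'.
Proof.
move=> iq h1 h2; apply/eqP/negPn/negP => oo.
exact: (lf_coprime cop oo iq h1 h2).
Qed.

Lemma val_lf_other q o o' : irreducible q -> dvdr q (lf o) -> o' != o -> val q (lf o') = 0%N.
Proof.
move=> iq h oo; apply/val_eq0 => //; first exact: lf0.
by move=> h'; move: oo; rewrite (lf_irr_unique iq h' h) eqxx.
Qed.

Lemma sum_val_lf q o (e : option k -> int) (os : seq (option k)) : irreducible q ->
  uniq os -> (forall o, o \notin os -> e o = 0) -> dvdr q (lf o) ->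
  \sum_(o' <- os) e o' * (val q (lf o'))%:Z = e o * (val q (lf o))%:Z.
Proof.
move=> iq uos e0 h; case oos : (o \in os).
  rewrite (bigD1_seq o) //= big1 ?addr0 // => o' oo.
  by rewrite (val_lf_other iq h oo) mulr0.
rewrite e0 ?oos // mul0r big1_seq // => o' /andP[_ o'os].
rewrite (val_lf_other iq h) ?mulr0 //.
by apply: contraFneq oos => <-.
Qed.

Lemma lf_factor o : exists2 q, irreducible q & dvdr q (lf o).
Proof.
by apply: (UFD_irreducible_dvd U (lf0 o)); apply: (lf_nonunit gr B0 tu ha hb li).
Qed.

(* Homogeneous primes containing no complete fibre of the pencil have
   independent degrees. *)
Lemma rank_bound n (p : 'I_n -> B) :
  (forall i, irreducible (p i)) -> (forall i, exists d, Bg d (p i)) ->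
  (forall i j, i != j -> ~ dvdr (p i) (p j)) ->
  (forall o, exists q, [/\ irreducible q, dvdr q (lf o) & forall i, ~ dvdr q (p i)]) ->
  (n <= s)%N.
Proof.
move=> ip hp np Hq; rewrite leqNgt; apply/negP => sn.
have [d hd] := choice hp; have [z [[i0 z0] ez]] := int_relation d sn.
(* The positive part: an integral relation among the degrees becomes an equality of the degrees of
   two monomials. *)
pose al (c : int) : nat := if c is Posz l then l else 0%N.
have alE c : c = (al c)%:Z - (al (- c))%:Z.
  by case: c => [[|c]|c] //=; rewrite ?subr0 ?NegzE ?opprK //= sub0r.
have p0 i : p i != 0 by case: (ip i).
pose M (w : 'I_n -> int) := \prod_i p i ^+ al (w i).
have M0 w : M w != 0 by apply/prodf_neq0 => i _; rewrite expf_neq0.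
have hM w : Bg (\sum_i d i *+ al (w i)) (M w).
  by apply: (hom_prod gr) => i _; apply: (homX gr).
have eM : \sum_i d i *+ al (z i) = \sum_i d i *+ al (- z i).
  apply/rowP => j; apply/eqP; rewrite -subr_eq0 !summxE -sumrB -[X in _ == X](ez j).
  have aux (x : int) (u v : nat) : x *+ u - x *+ v = (u%:Z - v%:Z) * x.
    by rewrite -[x *+ u]mulr_natr -[x *+ v]mulr_natr !natz; ring.
  by apply/eqP; apply: eq_bigr => i _; rewrite !mulmxnE aux -alE.
have hM2 : Bg (\sum_i d i *+ al (z i)) (M (fun i => - z i)) by rewrite eM; apply: hM.
have [e [os [uos e0 se H]]] := same_degree_relation (hM z) hM2 (M0 _) (M0 _).
have vM q w : irreducible q -> val q (M w) = (\sum_i al (w i) * val q (p i))%N.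
  move=> iq; rewrite val_prod // => [|i]; last by rewrite expf_neq0.
  by apply: eq_bigr => i _; rewrite valX.
(* Each member has a prime factor dividing no [p i]; both monomials have valuation 0 there, which
   kills the coefficient of that member. *)
have eo o : e o = 0.
  have [q [iq qo qp]] := Hq o.
  have vq w : val q (M w) = 0%N.
    by rewrite vM // big1 // => i _; rewrite (val_eq0 iq (p0 i)).2 ?muln0.
  have := H q iq; rewrite !vq add0r (sum_val_lf iq uos e0 qo) => /esym/eqP.
  rewrite mulf_eq0 => /orP[/eqP//|]; rewrite eqz_nat => /eqP.
  by rewrite (val_eq0 iq (lf0 o)).
have vi w : val (p i0) (M w) = al (w i0).
  rewrite vM // (bigD1 i0) //= val_self // muln1 big1 ?addn0 // => i ii.
  rewrite (val_eq0 (ip i0) (p0 i)).2 ?muln0 //; apply: np.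
  by rewrite eq_sym.
have := H (p i0) (ip i0); rewrite !vi big1 ?addr0 => [|o _]; last by rewrite eo mul0r.
by move=> h; move/eqP: z0; apply; rewrite [LHS]alE h subrr.
Qed.

(** The roots w and w' have equal degrees, as Z^s is torsion free, so their valuations differ by
    members of the pencil. At a prime factor of [lf o] this reads v = f(o) l v, where v is the
    nonzero valuation of w; hence l divides 1. *)
Lemma no_common_power o o' l w w' u u' : o != o' -> (1 < l)%N ->
  u \is a GRing.unit -> u' \is a GRing.unit ->
  lf o = u * w ^+ l -> lf o' = u' * w' ^+ l -> False.
Proof.
move=> oo l1 uu uu' e e'.
have hlf := lf_hom gr ha hb.
have root_deg o1 v c : c \is a GRing.unit -> lf o1 = c * v ^+ l -> exists2 d, Bg d v & d *+ l = g.
  move=> cu e1; have dv : dvdr v (lf o1).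
    by rewrite e1; apply: dvdr_mull; rewrite -(prednK (ltnW l1)) exprS; apply/dvdr_mulr/dvdrr.
  have [d hd _] := hom_dvdr gr (lf0 o1) (hlf o1) dv; exists d => //.
  have [c1 c10 ec] := unit_const tu cu.
  apply: (hom_uniq gr (x := lf o1)); last exact: lf0.
    by rewrite e1 ec; apply: (hom_scale gr); apply: (homX gr).
  exact: hlf.
have [d hd ed] := root_deg _ _ _ uu e; have [d' hd' ed'] := root_deg _ _ _ uu' e'.
have dd : d = d'.
  apply/rowP => j; have /rowP/(_ j) := etrans ed (esym ed'); rewrite !mulmxnE.
  rewrite -[X in X = _]mulr_natr -[X in _ = X]mulr_natr natz; apply: mulIf.
  by apply/eqP; lia.
have nz v c o1 : lf o1 = c * v ^+ l -> v != 0.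
  move=> e1; apply: contra_neq (lf0 o1) => h; rewrite e1 h expr0n.
  by case: (l) l1 => //= *; rewrite mulr0.
have w0 := nz _ _ _ e; have w'0 := nz _ _ _ e'.
rewrite -dd in hd'.
have [f [os [uos f0 sf H]]] := same_degree_relation hd hd' w0 w'0.
have [q iq qo] := lf_factor o.
have u0 : u != 0 by apply: contraTneq uu => ->; rewrite unitr0.
have u'0 : u' != 0 by apply: contraTneq uu' => ->; rewrite unitr0.
have v1 : val q (lf o) = (l * val q w)%N.
  by rewrite e val_mul ?expf_neq0 // val_unit // add0n valX.
have v2 : val q w' = 0%N.
  have : val q (lf o') = 0%N by apply: (val_lf_other iq qo); rewrite eq_sym.
  rewrite e' val_mul ?expf_neq0 // val_unit // add0n valX // => /eqP.
  by rewrite muln_eq0 => /orP[/eqP l0|/eqP//]; rewrite l0 in l1.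
have := H q iq; rewrite (sum_val_lf iq uos f0 qo) v2 v1 add0r.
have vw : (val q w != 0)%N.
  apply/eqP => h; move: (val_eq0 iq (lf0 o)).1; rewrite v1 h muln0.
  by move=> /(_ erefl).
move: vw; case: (val q w) => // n _ h.
have {}h : n.+1%:Z * (f o * l%:Z) = n.+1%:Z * 1 by rewrite mulr1 [RHS]h PoszM; ring.
have {}h := mulfI (isT : n.+1%:Z != 0) h.
have : (l%:Z %| f o * l%:Z)%Z by apply: dvdz_mull.
by rewrite h dvdz1 /= => /eqP e1; rewrite e1 in l1.
Qed.

Lemma pen_deg_neq0 : g != 0.
Proof.
apply/eqP => g0; have := lin_indep_nonunit gr B0 tu ha hb li.
move: hb; rewrite g0 => /B0[c e]; rewrite e rmorph_unit // unitfE.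
by apply: contra_neq (proj1 li) => c0; rewrite e c0 rmorph0.
Qed.

Lemma dvd_lf_hom q o : dvdr q (lf o) -> exists d, Bg d q.
Proof.
by move=> h; have [d hd _] := hom_dvdr gr (lf0 o) (lf_hom gr ha hb o) h; exists d.
Qed.

(** One prime is taken from each such member. The other prime shows that no fibre is complete, so
    [rank_bound] applies. *)
Lemma reducible_members_multi (r : seq (option k)) : uniq r ->
  {in r, forall o, exists p q, [/\ irreducible p, irreducible q, dvdr p (lf o), dvdr q (lf o) & ~ dvdr p q]} ->
  (size r <= s)%N.
Proof.
move=> ur H; have HP (i : 'I_(size r)) : exists pq : B * B, [/\ irreducible pq.1, irreducible pq.2,
    dvdr pq.1 (lf (nth None r i)), dvdr pq.2 (lf (nth None r i)) & ~ dvdr pq.1 pq.2].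
  by have [p [q ?]] := H _ (mem_nth None (ltn_ord i)); exists (p, q).
have [pq hpq] := choice HP.
apply: (@rank_bound (size r) (fun i => (pq i).1)).
- by move=> i; case: (hpq i).
- by move=> i; case: (hpq i) => _ _ /dvd_lf_hom.
- move=> i j ij d; case: (hpq i) => i1 _ d1 _ _; case: (hpq j) => _ _ d2 _ _.
  have /eqP := lf_irr_unique i1 d1 (dvdr_trans d d2).
  by rewrite nth_uniq // => /eqP e; move: ij; rewrite (val_inj e) eqxx.
- move=> o; have [or|or] := boolP (o \in r).
    pose i0 := Ordinal (etrans (index_mem o r) or : (index o r < size r)%N).
    case: (hpq i0) => p1 q1; rewrite /= nth_index // => p2 q2 npq.
    exists (pq i0).2; split=> // i d; case: (hpq i) => ip _ di _ _.
    have e : o = nth None r i := lf_irr_unique q1 q2 (dvdr_trans d di).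
    have ei : i = i0 by apply: val_inj; rewrite /= e index_uniq.
    by apply: npq; rewrite -ei; rewrite ei in d ip *; apply: irreducible_assoc d.
  have [q iq qo] := lf_factor o; exists q; split=> // i d; case: (hpq i) => ip _ di _ _.
  move: or; rewrite (lf_irr_unique iq qo (dvdr_trans d di)).
  by rewrite mem_nth.
Qed.

(** By [no_common_power] distinct members have distinct exponents l, and each l divides all
    coordinates of [g], one of which is nonzero. *)
Lemma power_members_bound : exists M, forall r : seq (option k), uniq r ->
  {in r, forall o, exists l p u, [/\ (1 < l)%N, u \is a GRing.unit & lf o = u * p ^+ l]} ->
  (size r <= M)%N.
Proof.
have [j gj] : exists j, g 0 j != 0.
  apply: contrapT => H; move/eqP: pen_deg_neq0; apply; apply/rowP => j; rewrite mxE.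
  by apply: contrapT => h; apply: H; exists j; apply/eqP.
exists (absz (g 0 j)) => r ur H.
have HL o : exists l, o \in r -> exists p u, [/\ (1 < l)%N, u \is a GRing.unit & lf o = u * p ^+ l].
  case or : (o \in r); last by exists 0%N.
  by have [l [p [u h]]] := H o or; exists l => _; exists p, u.
have [l hl] := choice HL.
have ul : uniq (map l r).
  rewrite map_inj_in_uniq // => o o' or or' e; apply/eqP/negPn/negP => oo.
  have [p [u [l1 uu e1]]] := hl o or; have [p' [u' [_ uu' e2]]] := hl o' or'.
  by rewrite e in e1 l1; apply: (no_common_power oo l1 uu uu' e1 e2).
rewrite -(size_map l) -(size_iota 1 (absz (g 0 j))); apply: uniq_leq_size => //.
move=> _ /mapP[o or ->]; have [p [u [l1 uu e]]] := hl o or.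
rewrite mem_iota (ltnW l1) /= add1n ltnS.
have dv : dvdr p (lf o).
  by rewrite e; apply: dvdr_mull; rewrite -(prednK (ltnW l1)) exprS; apply/dvdr_mulr/dvdrr.
have [d hd] := dvd_lf_hom dv; have [c c0 ec] := unit_const tu uu.
have eg : d *+ l o = g.
  apply: (hom_uniq gr (x := lf o)); last exact: lf0.
    by rewrite e ec; apply: (hom_scale gr); apply: (homX gr).
  exact: (lf_hom gr ha hb).
apply: dvdn_leq; first by rewrite absz_gt0.
have -> : g 0 j = d 0 j * (l o)%:Z by rewrite -eg mulmxnE -mulr_natr natz.
by rewrite abszM dvdn_mull.
Qed.

Lemma reducible_member_cases o : ~ irreducible (lf o) ->
  (exists p q, [/\ irreducible p, irreducible q, dvdr p (lf o), dvdr q (lf o) & ~ dvdr p q]) \/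
  exists l p u, [/\ (1 < l)%N, u \is a GRing.unit & lf o = u * p ^+ l].
Proof.
move=> nirr; apply: contrapT => /not_orP[n1 n2].
have [p ip po] := lf_factor o; have [_ _ _ _ /(_ _ (lf0 o))[y e ny]] := hval ip.
have y0 : y != 0 by apply: contra_neq (lf0 o) => h; rewrite e h mulr0.
have [yu|yu] := boolP (y \is a GRing.unit); last first.
  have [q iq qy] := UFD_irreducible_dvd U y0 yu; apply: n1; exists p, q; split=> //.
    by rewrite e; apply: dvdr_mull.
  by move=> pq; apply: ny; apply: dvdr_trans qy.
move: e; case: (val p (lf o)) => [|[|l]] e.
- have := lf_nonunit gr B0 tu ha hb li o.
  by rewrite e expr0 mul1r yu.
- by apply: nirr; rewrite e expr1 mulrC; apply: irreducible_unit_mul.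
- by apply: n2; exists l.+2, p, y; rewrite mulrC.
Qed.

Lemma reducible_members_finite : exists r : seq (option k), forall o, ~ irreducible (lf o) -> o \in r.
Proof.
have [M hM] := power_members_bound.
have [|r [_ hr]] := @finite_of_bounded (option k) (fun o => ~ irreducible (lf o)) (s + M); last first.
  by exists r => o /hr.
move=> r ur H.
pose A o := `[< exists p q, [/\ irreducible p, irreducible q, dvdr p (lf o), dvdr q (lf o) & ~ dvdr p q] >].
rewrite -(count_predC A r) -!size_filter leq_add //.
  apply: reducible_members_multi; first exact: filter_uniq.
  by move=> o; rewrite mem_filter => /andP[/asboolP].
apply: hM; first exact: filter_uniq.
move=> o; rewrite mem_filter => /andP[/= /asboolP nA or].
by case: (reducible_member_cases (H o or)).
Qed.

(** Horizontal for the rational map a / b to the projective line: the divisor of [q] lies in no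
    fibre. *)
Definition horizontal q := [/\ irreducible q, exists d, Bg d q & forall o, ~ dvdr q (lf o)].

(** A maximal list without divisibilities is taken. Prime factors of members divide none of its
    entries, so [rank_bound] limits its length. *)
Lemma horizontals_finite : exists m (q : 'I_m -> B), [/\ forall i, horizontal (q i),
  forall i j, i != j -> ~ dvdr (q i) (q j) & forall p, horizontal p -> exists i, dvdr p (q i)].
Proof.
have [||r [h1 h2 h3]] := @maximal_pairwise B horizontal (fun p q => dvdr p q \/ dvdr q p) s.
- by move=> x y [h|h]; [right|left].
- move=> r np hr.
  apply: (@rank_bound (size r) (fun i => nth 0 r i)).
  + by move=> i; case: (hr _ (mem_nth 0 (ltn_ord i))).
  + by move=> i; case: (hr _ (mem_nth 0 (ltn_ord i))).
  + move=> i j; rewrite neq_ltn => /orP[] ij d.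
      by apply: (np i j _ 0); [rewrite ij ltn_ord|left].
    by apply: (np j i _ 0); [rewrite ij ltn_ord|right].
  + move=> o; have [q iq qo] := lf_factor o; exists q; split=> // i d.
    have [ip _ nl] := hr _ (mem_nth 0 (ltn_ord i)); apply: (nl o).
    exact: dvdr_trans (irreducible_assoc iq ip d) qo.
exists (size r), (fun i => nth 0 r i); split.
- by move=> i; apply: h2; rewrite mem_nth.
- move=> i j; rewrite neq_ltn => /orP[] ij d.
    by apply: (h1 i j _ 0); [rewrite ij ltn_ord|left].
  by apply: (h1 j i _ 0); [rewrite ij ltn_ord|right].
- move=> p hp; have [y yr hy] := h3 p hp.
  have ir : (index y r < size r)%N by rewrite index_mem.
  exists (Ordinal ir); rewrite /= nth_index //; case: hy => // d.
  by apply: irreducible_assoc d; [case: (h2 _ yr)|case: hp].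
Qed.

Lemma power_list x : x != 0 -> exists u (l : seq (B * nat)), [/\ u \is a GRing.unit,
  forall i, (i < size l)%N -> irreducible (nth (0%R, 0%N) l i).1 /\ (0 < (nth (0%R, 0%N) l i).2)%N,
  forall i j, (i < size l)%N -> (j < size l)%N -> i != j ->
     ~ dvdr (nth (0%R, 0%N) l i).1 (nth (0%R, 0%N) l j).1
  & x = u * \prod_(i < size l) (nth (0%R, 0%N) l i).1 ^+ (nth (0%R, 0%N) l i).2].
Proof.
have [len [lM l0 lu l1]] := UFD_length U.
elim: {x}(len x) {-2}x (leqnn (len x)) => [|n IH] x lx x0.
  exists x, [::]; split=> //; last by rewrite big_ord0 mulr1.
  by apply: lu => //; move: lx; rewrite leqn0 => /eqP.
have [xu|xu] := boolP (x \is a GRing.unit).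
  by exists x, [::]; split=> //; rewrite big_ord0 mulr1.
have [p ip px] := UFD_irreducible_dvd U x0 xu; have [p0 pu _] := ip.
have [_ _ _ _ /(_ _ x0)[y e ny]] := hval ip.
have y0 : y != 0 by apply: contra_neq x0 => h; rewrite e h mulr0.
have v0 : (0 < val p x)%N.
  by rewrite lt0n; apply/eqP => /(val_eq0 ip x0); apply.
have [|u [l [uu h1 h2 ey]]] := IH y _ y0.
  rewrite -ltnS; apply: leq_trans lx; rewrite {1}e -(prednK v0) exprS -mulrA.
  by rewrite lM ?mulf_neq0 ?expf_neq0 // (l1 p p0).2 // add1n ltnS lM ?expf_neq0 // leq_addl.
have dy i : (i < size l)%N -> dvdr (nth (0%R, 0%N) l i).1 y.
  move=> hi; rewrite ey (bigD1 (Ordinal hi)) //=; apply/dvdr_mull/dvdr_mulr.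
  have [_ h] := h1 i hi; rewrite -(prednK h) exprS; exact/dvdr_mulr/dvdrr.
exists u, ((p, val p x) :: l); split=> //.
- by case=> [|i] //= hi; apply: h1.
- case=> [|i] [|j] //= hi hj ij; last by apply: h2.
    by move=> d; apply: ny; apply: dvdr_trans (dy _ hj).
  move=> d; apply: ny; apply: dvdr_trans (dy _ hi).
  by apply: irreducible_assoc d => //; case: (h1 _ hi).
- by rewrite /= big_ord_recl /= {1}e {1}ey; ring.
Qed.

Lemma closed_root (c : k) n : (0 < n)%N -> exists z, z ^+ n = c.
Proof.
move=> n0; have /closed_rootP[z] : size ('X^n - c%:P) != 1%N.
  by rewrite size_XnsubC // eqSS -lt0n.
by rewrite rootE !hornerE subr_eq0 => /eqP; exists z.
Qed.

Lemma power_factorization x : x != 0 -> x \isn't a GRing.unit ->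
  exists n (p : 'I_n -> B) (be : 'I_n -> nat), [/\ (0 < n)%N, forall i, irreducible (p i),
   forall i, (0 < be i)%N, forall i j, i != j -> ~ dvdr (p i) (p j) & x = \prod_i p i ^+ be i].
Proof.
move=> x0 xu; have [u [l [uu h1 h2 e]]] := power_list x0.
have [c c0 ec] := unit_const tu uu.
have l0 : (0 < size l)%N.
  rewrite lt0n; apply/eqP => h; move: xu; rewrite e.
  have -> : \prod_(i < size l) (nth (0%R, 0%N) l i).1 ^+ (nth (0%R, 0%N) l i).2 = 1.
    by apply: big1 => i _; have := leq_trans (ltn_ord i) (eq_leq h).
  by rewrite mulr1 uu.
pose i0 := Ordinal l0.
(* The unit is a constant; its root of order the first exponent is absorbed into the first prime. *)
have [z ez] := closed_root c (h1 0%N l0).2.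
have z0 : z != 0 by apply: contra_neq c0 => h; rewrite -ez h expr0n gtn_eqF // (h1 0%N l0).2.
have zu : iota z \is a GRing.unit by rewrite rmorph_unit ?unitfE.
pose w (i : 'I_(size l)) := if i == i0 then iota z else 1.
have wu i : w i \is a GRing.unit by rewrite /w; case: ifP => // _; apply: unitr1.
exists (size l), (fun i => w i * (nth (0%R, 0%N) l i).1), (fun i => (nth (0%R, 0%N) l i).2); split=> //.
- by move=> i; apply: irreducible_unit_mul => //; case: (h1 _ (ltn_ord i)).
- by move=> i; case: (h1 _ (ltn_ord i)).
- move=> i j ij d; apply: (h2 i j (ltn_ord i) (ltn_ord j) ij).
  have [d' ed] := d; exists (d' * w i / w j); apply: (mulrI (wu j)); rewrite ed.
  by have := divrr (wu j); move: (w j)^-1 => v e1; rewrite -[LHS]mul1r -e1; ring.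
- rewrite e ec -ez rmorphXn; under [RHS]eq_bigr do rewrite exprMn.
  rewrite big_split /=; congr (_ * _); rewrite (bigD1 i0) //= big1 => [|i ii].
    by rewrite mulr1 /w eqxx.
  by rewrite /w (negbTE ii) expr1n.
Qed.

End PencilStructure.

(** * The pencil attached to trinomial data *)

Section TrinomialConfig.
Variables (k : closedFieldType) (D : trinomial_data k) (m : nat).
Local Notation N := (\sum_(i < (tri_r D).+1) tri_n D i)%N.
Local Notation V := ('I_N + 'I_m)%type.

(** Exponent vector of the monomial T_i on the set of all variables. *)
Definition tri_bv (i : 'I_(tri_r D).+1) (v : V) : nat :=
  if v is inl a then
    if tag (tagnat.sig a) == i then tri_beta D _ (tagged (tagnat.sig a)) else 0%N
  else 0%N.
Arguments tri_bv : simpl never.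

Lemma tri_bv_Rank i i' (j : 'I_(tri_n D i)) :
  tri_bv i' (inl (tagnat.Rank i j)) = if i == i' then tri_beta D i j else 0%N.
Proof. by rewrite /tri_bv /tagnat.Rank tagnat.rankK. Qed.

Lemma tri_bv_disj i i' v : tri_bv i v != 0%N -> tri_bv i' v != 0%N -> i = i'.
Proof.
rewrite /tri_bv; case: v => //= a; case: (tag _ =P i) => // <- _; by case: (tag _ =P i').
Qed.

Lemma tri_bv_neq0 i : exists v, tri_bv i v != 0%N.
Proof.
exists (inl (tagnat.Rank i (Ordinal (tri_n_gt0 i)))).
by rewrite tri_bv_Rank eqxx -lt0n tri_beta_gt0.
Qed.

Lemma mon_Rank (R : comNzRingType) (t : V -> R) (al : V -> nat) :
  mon t al = (\prod_i \prod_(j < tri_n D i) t (inl (tagnat.Rank i j)) ^+ al (inl (tagnat.Rank i j)))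
     * \prod_l t (inr l) ^+ al (inr l).
Proof.
rewrite /mon big_sumType /=; congr (_ * _).
rewrite (reindex _ (@tagnat.rank_bij_on _ (tri_n D))) /= sig_big_dep /=.
by apply: eq_bigr => -[i j] _.
Qed.

Lemma mmap_tri_T (R : comNzRingType) (kap : {rmorphism k -> R}) (t : V -> R) i :
  mmap kap (fun a => t (inl a)) (tri_T D i) = mon t (tri_bv i).
Proof.
rewrite mon_Rank /tri_T rmorph_prod /= [X in _ = _ * X]big1 ?mulr1; last first.
  by move=> l _; rewrite /tri_bv expr0.
rewrite [RHS](bigD1 i) //= [X in _ = _ * X]big1 ?mulr1; last first.
  by move=> i' ii; apply: big1 => j _; rewrite tri_bv_Rank (negbTE ii) expr0.
apply: eq_bigr => j _; rewrite tri_bv_Rank eqxx rmorphXn /=; congr (_ ^+ _).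
exact: etrans (mmapX _ _ _) (mmap1U _ _).
Qed.

Lemma mmap_tri_rel (R : comNzRingType) (kap : {rmorphism k -> R}) (t : V -> R) i :
  mmap kap (fun a => t (inl a)) (tri_rel D i) =
  mon t (tri_bv ord0) + kap (tri_lam D i) * mon t (tri_bv (inord 1)) + mon t (tri_bv (inord i.+2)).
Proof. by rewrite /tri_rel !mmapD mmapZ !mmap_tri_T. Qed.

(** With a = T_0 and b = T_1, the relation says that the next T is -(a + lambda b), minus the member
    at the point -lambda. T_0 and T_1 are the members at 0 and at infinity. The default 0 of [oapp]
    is never reached, as [j] is in range. *)
Definition tri_point (i : 'I_(tri_r D).+1) : option k :=
  match val i with
  | 0 => Some 0
  | 1 => None
  | j.+2 => Some (- oapp (tri_lam D) 0 (insub j))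
  end.

Definition tri_sign (i : 'I_(tri_r D).+1) : k := if (val i < 2)%N then 1 else -1.

Definition tri_ell i : {poly k} := tri_sign i *: lfpoly (tri_point i).

Lemma size_tri_ell i : (size (tri_ell i) <= 2)%N.
Proof. exact: leq_trans (size_scale_leq _ _) (size_lfpoly _). Qed.

Lemma tri_point_inj : injective tri_point.
Proof.
have r0 := tri_r_gt0 D.
move=> [i hi] [i' hi'] e; apply: val_inj => /=; move: e; rewrite /tri_point /=.
have ins j (hj : (j.+2 < (tri_r D).+1)%N) : exists jj : 'I_(tri_r D).-1, insub j = Some jj /\ val jj = j.
  have hj' : (j < (tri_r D).-1)%N by lia.
  by rewrite insubT; exists (Ordinal hj').
case: i hi => [|[|i]] hi; case: i' hi' => [|[|i']] hi' //=.
- have [jj [-> _]] := ins _ hi'; case=> /eqP; rewrite eq_sym oppr_eq0 (negbTE (tri_lam_neq0 _)) //.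
- have [jj [-> _]] := ins _ hi; case=> /eqP; rewrite oppr_eq0 (negbTE (tri_lam_neq0 _)) //.
- have [jj [-> <-]] := ins _ hi; have [jj' [-> <-]] := ins _ hi'.
  by case=> /oppr_inj /(@tri_lam_inj _ D) ->.
Qed.

Lemma tri_forms (R : comNzRingType) (kap : {rmorphism k -> R}) (t : V -> R) :
  (forall i, mmap kap (fun a => t (inl a)) (tri_rel D i) = 0) ->
  forall i, mon t (tri_bv i) =
    hf kap (tri_ell i) 1 (mon t (tri_bv ord0)) (mon t (tri_bv (inord 1))).
Proof.
have r0 := tri_r_gt0 D.
move=> H i; rewrite /tri_ell hfZ; case: i => -[|[|i]] hi.
- rewrite /tri_sign /tri_point /= rmorph1 mul1r hf_XsubC rmorph0 mul0r subr0.
  by congr (mon t (tri_bv _)); apply: val_inj.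
- rewrite /tri_sign /tri_point /= rmorph1 mul1r hf1 expr1.
  by congr (mon t (tri_bv _)); apply: val_inj; rewrite /= inordK.
have hi' : (i < (tri_r D).-1)%N by lia.
rewrite /tri_sign /tri_point /= insubT /= hf_XsubC !rmorphN rmorph1.
have := H (Ordinal hi'); rewrite mmap_tri_rel => /eqP; rewrite addr_eq0 => /eqP e.
rewrite mulN1r mulNr opprK e opprK.
by congr (mon t (tri_bv _)); apply: val_inj; rewrite /= inordK.
Qed.

End TrinomialConfig.
Arguments tri_bv : simpl never.

(** * Trinomial data from a pencil, and the isomorphism *)

Lemma sum_transfer (I : finType) (T : eqType) (M : nmodType) (f : I -> T) (os : seq T) (F : T -> M) :
  injective f -> uniq os -> (forall o, o \notin os -> F o = 0) ->
  (forall o, (forall l, o != f l) -> F o = 0) -> \sum_(o <- os) F o = \sum_l F (f l).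
Proof.
move=> fI uos F0 F1; rewrite -(big_map f xpredT F).
have H (r : seq T) : \sum_(o <- r) F o = \sum_(o <- [seq o <- r | F o != 0]) F o.
  rewrite big_filter [LHS](bigID (fun o => F o != 0)) /= [X in _ + X]big1 ?addr0 //.
  by move=> o /negPn/eqP.
rewrite H [RHS]H; apply: perm_big; apply: uniq_perm.
- exact: filter_uniq.
- by rewrite filter_uniq // map_inj_uniq ?index_enum_uniq.
move=> o; rewrite !mem_filter; have [e|oF] := eqVneq (F o) 0; first by [].
rewrite /=; transitivity true.
  by apply: contraT => /F0 e; rewrite e eqxx in oF.
symmetry; apply: contraT => h; case/eqP: oF; apply: F1 => l.
by apply: contraNneq h => ->; rewrite map_f ?mem_index_enum.
Qed.

Section PencilData.
Variables (k : closedFieldType) (B : idomainType) (iota : {rmorphism k -> B}).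
Variables (s : nat) (Bg : 'rV[int]_s -> B -> Prop) (gr : grading iota Bg).
Hypothesis B0 : deg0_const iota Bg.
Hypothesis U : UFD B.
Hypothesis tu : trivial_units iota.
Variables (g : 'rV[int]_s) (a b : B) (pen : pencil iota Bg g a b).
Local Notation lf := (lf iota a b).

Lemma pencil_data_exists : exists (D : trinomial_data k) (p : forall i, 'I_(tri_n D i) -> B),
  [/\ forall i j, irreducible (p i j), forall i j j', j != j' -> ~ dvdr (p i j) (p i j'),
      forall i, \prod_j p i j ^+ tri_beta D i j = iota (tri_sign i) * lf (tri_point i)
    & forall o, ~ irreducible (lf o) -> exists i : 'I_(tri_r D).+1, o = tri_point i].
Proof.
have [val hval] := UFD_valuation U.
have [red hred] := reducible_members_finite gr B0 U tu pen hval.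
(* The points 0 and infinity are listed whether or not their members are reducible, because they
   provide T_0 and T_1; [zs] holds the other points. *)
pose zs := [seq z <- undup (pmap id red) | z != 0].
pose pts := [:: Some 0, None & map Some zs].
have upts : uniq pts.
  rewrite /pts /= inE negb_or /= andbC -andbA; apply/and3P; split.
  - by apply/mapP => -[].
  - by rewrite map_inj_uniq ?filter_uniq ?undup_uniq // => x y [].
  - by apply/negP => /mapP[z + [e]]; rewrite -e mem_filter eqxx.
have mpts o : ~ irreducible (lf o) -> o \in pts.
  move=> /hred h; case: o h => [z|] h; rewrite !inE ?orbT //.
  have [->|z0] := eqVneq z 0; first by rewrite eqxx.
  rewrite map_f ?orbT // mem_filter z0 mem_undup mem_pmap.
  by apply/mapP; exists (Some z).
pose sg (i : 'I_(size zs).+2) : k := if (i < 2)%N then 1 else -1.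
have sg0 i : sg i != 0 by rewrite /sg; case: ifP; rewrite ?oppr_eq0 oner_eq0.
have sgu i : iota (sg i) \is a GRing.unit by rewrite rmorph_unit ?unitfE.
pose pt (i : 'I_(size zs).+2) := nth None pts i.
have spts : size pts = (size zs).+2 by rewrite /= size_map.
have pt_inj : injective pt.
  move=> i i' e; apply: val_inj; apply/eqP; rewrite -(nth_uniq None (s := pts)) ?spts ?ltn_ord //.
  exact/eqP.
(* The number of factors, the primes and the exponents are packed together so that one choice
   produces them for all [i]. *)
have H (i : 'I_(size zs).+2) : exists X : {n : nat & (('I_n -> B) * ('I_n -> nat))%type},
  [/\ (0 < tag X)%N, forall j, irreducible ((tagged X).1 j), forall j, (0 < (tagged X).2 j)%N,
   forall j j', j != j' -> ~ dvdr ((tagged X).1 j) ((tagged X).1 j')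
   & iota (sg i) * lf (pt i) = \prod_j (tagged X).1 j ^+ (tagged X).2 j].
  have := lf_nonunit gr B0 tu (pen_hom_a pen) (pen_hom_b pen) (pen_indep pen) (pt i).
  have n0 := lf0 pen (pt i); move=> nu.
  have [||n [p [be [h1 h2 h3 h4 h5]]]] := @power_factorization k B iota U tu val hval (iota (sg i) * lf (pt i)).
  - by rewrite mulf_neq0 // fmorph_eq0.
  - by rewrite unitrM sgu.
  by exists (Tagged (fun n => ('I_n -> B) * ('I_n -> nat))%type (p, be)).
have [X hX] := choice H.
have cop (i i' : 'I_(size zs).+2) : i != i' -> coprime (\big[gcdn/0%N]_(j < tag (X i)) (tagged (X i)).2 j)
                               (\big[gcdn/0%N]_(j < tag (X i')) (tagged (X i')).2 j).
  move=> ii; set d := (\big[gcdn/0%N]_(j < tag (X i)) _)%N; set d' := (\big[gcdn/0%N]_(j < tag (X i')) _)%N.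
  pose e := gcdn d d'.
  have dvd i0 : (e %| \big[gcdn/0%N]_(j < tag (X i0)) (tagged (X i0)).2 j)%N ->
      exists w, lf (pt i0) = iota (sg i0) * w ^+ e.
    move=> he; have [_ _ _ _ eq] := hX i0.
    exists (\prod_j (tagged (X i0)).1 j ^+ ((tagged (X i0)).2 j %/ e)%N).
    rewrite -prodrXl; under eq_bigr => j _.
      rewrite -exprM divnK; last by apply: dvdn_trans he _; rewrite (bigD1 j) //= dvdn_gcdl.
      over.
    rewrite -eq mulrA -rmorphM /sg; case: ifP => _; by rewrite ?mulr1 ?mulrNN ?mulr1 rmorph1 mul1r.
  have e0 : (0 < e)%N.
    rewrite gcdn_gt0; apply/orP; left.
    have [n0 _ b0 _ _] := hX i; rewrite /d (bigD1 (Ordinal n0)) //= gcdn_gt0.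
    by rewrite b0.
  rewrite /coprime -/e eqn_leq e0 andbT leqNgt; apply/negP => e1.
  have [w ew] := dvd i (dvdn_gcdl _ _); have [w' ew'] := dvd i' (dvdn_gcdr _ _).
  have pp : pt i != pt i' by apply: contra_neq ii; apply: pt_inj.
  exact: (no_common_power gr B0 U tu pen hval pp e1 (sgu i) (sgu i') ew ew').
pose D := @TrinomialData k (size zs).+1 (fun i => tag (X i)) (fun i => (tagged (X i)).2)
  (fun j : 'I_(size zs) => - zs`_j) isT
  (fun i => let: And5 h _ _ _ _ := hX i in h) (fun i => let: And5 _ _ h _ _ := hX i in h) cop.
have lam0 (j : 'I_(size zs)) : - zs`_j != 0.
  rewrite oppr_eq0; have : zs`_j \in zs by rewrite mem_nth.
  by rewrite mem_filter => /andP[].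
have lamI : injective (fun j : 'I_(size zs) => - zs`_j).
  move=> j j' /oppr_inj/eqP; rewrite nth_uniq ?filter_uniq ?undup_uniq // => /eqP e.
  exact: val_inj.
have ptE (i : 'I_(size zs).+2) : tri_point (D := D lam0 lamI) i = pt i.
  rewrite /tri_point /pt; case: i => -[|[|j]] hj //=.
  have hj' : (j < size zs)%N by [].
  by rewrite insubT /= opprK (nth_map 0).
exists (D lam0 lamI), (fun i => (tagged (X i)).1); split.
- by move=> i; have [_ h _ _ _] := hX i.
- by move=> i; have [_ _ _ h _] := hX i.
- by move=> i; have [_ _ _ _ h] := hX i; rewrite ptE -h.
- move=> o /mpts opts; have io : (index o pts < (size zs).+2)%N by rewrite -spts index_mem.
  by exists (Ordinal io); rewrite ptE /pt /= nth_index.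
Qed.

End PencilData.

Lemma mmap_qgen (k : fieldType) (N m : nat) (T : comNzRingType) (pi : {rmorphism {mpoly k[N]} -> T}) p :
  mmap (qkap m pi) (fun a => qgen pi (inl a : 'I_N + 'I_m)) p = qincl m pi p.
Proof.
rewrite [in RHS](mpolyE p) rmorph_sum /mmap; apply: eq_bigr => i _.
rewrite -mul_mpolyC rmorphM; congr (_ * _).
rewrite mpolyXE_id rmorph_prod /mmap1; apply: eq_bigr => a _.
by rewrite rmorphXn.
Qed.

Section PencilIso.
Variables (k : closedFieldType) (B : idomainType) (iota : {rmorphism k -> B}).
Variables (s : nat) (Bg : 'rV[int]_s -> B -> Prop) (gr : grading iota Bg).
Hypothesis U : UFD B.
Hypothesis tu : trivial_units iota.
Variables (g : 'rV[int]_s) (a b : B) (pen : pencil iota Bg g a b).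
Local Notation lf := (lf iota a b).
Variables (D : trinomial_data k) (p : forall i, 'I_(tri_n D i) -> B).
Hypothesis ip : forall i j, irreducible (p (i := i) j).
Hypothesis np : forall i j j', j != j' -> ~ dvdr (p (i := i) j) (p j').
Hypothesis pE : forall i, \prod_j p (i := i) j ^+ tri_beta D i j = iota (tri_sign i) * lf (tri_point i).
Hypothesis redE : forall o, ~ irreducible (lf o) -> exists i : 'I_(tri_r D).+1, o = tri_point i.
Variables (m : nat) (q : 'I_m -> B).
Hypothesis hq : forall i, horizontal iota Bg a b (q i).
Hypothesis nq : forall i j, i != j -> ~ dvdr (q i) (q j).
Hypothesis Hq : forall x, horizontal iota Bg a b x -> exists i, dvdr x (q i).
Variable (val : B -> B -> nat).
Hypothesis hval : forall q, irreducible q ->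
  [/\ forall x y, x != 0 -> y != 0 -> val q (x * y) = (val q x + val q y)%N,
      forall x, x != 0 -> (val q x = 0%N <-> ~ dvdr q x),
      val q q = 1%N,
      forall p, irreducible p -> dvdr q p -> val q p = 1%N
    & forall x, x != 0 -> exists2 y, x = q ^+ val q x * y & ~ dvdr q y].
Local Notation N := (\sum_(i < (tri_r D).+1) tri_n D i)%N.
Local Notation V := ('I_N + 'I_m)%type.

Definition pen_gen (v : V) : B :=
  match v with inl c => p (tagged (tagnat.sig c)) | inr l => q l end.
Arguments pen_gen : simpl never.
Local Notation t := pen_gen.

Lemma pen_gen_Rank i j : t (inl (tagnat.Rank i j)) = p (i := i) j.
Proof. by rewrite /pen_gen /tagnat.Rank tagnat.rankK. Qed.

Lemma pen_gen_lf c : dvdr (p (tagged (tagnat.sig c))) (lf (tri_point (tag (tagnat.sig c)))).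
Proof.
case: (tagnat.sig c) => i j /=; set o := tri_point i.
have : dvdr (p j) (iota (tri_sign i) * lf o).
  rewrite -pE (bigD1 j) //= -(prednK (tri_beta_gt0 j)) exprS.
  by do 2!apply: dvdr_mulr; apply: dvdrr.
case=> d e; exists (iota (tri_sign i) * d); rewrite -mulrA -e mulrA -rmorphM.
by rewrite /tri_sign; case: ifP => _; rewrite ?mulrNN ?mulr1 rmorph1 mul1r.
Qed.

Lemma pen_gen_irr v : irreducible (t v).
Proof. by case: v => [c|l] /=; [apply: ip|case: (hq l)]. Qed.

Lemma pen_gen_neq0 v : t v != 0. Proof. by case: (pen_gen_irr v). Qed.

Lemma pen_gen_hom v : exists d, Bg d (t v).
Proof.
case: v => [c|l] /=; last by case: (hq l).
exact: (dvd_lf_hom gr pen (pen_gen_lf c)).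
Qed.

Lemma pen_gen_ndvd v w : v != w -> ~ dvdr (t v) (t w).
Proof.
case: v w => [c|l] [c'|l'] vw.
- move=> d; have h1 := pen_gen_lf c; have h2 := pen_gen_lf c'.
  have e := tri_point_inj (lf_irr_unique pen (pen_gen_irr (inl c)) h1 (dvdr_trans d h2)).
  have cc : c != c' by apply: contra_neq vw => ->.
  have : tagnat.sig c != tagnat.sig c'.
    by apply: contra_neq cc => h; rewrite -[c]tagnat.sigK h tagnat.sigK.
  move: e d; rewrite /pen_gen; case: (tagnat.sig c) => i j; case: (tagnat.sig c') => i' j' /= e.
  by case: i' / e j' => j' d jj; apply: (np _ d); apply: contra_neq jj => ->.
- move=> d; have [_ _ h] := hq l'; apply: (h (tri_point (tag (tagnat.sig c)))).
  apply: dvdr_trans (pen_gen_lf c).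
  exact: (irreducible_assoc (pen_gen_irr (inl c)) (pen_gen_irr (inr l')) d).
- by move=> d; have [_ _ h] := hq l; apply: (h _ (dvdr_trans d (pen_gen_lf c'))).
- by apply: nq; apply: contra_neq vw => ->.
Qed.

Lemma val_mon v al : val (t v) (mon t al) = al v.
Proof.
have iv := pen_gen_irr v.
rewrite /mon (val_prod hval _ iv) => [|i]; last by rewrite expf_neq0 ?pen_gen_neq0.
rewrite (bigD1 v) //= (valX hval) ?pen_gen_neq0 //.
rewrite (val_self hval iv) muln1 big1 ?addn0 // => w wv.
rewrite (valX hval) ?pen_gen_neq0 //.
rewrite (_ : val _ _ = 0%N) ?muln0 //; apply/(val_eq0 hval) => //; first exact: pen_gen_neq0.
by apply: pen_gen_ndvd; rewrite eq_sym.
Qed.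

Lemma mon_pen i : mon t (tri_bv i) = iota (tri_sign i) * lf (tri_point i).
Proof.
rewrite mon_Rank [X in _ * X]big1 => [|l _]; last by rewrite /tri_bv expr0.
rewrite mulr1 (bigD1 i) //= [X in _ * X]big1 ?mulr1 => [|i' ii]; last first.
  by apply: big1 => j _; rewrite tri_bv_Rank (negbTE ii) expr0.
by rewrite -pE; apply: eq_bigr => j _; rewrite tri_bv_Rank eqxx pen_gen_Rank.
Qed.

Lemma mon_pen0 : mon t (tri_bv ord0) = a.
Proof. by rewrite mon_pen /tri_sign /tri_point /= rmorph1 rmorph0 mul1r mul0r subr0. Qed.

Lemma mon_pen1 : mon t (tri_bv (inord 1)) = b.
Proof.
have r0 := tri_r_gt0 D.
by rewrite mon_pen /tri_sign /tri_point /= inordK //= rmorph1 mul1r.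
Qed.

Lemma pen_rel i : mmap iota (fun c => t (inl c)) (tri_rel D i) = 0.
Proof.
rewrite mmap_tri_rel mon_pen0 mon_pen1 mon_pen.
have hi : (i.+2 < (tri_r D).+1)%N by have := ltn_ord i; have := tri_r_gt0 D; lia.
rewrite /tri_sign /tri_point /= inordK //= valK /= rmorphN rmorph1 rmorphN.
by rewrite /lf; move: (iota _) => w; ring.
Qed.

Lemma mon_hom al : exists d, Bg d (mon t al).
Proof.
have [d hd] := choice pen_gen_hom; exists (\sum_v d v *+ al v).
by apply: (hom_prod gr) => v _; apply: (homX gr).
Qed.

Lemma mon_neq0 al : mon t al != 0.
Proof. by apply/prodf_neq0 => v _; rewrite expf_neq0 ?pen_gen_neq0. Qed.

(** A member outside the listed points is irreducible and associated to no generator, so it has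
    valuation 0 on both monomials and its coefficient is 0; only the fibres T_l remain. *)
Lemma same_degree_mon d al be : Bg d (mon t al) -> Bg d (mon t be) ->
  exists e : 'I_(tri_r D).+1 -> int, \sum_l e l = 0 /\
     forall v, (al v)%:Z = (be v)%:Z + \sum_l e l * (tri_bv l v)%:Z.
Proof.
move=> h1 h2; have [e [os [uos e0 es H]]] := same_degree_relation pen hval h1 h2 (mon_neq0 _) (mon_neq0 _).
have valz x al' : irreducible x -> (forall v, ~ dvdr (t v) x) -> val x (mon t al') = 0%N.
  move=> ix nx; rewrite /mon (val_prod hval) // => [|v]; last by rewrite expf_neq0 ?pen_gen_neq0.
  rewrite big1 // => v _; rewrite (valX hval) ?pen_gen_neq0 //.
  rewrite (_ : val _ _ = 0%N) ?muln0 //; apply/(val_eq0 hval) => //; first exact: pen_gen_neq0.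
  by move=> d'; apply: (nx v); apply: irreducible_assoc d' => //; apply: pen_gen_irr.
have eo o : (forall l : 'I_(tri_r D).+1, o != tri_point l) -> e o = 0.
  move=> ho; have io : irreducible (lf o).
    by apply: contrapT => /redE[i ei]; have := ho i; rewrite ei eqxx.
  have nv v : ~ dvdr (t v) (lf o).
    case: v => [c|l] d'; last by have [_ _ h] := hq l; apply: (h _ d').
    have := lf_irr_unique pen (pen_gen_irr (inl c)) d' (pen_gen_lf c) => ei.
    by have := ho (tag (tagnat.sig c)); rewrite -ei eqxx.
  have := H _ io; rewrite !valz // (sum_val_lf pen hval io uos e0 (dvdrr _)).
  by rewrite (val_self hval io) mulr1 add0r => <-.
exists (fun l => e (tri_point l)); split.
  apply: etrans es; symmetry; apply: (sum_transfer (F := e) (@tri_point_inj _ D) uos e0 eo).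
move=> v; have := H _ (pen_gen_irr v); rewrite !val_mon => ->; congr (_ + _).
rewrite (sum_transfer (@tri_point_inj _ D) uos (F := fun o => e o * (val (t v) (lf o))%:Z)).
- apply: eq_bigr => l _; congr (_ * Posz _); rewrite -(val_mon v) mon_pen.
  have iv := pen_gen_irr v.
  rewrite (val_mul hval) ?(lf0 pen) // ?fmorph_eq0; last by rewrite /tri_sign; case: ifP; rewrite ?oppr_eq0 oner_eq0.
  rewrite (val_const iota hval) // /tri_sign; case: ifP; by rewrite ?oppr_eq0 oner_eq0.
- by move=> o /e0->; rewrite mul0r.
- by move=> o /eo->; rewrite mul0r.
Qed.

Section Phi.
Variables (T : comNzRingType) (pi : {rmorphism {mpoly k[N]} -> T}).
Hypothesis pi_surj : forall x, exists p, x = pi p.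
Hypothesis pi_rel : forall i, pi (tri_rel D i) = 0.
Variable phi : {rmorphism {mpoly T[m]} -> B}.
Hypothesis phic : forall c, phi (qkap m pi c) = iota c.
Hypothesis phiv : forall v, phi (qgen pi v) = t v.

(** An element of the kernel is sorted by the degrees of the images of its monomials. Already in the
    source, each class is one monomial times a form in T_0, T_1; its image vanishes only with the
    form, as a and b are independent. *)
Lemma pen_iso_inj : injective phi.
Proof.
move=> x y exy; apply/eqP; rewrite -subr_eq0; apply/eqP.
have : phi (x - y) = 0 by rewrite rmorphB exy subrr.
move: (x - y) => {exy}x {y}; have [n [c [al ->]]] := q_expansion pi_surj x => e0.
set Y := fun i => qkap m pi (c i) * mon (qgen pi) (al i).
have phim be : phi (mon (qgen pi) be) = mon t be.
  by rewrite /mon rmorph_prod; apply: eq_bigr => v _; rewrite rmorphXn phiv.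
have [d hd] := choice (fun i => mon_hom (al i)).
have cls i0 : \sum_(i | d i == d i0) Y i = 0.
  have [ga [j [dd [_ _ H]]]] := normal_form (@tri_bv_disj k D m) (@tri_bv_neq0 k D m) (al i0) (@size_tri_ell k D).
  have [|P sP hP] := H _ (fun i => d i == d i0) c al.
    by move=> i /eqP e; apply: (same_degree_mon (d := d i0)); [rewrite -e|]; apply: hd.
  rewrite /Y (hP _ (qkap m pi) (qgen pi) (mon (qgen pi) (tri_bv ord0)) (mon (qgen pi) (tri_bv (inord 1)))); last first.
    apply: tri_forms => i; rewrite mmap_qgen /= pi_rel; exact: rmorph0.
  have h2 := hP B iota t _ _ (tri_forms pen_rel).
  have : \sum_(i | d i == d i0) iota (c i) * mon t (al i) = 0.
    have : hcomp gr _ (d i0) = 0 := etrans (congr1 (fun x => hcomp gr x (d i0)) e0) (hcomp0 gr _).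
    rewrite rmorph_sum hcomp_sum => e1.
    rewrite -[RHS]e1 big_mkcond /=; apply: eq_bigr => i _.
    rewrite rmorphM phic phim (hcomp_homE gr (hom_scale gr (c i) (hd i))).
    by rewrite eq_sym.
  rewrite h2 mon_pen0 mon_pen1 => /eqP; rewrite mulf_eq0 (negbTE (mon_neq0 _)) /= => hz.
  have [-> |P0] := eqVneq P 0; first by rewrite hf0 mulr0.
  by have := hf_neq0 sP P0 (pen_indep pen); rewrite hz.
(* One index is picked in each degree class, so that the sum can be partitioned over
   representatives. *)
pose rep i := odflt i [pick i' | d i' == d i].
rewrite (partition_big rep xpredT) //= big1 // => i0 _.
have [[i1 e1]|nx] := EM (exists i, rep i = i0); last first.
  by apply: big_pred0 => i; apply/eqP => h; apply: nx; exists i.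
rewrite -[RHS](cls i1); apply: eq_bigl => i.
have hrep i' : d (rep i') = d i' by rewrite /rep; case: pickP => //= i'' /eqP.
apply/eqP/eqP => [h|h]; first by rewrite -hrep h -e1 hrep.
rewrite -e1 /rep h; case: pickP => //= /(_ i1); by rewrite eqxx.
Qed.

(** Homogeneous primes suffice. One that divides no member is associated to some [q l]; any other is
    associated to an irreducible member, a combination of a and b, or to a prime factor of some
    T_i. *)
Lemma pen_iso_surj x : exists y, phi y = x.
Proof.
pose im x := exists y, phi y = x.
have imM u w : im u -> im w -> im (u * w).
  by move=> [y <-] [z <-]; exists (y * z); rewrite rmorphM.
have imD u w : im u -> im w -> im (u + w).
  by move=> [y <-] [z <-]; exists (y + z); rewrite rmorphD.
have imC c : im (iota c) by exists (qkap m pi c).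
have imt v : im (t v) by exists (qgen pi v).
have imu u : u \is a GRing.unit -> im u by move=> /(unit_const tu)[c _ ->].
have imas u w : irreducible u -> irreducible w -> dvdr u w -> im w -> im u.
  move=> iu iw uw hw; have wu := irreducible_assoc iu iw uw.
  have [_ wn _] := iw; have [v uv ->] := irreducible_dvd_assoc wn iu wu.
  by apply: (imM _ _) => //; apply: imu.
have imX u n : im u -> im (u ^+ n).
  by move=> hu; elim: n => [|n IH]; [rewrite expr0 -(rmorph1 iota)|rewrite exprS; apply: (imM _ _)].
have imm al : im (mon t al).
  by apply: (big_ind im) => [|u w|v _]; [rewrite -(rmorph1 iota)|apply: (imM _ _)|apply: (imX _ _)].
have iml o : im (lf o).
  have ha : im a by rewrite -mon_pen0.
  have hb : im b by rewrite -mon_pen1.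
  case: o => [z|] //=; apply: (imD _ _) => //.
  by rewrite -mulN1r -(rmorph1 iota) -rmorphN; apply: (imM _ _) => //; apply: (imM _ _).
have imi u d : irreducible u -> Bg d u -> im u.
  move=> iu hu; have [hor|nhor] := EM (horizontal iota Bg a b u).
    by have [l ul] := Hq hor; apply: (imas u (q l) iu (pen_gen_irr (inr l)) ul (imt (inr l))).
  have [o uo] : exists o, dvdr u (lf o).
    by apply: contrapT => h; apply: nhor; split=> //; [exists d|move=> o h'; apply: h; exists o].
  have [io|/redE[i ei]] := EM (irreducible (lf o)); first exact: (imas u _ iu io uo).
  have : dvdr u (\prod_(j <- index_enum 'I_(tri_n D i)) p j ^+ tri_beta D i j).
    by rewrite pE -ei; apply: dvdr_mull.
  move=> /(dvdr_prime_prod (UFD_irreducible_prime U iu))[j /(dvdr_primeX (UFD_irreducible_prime U iu)) uj _].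
  by apply: (imas u _ iu _ uj) => //; rewrite -pen_gen_Rank.
have imh u d : Bg d u -> im u.
  move=> hu; have [->|u0] := eqVneq u 0; first by rewrite -(rmorph0 iota).
  have [c [r [uc ir e]]] := UFD_factor U u0; rewrite e; apply: (imM _ _); first exact: imu.
  rewrite big_seq; apply: (big_ind im) => [|v w|v vr]; [by rewrite -(rmorph1 iota)|exact: imM|].
  have [|d' hd' _] := hom_dvdr gr u0 hu (y := v).
    by rewrite e; apply: dvdr_mull; rewrite (big_rem _ vr) /=; apply/dvdr_mulr/dvdrr.
  exact: (imi v d' (ir v vr)).
rewrite (sum_hcomp gr x); apply: (big_ind im) => [|v w|h _]; [by rewrite -(rmorph0 iota)|exact: imD|].
exact: (imh _ h (hcomp_hom gr x h)).
Qed.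

End Phi.

End PencilIso.

(* [pi] presents [T] as the trinomial ring of [D]: keeping [T] abstract avoids
   unfolding the quotient. *)
Definition tri_presents (k : fieldType) (D : trinomial_data k) (T : comNzRingType)
    (pi : {rmorphism {mpoly k[\sum_(i < (tri_r D).+1) tri_n D i]} -> T}) :=
  [/\ forall x, exists p, x = pi p, forall i, pi (tri_rel D i) = 0 &
   forall (E : comNzRingType) (kap : {rmorphism k -> E}) v, (forall i, mmap kap v (tri_rel D i) = 0) ->
     exists g : {rmorphism T -> E}, forall p, g (pi p) = mmap kap v p].

Lemma tri_pi_presents (k : fieldType) (D : trinomial_data k) : tri_presents (tri_pi D).
Proof.
split=> [||E kap v rel0]; [exact: tri_pi_surj|exact: tri_pi_rel|].
by exists (tri_lift_rmorphism rel0) => p; apply: tri_lift_pi.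
Qed.

Definition tri_iso (k : fieldType) (B : idomainType) (iota : {rmorphism k -> B}) (N m : nat) (T : comNzRingType)
    (pi : {rmorphism {mpoly k[N]} -> T}) :=
  exists f : {rmorphism {mpoly T[m]} -> B}, bijective f /\ forall c, f (qkap m pi c) = iota c.

(* With the right-hand side as the witness, unification unfolds the quotient and
   does not terminate in practice. *)
Lemma iso_trinomialE (k : fieldType) (B : idomainType) (iota : {rmorphism k -> B}) (D : trinomial_data k) m :
  iso_trinomial iota D m = tri_iso iota m (tri_pi D).
Proof. exact (erefl (iso_trinomial iota D m)). Qed.

Lemma pencil_iso (k : closedFieldType) (B : idomainType) (iota : {rmorphism k -> B})
    s (Bg : 'rV[int]_s -> B -> Prop) g a b :
  grading iota Bg -> deg0_const iota Bg -> UFD B -> trivial_units iota -> pencil iota Bg g a b ->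
  exists (D : trinomial_data k) (m : nat), forall (T : comNzRingType) (pi : {rmorphism _ -> T}), @tri_presents _ D T pi -> tri_iso iota m pi.
Proof.
move=> gr B0 U tu pen; have [D [p [ip np pE redE]]] := pencil_data_exists gr B0 U tu pen.
have [val hval] := UFD_valuation U.
have [m [q [hq nq Hq]]] := horizontals_finite gr B0 U tu pen hval.
exists D, m => T pi [psurj prel plift].
have [g0 hg0] := plift B iota _ (pen_rel pE q).
have [phi [phic phiv]] := qlift_exists hg0; exists phi; split=> //.
have inj := pen_iso_inj gr pen ip np pE redE hq nq hval psurj prel phic phiv.
have surj := pen_iso_surj gr U tu ip pE redE hq Hq phic phiv.
have [psi hpsi] := choice surj; exists psi => x; last exact: hpsi.
by apply: inj; rewrite hpsi.
Qed.

(** * Graded factoriality *)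

Section FactorialStep.
Import Order.TTheory Num.Theory.
Variables (k : fieldType) (B : idomainType) (iota : {rmorphism k -> B}).
Implicit Types (x y z a b q : B).

(** Primality tested within a class [Q]. The classes in use consist of the elements homogeneous in
    the first few coordinates, which interpolate between homogeneous elements and all of [B]. *)
Definition primeQ (Q : B -> Prop) q := [/\ Q q, q != 0, q \isn't a GRing.unit
  & forall a b, Q a -> Q b -> dvdr q (a * b) -> dvdr q a \/ dvdr q b].

Definition factorialQ (Q : B -> Prop) := forall x, Q x -> x != 0 ->
  exists u r, [/\ u \is a GRing.unit, {in r, forall p, primeQ Q p} & x = u * \prod_(p <- r) p].

Variables (Bz : int -> B -> Prop) (gr : grading iota Bz) (Q : B -> Prop).
Local Notation top := (top gr).
Local Notation bot := (bot gr).
Local Notation lead x := (hcomp gr x (top x)).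
Hypothesis QM : forall x y, Q x -> Q y -> Q (x * y).
Hypothesis Qdiv : forall x y, x * y != 0 -> Q (x * y) -> Q x.
Hypothesis Qcomp : forall x c, Q x -> Q (hcomp gr x c).
Hypothesis Qcross : forall x y, Q x -> Q y -> Q (lead y * x - lead x * y).

Definition homQ x := Q x /\ exists c, Bz c x.

Lemma homQ_comp x c : Q x -> homQ (hcomp gr x c).
Proof. by move=> qx; split; [apply: Qcomp|exists c; apply: hcomp_hom]. Qed.

Lemma homQM x y : homQ x -> homQ y -> homQ (x * y).
Proof.
move=> [qx [c hx]] [qy [d hy]]; split; first exact: QM.
by exists (c + d); apply: (gradM gr).
Qed.

Lemma homQ_div x y : x * y != 0 -> homQ (x * y) -> homQ x.
Proof.
move=> xy0 [qxy [c hc]]; split; first exact: Qdiv qxy.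
by have [a [b [ha _]]] := hom_factor_int gr xy0 hc; exists a.
Qed.

Lemma Qdivr x y : x * y != 0 -> Q (x * y) -> Q y.
Proof. rewrite mulrC; exact: Qdiv. Qed.

(* Remove the components divisible by q: the leading components of what remains
   multiply to the leading component of the product. *)
Lemma homQ_prime q : primeQ homQ q -> primeQ Q q.
Proof.
move=> [[Qq [e he]] q0 qu pq]; split=> // a b Qa Qb qab.
have top_bad x : Q x -> ~ dvdr q x -> exists m, [/\ ~ dvdr q (hcomp gr x m) &
    forall i, (m < i)%R -> dvdr q (hcomp gr x i)].
  move=> Qx nx; pose bad i := `[< ~ dvdr q (hcomp gr x i) >].
  have [i0 hi0] : exists i0, i0 \in [seq i <- supp gr x | bad i].
    apply: contrapT => H; apply: nx; rewrite (sum_hcomp gr x) big_seq.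
    apply: (big_ind (dvdr q)) => [|u v|i ix]; [exact: dvdr0|exact: dvdrD|].
    by apply: contrapT => h; apply: H; exists i; rewrite mem_filter ix andbT; apply/asboolP.
  have [m + hm] := seq_max_exists hi0; rewrite mem_filter => /andP[/asboolP nm _].
  exists m; split=> // i mi; apply: contrapT => h.
  have : i \in [seq i <- supp gr x | bad i].
    rewrite mem_filter mem_supp; apply/andP; split; first exact/asboolP.
    by apply/eqP => e0; apply: h; rewrite e0; apply: dvdr0.
  by move=> /hm; rewrite leNgt mi.
have [|na] := EM (dvdr q a); first by left.
have [|nb] := EM (dvdr q b); first by right.
have [m [nm hm]] := top_bad a Qa na; have [n [nn hn]] := top_bad b Qb nb.
suff : dvdr q (hcomp gr a m * hcomp gr b n).
  by move=> /(pq _ _ (homQ_comp m Qa) (homQ_comp n Qb))[].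
have := hcomp_dvdr gr he qab (m + n); rewrite hcompM.
have rest i : i != m -> dvdr q (hcomp gr a i * hcomp gr b (m + n - i)).
  rewrite neq_lt => /orP[im|mi]; last by apply/dvdr_mulr/hm.
  by apply/dvdr_mull/hn; lia.
have enn : m + n - m = n by lia.
case ms : (m \in supp gr a); last first.
  move/negbT: ms; rewrite mem_supp negbK => /eqP e0; by case: nm; rewrite e0; apply: dvdr0.
rewrite (bigD1_seq m) ?supp_uniq //= enn => h.
rewrite -[X in dvdr q X](addrK (\sum_(i <- supp gr a | i != m) hcomp gr a i * hcomp gr b (m + n - i))).
apply: dvdrB => //; apply: (big_ind (dvdr q)) => [|u v|i im]; [exact: dvdr0|exact: dvdrD|exact: rest].
Qed.

Lemma primeQ_factor (P : B -> Prop) q (r : seq B) u : primeQ P q -> P u -> {in r, forall p, P p} ->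
  P 1 -> (forall x y, P x -> P y -> P (x * y)) ->
  dvdr q (u * \prod_(p <- r) p) -> dvdr q u \/ exists2 p, p \in r & dvdr q p.
Proof.
move=> [_ _ _ pq] Pu Pr P1 PM.
have Pp s : {in s, forall p, P p} -> P (\prod_(p <- s) p).
  by move=> h; rewrite big_seq; apply: (big_ind P).
elim: r u Pu Pr => [|p r IH] u Pu Pr; first by rewrite big_nil mulr1; left.
have Pp0 : P p by apply: Pr; rewrite mem_head.
have Pr' : {in r, forall p, P p} by move=> x xr; apply: Pr; rewrite inE xr orbT.
rewrite big_cons mulrA => /(IH _ (PM _ _ Pu Pp0) Pr')[/(pq _ _ Pu Pp0)[|h]|[p' p'r h]].
- by left.
- by right; exists p; rewrite ?mem_head.
- by right; exists p'; rewrite // inE p'r orbT.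
Qed.

Hypothesis FQ : factorialQ homQ.

Definition primitiveQ x := forall q, primeQ homQ q -> ~ dvdr q x.

Lemma primitive_homQ_unit x y : primitiveQ x -> homQ y -> dvdr y x -> y != 0 -> y \is a GRing.unit.
Proof.
move=> px hy yx y0; have [u [r [uu hr e]]] := FQ hy y0.
case: r hr e => [|p r] hr e; first by rewrite e big_nil mulr1.
case: (px p); first by apply: hr; rewrite mem_head.
apply: dvdr_trans yx; rewrite e big_cons; apply/dvdr_mull/dvdr_mulr/dvdrr.
Qed.

(** The primes of [s] are distributed over [c] and [z], neither of which need be homogeneous in the
    new coordinate; [homQ_prime] permits this. *)
Lemma clear_homQ s x c z : homQ s -> s != 0 -> Q x -> x != 0 -> s * x = c * z ->
  exists c1 z1 sg, [/\ x = c1 * z1, z = sg * z1, dvdr c1 c & homQ sg].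
Proof.
move=> hs s0 Qx x0; have [u [r [uu hr e]]] := FQ hs s0.
have hu : homQ u by apply: (homQ_div (y := \prod_(p <- r) p)); rewrite -e.
have hu1 : homQ 1.
  by apply: (homQ_div (y := u)); rewrite mul1r //; apply: contraTneq uu => ->; rewrite unitr0.
rewrite {s hs s0}e; elim: r hr c z => [|p r IH] hr c z.
  rewrite big_nil mulr1 => e; exists (c / u), z, 1; split=> //.
  - by rewrite mulrAC -e mulrAC mulrV // mul1r.
  - by rewrite mul1r.
  - by exists u; rewrite mulrC divrK.
have pp := hr p (mem_head _ _); have [hp p0 pu _] := pp.
have [_ _ _ qp] := homQ_prime pp.
rewrite big_cons => e.
have hr' : {in r, forall p, primeQ homQ p} by move=> y yr; apply: hr; rewrite inE yr orbT.
have cz0 : c * z != 0.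
  rewrite -e; apply: mulf_neq0 => //; apply: mulf_neq0; first by apply: contraTneq uu => ->; rewrite unitr0.
  rewrite mulf_neq0 // prodf_seq_neq0; apply/allP => y yr; by case: (hr' y yr).
have Qcz : Q (c * z).
  rewrite -e; apply: QM => //; apply: QM; first by case: hu.
  apply: QM; first by case: hp.
  by rewrite big_seq; apply: (big_ind Q) => [|v w|y yr]; [case: hu1|apply: QM|case: (hr' y yr) => -[]].
have Qc := Qdiv cz0 Qcz; have Qz := Qdivr cz0 Qcz.
have pcz : dvdr p (c * z) by rewrite -e; exists (u * (\prod_(j <- r) j) * x); ring.
case: (qp _ _ Qc Qz pcz) => -[w ew].
  have [|c1 [z1 [sg [e1 e2 e3 e4]]]] := IH hr' w z.
    by apply: (mulfI p0); rewrite [RHS]mulrA [p * w]mulrC -ew -e; ring.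
  by exists c1, z1, sg; split=> //; rewrite ew; apply: dvdr_mulr.
have [|c1 [z1 [sg [e1 e2 e3 e4]]]] := IH hr' c w.
  by apply: (mulfI p0); rewrite [RHS]mulrCA [p * w]mulrC -ew -e; ring.
exists c1, z1, (sg * p); split=> //; last exact: homQM.
by rewrite ew e2; ring.
Qed.

(** A form of Gauss's lemma: the part of [s] that goes into [x] is homogeneous and divides a
    primitive element, so it is a unit. *)
Lemma primitive_dvd_mul s x a : homQ s -> s != 0 -> Q x -> x != 0 -> primitiveQ x ->
  Q a -> a != 0 -> dvdr x (s * a) -> dvdr x a.
Proof.
move=> hs s0 Qx x0 px Qa a0 [c e].
have [c1 [z1 [sg [e1 e2 _ hsg]]]] := clear_homQ hs s0 Qa a0 e.
have sg0 : sg != 0 by apply: contra_neq x0 => h; rewrite e2 h mul0r.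
have sgu : sg \is a GRing.unit.
  by apply: (primitive_homQ_unit px hsg) => //; rewrite e2; apply/dvdr_mulr/dvdrr.
by exists (c1 / sg); rewrite e2 e1 mulrA divrK.
Qed.

(** Width of the support in the new coordinate; it plays the role of the degree in Euclid's
    algorithm. *)
Definition spread x : nat := absz (top x - bot x)%R.

Lemma spreadM x y : x != 0 -> y != 0 -> spread (x * y) = (spread x + spread y)%N.
Proof.
move=> x0 y0; rewrite /spread topM // botM //.
by have := bot_le_top gr x0; have := bot_le_top gr y0; lia.
Qed.

Lemma spread0 x : x != 0 -> Q x -> spread x = 0%N -> homQ x.
Proof.
move=> x0 Qx h; split=> //; apply/(hom_top_bot gr x0).
by move: h; rewrite /spread; have := bot_le_top gr x0; lia.
Qed.

(** The leading terms cancel: what remains lives in degrees from bot x + top y to strictly below top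
    x + top y. *)
Lemma spread_cross x y : x != 0 -> y != 0 -> (spread y <= spread x)%N ->
  lead y * x - lead x * y != 0 -> (spread (lead y * x - lead x * y) < spread x)%N.
Proof.
move=> x0 y0 yx w0; set w := _ - _ in w0 *.
have hw i : hcomp gr w i != 0 -> (bot x + top y <= i < top x + top y)%R.
  have hi : hcomp gr w i = lead y * hcomp gr x (i - top y) - lead x * hcomp gr y (i - top x).
    by rewrite /w hcompD hcompN !(hcomp_homM gr _ _ (hcomp_hom gr _ _)).
  rewrite hi => h; have bx := bot_le_top gr x0; have by_ := bot_le_top gr y0.
  have sxy : (top y - bot y <= top x - bot x)%R by move: yx; rewrite /spread; lia.
  have ub : (i <= top x + top y)%R.
    rewrite leNgt; apply/negP => hgt; move: h.
    have -> : hcomp gr x (i - top y) = 0.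
      by apply/eqP/negPn/negP => /top_max; lia.
    have -> : hcomp gr y (i - top x) = 0.
      by apply/eqP/negPn/negP => /top_max; lia.
    by rewrite !mulr0 subrr eqxx.
  have lb : (bot x + top y <= i)%R.
    rewrite leNgt; apply/negP => hgt; move: h.
    have -> : hcomp gr x (i - top y) = 0.
      by apply/eqP/negPn/negP => /bot_min; lia.
    have -> : hcomp gr y (i - top x) = 0.
      by apply/eqP/negPn/negP => /bot_min; lia.
    by rewrite !mulr0 subrr eqxx.
  rewrite lb lt_neqAle ub andbT; apply/eqP => e; move: h; rewrite e addrK.
  by rewrite [top x + top y]addrC addrK mulrC subrr eqxx.
have := hw _ (hcomp_top gr w0); have := hw _ (hcomp_bot gr w0).
by have := bot_le_top gr w0; have := bot_le_top gr x0; rewrite /spread; lia.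
Qed.

(* Euclid: an element of least spread in Q and the ideal (x, a) divides x and a
   up to homogeneous factors. *)
Lemma irreducible_primeQ x : Q x -> x != 0 -> x \isn't a GRing.unit -> primitiveQ x ->
  (forall y z, x = y * z -> spread y = 0%N \/ spread z = 0%N) -> primeQ Q x.
Proof.
move=> Qx x0 xu px irr; split=> // a b Qa Qb xab.
have [->|b0] := eqVneq b 0; first by right; apply: dvdr0.
have [->|a0] := eqVneq a 0; first by left; apply: dvdr0.
pose I z := Q z /\ exists al be, z = al * x + be * a.
pose P n := `[< exists z, [/\ I z, z != 0 & spread z = n] >].
have exP : exists n, P n.
  exists (spread x); apply/asboolP; exists x; split=> //; split=> //.
  by exists 1, 0; rewrite mul1r mul0r addr0.
case: (ex_minnP exP) => n /asboolP[z [[Qz [al [be ez]]] z0 sz]] hmin.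
have div y : I y -> y != 0 -> exists s c, [/\ homQ s, s != 0 & s * y = c * z].
  elim: {y}(spread y).+1 {-2}y (ltnSn (spread y)) => // N IH y hy Iy y0.
  have [Qy [al' [be' ey]]] := Iy.
  have zy : (spread z <= spread y)%N by rewrite sz; apply: hmin; apply/asboolP; exists y.
  have [w0|w0] := eqVneq (lead z * y - lead y * z) 0.
    exists (lead z), (lead y); split; [exact: homQ_comp|exact: hcomp_top|].
    by apply/eqP; rewrite -subr_eq0 w0.
  have lt := spread_cross y0 z0 zy w0.
  have [||s [c [hs s0 e]]] := IH (lead z * y - lead y * z) _ _ w0.
  - exact: leq_trans lt hy.
  - split; first exact: Qcross.
    by exists (lead z * al' - lead y * al), (lead z * be' - lead y * be); move: (lead z) (lead y) => u v; rewrite ey ez; ring.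
  exists (s * lead z), (c + s * lead y); split.
  - by apply: homQM => //; apply: homQ_comp.
  - by rewrite mulf_neq0 // hcomp_top.
  - by rewrite mulrDl -e; ring.
have Ix : I x by split=> //; exists 1, 0; rewrite mul1r mul0r addr0.
have Ia : I a by split=> //; exists 0, 1; rewrite mul1r mul0r add0r.
have [s [c [hs s0 e]]] := div x Ix x0; have [t [c' [ht t0 e']]] := div a Ia a0.
have [c1 [z1 [sg [ex ezz c1c hsg]]]] := clear_homQ hs s0 Qx x0 e.
have c1z1 : c1 * z1 != 0 by rewrite -ex.
have /andP[c10 z10] : (c1 != 0) && (z1 != 0) by move: c1z1; rewrite mulf_eq0 negb_or.
have Qc1z1 : Q (c1 * z1) by rewrite -ex.
case: (irr _ _ ex) => h.
  have hc1 := spread0 c10 (Qdiv c1z1 Qc1z1) h.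
  have cu : c1 \is a GRing.unit.
    by apply: (primitive_homQ_unit px hc1) => //; rewrite ex; apply/dvdr_mulr/dvdrr.
  left; apply: (primitive_dvd_mul ht t0 Qx x0 px Qa a0).
  by exists (c' * sg / c1); rewrite e' ezz ex [RHS]mulrA divrK // mulrA.
have hz1 := spread0 z10 (Qdivr c1z1 Qc1z1) h.
have hz : homQ z by rewrite ezz; apply: homQM.
right; apply: (primitive_dvd_mul hz z0 Qx x0 px Qb b0).
rewrite ez mulrDl; apply: dvdrD; first by rewrite mulrAC; apply/dvdr_mull/dvdrr.
by rewrite -mulrA; apply: dvdr_mull.
Qed.

(** A homogeneous prime factor of [x] also divides the leading component of [x], whose factorization
    bounds the number of steps. *)
Lemma strip_primes x : Q x -> x != 0 -> exists r x',
  [/\ {in r, forall p, primeQ homQ p}, x = (\prod_(p <- r) p) * x' & primitiveQ x'].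
Proof.
move=> Qx x0.
have l0 := hcomp_top gr x0.
have [u [r [uu hr e]]] := FQ (homQ_comp (top x) Qx) l0.
elim: {r}(size r).+1 {-2}r (ltnSn (size r)) u uu hr x Qx x0 l0 e => // n IH r sr u uu hr x Qx x0 l0 e.
have [[q [pq qx]]|H] := EM (exists q, primeQ homQ q /\ dvdr q x); last first.
  by exists [::], x; split=> //; [rewrite big_nil mul1r|move=> q pq qx; apply: H; exists q].
have [hq q0 qu pq'] := pq; have [_ [dq hdq]] := hq.
have ql : dvdr q (u * \prod_(p <- r) p) by rewrite -e; apply: (hcomp_dvdr gr hdq qx).
have lu : homQ (u * \prod_(p <- r) p) by rewrite -e; apply: homQ_comp.
have hu : homQ u by apply: homQ_div lu; rewrite -e.
have h1 : homQ 1 by apply: (homQ_div (y := u)); rewrite mul1r //; apply: contraTneq uu => ->; rewrite unitr0.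
have nqu : ~ dvdr q u by move=> /dvdr_unitP/(_ uu) h; rewrite h in qu.
have [|[p pr qp]] := primeQ_factor pq hu (fun p pr => let: And4 h _ _ _ := hr p pr in h) h1 homQM ql; first by [].
have [y ey] := qx; have y0 : y != 0 by apply: contra_neq x0 => h; rewrite ey h mul0r.
have Qy : Q y by apply: (Qdiv (y := q)); rewrite -ey.
have [v ev] := qp; have [[_ [dp hdp]] p0 pu pp] := hr p pr.
have hv : homQ v by apply: (homQ_div (y := q)); rewrite -ev //; case: (hr p pr).
have vu : v \is a GRing.unit.
  case: (pp v q hv hq); first by rewrite -ev; apply: dvdrr.
    move=> [w ew]; move/negP: qu; case; apply/unitrPr; exists w.
    by apply: (mulfI p0); rewrite mulr1 {2}ev ew; ring.
  move=> [w ew]; apply/unitrPr; exists w; apply: (mulIf q0).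
  by rewrite mul1r {2}ew {1}ev; ring.
have tq : hcomp gr q (top q) = q.
  have := hcomp_top gr q0; rewrite (hcomp_homE gr hdq); by case: (top q =P dq) => // _; rewrite eqxx.
have ely : lead y = (u * v) * \prod_(p <- rem p r) p.
  apply: (mulIf q0); rewrite -{1}tq -hcompM_top -topM // -ey e (big_rem _ pr) /= {1}ev; ring.
have [||||r' [x' [h1' h2' h3']]] := IH (rem p r) _ (u * v) _ _ y Qy y0 _ ely.
- by move: sr; rewrite size_rem //; case: (r) pr => /= [|a0 r1] // _; rewrite ltnS.
- by rewrite unitrM uu.
- by move=> p' /mem_rem; apply: hr.
- exact: hcomp_top.
exists (q :: r'), x'; split=> //.
  by move=> p'; rewrite inE => /orP[/eqP->|/h1'].
by rewrite big_cons ey h2'; ring.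
Qed.

(** Homogeneous primes are stripped off first. The primitive rest is split while both factors have
    positive spread; when this is impossible, it is prime by [irreducible_primeQ]. *)
Theorem factorial_step : factorialQ Q.
Proof.
move=> x; elim: {x}(spread x).+1 {-2}x (ltnSn (spread x)) => // n IH x sx Qx x0.
have [r [x' [hr e px]]] := strip_primes Qx x0.
have xx0 : (\prod_(p <- r) p) * x' != 0 by rewrite -e.
have /andP[r0 x'0] : (\prod_(p <- r) p != 0) && (x' != 0) by move: xx0; rewrite mulf_eq0 negb_or.
have Qx' : Q x' by apply: (Qdivr xx0); rewrite -e.
have hr' : {in r, forall p, primeQ Q p} by move=> p /hr; apply: homQ_prime.
suff [u [r' [uu hr'' ex']]] : exists u r', [/\ u \is a GRing.unit, {in r', forall p, primeQ Q p} & x' = u * \prod_(p <- r') p].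
  by exists u, (r ++ r'); split=> //; [move=> p; rewrite mem_cat => /orP[/hr'|/hr'']|rewrite big_cat /= e ex'; ring].
have [xu|xu] := boolP (x' \is a GRing.unit); first by exists x', [::]; rewrite big_nil mulr1.
have sx' : (spread x' <= spread x)%N by rewrite e spreadM // leq_addl.
have [[y [z [ey y1 z1]]]|H] := EM (exists y z, [/\ x' = y * z, spread y != 0%N & spread z != 0%N]); last first.
  exists 1, [:: x']; rewrite unitr1 big_seq1 mul1r; split=> // p; rewrite inE => /eqP->.
  apply: irreducible_primeQ => // y z ey; apply: contrapT => /not_orP[h1 h2].
  by apply: H; exists y, z; split=> //; apply/eqP.
have yz0 : y * z != 0 by rewrite -ey.
have /andP[y0 z0] : (y != 0) && (z != 0) by move: yz0; rewrite mulf_eq0 negb_or.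
have Qyz : Q (y * z) by rewrite -ey.
move: (leq_ltn_trans sx' sx); rewrite ey spreadM // => hs.
have [|u1 [r1 [uu1 hr1 e1]]] := IH y _ (Qdiv yz0 Qyz) y0; first by move: hs y1 z1; lia.
have [|u2 [r2 [uu2 hr2 e2]]] := IH z _ (Qdivr yz0 Qyz) z0; first by move: hs y1 z1; lia.
exists (u1 * u2), (r1 ++ r2); split.
- by rewrite unitrM uu1.
- by move=> p; rewrite mem_cat => /orP[/hr1|/hr2].
- by rewrite big_cat /= e1 e2; ring.
Qed.

End FactorialStep.

Section GradedFactorial.
Variables (k : fieldType) (B : idomainType) (iota : {rmorphism k -> B}).
Variables (s : nat) (Bg : 'rV[int]_s -> B -> Prop) (gr : grading iota Bg).

(** A component for one coordinate is a partial sum of the fine components, so the degree in another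
    coordinate is kept. *)
Lemma coarse_hcomp (L1 L2 : 'rV[int]_s -> int) (h2 : {morph L2 : x y / x + y}) c d x :
  coarse gr L1 c x -> coarse gr L1 c (hcomp (coarse_grading gr h2) x d).
Proof.
move=> hx g; set y := hcomp _ x d => yg; apply: hx.
have hy : coarse gr L2 d y := hcomp_hom (coarse_grading gr h2) x d.
have Lg := hy g yg; apply: contra_neq yg => xg.
suff -> : hcomp gr y g = hcomp gr x g by [].
rewrite {1}(sum_hcomp (coarse_grading gr h2) x) hcomp_sum.
have z e : e != d -> hcomp gr (hcomp (coarse_grading gr h2) x e) g = 0.
  move=> ed; apply/eqP/negPn/negP => h.
  have := hcomp_hom (coarse_grading gr h2) x e g h; rewrite Lg => de.
  by rewrite de eqxx in ed.
case ds : (d \in supp (coarse_grading gr h2) x).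
  by rewrite (bigD1_seq d) ?supp_uniq //= big1 ?addr0.
rewrite big1_seq => [|e /andP[_ es]]; last by apply: z; apply: contraFneq ds => <-.
move/negbT: ds; rewrite mem_supp negbK => /eqP; rewrite -/y => ->.
exact: hcomp0.
Qed.

Definition homQ_upto i x := forall j : 'I_s, (j < i)%N -> exists c, coarse gr (deg_coord j) c x.

Lemma homQ_upto_step (i : 'I_s) :
  factorialQ (homQ_upto i.+1) -> factorialQ (homQ_upto i).
Proof.
move=> F; apply: (@factorial_step k B iota _ (coord_gr gr i) (homQ_upto i)).
- move=> x y hx hy j ji; have [c hc] := hx j ji; have [d hd] := hy j ji.
  by exists (c + d); apply: (gradM (coord_gr gr j)).
- move=> x y xy0 hxy j ji; have [c hc] := hxy j ji.
  by have [a [b [ha _]]] := hom_factor_int (coord_gr gr j) xy0 hc; exists a.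
- by move=> x c hx j ji; have [d hd] := hx j ji; exists d; apply: coarse_hcomp.
- move=> x y hx hy j ji; have [c hc] := hx j ji; have [d hd] := hy j ji; exists (c + d).
  apply: (homB (coord_gr gr j)); last by apply: (gradM (coord_gr gr j)) => //; apply: coarse_hcomp.
  by rewrite addrC; apply: (gradM (coord_gr gr j)) => //; apply: coarse_hcomp.
have <- // : homQ_upto i.+1 = homQ (coarse gr (deg_coord i)) (homQ_upto i).
apply: funext => x; apply: propext; split=> [H|[H1 H2] j].
  by split=> [j ji|]; apply: H => //; rewrite ltnS ltnW.
by rewrite ltnS leq_eqVlt => /orP[/eqP/val_inj->//|]; apply: H1.
Qed.

(** Descent on the number of coordinates in which homogeneity is imposed, from all [s] of them to
    none. *)
Lemma factorialQ_True : factorialQ (fun x => exists g, Bg g x) -> factorialQ (fun _ : B => True).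
Proof.
move=> F.
have H i : (i <= s)%N -> factorialQ (homQ_upto (s - i)).
  elim: i => [_|i IH si].
    rewrite subn0; have <- // : (fun x => exists g, Bg g x) = homQ_upto s.
    apply: funext => x; apply: propext; split=> [[g hg] j _|H].
      by exists (g 0 j) => h; rewrite (hcomp_homE gr hg); case: (h =P g) => [->|]; rewrite ?eqxx.
    have [c hc] := choice (fun j => H j (ltn_ord j)).
    exists (\row_j c j); apply/(hom_hcomp gr) => h xh; apply/rowP => j.
    by rewrite mxE -(hc j _ xh).
  have hi : (s - i.+1 < s)%N by lia.
  apply: (homQ_upto_step (i := Ordinal hi)) => /=.
  by rewrite (_ : (s - i.+1).+1 = s - i)%N; [apply: IH; lia|lia].
have <- // : homQ_upto 0 = (fun=> True).
  by apply: funext => x; apply: propext; split.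
by rewrite -(subnn s); apply: H.
Qed.

Lemma graded_UFD : factorialQ (fun x => exists g, Bg g x) -> UFD B.
Proof.
move=> /factorialQ_True F; apply: UFD_of_prime_factorizations => x x0 xu.
have [u [r [uu hr e]]] := F x I x0.
have pr : {in r, forall p, prime_elt p}.
  by move=> p /hr[_ p0 pu pp]; split=> // a b; apply: pp.
case: r hr pr e => [|p r] hr pr e; first by move: xu; rewrite e big_nil mulr1 uu.
exists (u * p :: r); last by rewrite e !big_cons mulrA.
move=> q; rewrite inE => /orP[/eqP->|qr]; last by apply: pr; rewrite inE qr orbT.
have [p0 pu pp] := pr p (mem_head _ _).
have u0 : u != 0 by apply: contraTneq uu => ->; rewrite unitr0.
have up : dvdr p (u * p) by apply/dvdr_mull/dvdrr.
have pup : dvdr (u * p) p by exists u^-1; rewrite mulrA mulVr // mul1r.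
split; [by rewrite mulf_neq0|by rewrite unitrM uu|].
move=> a b /(dvdr_trans up)/pp[] h; [left|right]; exact: dvdr_trans pup h.
Qed.

End GradedFactorial.

(* Smith normal form: rows that stay independent modulo every prime extend to a
   basis, so their lattice is the kernel of a split surjection. *)
Lemma primitive_lattice r n (M : 'M[int]_(r, n)) :
  (forall q, prime q -> forall v : 'rV[int]_r, (forall a, (q %| (v *m M)%R ord0 a)%Z) ->
     forall i, (q %| v ord0 i)%Z) ->
  exists (W : 'M[int]_(n, n - r)) (Z : 'M[int]_(n - r, n)),
  [/\ Z *m W = 1%:M, M *m W = 0 & forall v : 'rV[int]_n, v *m W = 0 -> exists c : 'rV_r, v = c *m M].
Proof.
move=> prim; have [L Lu [R Ru [d _ eM]]] := int_Smith_normal_form M.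
pose S : 'M[int]_(r, n) := \matrix_(i, j) (d`_i *+ (i == j :> nat)).
have MR : M *m invmx R = L *m S by rewrite eM -!mulmxA mulmxV // mulmx1.
(* A row of the diagonal form divisible by q yields a combination of the rows of [M] divisible by q,
   with coefficients that are not all so. Hence [r] is at most [n] and all elementary divisors are
   units. *)
have bad (i : 'I_r) q : prime q -> ~ forall a, (q %| S i a)%Z.
  move=> pq h; pose v := delta_mx 0 i *m invmx L : 'rV[int]_r.
  have vM : v *m M = row i S *m R by rewrite eM /v -!mulmxA mulKmx // mulmxA -rowE.
  have /prim hv : forall a, (q %| (v *m M)%R ord0 a)%Z.
    move=> a; rewrite vM mxE; apply: rpred_sum => b _.
    by rewrite mxE; apply: dvdz_mulr.
  have : (q %| (v *m L)%R ord0 i)%Z.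
    rewrite mxE; apply: rpred_sum => b _; apply: dvdz_mulr; exact: hv.
  rewrite /v mulmxKV // mxE !eqxx /= dvdzE /= dvdn1 => /eqP q1.
  by rewrite q1 in pq.
have rn : (r <= n)%N.
  rewrite leqNgt; apply/negP => nr; apply: (bad (Ordinal nr) 2%N) => // a.
  by rewrite mxE /= gtn_eqF // mulr0n dvdz0.
have du (i : 'I_r) : absz (d`_i)%R = 1%N.
  apply/eqP; apply/negPn/negP => d1.
  have [q pq qd] : exists2 q, prime q & (q %| absz (d`_i)%R)%N.
    have [/eqP d0|d0] := posnP (absz (d`_i)%R); first by exists 2%N => //; move/eqP: d0 => ->.
    have /pdivP[q pq qd] : (1 < absz (d`_i)%R)%N by rewrite ltn_neqAle eq_sym d1.
    by exists q.
  apply: (bad i q pq) => a; rewrite mxE; case: eqP => _; last by rewrite mulr0n dvdz0.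
  by rewrite mulr1n dvdzE.
have dd (i : 'I_r) : d`_i * d`_i = 1.
  by have := du i; case: (d`_i) => -[|[|?]].
(* [E] selects the last n - r coordinates, on which the diagonal form vanishes. *)
pose E : 'M[int]_(n, n - r) := \matrix_(a, j) ((a == r + j :> nat)%N)%:R.
have SE : S *m E = 0.
  apply/matrixP => i j; rewrite !mxE big1 // => a _; rewrite !mxE.
  case: eqP => [ia|_]; last by rewrite mul0r.
  by rewrite -ia ltn_eqF ?mulr0 // (leq_trans (ltn_ord i)) // leq_addr.
exists (invmx R *m E), (E^T *m R); split.
- rewrite mulmxA -(mulmxA E^T) mulmxV // mulmx1; apply/matrixP => i j; rewrite !mxE.
  have ri : (r + i < n)%N by rewrite -ltn_subRL.
  rewrite (bigD1 (Ordinal ri)) //= !mxE /= eqxx mul1r eqn_add2l big1 ?addr0 // => a ai.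
  by rewrite !mxE; case: (_ =P (r + i)%N) ai => [e|_ _]; rewrite ?mul0r //; case/eqP; apply: val_inj.
- by rewrite mulmxA MR -mulmxA SE mulmx0.
move=> v vW; pose u := v *m invmx R.
have uE : u *m E = 0 by rewrite /u -mulmxA.
have u0 (a : 'I_n) : (r <= a)%N -> u 0 a = 0.
  move=> ra; have ar : (a - r < n - r)%N by rewrite ltn_sub2r // (leq_ltn_trans ra).
  have := congr1 (fun X : 'rV_(n - r) => X 0 (Ordinal ar)) uE; rewrite [LHS]mxE [RHS]mxE (bigD1 a) //= [E _ _]mxE /= subnKC // eqxx mulr1.
  rewrite big1 ?addr0 // => b ba; rewrite [E _ _]mxE /= subnKC //.
  by rewrite (_ : (b == a :> nat) = false) ?mulr0 //; apply/negbTE.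
pose c : 'rV[int]_r := \row_i (d`_i * u 0 (widen_ord rn i)).
have cS : c *m S = u.
  apply/rowP => a; rewrite mxE; have [ra|ar] := leqP r a.
    rewrite u0 // big1 // => i _; rewrite !mxE ltn_eqF ?mulr0n ?mulr0 //.
    exact: leq_trans (ltn_ord i) ra.
  have /= dda := dd (Ordinal ar).
  rewrite (bigD1 (Ordinal ar)) //= [c _ _]mxE [S _ _]mxE /= eqxx mulr1n mulrAC dda mul1r.

  rewrite (_ : widen_ord rn _ = a); last exact: val_inj.
  rewrite big1 ?addr0 // => i ia; rewrite !mxE; case: eqP => [e|_]; last by rewrite mulr0n mulr0.
  by case/eqP: ia; apply: val_inj.
by exists (c *m invmx L); rewrite eM -/S !mulmxA mulmxKV // cS /u mulmxKV.
Qed.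

Lemma primitive_weights (V : finType) r (b : 'I_r -> V -> int) :
  (forall q (v : 'I_r -> int), prime q -> (forall a, (q %| \sum_i v i * b i a)%Z) ->
     forall i, (q %| v i)%Z) ->
  exists s (W : V -> 'rV[int]_s),
  [/\ forall j : 'I_s, exists Z : V -> int, \sum_v Z v *: W v = delta_mx 0 j,
      forall i, \sum_v b i v *: W v = 0
    & forall c : V -> int, \sum_v c v *: W v = 0 ->
        exists w : 'I_r -> int, forall v, c v = \sum_i w i * b i v].
Proof.
move=> prim; pose M : 'M[int]_(r, #|V|) := \matrix_(i, a) b i (enum_val a).
have [|W [Z [ZW MW kW]]] := @primitive_lattice _ _ M.
  move=> q pq v hv; apply: (prim q _ pq) => a; have := hv (enum_rank a).
  by rewrite mxE; under eq_bigr do rewrite mxE enum_rankK.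
have sumV (F : V -> 'rV[int]_(#|V| - r)) : \sum_v F v = \sum_(a < #|V|) F (enum_val a).
  by rewrite (reindex _ (onW_bij _ (@enum_val_bij V))).
exists (#|V| - r)%N, (fun v => row (enum_rank v) W); split.
- move=> j; exists (fun v => Z j (enum_rank v)); rewrite sumV.
  apply/rowP => c; have := congr1 (fun X : 'M_(#|V| - r) => X j c) ZW.
  rewrite !mxE eqxx /= eq_sym => <-; rewrite summxE; apply: eq_bigr => a _.
  by rewrite !mxE enum_valK.
- move=> i; rewrite sumV; apply/rowP => c.
  have := congr1 (fun X : 'M_(r, #|V| - r) => X i c) MW; rewrite !mxE => e.
  rewrite -[RHS]e summxE; apply: eq_bigr => a _.
  by rewrite !mxE enum_valK.
move=> c hc; pose u : 'rV[int]_(#|V|) := \row_a c (enum_val a).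
have uW : u *m W = 0.
  apply/rowP => d; have := congr1 (fun X : 'rV_(#|V| - r) => X 0 d) hc.
  rewrite sumV !mxE summxE => e; rewrite -[RHS]e; apply: eq_bigr => a _.
  by rewrite !mxE enum_valK.
have [w ew] := kW u uW; exists (fun i => w 0 i) => v.
have := congr1 (fun X : 'rV_(#|V|) => X 0 (enum_rank v)) ew.
rewrite !mxE enum_rankK => ->; apply: eq_bigr => i _.
by rewrite mxE enum_rankK.
Qed.

Section Weights.
Variables (k : closedFieldType) (D : trinomial_data k) (m : nat).
Local Notation N := (\sum_(i < (tri_r D).+1) tri_n D i)%N.
Local Notation V := ('I_N + 'I_m)%type.
Local Notation r := (tri_r D).
Local Notation bv := (@tri_bv k D m).

(** In the block of T_0 the divisibility says that q divides the sum of the v_i or d_0; in the block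
    paired with v_i, that q divides v_i or the gcd of that block. At most one gcd is divisible by q.
    If it is that of v_i, then q divides the sum and all other v, hence v_i too. *)
Lemma tri_primitive q (v : 'I_r -> int) : prime q ->
  (forall a : V, (q %| \sum_i v i * ((bv ord0 a)%:Z - (bv (lift ord0 i) a)%:Z))%Z) ->
  forall i, (q %| v i)%Z.
Proof.
move=> pq h.
pose G (i : 'I_r.+1) := (\big[gcdn/0%N]_(j < tri_n D i) tri_beta D i j)%N.
have h0 : (q %| \sum_i v i)%Z \/ (q %| G ord0)%N.
  have [|nd] := boolP (q %| \sum_i v i)%Z; [by left|right].
  apply/dvdn_biggcdP => j _; have := h (inl (tagnat.Rank ord0 j)).
  rewrite (eq_bigr (fun i => v i * (tri_beta D ord0 j)%:Z)) => [|i _].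
    by rewrite -mulr_suml dvdzE abszM Euclid_dvdM // -dvdzE (negbTE nd).
  by rewrite !tri_bv_Rank eqxx (negbTE (neq_lift _ _)) subr0.
have hi i : (q %| v i)%Z \/ (q %| G (lift ord0 i))%N.
  have [|nd] := boolP (q %| v i)%Z; [by left|right].
  apply/dvdn_biggcdP => j _; have := h (inl (tagnat.Rank (lift ord0 i) j)).
  rewrite (_ : \sum_i' _ = - (v i * (tri_beta D (lift ord0 i) j)%:Z)).
    by rewrite dvdzE abszN abszM Euclid_dvdM // -dvdzE (negbTE nd).
  apply: (etrans (bigD1 i isT)); rewrite [X in _ + X = _]big1 /= => [|i' ii].
    by rewrite addr0 !tri_bv_Rank eqxx eq_sym (negbTE (neq_lift _ _)) sub0r mulrN.
  rewrite !tri_bv_Rank eq_sym (negbTE (neq_lift _ _)) (inj_eq (@lift_inj _ _)) eq_sym (negbTE ii).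
  by rewrite subrr mulr0.
have cop (i i' : 'I_r.+1) : i != i' -> (q %| G i)%N -> ~ (q %| G i')%N.
  move=> ii h1 h2; have : (q %| gcdn (G i) (G i'))%N by rewrite dvdn_gcd h1.
  by rewrite (eqP (tri_coprime ii)) dvdn1 => /eqP q1; rewrite q1 in pq.
move=> i; case: (hi i) => // hG.
have hs : (q %| \sum_i v i)%Z by case: h0 => // h0; case: (cop _ _ (neq_lift ord0 i) h0 hG).
rewrite (bigD1 i) //= in hs; move: hs; rewrite dvdzE => hs; rewrite dvdzE.
have ho : (q %| \sum_(i' | i' != i) v i')%Z.
  apply: rpred_sum => i' ii; case: (hi i') => // hG'.
  by case: (cop _ _ _ hG' hG); rewrite (inj_eq (@lift_inj _ _)).
have hs' : (q %| v i + \sum_(i' | i' != i) v i')%Z by rewrite dvdzE.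
by have := rpredB hs' ho; rewrite addrK dvdzE.
Qed.

Lemma tri_weights : exists s (W : V -> 'rV[int]_s),
  [/\ forall j : 'I_s, exists Z : V -> int, \sum_v Z v *: W v = delta_mx 0 j,
      forall l, \sum_v W v *+ bv l v = \sum_v W v *+ bv ord0 v
    & forall c : V -> int, \sum_v c v *: W v = 0 ->
        exists e : 'I_r.+1 -> int, \sum_l e l = 0 /\ forall v, c v = \sum_l e l * (bv l v)%:Z].
Proof.
have [|s [W [h1 h2 h3]]] := @primitive_weights V r (fun i v => (bv ord0 v)%:Z - (bv (lift ord0 i) v)%:Z).
  by move=> q v pq hv; apply: (tri_primitive pq hv).
exists s, W; split=> //.
- move=> l; case: (unliftP ord0 l) => [i ->|-> //].
  apply/eqP; rewrite eq_sym -subr_eq0 -sumrB -[X in _ == X](h2 i); apply/eqP.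
  by apply: eq_bigr => v _; rewrite scalerBl -!scaler_nat !natz.
move=> c /h3[w hw].
(* A combination of the differences beta_0 - beta_i is rewritten on all the beta_l; the coefficient
   of beta_0 balances the others. *)
exists (fun l => oapp (fun i => - w i) (\sum_i w i) (unlift ord0 l)); split.
  rewrite big_ord_recl unlift_none /=; under [X in _ + X]eq_bigr do rewrite liftK /=.
  by rewrite sumrN addrN.
move=> v; rewrite hw big_ord_recl unlift_none /= mulr_suml.
under [X in _ + X]eq_bigr do rewrite liftK /=.
rewrite -big_split /=; apply: eq_bigr => i _.
by rewrite mulrBr mulNr.
Qed.

End Weights.

(** * The grading of a trinomial ring *)

Section LaurentMonomials.
Variables (E : fieldType) (s : nat) (x : 'I_s -> E).
Hypothesis x0 : forall j, x j != 0.

Definition laurent (g : 'rV[int]_s) := \prod_j x j ^ g 0 j.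

Lemma laurentD g h : laurent (g + h) = laurent g * laurent h.
Proof. by rewrite -big_split; apply: eq_bigr => j _; rewrite mxE expfzDr. Qed.

Lemma laurent0 : laurent 0 = 1.
Proof. by apply: big1 => j _; rewrite mxE expr0z. Qed.

Lemma laurentMn g n : laurent (g *+ n) = laurent g ^+ n.
Proof.
by elim: n => [|n IH]; rewrite ?mulr0n ?laurent0 ?expr0 // mulrS laurentD IH exprS.
Qed.

Lemma laurent_sum (I : Type) (r : seq I) (P : pred I) (F : I -> 'rV[int]_s) :
  laurent (\sum_(i <- r | P i) F i) = \prod_(i <- r | P i) laurent (F i).
Proof. by apply: (big_morph laurent laurentD laurent0). Qed.

Lemma laurent_nat (g : 'rV[int]_s) (al : 'X_{1..s}) : (forall j, g 0 j = (al j)%:Z) ->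
  laurent g = \prod_j x j ^+ al j.
Proof. by move=> H; apply: eq_bigr => j _; rewrite H. Qed.

Lemma mon_laurent (V : finType) (E' : comNzRingType) (i : {rmorphism E' -> E}) (W : V -> 'rV[int]_s) (p : V -> E') al :
  mon (fun v => i (p v) * laurent (W v)) al = i (mon p al) * laurent (\sum_v W v *+ al v).
Proof.
rewrite /mon rmorph_prod laurent_sum -big_split; apply: eq_bigr => v _.
by rewrite exprMn laurentMn rmorphXn.
Qed.

End LaurentMonomials.

Section LaurentFraction.
Variables (B : idomainType) (s : nat).
Local Notation E := {fraction {mpoly B[s]}}.

(** Laurent polynomials over [B] are realized inside the fraction field of the polynomial ring
    B[x_1, ..., x_s]. *)
Definition lvar (j : 'I_s) : E := @tofrac {mpoly B[s]} 'X_j.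
Definition lincl : {rmorphism B -> E} := @tofrac {mpoly B[s]} \o @mpolyC s B.

Lemma lvar_neq0 j : lvar j != 0.
Proof.
rewrite /lvar tofrac_eq0; apply/eqP => h.
by have /eqP := congr1 (fun p => p@_U_(j)%MM) h; rewrite mcoeffX eqxx mcoeff0 oner_eq0.
Qed.

(** Multiplying by the monomial with all exponents [K] makes the exponents nonnegative; distinct
    monomials of a polynomial ring are independent. *)
Lemma laurent_indep (r : seq 'rV[int]_s) (y : 'rV[int]_s -> B) : uniq r ->
  \sum_(g <- r) lincl (y g) * laurent lvar g = 0 -> {in r, forall g, y g = 0}.
Proof.
move=> ur e.
pose K := (\sum_(g <- r) \sum_j absz (g ord0 j))%N.
have hK g j : g \in r -> (absz (g ord0 j) <= K)%N.
  move=> gr; rewrite /K (big_rem _ gr) /= (bigD1 j) //=.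
  by rewrite -addnA leq_addr.
pose mg (g : 'rV[int]_s) : 'X_{1..s} := [multinom absz (g 0 j + K%:Z)%R | j < s].
have hmg g j : g \in r -> g 0 j + K%:Z = (mg g j)%:Z.
  have aux (z : int) (n : nat) : (absz z <= n)%N -> z + n%:Z = (absz (z + n%:Z)%R)%:Z by lia.
  by move=> gr; rewrite mnmE; apply: aux; apply: hK.
pose KK : 'rV[int]_s := const_mx K%:Z.
have eX g : g \in r -> laurent lvar g * laurent lvar KK = tofrac ('X_[mg g] : {mpoly B[s]}).
  move=> gr; rewrite -(laurentD lvar_neq0) (@laurent_nat _ _ lvar _ (mg g)) => [|j].
    by rewrite mpolyXE_id rmorph_prod; apply: eq_bigr => j _; rewrite rmorphXn.
  by rewrite !mxE hmg.
have e2 : \sum_(g <- r) y g *: ('X_[mg g] : {mpoly B[s]}) = 0.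
  apply/eqP; rewrite -tofrac_eq0; apply/eqP.
  have := congr1 (fun w => w * laurent lvar KK) e; rewrite mul0r => e'.
  rewrite -[RHS]e' rmorph_sum mulr_suml; apply: eq_big_seq => g gr.
  by rewrite -mulrA (eX g gr) -mul_mpolyC rmorphM.
move=> g gr; have := congr1 (fun p => p@_(mg g)) e2.
rewrite mcoeff0 raddf_sum (bigD1_seq g) //= mcoeffZ mcoeffX eqxx mulr1.
rewrite big1_seq ?addr0 // => h /andP[hg hr]; rewrite mcoeffZ mcoeffX.
case: eqP => [em|_]; last by rewrite mulr0.
case/eqP: hg; apply/rowP => j; apply: (addIr K%:Z).
by rewrite [LHS]hmg // [RHS]hmg // em.
Qed.

End LaurentFraction.

Section TrinomialPoints.
Variables (k : closedFieldType) (D : trinomial_data k) (m : nat).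
Local Notation N := (\sum_(i < (tri_r D).+1) tri_n D i)%N.
Local Notation V := ('I_N + 'I_m)%type.
Local Notation bv := (@tri_bv k D m).

Lemma Rank_sig (a : 'I_N) : tagnat.Rank (tag (tagnat.sig a)) (tagged (tagnat.sig a)) = a.
Proof. by rewrite -[RHS]tagnat.sigK /tagnat.Rank; case: (tagnat.sig a). Qed.

Lemma tri_sign_neq0 l : tri_sign (D := D) l != 0.
Proof. by rewrite /tri_sign; case: ifP; rewrite ?oppr_eq0 oner_eq0. Qed.

Lemma tri_sign_lf (E : idomainType) (kap : {rmorphism k -> E}) x y l :
  hf kap (tri_ell l) 1 x y = kap (tri_sign (D := D) l) * lf kap x y (tri_point l).
Proof. by rewrite /tri_ell hfZ hf_lfpoly. Qed.

Lemma rel_of_lf (E : idomainType) (kap : {rmorphism k -> E}) (t : V -> E) x y :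
  (forall l, mon t (bv l) = kap (tri_sign l) * lf kap x y (tri_point l)) ->
  forall i, mmap kap (fun a => t (inl a)) (tri_rel D i) = 0.
Proof.
move=> H i; rewrite mmap_tri_rel !H.
have r0 := tri_r_gt0 D.
have hi : (i.+2 < (tri_r D).+1)%N by have := ltn_ord i; lia.
rewrite /tri_sign /tri_point /= !inordK //= valK /= !rmorphN !rmorph1 rmorph0.
by rewrite /lf; move: (kap _) => w; ring.
Qed.

(* The point of k^2 lying on the line of the member o of the pencil. *)
Definition line_point (o : option k) : k * k := if o is Some z then (z, 1) else (1, 0).

Lemma lf_line_point o o' : lf idfun (line_point o).1 (line_point o).2 o' = 0 <-> o' = o.
Proof.
case: o o' => [z|] [z'|] /=; rewrite ?mulr1 ?mulr0 ?subr0; split=> //.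
- by move=> /eqP; rewrite subr_eq0 => /eqP->.
- by case=> ->; rewrite subrr.
- by move/eqP; rewrite oner_eq0.
- by move/eqP; rewrite oner_eq0.
Qed.

(** A point on the line of [o] prescribes the value of every T_l. In each block the variable [J l]
    takes it, through a root of the right order, and the other variables are 1; so zeros occur only
    at [J l] in the block of [o]. *)
Lemma tri_point_values (o : option k) (J : forall l, 'I_(tri_n D l)) : exists t : V -> k,
  [/\ forall l, mon t (bv l) = tri_sign l * lf idfun (line_point o).1 (line_point o).2 (tri_point l),
      forall l j, t (inl (tagnat.Rank l j)) = 0 <-> tri_point l = o /\ j = J l
    & forall y, t (inr y) = 1].
Proof.
pose w l := tri_sign l * lf idfun (line_point o).1 (line_point o).2 (tri_point (D := D) l).
have [rt hrt] := choice (fun l => @closed_root k (w l) _ (tri_beta_gt0 (J l))).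
have [t [tR t1]] : exists t : V -> k,
    (forall l j, t (inl (tagnat.Rank l j)) = if j == J l then rt l else 1) /\ forall y, t (inr y) = 1.
  exists (fun v : V => match v with
    | inl a => let u := tagnat.sig a in if tagged u == J (tag u) then rt (tag u) else 1
    | inr _ => 1 end); split=> // l j.
  by rewrite /tagnat.Rank tagnat.rankK.
exists t; split=> // l.
  rewrite mon_Rank [X in _ * X]big1 => [|y _]; last by rewrite /tri_bv expr0.
  rewrite mulr1 (bigD1 l) //= [X in _ * X]big1 ?mulr1 => [|i ii]; last first.
    by apply: big1 => j _; rewrite tri_bv_Rank (negbTE ii) expr0.
  rewrite (bigD1 (J l)) //= [X in _ * X]big1 ?mulr1 => [|j jj]; last first.
    by rewrite tR (negbTE jj) expr1n.
  by rewrite tR tri_bv_Rank !eqxx hrt.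
move=> j; rewrite tR; case: eqP => [->|nj]; last first.
  by split=> [/eqP|[_ /nj//]]; rewrite oner_eq0.
have e : (rt l == 0) = (w l == 0).
  by rewrite -[in RHS](hrt l) expf_eq0 tri_beta_gt0.
have e2 : w l = 0 <-> tri_point l = o.
  rewrite -lf_line_point /w; split=> [/eqP|->]; last by rewrite mulr0.
  by rewrite mulf_eq0 (negbTE (tri_sign_neq0 l)) => /eqP.
split=> [/eqP|[h _]]; first by rewrite e => /eqP/e2.
by apply/eqP; rewrite e; apply/eqP/e2.
Qed.

End TrinomialPoints.

(** * Homogeneous primes and grading of a trinomial ring *)

Section TrinomialModel.
Variables (k : closedFieldType) (D : trinomial_data k) (m : nat).
Local Notation N := (\sum_(i < (tri_r D).+1) tri_n D i)%N.
Local Notation V := ('I_N + 'I_m)%type.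
Local Notation bv := (@tri_bv k D m).
Variables (B : idomainType) (iota : {rmorphism k -> B}) (p : V -> B).
Hypothesis gens : forall x, exists n (c : 'I_n -> k) (al : 'I_n -> V -> nat),
  x = \sum_i iota (c i) * mon p (al i).
Hypothesis rel : forall i, mmap iota (fun a => p (inl a)) (tri_rel D i) = 0.
Hypothesis lift : forall (E : comNzRingType) (kap : {rmorphism k -> E}) (t : V -> E),
  (forall i, mmap kap (fun a => t (inl a)) (tri_rel D i) = 0) ->
  exists g : {rmorphism B -> E}, (forall c, g (iota c) = kap c) /\ forall v, g (p v) = t v.

Local Notation X := (mon p (bv ord0)).
Local Notation Y := (mon p (bv (inord 1))).
Local Notation lfB := (lf iota X Y).

Lemma model_forms l : mon p (bv l) = hf iota (tri_ell l) 1 X Y.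
Proof. exact: tri_forms. Qed.

Lemma model_block l : mon p (bv l) = iota (tri_sign l) * lfB (tri_point l).
Proof. by rewrite model_forms tri_sign_lf. Qed.

Lemma map_mon (E : comNzRingType) (g : {rmorphism B -> E}) al : g (mon p al) = mon (g \o p) al.
Proof. by rewrite rmorph_prod; apply: eq_bigr => v _; rewrite rmorphXn. Qed.

Lemma map_lf (E : idomainType) (kap : {rmorphism k -> E}) (g : {rmorphism B -> E}) x y o :
  (forall c, g (iota c) = kap c) -> g (lf iota x y o) = lf kap (g x) (g y) o.
Proof. by move=> gk; case: o => [z|] //=; rewrite rmorphB rmorphM gk. Qed.

Lemma model_point (o : option k) (J : forall l, 'I_(tri_n D l)) : exists g : {rmorphism B -> k},
  [/\ forall o', g (lfB o') = 0 <-> o' = o,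
      forall l j, g (p (inl (tagnat.Rank l j))) = 0 <-> tri_point l = o /\ j = J l
    & forall y, g (p (inr y)) = 1].
Proof.
have [t [h1 h2 h3]] := tri_point_values m o J.
have [|g [gk gt]] := lift (kap := idfun) (t := t); first exact: (@rel_of_lf k D m k idfun t _ _ h1).
exists g; split=> [o'|l j|y]; rewrite ?gt //.
have gm l : g (mon p (bv l)) = tri_sign l * lf idfun (line_point o).1 (line_point o).2 (tri_point l).
  by rewrite map_mon -h1; apply: eq_bigr => v _; rewrite /= gt.
have r0 := tri_r_gt0 D.
rewrite (map_lf _ _ _ gk) !gm -(lf_line_point o o').
by rewrite /tri_sign /tri_point /= !inordK //= !mul1r mul0r subr0.
Qed.

(** The candidates for homogeneous primes. [proper] excludes the members at the points of the T_l,
    which are products of variables up to sign. *)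
Definition atom (a : V + option k) : B := match a with inl v => p v | inr o => lfB o end.
Definition proper (a : V + option k) : Prop := if a is inr o then forall l, tri_point (D := D) l <> o else True.

Let J0 l := Ordinal (tri_n_gt0 (t := D) l).

Lemma unlisted_point (os : seq (option k)) : exists o : option k, o \notin os /\ forall l, tri_point (D := D) l <> o.
Proof.
have [z hz] := closed_field_avoid (pmap id (os ++ [seq tri_point (D := D) l | l <- enum 'I_(tri_r D).+1])).
have {}hz : Some z \notin os ++ [seq tri_point (D := D) l | l <- enum 'I_(tri_r D).+1].
  by apply: contra hz => h; rewrite mem_pmap; apply/mapP; exists (Some z).
move: hz; rewrite mem_cat negb_or => /andP[h1 h2]; exists (Some z); split=> // l e.
by move/negP: h2; apply; rewrite -e map_f ?mem_enum.
Qed.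

(** At a point on a member outside the listed ones, all variables are nonzero. *)
Lemma pvar_neq0 v : p v != 0.
Proof.
have [o [_ ho]] := unlisted_point [::]; have [g [_ h2 h3]] := model_point o J0.
have gv : g (p v) != 0.
  case: v => [a|y]; last by rewrite h3 oner_eq0.
  by rewrite -[a]Rank_sig; apply/eqP => /h2[/ho].
by apply: contra_neq gv => ->; rewrite rmorph0.
Qed.

Lemma lfB_neq0 o : lfB o != 0.
Proof.
have [o' [oo _]] := unlisted_point [:: o]; have [g [h1 _ _]] := model_point o' J0.
have gv : g (lfB o) != 0 by apply/eqP => /h1 e; move: oo; rewrite e mem_head.
by apply: contra_neq gv => ->; rewrite rmorph0.
Qed.

Lemma atom_neq0 a : atom a != 0.
Proof. by case: a => [v|o]; [apply: pvar_neq0|apply: lfB_neq0]. Qed.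

(** For a variable of block l: a point on the member of T_l at which this variable is the chosen
    zero. For an adjoined polynomial variable: the endomorphism setting it to 0. For a proper
    member: any point on it. *)
Lemma atom_separation a : proper a -> exists (E : idomainType) (g : {rmorphism B -> E}),
  g (atom a) = 0 /\ forall a', proper a' -> a' <> a -> g (atom a') <> 0.
Proof.
case: a => [[c|y]|o] pa.
- rewrite -[c]Rank_sig; move: (tag _) (tagged _) => l j {c pa} /=.
  have [g [h1 h2 h3]] := model_point (tri_point l) (fun l' => insubd (J0 l') (val j)).
  have Jl : insubd (J0 l) (val j) = j by rewrite valKd.
  exists k, g; split=> [|[[c|y]|o] pa aa /=].
  + by apply/h2; rewrite Jl.
  + move: aa; rewrite -[c]Rank_sig; move: (tag _) (tagged _) => l' j' aa /h2[/tri_point_inj/esym e].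
    by case: l' / e j' aa => j' aa; rewrite Jl => ej; apply: aa; rewrite ej.
  + by rewrite h3 => /eqP; rewrite oner_eq0.
  + by move/h1 => e; apply: (pa l).
- have [|g [gk gt]] := lift (kap := iota) (t := fun v => if v == inr y then 0 else p v).
    by move=> i; rewrite -[RHS](rel i).
  exists B, g; split=> [|[v|o] pa' aa] /=; first by rewrite gt eqxx.
    rewrite gt; case: (v =P inr y) => [e|_]; last exact/eqP/pvar_neq0.
    by case: aa; rewrite e.
  have gm l : g (mon p (bv l)) = mon p (bv l).
    rewrite map_mon; apply: eq_bigr => -[c|y'] _; first by rewrite /= gt.
    by rewrite /tri_bv !expr0.
  by rewrite (map_lf _ _ _ gk) !gm => h; case/eqP: (lfB_neq0 o).
have [g [h1 h2 h3]] := model_point o J0.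
exists k, g; split=> [|[[c|y]|o'] pa' aa /=].
- exact/h1.
- by rewrite -[c]Rank_sig => /h2[e _]; apply: (pa _ e).
- by rewrite h3 => /eqP; rewrite oner_eq0.
- by move/h1 => e; apply: aa; rewrite e.
Qed.

Lemma model_affine : affine iota.
Proof.
exists (N + m)%N, (fun a => p (split a)) => b.
pose im y := exists P : {mpoly k[N + m]}, y = mmap iota (fun a => p (split a)) P.
have imM u w : im u -> im w -> im (u * w).
  by move=> [P ->] [Q ->]; exists (P * Q); rewrite rmorphM.
have imD u w : im u -> im w -> im (u + w).
  by move=> [P ->] [Q ->]; exists (P + Q); rewrite rmorphD.
have imC c : im (iota c) by exists c%:MP; rewrite mmapC.
have im0 : im 0 by rewrite -(rmorph0 iota).
have im1 : im 1 by rewrite -(rmorph1 iota).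
have imv v : im (p v) by exists 'X_(unsplit v); rewrite mmapX mmap1U unsplitK.
have imX u n : im u -> im (u ^+ n).
  by move=> hu; elim: n => [|n IH]; rewrite ?expr0 // exprS; apply: (imM _ _).
have [n [c [al ->]]] := gens b.
apply: (big_ind im) => [//|u w|i _]; first exact: imD.
apply: (imM _ _) => //; apply: (big_ind im) => [//|u w|v _]; first exact: imM.
exact: imX.
Qed.

Section Graded.
Variables (s : nat) (W : V -> 'rV[int]_s).
Hypothesis Wgen : forall j : 'I_s, exists Z : V -> int, \sum_v Z v *: W v = delta_mx 0 j.
Hypothesis Wbv : forall l, \sum_v W v *+ bv l v = \sum_v W v *+ bv ord0 v.
Hypothesis Wker : forall c : V -> int, \sum_v c v *: W v = 0 ->
  exists e : 'I_(tri_r D).+1 -> int, \sum_l e l = 0 /\ forall v, c v = \sum_l e l * (bv l v)%:Z.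
Variables (E : fieldType) (incl : {rmorphism B -> E}) (x : 'I_s -> E).
Hypothesis x0 : forall j, x j != 0.
Hypothesis xindep : forall (r : seq 'rV[int]_s) (y : 'rV[int]_s -> B), uniq r ->
  \sum_(g <- r) incl (y g) * laurent x g = 0 -> {in r, forall g, y g = 0}.

Definition dg (al : V -> nat) := \sum_v W v *+ al v.

(** All T_l have the same weight, so twisting each variable by the Laurent monomial of its weight
    multiplies each relation by a single monomial. *)
Lemma model_Phi : exists Phi : {rmorphism B -> E}, (forall c, Phi (iota c) = incl (iota c)) /\
  forall al, Phi (mon p al) = incl (mon p al) * laurent x (dg al).
Proof.
pose t v := incl (p v) * laurent x (W v); pose kap : {rmorphism k -> E} := incl \o iota.
have tm al : mon t al = incl (mon p al) * laurent x (dg al) by apply: mon_laurent.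
have [|Phi [h1 h2]] := lift (kap := kap) (t := t).
  pose z := laurent x (dg (bv ord0)).
  apply: (@rel_of_lf k D m E kap t (incl X * z) (incl Y * z)) => l.
  rewrite tm {1}/dg Wbv -/(dg _) -/z (model_block l) rmorphM -mulrA; congr (_ * _).
  case: (tri_point l) => [u|] //=; rewrite rmorphB rmorphM mulrBl; congr (_ - _).
  by rewrite -mulrA.
exists Phi; split=> [c|al]; first exact: h1.
by rewrite -tm map_mon; apply: eq_bigr => v _; rewrite /= h2.
Qed.

Variable Phi : {rmorphism B -> E}.
Hypothesis Phik : forall c, Phi (iota c) = incl (iota c).
Hypothesis Phim : forall al, Phi (mon p al) = incl (mon p al) * laurent x (dg al).

(** Homogeneous elements as eigenvectors of the torus coaction [Phi]. *)
Definition model_deg (g : 'rV[int]_s) (y : B) := Phi y = incl y * laurent x g.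
Local Notation Bg := model_deg.

Lemma deg_mon al : Bg (dg al) (mon p al). Proof. exact: Phim. Qed.

Lemma deg_scale c g y : Bg g y -> Bg g (iota c * y).
Proof. by rewrite /Bg => h; rewrite !rmorphM Phik h mulrA. Qed.

Lemma degD g y z : Bg g y -> Bg g z -> Bg g (y + z).
Proof. by rewrite /Bg => h1 h2; rewrite !rmorphD h1 h2 mulrDl. Qed.

Lemma deg_zero g : Bg g 0. Proof. by rewrite /Bg !rmorph0 mul0r. Qed.

Lemma partition_degrees n (F : 'I_n -> B) (h : 'I_n -> 'rV[int]_s) :
  \sum_i F i = \sum_(g <- undup [seq h i | i <- enum 'I_n]) \sum_(i | h i == g) F i.
Proof.
under [RHS]eq_bigr do rewrite big_mkcond.
rewrite exchange_big /=; apply: eq_bigr => i _.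
have hi : h i \in undup [seq h i | i <- enum 'I_n] by rewrite mem_undup map_f ?mem_enum.
rewrite (bigD1_seq _ hi) ?undup_uniq //= eqxx big1 ?addr0 //.
by move=> g; rewrite eq_sym => /negbTE->.
Qed.

Lemma model_grading : grading iota Bg.
Proof.
split.
- exact: deg_zero.
- exact: degD.
- by move=> g h y z; rewrite /Bg => h1 h2; rewrite !rmorphM h1 h2 laurentD // mulrACA.
- by move=> c; rewrite /Bg laurent0 mulr1 Phik.
- move=> b; have [n [c [al ->]]] := gens b.
  exists (undup [seq dg (al i) | i <- enum 'I_n]).
  exists (fun g => \sum_(i | dg (al i) == g) iota (c i) * mon p (al i)); split.
    move=> g; apply: (big_ind (Bg g)) => [|y z|i /eqP<-]; [exact: deg_zero|exact: degD|].
    by apply: deg_scale; apply: deg_mon.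
  exact: partition_degrees.
- move=> r y ur hy e; apply: xindep => //.
  rewrite -[RHS](rmorph0 Phi) -e rmorph_sum; apply: eq_bigr => g _.
  exact/esym/hy.
Qed.

Let gr := model_grading.

Lemma dg_exact al be : dg al = dg be -> exists e : 'I_(tri_r D).+1 -> int, \sum_l e l = 0 /\
  forall v, (al v)%:Z = (be v)%:Z + \sum_l e l * (bv l v)%:Z.
Proof.
move=> e; have [|f [f0 hf]] := Wker (c := fun v => (al v)%:Z - (be v)%:Z).
  apply/eqP; rewrite -[X in _ == X](subrr (dg be)) -{1}e /dg -sumrB; apply/eqP.
  by apply: eq_bigr => v _; rewrite scalerBl -!scaler_nat !natz.
by exists f; split=> // v; rewrite -hf addrC subrK.
Qed.

Lemma deg_component g y n (c : 'I_n -> k) (al : 'I_n -> V -> nat) : Bg g y ->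
  y = \sum_i iota (c i) * mon p (al i) -> y = \sum_(i | dg (al i) == g) iota (c i) * mon p (al i).
Proof.
move=> hy e; have : hcomp gr y g = y by rewrite (hcomp_homE gr hy) eqxx.
rewrite {1}e hcomp_sum => <-; rewrite [RHS]big_mkcond /=; apply: eq_bigr => i _.
by rewrite (hcomp_homE gr (deg_scale (c i) (deg_mon (al i)))) eq_sym.
Qed.

Lemma hom_degree g y : Bg g y -> y != 0 -> exists al, g = dg al.
Proof.
move=> hy y0; have [n [c [al e]]] := gens y; have e2 := deg_component hy e.
apply: contrapT => H; move/eqP: y0; apply; rewrite e2 big_pred0 // => i.
by apply/eqP => h; apply: H; exists (al i).
Qed.

Lemma hom_normal al0 : exists ga j (d : 'I_(tri_r D).+1 -> nat),
  [/\ forall v, (al0 v = ga v + \sum_l d l * bv l v)%N, (j = \sum_l d l)%N &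
   forall y, Bg (dg al0) y -> exists2 P : {poly k}, (size P <= j.+1)%N & y = mon p ga * hf iota P j X Y].
Proof.
have [ga [j [d [h1 h2 H]]]] := normal_form (@tri_bv_disj k D m) (@tri_bv_neq0 k D m) al0 (@size_tri_ell k D).
exists ga, j, d; split=> // y hy; have [n [c [al e]]] := gens y.
have [|P sP hP] := H _ (fun i => dg (al i) == dg al0) c al.
  by move=> i /eqP; apply: dg_exact.
by exists P => //; rewrite (deg_component hy e) (hP B iota p X Y model_forms).
Qed.

Lemma deg_pvar v : Bg (W v) (p v).
Proof.
have e1 : mon p (fun w => (w == v) : nat) = p v.
  by rewrite /mon (bigD1 v) //= eqxx expr1 big1 ?mulr1 // => w /negbTE->.
have e2 : dg (fun w => (w == v) : nat) = W v.
  by rewrite /dg (bigD1 v) //= eqxx mulr1n big1 ?addr0 // => w /negbTE->.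
by rewrite -{1}e1 -e2; apply: deg_mon.
Qed.

Lemma deg_lfB o : Bg (dg (bv ord0)) (lfB o).
Proof.
have hY : Bg (dg (bv ord0)) Y by rewrite /dg -(Wbv (inord 1)); apply: deg_mon.
case: o => [z|] //=; apply: (homB gr); first exact: deg_mon.
exact: deg_scale.
Qed.

Lemma deg_atom a : exists g, Bg g (atom a).
Proof. by case: a => [v|o]; [exists (W v); apply: deg_pvar|exists (dg (bv ord0)); apply: deg_lfB]. Qed.

Definition atomic y := exists c (r : seq (V + option k)),
  [/\ c != 0, forall a, a \in r -> proper a & y = iota c * \prod_(a <- r) atom a].

Lemma atomicM y z : atomic y -> atomic z -> atomic (y * z).
Proof.
move=> [c [r [c0 hr ->]]] [d [t [d0 ht ->]]]; exists (c * d), (r ++ t); split.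
- exact: mulf_neq0.
- by move=> a; rewrite mem_cat => /orP[/hr|/ht].
- by rewrite big_cat rmorphM /=; ring.
Qed.

Lemma atomic_const c : c != 0 -> atomic (iota c).
Proof. by move=> c0; exists c, [::]; rewrite big_nil mulr1. Qed.

Lemma atomic_atom a : proper a -> atomic (atom a).
Proof.
move=> pa; exists 1, [:: a]; rewrite oner_eq0 big_seq1 rmorph1 mul1r; split=> // a'.
by rewrite inE => /eqP->.
Qed.

Lemma atomic_prod (I : eqType) (r : seq I) (F : I -> B) : (forall i, i \in r -> atomic (F i)) ->
  atomic (\prod_(i <- r) F i).
Proof.
move=> H; rewrite big_seq; apply: (big_ind atomic) => [|y z|i /H//]; last exact: atomicM.
by rewrite -(rmorph1 iota); apply: atomic_const; apply: oner_neq0.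
Qed.

Lemma atomic_mon al : atomic (mon p al).
Proof.
apply: atomic_prod => v _; elim: (al v) => [|n IH].
  by rewrite expr0 -(rmorph1 iota); apply: atomic_const; apply: oner_neq0.
by rewrite exprS; apply: atomicM => //; apply: (@atomic_atom (inl v)).
Qed.

Lemma atomic_lfB o : atomic (lfB o).
Proof.
have [[l e]|H] := EM (exists l, tri_point (D := D) l = o); last first.
  by apply: (@atomic_atom (inr o)) => l e; apply: H; exists l.
have -> : lfB o = iota (tri_sign (D := D) l) * mon p (bv l).
  rewrite (model_block l) e mulrA -rmorphM /tri_sign.
  by case: ifP => _; rewrite ?mulrNN mulr1 rmorph1 mul1r.
by apply: atomicM; [apply/atomic_const/tri_sign_neq0|apply: atomic_mon].
Qed.

(** A homogeneous element is a monomial times a binary form, which splits into members; a member at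
    a listed point is again a monomial up to sign. *)
Lemma hom_atomic g y : Bg g y -> y != 0 -> atomic y.
Proof.
move=> hy y0; have [al eg] := hom_degree hy y0; rewrite eg in hy.
have [ga [j [d [_ _ H]]]] := hom_normal al; have [P sP eP] := H y hy.
have P0 : P != 0 by apply: contra_neq y0 => e; rewrite eP e hf0 mulr0.
have [c [r [c0 _ er _ _]]] := hf_lf_split iota sP P0.
rewrite eP er; apply: atomicM; first exact: atomic_mon.
apply: atomicM; first exact: atomic_const.
by apply: atomic_prod => o _; apply: atomic_lfB.
Qed.

Lemma atom_nonunit a : proper a -> atom a \isn't a GRing.unit.
Proof.
move=> pa; have [F [h [h0 _]]] := atom_separation pa; apply/negP => /(rmorph_unit h).
by rewrite h0 unitr0.
Qed.

(** The morphism killing [atom a] and no other proper atom kills the product, hence one of the two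
    factors; then [a] occurs among the atoms of that factor. *)
Lemma atom_prime a : proper a -> primeQ (fun y => exists g, Bg g y) (atom a).
Proof.
move=> pa; split; [exact: deg_atom|exact: atom_neq0|exact: atom_nonunit|].
move=> y z [g hy] [h hz] d.
have [->|y0] := eqVneq y 0; first by left; apply: dvdr0.
have [->|z0] := eqVneq z 0; first by right; apply: dvdr0.
have [c [r [c0 hr ey]]] := hom_atomic hy y0; have [c' [r' [c'0 hr' ez]]] := hom_atomic hz z0.
have [F [f [f0 fa]]] := atom_separation pa.
have : f (y * z) = 0 by have [w ->] := d; rewrite rmorphM f0 mulr0.
have fk u : u != 0 -> f (iota u) != 0.
  move=> u0; apply: contraTneq (rmorph_unit f (rmorph_unit iota (_ : u \is a GRing.unit))); rewrite ?unitfE //.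
  by move=> ->; rewrite unitr0.
have fr t : (forall b, b \in t -> proper b) -> f (\prod_(b <- t) atom b) = 0 -> dvdr (atom a) (\prod_(b <- t) atom b).
  move=> ht; rewrite rmorph_prod => /eqP; rewrite prodf_seq_eq0 => /hasP[b bt /= /eqP fb].
  rewrite (big_rem _ bt) /=; apply: dvdr_mulr.
  have [->|ab] := EM (b = a); first exact: dvdrr.
  by case: (fa b (ht b bt) ab).
rewrite rmorphM => /eqP; rewrite mulf_eq0 => /orP[] /eqP.
- rewrite {1}ey rmorphM => /eqP; rewrite mulf_eq0 (negbTE (fk _ c0)) => /eqP/(fr r hr) h'.
  by left; rewrite ey; apply: dvdr_mull.
- rewrite {1}ez rmorphM => /eqP; rewrite mulf_eq0 (negbTE (fk _ c'0)) => /eqP/(fr r' hr') h'.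
  by right; rewrite ez; apply: dvdr_mull.
Qed.

Lemma model_UFD : UFD B.
Proof.
apply: (graded_UFD gr) => y [g hy] y0; have [c [r [c0 hr e]]] := hom_atomic hy y0.
exists (iota c), (map atom r); split.
- by rewrite rmorph_unit ?unitfE.
- by move=> _ /mapP[a /hr pa ->]; apply: atom_prime.
- by rewrite big_map.
Qed.

(** The zero exponent has zero reduced part and contains no full fibre, so elements of degree 0 are
    forms of degree 0. *)
Lemma model_deg0 : deg0_const iota Bg.
Proof.
move=> b; split=> [hb|[c ->]]; last exact: (grad_const gr).
have [ga [j [d [h1 h2 H]]]] := hom_normal (fun=> 0%N).
have d0 : dg (fun=> 0%N) = 0 by apply: big1 => v _; rewrite mulr0n.
have {}d0 : Bg (dg (fun=> 0%N)) b by rewrite d0.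
have [P sP ->] := H b d0.
have g0 v : ga v = 0%N by apply/eqP; have := h1 v; move/esym/eqP; rewrite addn_eq0 => /andP[].
have dl l : d l = 0%N.
  have [v hv] := tri_bv_neq0 m l; have := h1 v; move/esym/eqP; rewrite addn_eq0 => /andP[_].
  by rewrite (bigD1 l) //= addn_eq0 muln_eq0 (negbTE hv) orbF => /andP[/eqP].
have j0 : j = 0%N by rewrite h2 big1.
rewrite j0 in sP *; exists P`_0; rewrite (eq_mon p (be := fun=> 0%N)) // mon0 mul1r.
by rewrite (size1_polyC sP) hfC expr0 mulr1 coefC eqxx.
Qed.

Lemma model_unmixed : unmixed Bg.
Proof.
move=> g [y hy y0] [z hz z0]; have : Bg 0 (y * z) by rewrite -(subrr g); apply: (gradM gr).
move=> /model_deg0[c ec].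
have yu : y \is a GRing.unit.
  have : y * z \is a GRing.unit.
    rewrite ec rmorph_unit // unitfE; apply: contra_neq (mulf_neq0 y0 z0) => c0.
    by rewrite ec c0 rmorph0.
  by rewrite unitrM => /andP[].
have [c' [r [c0 hr e]]] := hom_atomic hy y0.
case: r hr e => [|a r] hr e.
  apply: (hom_uniq gr hy _ y0); rewrite e big_nil mulr1; exact: (grad_const gr).
case/negP: (atom_nonunit (hr a (mem_head _ _))); apply: (dvdr_unitP _ yu).
by rewrite e big_cons; apply/dvdr_mull/dvdr_mulr/dvdrr.
Qed.

Lemma model_effective : effective Bg.
Proof.
move=> H H0 HB Hw g.
have HN h : H h -> H (- h) by move=> hh; rewrite -sub0r; apply: HB.
have HD h h' : H h -> H h' -> H (h + h') by move=> a b; rewrite -[h']opprK; apply: (HB _ _) => //; apply: HN.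
have HM h (n : nat) : H h -> H (h *+ n).
  by move=> hh; elim: n => [|n IH]; rewrite ?mulr0n // mulrS; apply: (HD _ _).
have HZ h (n : int) : H h -> H (n *: h).
  move=> hh; have e (u : nat) : u%:Z *: h = h *+ u by rewrite -scaler_nat natz.
  by case: n => n; rewrite ?NegzE ?scaleNr e; [apply: HM|apply/HN/HM].
have HW v : H (W v) by apply: Hw; exists (p v); [apply: deg_pvar|apply: pvar_neq0].
have Hd j : H (delta_mx 0 j).
  have [Z <-] := Wgen j; apply: (big_ind H) => [//|a b|v _]; first exact: HD.
  exact: HZ.
rewrite (row_sum_delta g); apply: (big_ind H) => [//|a b|v _]; first exact: HD.
exact: HZ.
Qed.

End Graded.

End TrinomialModel.

(** * Rationality of the fraction field *)

Section PureTranscendental.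
Variables (k L E : fieldType) (f : {rmorphism k -> L}) (n : nat) (w : 'I_n -> L).
Hypothesis ind : alg_indep f w.
Hypothesis gen_all : forall z, gen f w z.
Variable tf : {rmorphism {mpoly k[n]} -> E}.
Hypothesis tf_inj : injective tf.
Local Notation ev := (mmap f w).

Lemma ev_eq P Q : ev P = ev Q -> P = Q.
Proof.
move=> e; apply/eqP; rewrite -subr_eq0; apply/eqP; apply: ind.
by rewrite rmorphB /= e subrr.
Qed.

Lemma ratio_exists z : exists PQ : {mpoly k[n]} * {mpoly k[n]}, ev PQ.2 != 0 /\ z * ev PQ.2 = ev PQ.1.
Proof. by have [P [Q h]] := gen_all z; exists (P, Q). Qed.

(** A presentation of [z] as P(w) / Q(w) is chosen; algebraic independence makes the value
    independent of the choice. *)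
Definition ratio_inv (z : L) : E := let PQ := projT1 (cid (ratio_exists z)) in tf PQ.1 / tf PQ.2.

Lemma tf_ev_neq0 Q : ev Q != 0 -> tf Q != 0.
Proof.
move=> h; apply/eqP => e; move/eqP: h; apply.
by rewrite (tf_inj (etrans e (esym (rmorph0 tf)))) rmorph0.
Qed.

Lemma ratio_invE z P Q : ev Q != 0 -> z * ev Q = ev P -> ratio_inv z = tf P / tf Q.
Proof.
move=> Q0 e; rewrite /ratio_inv; case: (cid _) => -[P' Q'] /= [Q'0 e'].
apply/eqP; rewrite eqr_div; [|exact: tf_ev_neq0|exact: tf_ev_neq0].
rewrite -!rmorphM; apply/eqP; congr (tf _); apply: ev_eq.
by rewrite !rmorphM /= -e -e'; ring.
Qed.

Lemma ratio_inv_zmod : zmod_morphism ratio_inv.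
Proof.
move=> y z; have [[P Q] [Q0 e]] := ratio_exists y; have [[P' Q'] [Q'0 e']] := ratio_exists z.
rewrite /= in Q0 e Q'0 e'.
have QQ : ev (Q * Q') != 0 by rewrite rmorphM; apply: mulf_neq0.
rewrite (ratio_invE Q0 e) (ratio_invE Q'0 e') (@ratio_invE _ (P * Q' - P' * Q) _ QQ); last first.
  by rewrite rmorphB !rmorphM /= -e -e'; ring.
rewrite rmorphB !rmorphM /= -[in RHS]mulNr addf_div; [|exact: tf_ev_neq0|exact: tf_ev_neq0].
by rewrite mulNr.
Qed.

Lemma ratio_inv_monoid : monoid_morphism ratio_inv.
Proof.
split=> [|y z].
  rewrite (@ratio_invE _ 1 1) ?rmorph1 ?oner_eq0 ?mulr1 //.
  by rewrite divr1.
have [[P Q] [Q0 e]] := ratio_exists y; have [[P' Q'] [Q'0 e']] := ratio_exists z.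
rewrite /= in Q0 e Q'0 e'.
have QQ : ev (Q * Q') != 0 by rewrite rmorphM; apply: mulf_neq0.
rewrite (ratio_invE Q0 e) (ratio_invE Q'0 e') (@ratio_invE _ (P * P') _ QQ).
  by rewrite !rmorphM mulf_div.
by rewrite !rmorphM /= -e -e'; ring.
Qed.

HB.instance Definition _ := GRing.isZmodMorphism.Build L E ratio_inv ratio_inv_zmod.
HB.instance Definition _ := GRing.isMonoidMorphism.Build L E ratio_inv ratio_inv_monoid.

Lemma pure_embedding : exists g : {rmorphism L -> E}, forall c, g (f c) = tf c%:MP.
Proof.
exists (ratio_inv : {rmorphism L -> E}) => c /=.
rewrite (@ratio_invE _ c%:MP 1) ?rmorph1 ?oner_eq0 //; first by rewrite divr1.
by rewrite mulr1 mmapC.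
Qed.

End PureTranscendental.

Section RationalDegreeZero.
Variables (k : fieldType) (B : idomainType) (iota : {rmorphism k -> B}).
Variables (s : nat) (Bg : 'rV[int]_s -> B -> Prop) (gr : grading iota Bg).
Local Notation L := {fraction B}.
Local Notation f := (@tofrac B \o iota : {rmorphism k -> L}).
Local Notation F := (@tofrac B).
Variables (x0 : 'rV[int]_s) (X Y : B) (hX : Bg x0 X) (hY : Bg x0 Y) (Y0 : Y != 0).
Hypothesis form_neq0 : forall (P : {poly k}) j, (size P <= j.+1)%N -> P != 0 -> hf iota P j X Y != 0.
Hypothesis ratio_form : forall g x y, Bg g x -> Bg g y -> y != 0 -> exists j (P Q : {poly k}),
  [/\ (size P <= j.+1)%N, (size Q <= j.+1)%N, hf iota Q j X Y != 0 &
      x * hf iota Q j X Y = y * hf iota P j X Y].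

Local Notation u := (F X / F Y).

Lemma frac_form (P : {poly k}) j : (size P <= j.+1)%N -> F (hf iota P j X Y) = F Y ^+ j * uniev f u P.
Proof.
move=> sP; rewrite clear_uniev //; last by rewrite tofrac_eq0.
rewrite /hf rmorph_sum; apply: eq_bigr => i _.
by rewrite !rmorphM !rmorphXn.
Qed.

Lemma homfrac_u : homfrac Bg 0 u.
Proof. by exists x0, x0, X, Y; rewrite subrr. Qed.

Lemma uniev_u_neq0 (P : {poly k}) : P != 0 -> uniev f u P != 0.
Proof.
move=> P0; have := form_neq0 (leqnSn (size P)) P0.
by rewrite -(tofrac_eq0 (hf _ _ _ _ _)) (frac_form (leqnSn _)) mulf_eq0 negb_or => /andP[].
Qed.

Lemma gen_uniev n (w : 'I_n -> L) v (P : {poly k}) : gen f w v -> gen f w (uniev f v P).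
Proof.
move=> hv; rewrite (unievE _ _ (leqnn (size P))); apply: gen_sum => i _.
apply: genM; [exact: gen_const|exact: genX].
Qed.

Lemma homfrac0_rational n (w : 'I_n -> L) z : gen f w u -> homfrac Bg 0 z -> gen f w z.
Proof.
move=> hu [a [b [x [y [hx hy y0 ab ->]]]]].
have eab : a = b by apply/eqP; rewrite -subr_eq0 ab.
rewrite eab in hx; have [j [P [Q [sP sQ Q0 e]]]] := ratio_form hx hy y0.
have FQ : uniev f u Q != 0.
  by move: Q0; rewrite -(tofrac_eq0 (hf _ _ _ _ _)) (frac_form sQ) mulf_eq0 negb_or => /andP[].
have -> : F x / F y = uniev f u P / uniev f u Q.
  apply/eqP; rewrite eqr_div //; last by rewrite tofrac_eq0.
  have FYj : F Y ^+ j != 0 by rewrite expf_neq0 // tofrac_eq0.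
  apply/eqP; apply: (mulfI FYj).
  have := congr1 F e; rewrite !rmorphM /= (frac_form sP) (frac_form sQ) => e2.
  by rewrite mulrCA e2 mulrCA; congr (_ * _); apply: mulrC.
by apply: genM; [|apply: genV]; apply: gen_uniev.
Qed.

Variables (z : 'I_s -> L) (hz : forall j, homfrac Bg (delta_mx 0 j) (z j)).
Hypothesis z0 : forall j, z j != 0.

Definition uz (i : 'I_s.+1) : L := oapp z u (unlift ord0 i).

Lemma uz_gen v : gen f uz v.
Proof.
have hu : gen f uz u by have := gen_var f uz ord0; rewrite /uz unlift_none.
have hzz j : gen f uz (z j) by have := gen_var f uz (lift ord0 j); rewrite /uz liftK.
by apply: (gen_of_homfrac0 gr hz z0) => // y; apply: homfrac0_rational.
Qed.

(** The relation is sorted by its monomials in [z], which have distinct degrees. Each coefficient is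
    a polynomial in u = X / Y that vanishes, so it is zero by [form_neq0]. *)
Lemma uz_indep : alg_indep f uz.
Proof.
(* A strict bound for all exponents of [p], so that exponents of [z] range over a finite type. *)
move=> p e; pose n := (\sum_(mu <- msupp p) \sum_j mu j).+1%N.
have hn mu j : mu \in msupp p -> (mu j < n)%N.
  move=> mup; rewrite ltnS (big_rem _ mup) /= (bigD1 j) //=.
  by rewrite -addnA leq_addr.
pose tl (mu : 'X_{1..s.+1}) : {ffun 'I_s -> 'I_n} := [ffun j => inord (mu (lift ord0 j))].
pose c a := \sum_(mu <- msupp p | tl mu == a) f p@_mu * u ^+ mu ord0.
pose dg (a : {ffun 'I_s -> 'I_n}) : 'rV[int]_s := \row_j (a j : nat)%:Z.
have dgI : injective dg.
  by move=> a b /rowP h; apply/ffunP => j; apply: val_inj; have := h j; rewrite !mxE => -[].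
pose zz (a : {ffun 'I_s -> 'I_n}) := \prod_j z j ^+ a j.
have zz0 a : zz a != 0.
  by apply/prodf_neq0 => j _; apply: expf_neq0.
have dgE (a : {ffun 'I_s -> 'I_n}) : dg a = \sum_j delta_mx 0 j *+ a j.
  apply/rowP => i; rewrite mxE summxE (bigD1 i) //= big1 => [|j ji].
    by rewrite mulmxnE mxE !eqxx addr0 /= -natz.
  by rewrite mulmxnE mxE eqxx /= eq_sym (negbTE ji) mul0rn.
have hc a : homfrac Bg (dg a) (c a * zz a).
  rewrite -[dg a]add0r; apply: (homfracM gr).
    apply: (homfrac_sum gr) => mu _; rewrite -[0]add0r; apply: (homfracM gr).
      exact: homfrac_const.
    by rewrite -(mul0rn _ (mu ord0)); apply: (homfracX gr); apply: homfrac_u.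
  by rewrite dgE; apply: (homfrac_prod gr) => j _; apply: (homfracX gr).
have ep : \sum_a c a * zz a = 0.
  rewrite -[RHS]e /mmap; under eq_bigr do rewrite mulr_suml big_mkcond.
  rewrite exchange_big /=; apply: eq_big_seq => mu mup.
  rewrite (bigD1 (tl mu)) //= eqxx big1 ?addr0; last by move=> a; rewrite eq_sym => /negbTE->.
  rewrite -mulrA; congr (_ * _); rewrite /mmap1 big_ord_recl /uz unlift_none; congr (_ * _).
  apply: eq_bigr => j _; rewrite liftK ffunE inordK //; exact: hn.
have H a : c a = 0.
  by have /eqP := homfrac_direct gr dgI hc ep a; rewrite mulf_eq0 (negbTE (zz0 a)) orbF => /eqP.
apply/mpolyP => mu; rewrite mcoeff0.
have [mup|] := boolP (mu \in msupp p); last by rewrite -mcoeff_eq0 => /eqP.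
pose P : {poly k} := \sum_(nu <- msupp p | tl nu == tl mu) p@_nu *: 'X^(nu ord0).
have eP : uniev f u P = c (tl mu).
  rewrite rmorph_sum; apply: eq_bigr => nu _.
  by rewrite /uniev /= map_polyZ map_polyXn /horner_eval hornerZ hornerXn.
have P0 : P = 0.
  apply/eqP; apply/negPn/negP => /uniev_u_neq0.
  by rewrite eP H eqxx.
have := congr1 (fun q : {poly k} => q`_(mu ord0)) P0; rewrite coef0 coef_sum.
rewrite big_mkcond /= (bigD1_seq mu) ?msupp_uniq //= eqxx coefZ coefXn eqxx mulr1.
rewrite big1_seq ?addr0 // => nu /andP[nm nup]; case: eqP => // etl.
rewrite coefZ coefXn; case: eqP => [e0|_]; last by rewrite mulr0.
case/eqP: nm; apply/mnmP => i; case: (unliftP ord0 i) => [j|] ->; last by rewrite e0.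
have := congr1 (fun a : {ffun 'I_s -> 'I_n} => val (a j)) etl.
by rewrite !ffunE /= !inordK //; apply: hn.
Qed.

End RationalDegreeZero.

(** * Transport along the isomorphism, and the equivalence *)

Section InverseMorphism.
Variables (R S : comNzRingType) (f : {rmorphism R -> S}) (h : S -> R).
Hypotheses (fK : cancel f h) (hK : cancel h f).

(** The map carries both cancellation proofs as arguments, so that morphism structures can be
    attached to it. *)
Definition inverse_map of cancel f h & cancel h f := h.
Local Notation g := (inverse_map fK hK).

Lemma inverse_zmod_morphism : zmod_morphism g.
Proof. by move=> x y; apply: (can_inj fK); rewrite rmorphB !hK. Qed.

Lemma inverse_monoid_morphism : monoid_morphism g.
Proof.
by split=> [|x y]; apply: (can_inj fK); rewrite ?rmorph1 ?rmorphM !hK.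
Qed.

HB.instance Definition _ := GRing.isZmodMorphism.Build S R g inverse_zmod_morphism.
HB.instance Definition _ := GRing.isMonoidMorphism.Build S R g inverse_monoid_morphism.

Lemma inverse_rmorphism : exists g' : {rmorphism S -> R}, g' =1 h.
Proof. by exists g. Qed.

End InverseMorphism.

Lemma map_mmap (k R S : comNzRingType) n (kap : {rmorphism k -> R}) (kap' : {rmorphism k -> S})
    (f : {rmorphism R -> S}) (t : 'I_n -> R) (P : {mpoly k[n]}) :
  (forall c, f (kap c) = kap' c) -> f (mmap kap t P) = mmap kap' (fun a => f (t a)) P.
Proof.
move=> H; rewrite /mmap rmorph_sum; apply: eq_bigr => i _; rewrite rmorphM H; congr (_ * _).
by rewrite /mmap1 rmorph_prod; apply: eq_bigr => j _; rewrite rmorphXn.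
Qed.

Section IsoConsequences.
Variables (k : closedFieldType) (D : trinomial_data k) (m : nat).
Variables (B : idomainType) (iota : {rmorphism k -> B}) (d : nat) (td : has_trdeg iota d).

(** The isomorphism enters only through the images of the variables: they span, satisfy the
    relations and are universal for them. *)
Lemma model_consequences (p : 'I_(\sum_(i < (tri_r D).+1) tri_n D i) + 'I_m -> B) :
  (forall x, exists n (c : 'I_n -> k) (al : 'I_n -> _ -> nat), x = \sum_i iota (c i) * mon p (al i)) ->
  (forall i, mmap iota (fun a => p (inl a)) (tri_rel D i) = 0) ->
  (forall (E : comNzRingType) (kap : {rmorphism k -> E}) (t : _ -> E),
    (forall i, mmap kap (fun a => t (inl a)) (tri_rel D i) = 0) ->
    exists g : {rmorphism B -> E}, (forall c, g (iota c) = kap c) /\ forall v, g (p v) = t v) ->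
  [/\ unirational iota, affine iota, UFD B & admits_effective_unmixed_grading iota d.-1].
Proof.
move=> gens rel lift.
have [s [W [Wgen Wbv Wker]]] := tri_weights D m.
have x0 := @lvar_neq0 B s; have xind := @laurent_indep B s.
have [Phi [Phik Phim]] := model_Phi rel lift Wbv (@lincl B s) x0.
have gr := model_grading gens x0 xind Phik Phim.
have eff := model_effective lift Wgen Phim.
have unm := model_unmixed gens rel lift Wker x0 xind Phik Phim.
have B0 := model_deg0 gens rel Wker x0 xind Phik Phim.
have ufd := model_UFD gens rel lift Wbv Wker x0 xind Phik Phim.
set X := mon p (tri_bv ord0); set Y := mon p (tri_bv (inord 1)).
have hX : model_deg (@lincl B s) (@lvar B s) Phi (dg W (tri_bv ord0)) X by apply: deg_mon.
have hY : model_deg (@lincl B s) (@lvar B s) Phi (dg W (tri_bv ord0)) Y.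
  by rewrite /dg -(Wbv (inord 1)); apply: deg_mon.
have Y0 : Y != 0 := lfB_neq0 lift None.
have form_neq0 (P : {poly k}) j : (size P <= j.+1)%N -> P != 0 -> hf iota P j X Y != 0.
  move=> sP P0; have [c [r [c0 _ -> _ _]]] := hf_lf_split iota sP P0.
  rewrite mulf_neq0 ?fmorph_eq0 // prodf_seq_neq0; apply/allP => o _.
  exact: lfB_neq0 lift o.
have ratio_form g x y : model_deg (@lincl B s) (@lvar B s) Phi g x ->
    model_deg (@lincl B s) (@lvar B s) Phi g y -> y != 0 -> exists j (P Q : {poly k}),
  [/\ (size P <= j.+1)%N, (size Q <= j.+1)%N, hf iota Q j X Y != 0 &
      x * hf iota Q j X Y = y * hf iota P j X Y].
  move=> hx hy y0; have [al eg] := hom_degree gens x0 xind Phik Phim hy y0.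
  rewrite eg in hx hy.
  have [ga [j [e [_ _ H]]]] := hom_normal gens rel Wker x0 xind Phik Phim al.
  have [P sP eP] := H x hx; have [Q sQ eQ] := H y hy.
  exists j, P, Q; split=> //; last by rewrite eP eQ; ring.
  by apply: contra_neq y0 => e0; rewrite eQ e0 mulr0.
have [z [hz z0]] := basis_homfracs gr eff.
have all := uz_gen gr Y0 ratio_form hz z0.
have ind := uz_indep gr hX hY Y0 form_neq0 hz z0.
(* X / Y and the [z] form an independent family of s + 1 generators of the fraction field, which
   fixes the rank of the weight lattice as d - 1. *)
have ds : d = s.+1.
  apply/eqP; rewrite eqn_leq (trdeg_le_generators td all) /=.
  exact: (trdeg_ge_indep td ind).
split=> //.
- have inj : injective (@tofrac {mpoly k[s.+1]}) by move=> q q' /eqP; rewrite tofrac_eq => /eqP.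
  by have [g hg] := pure_embedding ind all inj; exists s.+1, g.
- exact: model_affine gens.
- by rewrite ds; exists (model_deg (@lincl B s) (@lvar B s) Phi).
Qed.

Lemma iso_consequences (T : comNzRingType) (pi : {rmorphism {mpoly k[\sum_(i < (tri_r D).+1) tri_n D i]} -> T}) :
  tri_presents pi -> tri_iso iota m pi ->
  [/\ unirational iota, affine iota, UFD B & admits_effective_unmixed_grading iota d.-1].
Proof.
move=> [surj rel0 lift] [f [[h fK hK] fk]].
have [h' hh'] := inverse_rmorphism fK hK.
apply: (@model_consequences (fun v => f (qgen pi v))).
- move=> x; have [n [c [al e]]] := q_expansion surj (h x); exists n, c, al.
  rewrite -[LHS]hK e rmorph_sum; apply: eq_bigr => i _; rewrite rmorphM fk; congr (_ * _).
  by rewrite rmorph_prod; apply: eq_bigr => v _; rewrite rmorphXn.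
- move=> i; rewrite -(map_mmap _ _ fk) mmap_qgen /= rel0.
  by rewrite ?mpolyC0 !rmorph0.
- move=> E kap t ht; have [g0 hg0] := lift E kap _ ht.
  have [phi [phic phiv]] := qlift_exists hg0.
  exists (phi \o h' : {rmorphism B -> E}); split=> [c|v] /=.
    by rewrite hh' -fk fK phic.
  by rewrite hh' fK phiv.
Qed.

End IsoConsequences.

Section Equivalence.
Variables (k : closedFieldType) (B : idomainType) (iota : {rmorphism k -> B}) (d : nat).
Hypotheses (d2 : (2 <= d)%N) (td : has_trdeg iota d).

Lemma trinomial_of_grading : unirational iota \/ affine iota -> UFD B -> trivial_units iota ->
  admits_effective_grading iota d.-1 ->
  exists (D : trinomial_data k) (m : nat), iso_trinomial iota D m.
Proof.
move=> ua U tu [Bg [gr eff B0]].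
have td' : has_trdeg iota d.-1.+1 by rewrite prednK // ltnW.
have [g [a [b pen]]] : exists g a b, pencil iota Bg g a b.
  by case: ua => h; [apply: (unirational_pencil gr eff)|apply: (affine_pencil gr eff)].
have [D [m iso]] := pencil_iso gr B0 U tu pen.
by exists D, m; rewrite iso_trinomialE; apply/iso/tri_pi_presents.
Qed.

Lemma unmixed_grading_units : admits_effective_unmixed_grading iota d.-1 ->
  trivial_units iota /\ admits_effective_grading iota d.-1.
Proof.
move=> [Bg [gr eff un B0]]; split; last by exists Bg.
exact/(unmixed_trivial_units gr B0).
Qed.

Lemma trinomial_consequences :
  (exists (D : trinomial_data k) (m : nat), iso_trinomial iota D m) ->
  [/\ unirational iota, affine iota, UFD B & admits_effective_unmixed_grading iota d.-1].
Proof.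
move=> [D [m]]; rewrite iso_trinomialE.
exact: (iso_consequences td (@tri_pi_presents k D)).
Qed.

End Equivalence.

Theorem theorem1p2 (k : closedFieldType) (B : idomainType)
    (iota : {rmorphism k -> B}) (d : nat) :
  (2 <= d)%N -> has_trdeg iota d ->
  [<-> exists (D : trinomial_data k) (m : nat), iso_trinomial iota D m;
       unirational iota /\ UFD B
         /\ admits_effective_unmixed_grading iota d.-1;
       affine iota /\ UFD B
         /\ admits_effective_unmixed_grading iota d.-1;
       unirational iota /\ UFD B /\ trivial_units iota
         /\ admits_effective_grading iota d.-1;
       affine iota /\ UFD B /\ trivial_units iota
         /\ admits_effective_grading iota d.-1].
Proof.
move=> d2 td; have all := trinomial_consequences td; have back := trinomial_of_grading d2 td.
tfae.
- by case/all.
- move=> [un [U un_gr]]; have [tu gr] := unmixed_grading_units un_gr.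
  by case: (all (back (or_introl un) U tu gr)).
- move=> [af [U un_gr]]; have [tu gr] := unmixed_grading_units un_gr.
  by case: (all (back (or_intror af) U tu gr)).
- move=> [un [U [tu gr]]].
  by case: (all (back (or_introl un) U tu gr)).
- by move=> [af [U [tu gr]]]; apply: back => //; right.
Qed.
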